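(* Let $\mathfrak q(t)=\mathfrak q_t$, $t=(t_1,\dots,t_n)$, be a formal family of unital open-closed homotopy algebra structures on $(\mathfrak g,A)$ over $\mathcal M=\mathrm{Spf}(\mathbb C[[t_1,\dots,t_n]])$, with fixed $L_\infty$-structure $\mathfrak l$ on $\mathfrak g$ and fixed unit. The Getzler–Gauss–Manin connection $$\nabla=d-u^{-1}\sum_iR_{\partial_i\mathfrak q_t}\,dt_i$$ on the periodic cyclic complexes $(\mathcal E^\bullet,b+uB)$ of the family is flat up to chain homotopy. Precisely, for all $i,j$ its curvature is $$[\nabla_{\partial_i},\nabla_{\partial_j}]=\big[b+uB,\;u^{-2}\sigma(\partial_i\mathfrak q_t,\partial_j\mathfrak q_t)-u^{-2}R_{\partial_i\mathfrak q_t}\circ L_{\partial_j\mathfrak q_t}\big]_\circ .$$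
   Context: **Conventions.** The ground field is $k=\mathbb C$. For a graded vector space $V$, $|x|=\deg(x)-1$ is the shifted degree (the degree in $V[1]$); tensors have additive shifted degree, and a homogeneous multilinear map $D$ has shifted degree $|D|$ with $|D(z_1,\dots,z_n)|=|D|+\sum|z_i|$. All Koszul signs use shifted degrees. $\mathfrak g^{\wedge n}$ is the $n$-th graded symmetric power of $\mathfrak g[1]$. $[a]=\{1,\dots,a\}$. $I_1\sqcup\dots\sqcup I_n=[a]$ denotes a decomposition into disjoint, possibly empty, subsets with induced order; $J_1\dot\sqcup\cdots\dot\sqcup J_m=[d]$ denotes a decomposition into consecutive, possibly empty, intervals in this order. $y_I$, $x_J$ are the corresponding ordered products. Sums run over all decompositions of the indicated type of $[a]$ and $[d]$ (the $J$'s or $L,M,R$ in order of naming). **Canonical Koszul sign.** For a term built from operations and the inputs $y_{[a]},x_{[d]}$, delete all brackets to get a word whose letters are the operations ($\mathfrak q,\mathfrak l,D,E$, with their shifted degrees), inserted units $\mathbf 1$ (degree $-1$), and the $y_i$, $x_j$. Then $(-1)^\kappa$ in front of the term is the Koszul sign of permuting $\mathsf z\otimes y_{[a]}\otimes x_{[d]}$ into this word, where $\mathsf z$ is the product of the operation letters and inserted units in their relative order in the word. Example: for $y_{I_1}\otimes\mathfrak q(y_{I_2};x_R\otimes x_L)\otimes x_M$, $\kappa=\epsilon+|y_{I_1}|+|x_R|(|x_L|+|x_M|)$, where $y_{[a]}=(-1)^\epsilon y_{I_1}\wedge y_{I_2}$. Always $(-1)^\epsilon$ is the sign from decomposing $y_{[a]}$.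 **Unital OCHA.** An OCHA consists of graded vector spaces $\mathfrak g,A$, maps $\mathfrak l_n:\mathfrak g^{\wedge n}\to\mathfrak g$ ($n\ge1$) and $\mathfrak q_{n,m}:\mathfrak g^{\wedge n}\otimes A^{\otimes m}\to A$ ($(n,m)\neq(0,0)$), all of shifted degree $1$. Write $\mathfrak l=\sum\mathfrak l_n$, $\mathfrak q=\sum\mathfrak q_{n,m}$. They satisfy the $L_\infty$-relation $\sum_{I_1\sqcup I_2=[a]}(-1)^\epsilon\mathfrak l(\mathfrak l(y_{I_1})\wedge y_{I_2})=0$ and the OCHA relation $\sum(-1)^\epsilon\mathfrak q(\mathfrak l(y_{I_1})\wedge y_{I_2};x_{[d]})=\sum(-1)^\kappa\mathfrak q(y_{I_1};x_{J_1}\otimes\mathfrak q(y_{I_2};x_{J_2})\otimes x_{J_3})$. A unit is $\mathbf 1\in A$, $|\mathbf 1|=-1$, with $\mathfrak q_{0,2}(\mathbf 1,x)=(-1)^{|x|+1}\mathfrak q_{0,2}(x,\mathbf 1)=x$ and all other $\mathfrak q_{n,m}$ with an open input equal to $\mathbf 1$ vanishing. **Chains.** $C^{un}_\bullet(\mathfrak g;A,A)=\bigoplus_{l,k\ge0}\mathfrak g[1]^{\wedge l}\otimes A[1]^{\otimes(k+1)}$ with $$b(y_{[a]}\otimes x_{[d]})=\sum_{L\neq\emptyset}(-1)^\kappa y_{I_1}\otimes x_L\otimes\mathfrak q(y_{I_2};x_M)\otimes x_R+\sum_{L\neq\emptyset}(-1)^\kappa y_{I_1}\otimes\mathfrak q(y_{I_2};x_R\otimes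 x_L)\otimes x_M-\sum(-1)^\epsilon\mathfrak l(y_{I_1})\wedge y_{I_2}\otimes x_{[d]},$$ $L\dot\sqcup M\dot\sqcup R=[d]$. The normalized complex is $C_\bullet(\mathfrak g;A,A)=\bigoplus_{l,k\ge0}\mathfrak g[1]^{\wedge l}\otimes A[1]\otimes\bar A[1]^{\otimes k}$, $\bar A=A/\mathbb C\mathbf 1$, with induced differential $b$ (shifted degree $1$, $b^2=0$). **Cochains.** $C_{un}^\bullet(\mathfrak g;A,A)=\prod_{(i,j)\neq(0,0)}\mathrm{Hom}(\mathfrak g^{\wedge i}\otimes A^{\otimes j},A)$ with shifted degree, and $C^\bullet(\mathfrak g;A,A)$ is the subspace of cochains vanishing when an open input is $\mathbf 1$. $(D\bullet E)(y_{[a]};x_{[d]})=D\{E\}(y_{[a]};x_{[d]})=\sum(-1)^\kappa D(y_{I_1};x_{J_1}\otimes E(y_{I_2};x_{J_2})\otimes x_{J_3})$. **Operators on $C_\bullet(\mathfrak g;A,A)$** (formulas read in the normalized complex; $D,E\in C^\bullet(\mathfrak g;A,A)$ homogeneous; every sum over $J_1\dot\sqcup J_2\dot\sqcup\cdots=[d]$ has $J_1\neq\emptyset$): $B(y_{[a]};x_{[d]})=\sum_{L\dot\sqcup R=[d],L\ne\emptyset}(-1)^{|y_{[a]}|+|x_L||x_R|}y_{[a]}\otimes\mathbf 1\otimes x_R\otimes x_L$; $\iota_D(y_{[a]};x_{[d]})=(-1)^{|D|}\sum(-1)^\kappa y_{I_1}\otimes\mathfrak q(y_{I_2};x_{J_5}\otimes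 x_{J_1}\otimes D(y_{I_3};x_{J_2})\otimes x_{J_3})\otimes x_{J_4}$; $S_D(y_{[a]};x_{[d]})=\sum(-1)^{\kappa+|D|}y_{I_1}\otimes\mathbf 1\otimes x_{J_4}\otimes x_{J_1}\otimes D(y_{I_2};x_{J_2})\otimes x_{J_3}$; $L_D(y_{[a]};x_{[d]})=(-1)^{|D|}\sum(-1)^\kappa y_{I_1}\otimes x_{J_1}\otimes D(y_{I_2};x_{J_2})\otimes x_{J_3}+(-1)^{|D|}\sum(-1)^\kappa y_{I_1}\otimes D(y_{I_2};x_{J_3}\otimes x_{J_1})\otimes x_{J_2}$; $\iota_{\{D,E\}}(y_{[a]};x_{[d]})=\sum(-1)^{\kappa+|D|+|E|}y_{I_1}\otimes\mathfrak q(y_{I_2};x_{J_7}\otimes x_{J_1}\otimes D(y_{I_3};x_{J_2})\otimes x_{J_3}\otimes E(y_{I_4};x_{J_4})\otimes x_{J_5})\otimes x_{J_6}$; $S_{\{D,E\}}(y_{[a]};x_{[d]})=\sum(-1)^{\kappa+|D|+|E|}y_{I_1}\otimes\mathbf 1\otimes x_{J_6}\otimes x_{J_1}\otimes D(y_{I_2};x_{J_2})\otimes x_{J_3}\otimes E(y_{I_3};x_{J_4})\otimes x_{J_5}$. With $u$ a formal variable of degree $2$: $R_D=\iota_D+uS_D$, $R_{\{D,E\}}=\iota_{\{D,E\}}+uS_{\{D,E\}}$, and $$\sigma(D,E)=R_{\{D,E\}}+(-1)^{|D||E|}R_{\{E,D\}}+R_{D\bullet E}.$$ For operators, $[f,g]_\circ=f\circ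 g-(-1)^{|f||g|}g\circ f$. **Family.** A family of OCHA structures over $\mathcal M=\mathrm{Spf}(\mathbb C[[t_1,\dots,t_n]])$ with fixed $\mathfrak l$ and fixed unit $\mathbf 1$ is a $\mathfrak q(t)=\sum\mathfrak q_{m,n}(t)\in C^1_{un}(\mathfrak g;A,A)[[t]]$ satisfying, as formal power series in $t$, the OCHA relation with the constant $\mathfrak l$ and the unit relations; $\partial_i=\partial/\partial t_i$, and $\partial_i\mathfrak q_t\in C^\bullet(\mathfrak g;A,A)[[t]]$ has shifted degree $1$. $\mathcal E^\bullet=C_\bullet(\mathfrak g;A,A)((u))\otimes_{\mathbb C}\mathcal O_{\mathcal M}$ (tensor product $t$-adically completed), with differential $b+uB$, $b=b(t)$ being the Hochschild differential of $\mathfrak q(t)$. All operators above are formed using $\mathfrak q=\mathfrak q(t)$ and extended $\mathcal O_{\mathcal M}((u))$-linearly. $\nabla:\mathcal E^\bullet\to\mathcal E^\bullet\otimes\Omega^1_{\mathcal M}$ with $d$ the trivial connection, so $\nabla_{\partial_i}=\partial_i-u^{-1}R_{\partial_i\mathfrak q_t}$. *)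

(* Defs.v *)
From HB Require Import structures.
From mathcomp Require Import all_boot all_order all_algebra.
From mathcomp Require Import boolp functions reals complex.
From mathcomp Require Import freeg mpoly.

Set Implicit Arguments.
Unset Strict Implicit.
Unset Printing Implicit Defensive.

Import GRing.Theory.
Local Open Scope ring_scope.

Section QuotientModule.
Variables (K : fieldType) (V : lmodType K).

Definition submod_pred (S : submodClosed V) : {pred V} := S.

HB.instance Definition _ S := GRing.isZmodClosed.Build V (submod_pred S)
  (GRing.submod_closedB (GRing.submodClosedP S)).

Variable S : submodClosed V.
Local Open Scope quotient_scope.

Definition quot_module := Quotient.quot (submod_pred S).
Local Notation Q := quot_module.

HB.instance Definition _ : EqQuotient V (Quotient.equiv (submod_pred S)) Q :=
  EqQuotient.on Q.
HB.instance Definition _ := ZmodQuotient.on Q.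

Definition quot_scale (c : K) : Q -> Q := fun v => \pi_Q (c *: repr v).

Lemma quot_scale_pi c (v : V) : quot_scale c (\pi_Q v) = \pi_Q (c *: v).
Proof.
apply/eqP; rewrite /quot_scale -Quotient.idealrBE -scalerBr.
apply: (rpredZ c (_ : _ \in S)); rewrite -[_ \in S]/(_ \in submod_pred S).
by rewrite Quotient.idealrBE reprK.
Qed.

Fact quot_scaleA a b (v : Q) : quot_scale a (quot_scale b v) = quot_scale (a * b) v.
Proof. by elim/quotW: v => v; rewrite (quot_scale_pi b) !quot_scale_pi scalerA. Qed.

Fact quot_scale1 : left_id 1 quot_scale.
Proof. by elim/quotW=> v; rewrite quot_scale_pi scale1r. Qed.

Fact quot_scaleDr : right_distributive quot_scale +%R.
Proof.
move=> a; elim/quotW=> v; elim/quotW=> w.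
by rewrite -raddfD !quot_scale_pi scalerDr raddfD.
Qed.

Fact quot_scaleDl v : {morph quot_scale^~ v : a b / a + b}.
Proof.
by elim/quotW: v => v a b; rewrite !quot_scale_pi scalerDl raddfD.
Qed.

HB.instance Definition _ := GRing.Zmodule_isLmodule.Build K Q
  quot_scaleA quot_scale1 quot_scaleDr quot_scaleDl.

End QuotientModule.

(* A graded vector space is a family [V : int -> lmodType K]; its homogeneous
   elements, tagged with their unshifted degree, are the "letters" of [V].
   Every Koszul sign uses the shifted degree [sdeg]. *)

Section GradedMaps.
Variable K : fieldType.

Definition letter (V : int -> lmodType K) := {i : int & V i}.

Definition sdeg (V : int -> lmodType K) (x : letter V) : int := tag x - 1.

Definition sdegs (V : int -> lmodType K) (s : seq (letter V)) : int :=
  \sum_(x <- s) sdeg x.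

Definition multilinear (V : int -> lmodType K) (U : lmodType K)
    (f : seq (letter V) -> U) : Prop :=
  forall s1 i (c : K) (u v : V i) s2,
    f (s1 ++ Tagged V (c *: u + v) :: s2)
    = c *: f (s1 ++ Tagged V u :: s2) + f (s1 ++ Tagged V v :: s2).

Definition graded_symmetric (V : int -> lmodType K) (U : lmodType K)
    (f : seq (letter V) -> U) : Prop :=
  forall s1 a b s2,
    f (s1 ++ a :: b :: s2) = (-1) ^ (sdeg a * sdeg b) *: f (s1 ++ b :: a :: s2).

(* [y_I] for a colouring [c] whose [i]-th entry is the number of the block
   that contains the [i]-th input. *)
Definition part (T : Type) (c : seq nat) (s : seq T) (j : nat) : seq T :=
  mask [seq i == j | i <- c] s.

(* Blocks are numbered from 1. *)
Definition labels (m : nat) (c : seq 'I_m) : seq nat := [seq i.+1 | i : 'I_m <- c].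

(* A term with its brackets deleted: [Op d] is an operation or an inserted unit
   of shifted degree [d]; [Y j] is [y_{I_j}]; [X j] is [x_{J_j}]. *)
Inductive block := Op of int | Y of nat | X of nat.

(* The letters of [z (x) y_[a] (x) x_[d]] with their positions in it. All the
   letters of [z] have position 0: they never change their relative order. *)
Definition word_of (c e : seq nat) (dy dx : seq int) (w : seq block) :
    seq (nat * int) :=
  flatten [seq match b with
               | Op d => [:: (0%N, d)]
               | Y j => part c (zip (iota 1 (size dy)) dy) j
               | X j => part e (zip (iota (size dy).+1 (size dx)) dx) j
               end | b <- w].

Fixpoint koszul (w : seq (nat * int)) : K :=
  if w is p :: w' then
    (\prod_(r <- w' | (r.1 < p.1)%N) (-1) ^ (p.2 * r.2)) * koszul w'
  else 1.

End GradedMaps.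

Section OCHA.
Variables (K : fieldType) (g A : int -> lmodType K).
Local Notation gL := (letter g).
Local Notation AL := (letter A).

Definition kappa (c e : seq nat) (ys : seq gL) (xs : seq AL) (w : seq block) : K :=
  koszul K (word_of c e [seq sdeg y | y <- ys] [seq sdeg x | x <- xs] w).

(* [l ys k] and [D ys xs k] are the components of degree [k] of the values. *)
Definition brackets := seq gL -> forall k, g k.
Definition cochain := seq gL -> seq AL -> forall k, A k.

Definition bval (l : brackets) (ys : seq gL) : gL :=
  Tagged g (l ys (1 + sdegs ys + 1)).

(* The value of a cochain of shifted degree [p] on homogeneous inputs. *)
Definition cval (p : int) (D : cochain) (ys : seq gL) (xs : seq AL) : AL :=
  Tagged A (D ys xs (p + sdegs ys + sdegs xs + 1)).

(* [sum (-1)^epsilon t(y_{I_1}, y_{I_2})] over [I_1 |_| I_2 = [a]]. *)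
Definition shuffle_sum (U : lmodType K) (ys : seq gL)
    (t : seq gL -> seq gL -> U) : U :=
  \sum_(c : (size ys).-tuple 'I_2)
    koszul K (word_of (labels c) [::] [seq sdeg y | y <- ys] [::] [:: Y 1; Y 2])
      *: t (part (labels c) ys 1) (part (labels c) ys 2).

(* [sum (-1)^kappa t(y_I, x_J)] over [I_1 |_| ... |_| I_n = [a]] and consecutive
   intervals [J_1, ..., J_m] of [d], that is, nondecreasing colourings;
   [w] is the word of the term. *)
Definition koszul_sum (n m : nat) (J1_nonempty : bool) (U : lmodType K)
    (ys : seq gL) (xs : seq AL) (w : seq block)
    (t : (nat -> seq gL) -> (nat -> seq AL) -> U) : U :=
  \sum_(c : (size ys).-tuple 'I_n)
    \sum_(e : (size xs).-tuple 'I_m |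
          sorted leq (labels e) && (J1_nonempty ==> (1%N \in labels e)))
      kappa (labels c) (labels e) ys xs w
        *: t (part (labels c) ys) (part (labels e) xs).

Record L_infinity (l : brackets) : Prop := {
  Linf_multilinear : forall k, multilinear (l ^~ k);
  Linf_symmetric : forall k, graded_symmetric (l ^~ k);
  Linf_degree : forall ys k, k != 1 + sdegs ys + 1 -> l ys k = 0;
  Linf_nullary : forall k, l [::] k = 0;
  Linf_relation : forall ys k,
    shuffle_sum ys (fun y1 y2 => l (bval l y1 :: y2) k) = 0
}.

(* The elements of shifted degree [p] of [C_un(g; A, A)]. *)
Record is_cochain (p : int) (D : cochain) : Prop := {
  cochain_multilinear_closed : forall xs k, multilinear (fun ys => D ys xs k);
  cochain_multilinear_open : forall ys k, multilinear (fun xs => D ys xs k);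
  cochain_symmetric : forall xs k, graded_symmetric (fun ys => D ys xs k);
  cochain_degree : forall ys xs k,
    k != p + sdegs ys + sdegs xs + 1 -> D ys xs k = 0;
  cochain_nullary : forall k, D [::] [::] k = 0
}.

(* [D \bullet E] for cochains [D], [E] of shifted degrees [p], [r]. *)
Definition bullet (p r : int) (D E : cochain) : cochain := fun ys xs k =>
  koszul_sum 2 3 false ys xs
    [:: Op p; Y 1; X 1; Op r; Y 2; X 2; X 3]
    (fun y x => D (y 1) (x 1 ++ cval r E (y 2) (x 2) :: x 3) k).

Variable one : A 0.
Local Notation unit_letter := (Tagged A one).

(* The total space of chains: the free vector space on the words
   [y_1 ... y_l (x) x_0 (x) x_1 ... x_k] modulo [chain_rel]. *)
Definition word := (seq gL * (AL * seq AL))%type.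
Definition free_chain := {freeg word / K}.

(* [y_[a] (x) x_[d]]; words without open inputs do not occur in the complex. *)
Definition pure (ys : seq gL) (xs : seq AL) : free_chain :=
  if xs is x :: xs' then << (ys, (x, xs')) >> else 0.

Definition linear_ext (f : seq gL -> seq AL -> free_chain) : free_chain -> free_chain :=
  fglift (fun w : word => f w.1 (w.2.1 :: w.2.2)).

Inductive chain_rel : free_chain -> Prop :=
| chain_rel0 : chain_rel 0
| chain_rel_lin c v w : chain_rel v -> chain_rel w -> chain_rel (c *: v + w)
| chain_rel_closed ys1 i c (u v : g i) ys2 xs :
    chain_rel (pure (ys1 ++ Tagged g (c *: u + v) :: ys2) xs
      - (c *: pure (ys1 ++ Tagged g u :: ys2) xs
         + pure (ys1 ++ Tagged g v :: ys2) xs))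
| chain_rel_open ys xs1 i c (u v : A i) xs2 :
    chain_rel (pure ys (xs1 ++ Tagged A (c *: u + v) :: xs2)
      - (c *: pure ys (xs1 ++ Tagged A u :: xs2)
         + pure ys (xs1 ++ Tagged A v :: xs2)))
| chain_rel_symmetric ys1 a b ys2 xs :
    chain_rel (pure (ys1 ++ a :: b :: ys2) xs
      - (-1) ^ (sdeg a * sdeg b) *: pure (ys1 ++ b :: a :: ys2) xs)
| chain_rel_normalized ys x xs1 xs2 :
    chain_rel (pure ys (x :: xs1 ++ unit_letter :: xs2)).

Definition chain_relb : {pred free_chain} := fun v => `[< chain_rel v >].

Fact chain_relb_submod : submod_closed chain_relb.
Proof.
split=> [|c v w /asboolP rv /asboolP rw]; apply/asboolP; first exact: chain_rel0.
exact: chain_rel_lin.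
Qed.

HB.instance Definition _ :=
  GRing.isSubmodClosed.Build K free_chain chain_relb chain_relb_submod.

Definition chain : lmodType K := quot_module chain_relb.

(* The operator on chains with [y_[a] (x) x_[d] |-> f y_[a] x_[d]]; as usual for
   maps out of a quotient, this reading presupposes that the linear extension of
   [f] preserves [chain_rel]. *)
Definition chain_op (f : seq gL -> seq AL -> free_chain) (v : chain) : chain :=
  (\pi_(quot_module chain_relb) (linear_ext f (repr v)))%qT.

(* The part of the Hochschild differential that depends on [q]. *)
Definition b_open (q : cochain) : chain -> chain := chain_op (fun ys xs =>
  koszul_sum 2 3 true ys xs [:: Y 1; X 1; Op 1; Y 2; X 2; X 3]
    (fun y x => pure (y 1) (x 1 ++ cval 1 q (y 2) (x 2) :: x 3))
  + koszul_sum 2 3 true ys xs [:: Y 1; Op 1; Y 2; X 3; X 1; X 2]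
    (fun y x => pure (y 1) (cval 1 q (y 2) (x 3 ++ x 1) :: x 2))).

Definition b_closed (l : brackets) : chain -> chain := chain_op (fun ys xs =>
  shuffle_sum ys (fun y1 y2 => pure (bval l y1 :: y2) xs)).

Definition connes_B : chain -> chain := chain_op (fun ys xs =>
  \sum_(e : (size xs).-tuple 'I_2 |
        sorted leq (labels e) && (1%N \in labels e))
    let x := part (labels e) xs in
    (-1) ^ (sdegs ys + sdegs (x 1) * sdegs (x 2))
      *: pure ys (unit_letter :: x 2 ++ x 1)).

(* In the operators below [p] and [r] are the shifted degrees of [D] and [E]. *)

Definition iota_op (p : int) (q D : cochain) : chain -> chain :=
  chain_op (fun ys xs => (-1) ^ p *:
    koszul_sum 3 5 true ys xs
      [:: Y 1; Op 1; Y 2; X 5; X 1; Op p; Y 3; X 2; X 3; X 4]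
      (fun y x => pure (y 1)
        (cval 1 q (y 2) (x 5 ++ x 1 ++ cval p D (y 3) (x 2) :: x 3) :: x 4))).

Definition S_op (p : int) (D : cochain) : chain -> chain :=
  chain_op (fun ys xs => (-1) ^ p *:
    koszul_sum 2 4 true ys xs
      [:: Y 1; Op (-1); X 4; X 1; Op p; Y 2; X 2; X 3]
      (fun y x => pure (y 1)
        (unit_letter :: x 4 ++ x 1 ++ cval p D (y 2) (x 2) :: x 3))).

Definition L_op (p : int) (D : cochain) : chain -> chain :=
  chain_op (fun ys xs =>
    (-1) ^ p *: koszul_sum 2 3 true ys xs [:: Y 1; X 1; Op p; Y 2; X 2; X 3]
      (fun y x => pure (y 1) (x 1 ++ cval p D (y 2) (x 2) :: x 3))
    + (-1) ^ p *: koszul_sum 2 3 true ys xs [:: Y 1; Op p; Y 2; X 3; X 1; X 2]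
      (fun y x => pure (y 1) (cval p D (y 2) (x 3 ++ x 1) :: x 2))).

Definition iota2_op (p r : int) (q D E : cochain) : chain -> chain :=
  chain_op (fun ys xs => (-1) ^ (p + r) *:
    koszul_sum 4 7 true ys xs
      [:: Y 1; Op 1; Y 2; X 7; X 1; Op p; Y 3; X 2; X 3; Op r; Y 4; X 4; X 5; X 6]
      (fun y x => pure (y 1)
        (cval 1 q (y 2) (x 7 ++ x 1 ++ cval p D (y 3) (x 2) :: x 3
                             ++ cval r E (y 4) (x 4) :: x 5) :: x 6))).

Definition S2_op (p r : int) (D E : cochain) : chain -> chain :=
  chain_op (fun ys xs => (-1) ^ (p + r) *:
    koszul_sum 3 6 true ys xs
      [:: Y 1; Op (-1); X 6; X 1; Op p; Y 2; X 2; X 3; Op r; Y 3; X 4; X 5]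
      (fun y x => pure (y 1)
        (unit_letter :: x 6 ++ x 1 ++ cval p D (y 2) (x 2) :: x 3
                            ++ cval r E (y 3) (x 4) :: x 5))).

End OCHA.

(* Formal power series in [t_1, ..., t_n] with coefficients in [T]. *)
Definition tseries (n : nat) (T : Type) := 'X_{1..n} -> T.

Section Series.
Variables (K : fieldType) (n : nat).

(* The product of power series induced by a bilinear [f]. *)
Definition cauchy (S T : Type) (U : lmodType K) (f : S -> T -> U)
    (a : tseries n S) (b : tseries n T) : tseries n U := fun m =>
  \sum_(k : 'X_{1..n < (mdeg m).+1, (mdeg m).+1} | m == (k.1 + k.2)%MM)
    f (a k.1) (b k.2).

Definition constant (U : lmodType K) (u : U) : tseries n U :=
  fun m => if m == 0%MM then u else 0.

Definition partial (U : lmodType K) (i : 'I_n) (a : tseries n U) : tseries n U :=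
  fun m => a (m + U_(i))%MM *+ (m i).+1.

End Series.

Section Family.
Variables (K : fieldType) (g A : int -> lmodType K) (n : nat).
Local Notation family := (tseries n (cochain g A)).

Definition family_partial (i : 'I_n) (q : family) : family :=
  fun m ys xs k => partial i (fun m' => q m' ys xs k) m.

Definition family_bullet (p r : int) (D E : family) : family :=
  fun m ys xs k => cauchy (fun d e => bullet p r d e ys xs k) D E m.

Record unital_ocha_family (l : brackets g) (one : A 0) (q : family) : Prop := {
  family_closed : L_infinity l;
  family_cochain : forall m, is_cochain 1 (q m);
  family_relation : forall m ys xs k,
    shuffle_sum ys (fun y1 y2 => q m (bval l y1 :: y2) xs k)
    = family_bullet 1 1 q q m ys xs k;
  family_unit_left : forall i (x : A i),
    q 0%MM [::] [:: Tagged A one; Tagged A x] i = x;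
  family_unit_right : forall i (x : A i),
    (-1) ^ (sdeg (Tagged A x) + 1)
      *: q 0%MM [::] [:: Tagged A x; Tagged A one] i = x;
  family_unit_other : forall m ys xs1 xs2 k,
    ~ (m = 0%MM /\ ys = [::] /\ size (xs1 ++ Tagged A one :: xs2) = 2) ->
    q m ys (xs1 ++ Tagged A one :: xs2) k = 0
}.

Variable one : A 0.
Local Notation chain := (chain g one).

(* [e m k] is the coefficient of [t^m u^k]. The elements of
   [C((u)) (x) C[[t]]], completed t-adically, are singled out by [periodic]: the
   order of the pole in [u] may depend on [m]. The formulas for the operators
   make sense on all of [useries]. *)
Definition useries := tseries n (int -> chain).

Definition periodic (e : useries) : Prop :=
  forall m, exists N : int, forall k, (k < N)%R -> e m k = 0.

Definition u_power (j : int) (e : useries) : useries := fun m k => e m (k - j).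

(* The continuous O((u))-linear extension of a power series of operators. *)
Definition extend (T : tseries n (chain -> chain)) : useries -> useries :=
  cauchy (fun (f : chain -> chain) (e : int -> chain) => (f \o e : int -> chain)) T.

Definition b_family (l : brackets g) (q : family) : useries -> useries :=
  extend ((fun m => b_open (q m)) - constant (b_closed l)).

Definition B_family : useries -> useries := extend (constant (@connes_B _ _ _ _)).

(* The differential [b + uB]. *)
Definition differential (l : brackets g) (q : family) : useries -> useries :=
  b_family l q + (u_power 1 \o B_family).

Definition R_family (p : int) (q D : family) : useries -> useries :=
  extend (cauchy (iota_op p) q D)
  + (u_power 1 \o extend (fun m => S_op p (D m))).

Definition L_family (p : int) (D : family) : useries -> useries :=
  extend (fun m => L_op p (D m)).

Definition R2_family (p r : int) (q D E : family) : useries -> useries :=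
  extend (cauchy (fun (f : cochain g A -> chain -> chain) e => f e)
            (cauchy (fun q' d => iota2_op p r q' d) q D) E)
  + (u_power 1 \o extend (cauchy (S2_op p r) D E)).

Definition sigma_family (p r : int) (q D E : family) : useries -> useries :=
  R2_family p r q D E + (-1) ^ (p * r) *: R2_family r p q E D
  + R_family (p + r) q (family_bullet p r D E).

(* [f \o h - (-1)^(|f||h|) h \o f] for operators of degrees [p], [r]. *)
Definition graded_commutator (p r : int) (f h : useries -> useries) :
    useries -> useries :=
  (f \o h) - (-1) ^ (p * r) *: (h \o f).

(* The components of the connection in the directions [d/dt_i]. *)
Definition nabla (q : family) (i : 'I_n) : useries -> useries :=
  (fun e => partial i e) - (u_power (-1) \o R_family 1 q (family_partial i q)).

Definition homotopy (q : family) (i j : 'I_n) : useries -> useries :=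
  (u_power (-2) \o sigma_family 1 1 q (family_partial i q) (family_partial j q))
  - (u_power (-2) \o R_family 1 q (family_partial i q)
       \o L_family 1 (family_partial j q)).

End Family.

(* Main.v *)
Require Import Defs.
From HB Require Import structures.
From mathcomp Require Import all_boot all_order all_algebra.
From mathcomp Require Import boolp functions reals complex.
From mathcomp Require Import freeg mpoly.
From mathcomp Require Import ring lra zify.

Set Implicit Arguments.
Unset Strict Implicit.
Unset Printing Implicit Defensive.

Import GRing.Theory.
Local Open Scope ring_scope.

(** The connection is nabla_i = d/dt_i - u^-1 R_D with D = d_i q, and
    nabla_j = d/dt_j - u^-1 R_E with E = d_j q. The mixed second derivatives of
    q cancel in the curvature, so it has two parts: the commutators of the
    contractions and of the rotated insertions S, and the two terms in which D
    or E takes the place of q, produced by d_i iota_E - d_j iota_D. The first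
    derivatives of the structure relation say that D and E are closed. For
    closed cochains the theorem therefore reduces to identities between
    operators of a single structure:
    - b commutes with iota_D, and b and B anticommute with L_E;
    - b S_D - S_D b + B iota_D - iota_D B is L_D;
    - for the twofold insertion I of D and E, whose three summands are the terms
      of sigma, b I + I b is the commutator of iota_D and iota_E;
    - for the rotated twofold insertion S, b S + S b + B I + I B is the sum of
      the mixed commutators of iota and S, of L_D L_E, and of the two terms in
      which D or E takes the place of q;
    - products of two operators that insert the unit vanish on normalized
      chains.
    The product R_D L_E in the homotopy removes L_D L_E. The lemmas
    [iota_hoch], [hoch_rotinsF], [hoch_iota_comp] and [hoch_rotins_comp] are the
    identities, and [abstract_curvature] is their combination.

    Signs. Each letter and each operation carries a list of marks, whose length
    has the parity of its shifted degree. A chain is weighted by [alt], the sign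
    of the sequence of all marks, read from left to right. Then moving letters
    and operations costs no sign: the Koszul sign is the quotient of two weights
    ([kappa_marks], [koszul_sum_cut1]), operations on disjoint inputs commute
    ([opc_exch]), and an operation of degree 1 occurs with one mark. Two copies of
    q carry different marks, and the relation q{q} = q{l} of odd operations
    becomes antisymmetry in these marks ([io_swap]).

    Words. Operators are transposed: they act on functionals of a cyclic word
    with a first letter, and an operation is a map from a segment and a
    continuation to a value ([op]). In this form b is a derivation for all ways
    to cut a word ([tilde_derivation]), an operation that is closed commutes with
    it, and apart from products with B the failure of S to commute with b comes
    from words with the unit as an input of q. These terms are sums over
    rotations that telescope ([teleE]), and the part that does not cancel is L.
    All identities are thus consequences of the associativity of cutting a word.

    Return to chains. A functional in the image of the calculus is linear,
    antisymmetric in marks and zero on inner units, hence it defines an operator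
    on the quotient ([compatible_intro]), and with pairwise different marks its
    values determine the operator ([FinS_inj]). *)

(** * Identities in abelian groups *)

Section AbelianReflection.
Variable V : zmodType.

Inductive zexp := ZVar of nat | ZAdd of zexp & zexp | ZOpp of zexp | ZZero.

Fixpoint zcoef (e : zexp) (i : nat) : int :=
  match e with
  | ZVar j => (i == j)%:Z
  | ZAdd e1 e2 => zcoef e1 i + zcoef e2 i
  | ZOpp e1 => - zcoef e1 i
  | ZZero => 0
  end.

Fixpoint zbounded (n : nat) (e : zexp) : bool :=
  match e with
  | ZVar j => (j < n)%N
  | ZAdd e1 e2 => zbounded n e1 && zbounded n e2
  | ZOpp e1 => zbounded n e1
  | ZZero => true
  end.

Fixpoint zeval (env : seq V) (e : zexp) : V :=
  match e with
  | ZVar j => nth 0 env j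
  | ZAdd e1 e2 => zeval env e1 + zeval env e2
  | ZOpp e1 => - zeval env e1
  | ZZero => 0
  end.

Lemma zevalE env e : zbounded (size env) e ->
  zeval env e = \sum_(i < size env) env`_i *~ zcoef e i.
Proof.
elim: e => [j|e1 IH1 e2 IH2|e IH|] /=.
- move=> lj; rewrite (bigD1 (Ordinal lj)) //= eqxx mulr1z big1 ?addr0 // => i.
  by rewrite -val_eqE /= => /negbTE ->; rewrite mulr0z.
- case/andP=> /IH1 -> /IH2 ->; rewrite -big_split /=.
  by apply: eq_bigr => i _; rewrite mulrzDr.
- move/IH ->; rewrite -sumrN; apply: eq_bigr => i _; by rewrite mulrNz.
- by move=> _; rewrite big1 // => i _; rewrite mulr0z.
Qed.

Lemma zmod_reflect env e1 e2 :
  [&& zbounded (size env) e1, zbounded (size env) e2 &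
      all (fun i => zcoef e1 i == zcoef e2 i) (iota 0 (size env))] ->
  zeval env e1 = zeval env e2.
Proof.
case/and3P=> b1 b2 /allP ec; rewrite !zevalE //; apply: eq_bigr => i _.
by congr (_ *~ _); apply/eqP/ec; rewrite mem_iota add0n ltn_ord.
Qed.
End AbelianReflection.

Ltac zindex_syn x env :=
  match env with
  | cons x _ => constr:(0%N)
  | cons _ ?env' => let n := zindex_syn x env' in constr:(S n)
  end.
Ltac zindex_conv x env :=
  match env with
  | cons ?y _ => let _ := constr:(erefl x : x = y) in constr:(0%N)
  | cons _ ?env' => let n := zindex_conv x env' in constr:(S n)
  end.
Ltac zindex x env :=
  match env with
  | _ => zindex_syn x env
  | _ => zindex_conv x env
  end.
Ltac zinsert x env :=
  match env with
  | _ => let _ := zindex x env in env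
  | _ => constr:(cons x env)
  end.
Ltac zatoms V t env :=
  lazymatch t with
  | @GRing.add _ ?a ?b => let env := zatoms V a env in zatoms V b env
  | @GRing.opp _ ?a => zatoms V a env
  | @GRing.zero _ => env
  | _ => zinsert t env
  end.
Ltac zreify t env :=
  lazymatch t with
  | @GRing.add _ ?a ?b => let a := zreify a env in let b := zreify b env in constr:(ZAdd a b)
  | @GRing.opp _ ?a => let a := zreify a env in constr:(ZOpp a)
  | @GRing.zero _ => constr:(ZZero)
  | _ => let i := zindex t env in constr:(ZVar i)
  end.
(** Proves equalities of sums in an abstract abelian group. The terms are
    reified over their atoms, and the integer coefficients are compared; atoms
    are first matched syntactically, then up to conversion. *)
Ltac zmod :=
  lazymatch goal with
  | |- @eq ?T ?a ?b =>
    let env := zatoms T a (@nil T) in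
    let env := zatoms T b env in
    let ea := zreify a env in
    let eb := zreify b env in
    change (zeval env ea = zeval env eb); apply: zmod_reflect; vm_compute; reflexivity
  end.

(** * Operations on the segments of a word *)

Section Cuts.
Variables (L : Type) (V : zmodType).
Implicit Types (s t N R w : seq L) (x : L).

(** The deconcatenation coproduct of a word, summed. It is defined by recursion, so that
    its laws are inductions on the word. *)
Fixpoint cut s (G : seq L -> seq L -> V) : V :=
  if s is x :: s' then G [::] s + cut s' (fun a b => G (x :: a) b)
  else G [::] [::].

Lemma eq_cut s G G' : (forall a b, G a b = G' a b) -> cut s G = cut s G'.
Proof. by move=> eG; congr cut; do 2!apply: funext => ?. Qed.

Lemma cutD s G G' : cut s (fun a b => G a b + G' a b) = cut s G + cut s G'.
Proof. by elim: s G G' => //= x s IH G G'; rewrite IH addrACA. Qed.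

Lemma cut0 s : cut s (fun _ _ => 0) = 0.
Proof. by elim: s => //= x s ->; rewrite addr0. Qed.

Lemma cutN s G : cut s (fun a b => - G a b) = - cut s G.
Proof. by elim: s G => //= x s IH G; rewrite IH opprD. Qed.

Lemma cut_cat s x t G : cut (s ++ x :: t) G =
  cut s (fun a b => G a (b ++ x :: t)) + cut t (fun a b => G (s ++ x :: a) b).
Proof. by elim: s G => //= y s IH G; rewrite IH addrA. Qed.

Lemma cut_rcons s x G : cut (rcons s x) G =
  cut s (fun a b => G a (rcons b x)) + G (rcons s x) [::].
Proof. by elim: s G => //= y s IH G; rewrite IH addrA. Qed.

(** Coassociativity of deconcatenation. *)
Lemma cutA s (G : seq L -> seq L -> seq L -> V) :
  cut s (fun a b => cut a (fun a1 a2 => G a1 a2 b)) =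
  cut s (fun a b => cut b (fun b1 b2 => G a b1 b2)).
Proof.
elim: s G => //= x s IH G.
by rewrite cutD IH addrA.
Qed.

Lemma cutC s t (G : seq L -> seq L -> seq L -> seq L -> V) :
  cut s (fun a b => cut t (fun c d => G a b c d)) =
  cut t (fun c d => cut s (fun a b => G a b c d)).
Proof. by elim: s G => //= x s IH G; rewrite IH -cutD. Qed.

(** The sum over all ways to mark a letter, with the letter seen as the head of
    the right part or as the end of the left part. This is the reindexing that
    makes sums over rotations telescope. *)
Lemma cut_shift s (G : seq L -> L -> seq L -> V) :
  cut s (fun N R => if R is z :: R' then G N z R' else 0) =
  cut s (fun N R => if rev N is z :: N' then G (rev N') z R else 0).
Proof.
elim: s G => //= x s IH G.
rewrite add0r.
have -> : cut s (fun a b => if rev (x :: a) is z :: N' then G (rev N') z b else 0)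
  = cut s (fun a b => (if a is [::] then G [::] x b else 0) +
       if rev a is z :: N' then G (x :: rev N') z b else 0).
  apply: eq_cut => a b; rewrite rev_cons; case: a => [|y a] /=.
    by rewrite addr0.
  rewrite add0r; case E: (rev (y :: a)) => [|z N'] /=.
    by move: (congr1 size E); rewrite size_rev.
  by rewrite rev_rcons.
rewrite cutD -(IH (fun N z R => G (x :: N) z R)); case: s {IH} => [|y s] /=; first by rewrite addr0.
by rewrite cut0; zmod.
Qed.
End Cuts.

Lemma cut_morph (L : Type) (V V' : zmodType) (h : V -> V') (s : seq L) G :
  {morph h : u v / u + v} -> h (cut s G) = cut s (fun a b => h (G a b)).
Proof. by move=> hD; elim: s G => //= x s IH G; rewrite hD IH. Qed.

Section Operations.
Variables (L : Type) (V : zmodType).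
Implicit Types (s t N R w : seq L) (x : L) (H : seq L -> V) (k : L -> V).

(** An operation is transposed: it takes a segment of inputs and what is to be done
    with its output. *)
Definition op := seq L -> (L -> V) -> V.
Definition trans := (seq L -> V) -> seq L -> V.
Implicit Types (D E P Q : op) (Phi Psi : trans).

Definition op_add D := forall s k k', D s (fun a => k a + k' a) = D s k + D s k'.
(** Operations on different segments commute without sign, since in the marked
    setting everything is even. *)
Definition exch D E := forall s t (F : L -> L -> V),
  D s (fun a => E t (F a)) = E t (fun b => D s (F^~ b)).

Definition ins D : trans := fun H s =>
  cut s (fun s1 r => cut r (fun s2 s3 => D s2 (fun a => H (s1 ++ a :: s3)))).
(** The composition D{E}: E is applied to a segment of the inputs, and D to the word
    with the output of E in its place. *)
Definition dot D E : op := fun s k => ins E (fun t => D t k) s.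

Lemma op_ext D s k k' : (forall a, k a = k' a) -> D s k = D s k'.
Proof. by move=> e; congr (D _ _); apply: funext. Qed.

Lemma tr_ext Phi H H' s : (forall w, H w = H' w) -> Phi H s = Phi H' s.
Proof. by move=> e; congr (Phi _ _); apply: funext. Qed.

Lemma op_0 D s : op_add D -> D s (fun _ => 0) = 0.
Proof.
move=> aD; have := aD s (fun _ => 0) (fun _ => 0).
under [in X in X = _]op_ext do rewrite addr0.
by move/eqP; rewrite -subr_eq0 opprD addrA subrr add0r oppr_eq0 => /eqP.
Qed.

Lemma op_cut D s w (K : L -> seq L -> seq L -> V) : op_add D ->
  D s (fun a => cut w (K a)) = cut w (fun b c => D s (fun a => K a b c)).
Proof. by move=> aD; elim: w K => //= x w IH K; rewrite aD IH. Qed.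

Definition tr_add Phi := forall H H' N,
  Phi (fun w => H w + H' w) N = Phi H N + Phi H' N.
Definition tr_exch Phi D := forall s (H : L -> seq L -> V) N,
  Phi (fun w => D s (H^~ w)) N = D s (fun a => Phi (H a) N).

Lemma tr_0 Phi N : tr_add Phi -> Phi (fun _ => 0) N = 0.
Proof.
move=> aP; have := aP (fun _ => 0) (fun _ => 0) N.
under [in X in X = _]tr_ext do rewrite addr0.
by move/eqP; rewrite -subr_eq0 opprD addrA subrr add0r oppr_eq0 => /eqP.
Qed.

Lemma tr_N Phi H N : tr_add Phi -> Phi (fun w => - H w) N = - Phi H N.
Proof.
move=> aP; apply/eqP; rewrite -addr_eq0 -aP -[X in _ == X](tr_0 N aP); apply/eqP.
by apply: tr_ext => w; rewrite addNr.
Qed.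

Lemma tr_cut Phi w (K : seq L -> seq L -> seq L -> V) N : tr_add Phi ->
  Phi (fun v => cut w (K v)) N = cut w (fun b c => Phi (fun v => K v b c) N).
Proof. by move=> aD; elim: w K => //= x w IH K; rewrite aD IH. Qed.

Lemma ins_add D : op_add D -> tr_add (ins D).
Proof.
move=> aD H H' N; rewrite /ins -cutD; apply: eq_cut => s1 r.
by rewrite -cutD; apply: eq_cut => s2 s3; rewrite aD.
Qed.

Lemma ins_exch D E : op_add E -> exch D E -> tr_exch (ins D) E.
Proof.
move=> aE xDE s H N; rewrite /ins op_cut //; apply: eq_cut => s1 r.
by rewrite op_cut //; apply: eq_cut => s2 s3; apply: xDE.
Qed.

(** Insertion is a derivation for concatenation, so it distributes over the two
    parts of a cut. *)
Lemma ins_cut D (K : seq L -> seq L -> V) s : op_add D ->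
  ins D (fun w => cut w K) s =
  cut s (fun a b => ins D (K^~ b) a + ins D (K a) b).
Proof.
move=> aD; elim: s K => [|x s IH] K.
  by rewrite /ins /= aD addrC.
have insE H y t : ins D H (y :: t) =
  cut (y :: t) (fun s2 s3 => D s2 (fun a => H (a :: s3))) + ins D (fun w => H (y :: w)) t.
  by [].
rewrite insE /= ins_add // IH.
have -> : cut s (fun a b => D (x :: a) (fun a0 => K [::] (a0 :: b)
     + cut b (fun a1 b0 => K (a0 :: a1) b0)))
  = cut s (fun a b => D (x :: a) (fun a0 => K [::] (a0 :: b)))
  + cut s (fun p c => cut p (fun s2 b => D (x :: s2) (fun a => K (a :: b) c))).
  by rewrite cutA -cutD; apply: eq_cut => a b; rewrite aD op_cut.
have -> : D [::] (fun a => K [::] [:: a, x & s] +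
     (K [:: a] (x :: s) + cut s (fun a0 b => K [:: a, x & a0] b)))
  = D [::] (fun a => K [::] [:: a, x & s]) + (D [::] (fun a => K [:: a] (x :: s))
    + cut s (fun p c => D [::] (fun a => K [:: a, x & p] c))).
  by rewrite aD; congr (_ + _); rewrite aD op_cut.
have -> : cut s (fun a b => ins D (K^~ b) (x :: a) + ins D (K (x :: a)) b)
  = cut s (fun p c => D [::] (fun a => K [:: a, x & p] c))
  + cut s (fun p c => cut p (fun s2 b => D (x :: s2) (fun a => K (a :: b) c)))
  + cut s (fun a b => ins D (fun a' => K (x :: a') b) a + ins D [eta K (x :: a)] b).
  by rewrite -!cutD; apply: eq_cut => a b; rewrite insE /= -!addrA.
rewrite [ins D (K^~ _) [::]]/(ins D _ [::]) /= (insE (K [::])) /=.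
zmod.
Qed.

(** The inserted operation sits left of the distinguished letter, right of it, or
    swallows it. *)
Lemma ins_cat_cons P H R x w : op_add P ->
  ins P H (R ++ x :: w) = ins P (fun R' => H (R' ++ x :: w)) R
  + ins P (fun w' => H (R ++ x :: w')) w
  + cut R (fun R1 R2 => cut w (fun w1 w2 => P (R2 ++ x :: w1) (fun a => H (R1 ++ a :: w2)))).
Proof.
move=> aP; rewrite /ins cut_cat.
have -> : cut R (fun a b => cut (b ++ x :: w) (fun s2 s3 => P s2 (fun a0 => H (a ++ a0 :: s3))))
  = cut R (fun a b => cut b (fun s2 s3 => P s2 (fun a0 => H (a ++ a0 :: s3 ++ x :: w)))
       + cut w (fun w1 w2 => P (b ++ x :: w1) (fun a0 => H (a ++ a0 :: w2)))).
  by apply: eq_cut => a b; rewrite cut_cat.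
rewrite cutD -!addrA; congr (_ + _).
  by apply: eq_cut => a b; apply: eq_cut => c d; apply: op_ext => y; rewrite -catA.
rewrite addrC; congr (_ + _).
by apply: eq_cut => a b; apply: eq_cut => c d; apply: op_ext => y; rewrite -catA.
Qed.

Lemma ins_last D H s x : op_add D ->
  ins D H (rcons s x) = cut (rcons s x) (fun s1 s2 => D s2 (fun a => H (rcons s1 a)))
  + ins D (fun w => H (rcons w x)) s.
Proof.
move=> aD; rewrite /ins -!(cutA _ (fun s1 s2 s3 => D s2 (fun a => _))).
rewrite cut_rcons addrC; congr (_ + _).
  by apply: eq_cut => a b; apply: op_ext => y; rewrite cats1.
apply: eq_cut => a b; apply: eq_cut => c d; apply: op_ext => y.
by rewrite -rcons_cons rcons_cat.
Qed.

Definition ins2 D E : trans := fun H s =>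
  cut s (fun s1 r1 => cut r1 (fun s2 r2 => cut r2 (fun s3 r3 => cut r3 (fun s4 s5 =>
    E s4 (fun b => D s2 (fun a => H (s1 ++ a :: s3 ++ b :: s5))))))).

Lemma exch_sym D E : exch D E -> exch E D.
Proof. by move=> x s t F; rewrite x. Qed.

(** Two insertions are either side by side, in one of two orders, or nested. *)
Lemma ins_ins D E H s : op_add D -> op_add E -> exch D E ->
  ins E (ins D H) s = ins2 D E H s + ins2 E D H s + ins (dot D E) H s.
Proof.
move=> aD aE xDE.
have -> : ins E (ins D H) s = cut s (fun s1 r => cut r (fun s2 s3 =>
    E s2 (fun b => ins D (fun R' => H (R' ++ b :: s3)) s1))) +
  (cut s (fun s1 r => cut r (fun s2 s3 =>
    E s2 (fun b => ins D (fun w' => H (s1 ++ b :: w')) s3))) +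
  cut s (fun s1 r => cut r (fun s2 s3 =>
    E s2 (fun b => cut s1 (fun R1 R2 => cut s3 (fun w1 w2 =>
      D (R2 ++ b :: w1) (fun a => H (R1 ++ a :: w2)))))))).
  rewrite -!cutD; apply: eq_cut => s1 r; rewrite -!cutD; apply: eq_cut => s2 s3.
  rewrite addrA -!aE; apply: op_ext => b; exact: ins_cat_cons.
rewrite -[RHS]addrA; congr (_ + (_ + _)).
- transitivity (cut s (fun s1 r => cut s1 (fun t1 q => cut q (fun t2 t3 =>
    cut r (fun s2 s3 => E s2 (fun b => D t2 (fun a => H (t1 ++ a :: t3 ++ b :: s3)))))))).
    apply: eq_cut => s1 r; under [RHS]eq_cut => t1 q do rewrite cutC.
    rewrite cutC; apply: eq_cut => s2 s3; rewrite op_cut //; apply: eq_cut => t1 t2.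
    rewrite op_cut //; apply: eq_cut => u1 u2.
    by apply: op_ext => b; apply: op_ext => a; rewrite -catA.
  by rewrite cutA /ins2; apply: eq_cut => t1 r1; rewrite cutA.
- apply: eq_cut => s1 r; apply: eq_cut => s2 s3; rewrite op_cut //; apply: eq_cut => t1 t2.
  by rewrite op_cut //; apply: eq_cut => u1 u2; rewrite -xDE.
- transitivity (cut s (fun s1 r => cut s1 (fun R1 R2 => cut r (fun s2 s3 => cut s3 (fun w1 w2 =>
      E s2 (fun b => D (R2 ++ b :: w1) (fun a => H (R1 ++ a :: w2)))))))).
    apply: eq_cut => s1 r; rewrite cutC; apply: eq_cut => s2 s3; rewrite op_cut //.
    by apply: eq_cut => R1 R2; rewrite op_cut.
  rewrite cutA; apply: eq_cut => R1 r1.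
  under eq_cut => R2 r do rewrite -cutA.
  by rewrite -cutA.
Qed.

(** The side by side insertions cancel in the commutator of two insertions; only the
    pre-Lie commutator of the operations remains. *)
Lemma ins_comm D E H s : op_add D -> op_add E -> exch D E ->
  ins E (ins D H) s - ins D (ins E H) s = ins (dot D E) H s - ins (dot E D) H s.
Proof.
move=> aD aE xDE.
rewrite (ins_ins _ _ aD aE xDE) (ins_ins _ _ aE aD (exch_sym xDE)); zmod.
Qed.
End Operations.

(** * Transposed operators on cyclic words *)

Section ChainOps.
Variables (L : Type) (V : zmodType).
Implicit Types (s t xs N R w : seq L) (x : L) (H : seq L -> V) (k : L -> V).
Local Notation op := (op L V).
Local Notation trans := (trans L V).
Implicit Types (D E P Q : op) (Phi Psi : trans) (F : L -> seq L -> V)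
  (G : seq L -> L -> seq L -> V).

(** Sum over the cyclic rotations of a word that keep track of the first letter: it
    stands between the part [R] moved from the end to the front and the rest. *)
Definition rot G : L -> seq L -> V := fun x0 xs => cut xs (fun N R => G R x0 N).
Definition tid : trans := fun H s => H s.
Definition tcomp Phi Psi : trans := fun H s => Phi (Psi H) s.

(** The part of the Lie derivative in which the first letter is not an input. *)
Definition L0 D F : L -> seq L -> V := fun x0 xs => ins D (F x0) xs.
Definition ioG Q Phi F : seq L -> L -> seq L -> V := fun R x0 N =>
  cut N (fun N1 N2 => Phi (fun w => Q (R ++ x0 :: w) (fun b => F b N2)) N1).
(** The transpose of a contraction: Q has the first letter among its inputs, and the
    part of its inputs after the first letter is transformed by [Phi]. For
    [Phi = tid] this is the part of the Lie derivative in which the first letter is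
    an input; for [Phi = ins D] it is iota_D. *)
Definition io Q Phi F := rot (ioG Q Phi F).
Definition ssG u Phi F : seq L -> L -> seq L -> V := fun R x0 N =>
  Phi (fun w => F u (R ++ x0 :: w)) N.
(** The transpose of an operator that rotates a word, transforms its part after the
    first letter by [Phi] and puts the letter [u] in front. For [Phi = tid] this is
    the Connes operator; for [Phi = ins D] it is S_D. *)
Definition ss u Phi F := rot (ssG u Phi F).
(** The transpose of the Lie derivative. *)
Definition Lop D F : L -> seq L -> V := fun x0 xs => L0 D F x0 xs + io D tid F x0 xs.

(** Insertion of P into a cyclic word, of which the first letter is distinguished. *)
Definition tilde P G : seq L -> L -> seq L -> V := fun R x0 N =>
  ins P (fun R' => G R' x0 N) R + ins P (G R x0) N +
  cut R (fun R1 R2 => cut N (fun N1 N2 => P (R2 ++ x0 :: N1) (fun a => G R1 a N2))).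

Lemma eq_rot G G' x0 xs : (forall R N, G R x0 N = G' R x0 N) -> rot G x0 xs = rot G' x0 xs.
Proof. by move=> e; apply: eq_cut => a b. Qed.

Lemma tid_add : tr_add tid. Proof. by []. Qed.
Lemma tid_exch D : tr_exch tid D. Proof. by []. Qed.
Lemma tcomp_add Phi Psi : tr_add Phi -> tr_add Psi -> tr_add (tcomp Phi Psi).
Proof.
move=> a1 a2 H H' N; rewrite /tcomp -a1; apply: tr_ext => w; exact: a2.
Qed.
Lemma tcomp_exch Phi Psi D : tr_exch Phi D -> tr_exch Psi D -> tr_exch (tcomp Phi Psi) D.
Proof.
move=> a1 a2 s H N; rewrite /tcomp -a1; apply: tr_ext => w; exact: a2.
Qed.

Lemma tr_ins Phi P (H : seq L -> seq L -> V) s N : tr_add Phi -> tr_exch Phi P ->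
  Phi (fun w => ins P (H w) s) N = ins P (fun z => Phi (H^~ z) N) s.
Proof.
move=> aP xP; rewrite /ins tr_cut //; apply: eq_cut => s1 r.
by rewrite tr_cut //; apply: eq_cut => s2 s3; apply: xP.
Qed.

Lemma op_ins Q P (H : L -> seq L -> V) s t : op_add Q -> exch Q P ->
  Q t (fun b => ins P (H b) s) = ins P (fun z => Q t (H^~ z)) s.
Proof.
move=> aQ xQ; rewrite /ins op_cut //; apply: eq_cut => s1 r.
by rewrite op_cut //; apply: eq_cut => s2 s3; apply: xQ.
Qed.

Lemma rot_rot (T : seq L -> seq L -> seq L -> seq L -> V) xs :
  cut xs (fun N R => cut N (fun N1 N2 => cut N2 (fun N' R' => T R N1 N' R'))) =
  cut xs (fun N R => cut R (fun R' R2 => cut N (fun N1 N' => T R2 N1 N' R'))).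
Proof.
rewrite -[RHS](cutA xs (fun N R' R2 => cut N (fun N1 N' => T R2 N1 N' R'))).
by apply: eq_cut => N R; rewrite -cutA.
Qed.

(** A contraction of a sum over rotations is again a sum over rotations, because
    rotating a rotated word is a reindexing of two cuts ([rot_rot]). *)
Lemma io_rot P Phi G x0 xs : op_add P -> tr_add Phi ->
  io P Phi (rot G) x0 xs = rot (fun R x0 N => cut R (fun R1 R2 => cut N (fun Na Nb =>
    Phi (fun w => P (R2 ++ x0 :: w) (fun a => G R1 a Nb)) Na))) x0 xs.
Proof.
move=> aP aPhi; rewrite /io /rot /ioG -rot_rot; apply: eq_cut => N R.
apply: eq_cut => N1 N2; rewrite -tr_cut //; apply: tr_ext => w.
by rewrite -op_cut.
Qed.

(** A Lie derivative acts on a sum over rotations by inserting the operation in every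
    place of the cyclic word. *)
Lemma Lop_rot P G x0 xs : op_add P -> Lop P (rot G) x0 xs = rot (tilde P G) x0 xs.
Proof.
move=> aP; rewrite /Lop io_rot //.
rewrite /L0 /rot ins_cut // -cutD; apply: eq_cut => N R.
by rewrite /tilde /tid (addrC (ins P (fun R' => _) R)).
Qed.
End ChainOps.
Arguments tid {L V}.
Arguments tid_add {L V}.
Arguments tid_exch {L V}.

Section Commutation.
Variables (L : Type) (V : zmodType).
Implicit Types (s t xs N R w : seq L) (x : L) (H : seq L -> V) (k : L -> V).
Local Notation op := (op L V).
Local Notation trans := (trans L V).
Implicit Types (F : L -> seq L -> V).

Variable good : (L -> V) -> Prop.
Definition wgood H := forall s1 s2, good (fun a => H (s1 ++ a :: s2)).

Definition out_good (D : op) := forall s (K : L -> L -> V),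
  (forall b, good (K^~ b)) -> good (fun a => D s (K a)).
Definition in_good (D : op) := forall s1 s2 k,
  good k -> good (fun a => D (s1 ++ a :: s2) k).
Hypothesis good_add : forall k k', good k -> good k' -> good (fun a => k a + k' a).

Lemma good_cut s (K : L -> seq L -> seq L -> V) :
  (forall p q, good (fun a => K a p q)) -> good (fun a => cut s (K a)).
Proof.
elim: s K => [|x s IH] K gK /=; first exact: gK.
apply: good_add; first exact: gK.
by apply: (IH (fun a p q => K a (x :: p) q)) => p q; apply: gK.
Qed.

Lemma wgood_cut (K : seq L -> seq L -> V) :
  (forall q, wgood (K^~ q)) -> (forall p, wgood (K p)) -> wgood (fun s => cut s K).
Proof.
move=> g1 g2 s1 s2; under [X in good X]eq_fun => a do rewrite cut_cat.
apply: good_add; apply: good_cut => p q; first exact: g2.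
exact: (g1 q).
Qed.

Lemma wgood_cat H R t : wgood H -> wgood (fun w => H (R ++ w ++ t)).
Proof.
move=> gH s1 s2; have := gH (R ++ s1) (s2 ++ t).
by under eq_fun => a do rewrite -catA -cat_cons; under [in X in X -> _]eq_fun => a do rewrite (catA s1 (a :: s2) t).
Qed.
End Commutation.

(** * The transposed Hochschild differential *)

Section Core.
Variables (L : Type) (V : zmodType).
Implicit Types (s t xs N R w : seq L) (x : L) (H : seq L -> V) (k : L -> V).
Local Notation op := (op L V).
Local Notation trans := (trans L V).
Implicit Types (F : L -> seq L -> V).
Variable good : (L -> V) -> Prop.
Variables (P : op) (lam : V -> V).
Hypothesis aP : op_add P.
Hypothesis lamD : {morph lam : u v / u + v}.
Variables (Phi Phil : trans) (X : (seq L -> seq L -> V) -> seq L -> V).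
Hypothesis aPhi : tr_add Phi.
Hypothesis xPhi : tr_exch Phi P.
Hypothesis comultPhi : forall K N,
  Phi (fun w => cut w K) N = cut N (fun a b => Phi (K a) b) + X K N.
Hypothesis lamPhi : forall H N, lam (Phi H N) = Phi (fun w => lam (H w)) N + Phil H N.
Hypothesis commPhi : forall H N, wgood good H ->
  Phi (ins P H) N = ins P (Phi H) N - Phil H N.

(** The key computation. [Phi] acts on the part of a cyclic word after the first
    letter. Inserting P everywhere commutes with [Phi] up to the terms [X], in which
    P meets both the first letter and something that [Phi] has inserted, and this is
    what [comultPhi] measures. *)
Lemma tilde_derivation H R x0 N : wgood good H ->
  tilde P (fun R x0 N => Phi (fun w => H (R ++ x0 :: w)) N) R x0 N
    - lam (Phi (fun w => H (R ++ x0 :: w)) N)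
  = Phi (fun w => ins P H (R ++ x0 :: w) - lam (H (R ++ x0 :: w))) N
    - cut R (fun R1 R2 => X (fun w1 w2 => P (R2 ++ x0 :: w1) (fun a => H (R1 ++ a :: w2))) N).
Proof.
move=> gH; rewrite lamPhi aPhi tr_N //.
under [in X in _ = X + _ - _]tr_ext => w do rewrite ins_cat_cons //.
rewrite aPhi aPhi tr_ins // commPhi; last first.
  have := @wgood_cat _ _ good H (R ++ [:: x0]) [::] gH.
  by under [in X in X -> _]eq_fun => w do rewrite cats0 -catA.
rewrite tr_cut //.
have -> : cut R (fun b c => Phi (fun v => cut v (fun w1 w2 => P (c ++ x0 :: w1) (fun a => H (b ++ a :: w2)))) N)
  = cut R (fun R1 R2 => cut N (fun N1 N2 => P (R2 ++ x0 :: N1) (fun a => Phi (fun w => H (R1 ++ a :: w)) N2)))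
  + cut R (fun R1 R2 => X (fun w1 w2 => P (R2 ++ x0 :: w1) (fun a => H (R1 ++ a :: w2))) N).
  rewrite -cutD; apply: eq_cut => b c; rewrite comultPhi; congr (_ + _).
  by apply: eq_cut => N1 N2; apply: xPhi.
rewrite /tilde; zmod.
Qed.

(** The transpose of the Hochschild differential: [P] stands for q, and [lam] for the
    action of the brackets on the closed inputs. *)
Definition bdual F : L -> seq L -> V := fun x0 xs => Lop P F x0 xs - lam (F x0 xs).

Lemma lam0 : lam 0 = 0.
Proof. by apply: (addrI (lam 0)); rewrite -lamD !addr0. Qed.
(** The case of a rotation operator: the word after [u] is a plain word, so that P may
    be inserted in it without reference to [u]. *)
Lemma bt_ss u F x0 xs : wgood good (F u) ->
  bdual (ss u Phi F) x0 xs =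
  rot (fun R x0 N => Phi (fun w => ins P (F u) (R ++ x0 :: w) - lam (F u (R ++ x0 :: w))) N) x0 xs
  - rot (fun R x0 N => cut R (fun R1 R2 =>
     X (fun w1 w2 => P (R2 ++ x0 :: w1) (fun a => F u (R1 ++ a :: w2))) N)) x0 xs.
Proof.
move=> gF; rewrite /bdual /ss Lop_rot // {2}/rot (@cut_morph _ _ _ lam) // -cutN -cutD.
rewrite /rot -cutN -cutD; apply: eq_cut => N R; exact: tilde_derivation.
Qed.

Variables (Q Ql QP : op).
Hypothesis aQ : op_add Q.
Hypothesis xQP : exch Q P.
Hypothesis lamQ : forall s k, lam (Q s k) = Q s (fun a => lam (k a)) + Ql s k.
Hypothesis gQ : in_good good Q.
Hypothesis flat : forall s k, good k -> dot Q P s k - Ql s k = QP s k.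

(** The case of a contraction: besides [X] there are the insertions of P that meet the
    contracting operation Q, and they are collected by the relation [flat]. *)
Lemma bt_io F x0 xs : (forall N, good (F^~ N)) ->
  bdual (io Q Phi F) x0 xs =
  io Q Phi (fun b N => L0 P F b N - lam (F b N)) x0 xs
  + io QP Phi F x0 xs
  - rot (fun R x0 N => cut R (fun R1 R2 => cut N (fun N1 N2 =>
     X (fun w1 w2 => P (R2 ++ x0 :: w1) (fun a => Q (R1 ++ a :: w2) (fun b => F b N2))) N1))) x0 xs.
Proof.
move=> gF; rewrite /bdual {1}/io Lop_rot // {1}/io {2}/rot (@cut_morph _ _ _ lam) // -cutN -cutD.
rewrite /io /rot -cutN -!cutD; apply: eq_cut => N R.
pose GN N2 R x0 N1 := Phi (fun w => Q (R ++ x0 :: w) (fun b => F b N2)) N1.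
have -> : tilde P (ioG Q Phi F) R x0 N = cut N (fun N1 N2 => tilde P (GN N2) R x0 N1
   + Phi (fun w => Q (R ++ x0 :: w) (fun b => L0 P F b N2)) N1).
  rewrite /tilde.
  have -> : ins P (fun R' => ioG Q Phi F R' x0 N) R =
     cut N (fun N1 N2 => ins P (fun R' => GN N2 R' x0 N1) R).
    rewrite /ioG -(@tr_cut _ _ (ins P)) //; exact: ins_add.
  have -> : ins P (ioG Q Phi F R x0) N = cut N (fun N1 N2 =>
     ins P (GN N2 R x0) N1 +
     Phi (fun w => Q (R ++ x0 :: w) (fun b => L0 P F b N2)) N1).
    rewrite /ioG ins_cut //; apply: eq_cut => N1 N2; congr (_ + _).
    rewrite -tr_ins //; apply: tr_ext => w; by rewrite op_ins.
  have -> : cut R (fun R1 R2 => cut N (fun N1 N2 => P (R2 ++ x0 :: N1) (fun a => ioG Q Phi F R1 a N2)))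
    = cut N (fun N1' N2 => cut R (fun R1 R2 => cut N1' (fun N1 N1b => P (R2 ++ x0 :: N1)
         (fun a => GN N2 R1 a N1b)))).
    rewrite -[RHS]cutC; apply: eq_cut => R1 R2; rewrite cutA; apply: eq_cut => N1 N2.
    by rewrite /ioG op_cut.
  rewrite -!cutD; apply: eq_cut => N1 N2; zmod.
rewrite /ioG (@cut_morph _ _ _ lam) //.
have -> : cut R (fun R1 R2 => cut N (fun N1 N2 =>
     X (fun w1 w2 => P (R2 ++ x0 :: w1) (fun a => Q (R1 ++ a :: w2) (fun b => F b N2))) N1)) =
   cut N (fun N1 N2 => cut R (fun R1 R2 =>
     X (fun w1 w2 => P (R2 ++ x0 :: w1) (fun a => Q (R1 ++ a :: w2) (fun b => F b N2))) N1)).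
  exact: cutC.
rewrite -!cutN -!cutD; apply: eq_cut => N1 N2.
have gH : wgood good (fun W => Q W (fun b => F b N2)) by move=> s1 s2; apply: gQ.
have T := tilde_derivation R x0 N1 gH.
have -> : forall u v, tilde P (GN N2) R x0 N1 + u - v = (tilde P (GN N2) R x0 N1 - v) + u.
  by move=> u v; zmod.
rewrite T.
have -> : Phi (fun w => ins P (fun W => Q W (fun b => F b N2)) (R ++ x0 :: w) - lam (Q (R ++ x0 :: w) (fun b => F b N2))) N1
  = Phi (fun w => QP (R ++ x0 :: w) (fun b => F b N2)) N1
   - Phi (fun w => Q (R ++ x0 :: w) (fun b => lam (F b N2))) N1.
  rewrite -tr_N // -aPhi; apply: tr_ext => w; rewrite lamQ -flat //.
  rewrite -[dot _ _ _ _]/(ins P (fun W => Q W (fun b => F b N2)) (R ++ x0 :: w)); zmod.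
have -> : Phi (fun w => Q (R ++ x0 :: w) (fun b => L0 P F b N2 - lam (F b N2))) N1
  = Phi (fun w => Q (R ++ x0 :: w) (fun b => L0 P F b N2)) N1
   - Phi (fun w => Q (R ++ x0 :: w) (fun b => lam (F b N2))) N1.
  rewrite -tr_N // -aPhi; apply: tr_ext => w; rewrite aQ; congr (_ + _).
  apply/eqP; rewrite -addr_eq0 -aQ -[X in _ == X](op_0 (R ++ x0 :: w) aQ); apply/eqP.
  by apply: op_ext => a; rewrite addNr.
zmod.
Qed.
End Core.

(** * Unit letters and telescoping over rotations *)

Section CutSelect.
Variables (L : Type) (V : zmodType).
Implicit Types (W : seq L).

Lemma cut_nill W (g : seq L -> V) : cut W (fun N R => if N is [::] then g R else 0) = g W.
Proof. by case: W => //= x W; rewrite cut0 addr0. Qed.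

Lemma cut_nilr W (g : seq L -> V) : cut W (fun N R => if R is [::] then g N else 0) = g W.
Proof. by elim: W g => //= x W IH g; rewrite (IH (fun N => g (x :: N))) add0r. Qed.

Lemma cut_onel W (h : L -> seq L -> V) :
  cut W (fun N R => if N is [:: z] then h z R else 0) = if W is z :: W' then h z W' else 0.
Proof.
case: W => //= x W; rewrite add0r -[RHS](cut_nill W (h x)).
by apply: eq_cut => -[].
Qed.

Lemma cut_oner W (h : L -> seq L -> V) :
  cut W (fun N R => if R is [:: z] then h z N else 0) =
  if rev W is z :: W' then h z (rev W') else 0.
Proof.
case: (lastP W) => [|s x] //; rewrite rev_rcons /= revK cut_rcons addr0.
rewrite -[RHS](cut_nilr s (h x)); apply: eq_cut => a [|y b] //=.
by case: b.
Qed.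
End CutSelect.

Section Instances.
Variables (L : Type) (V : zmodType).
Implicit Types (s t xs N R w : seq L) (x : L) (H : seq L -> V) (k : L -> V).
Local Notation op := (op L V).
Local Notation trans := (trans L V).
Implicit Types (D E P Q : op) (Phi Psi : trans) (F : L -> seq L -> V)
  (G : seq L -> L -> seq L -> V) (K : seq L -> seq L -> V).

Definition tid_X K N : V := 0.
Definition ins_X D K N := cut N (fun a b => ins D (K^~ b) a).
Definition comp_X D E K N := cut N (fun a b =>
  ins E (ins D (K^~ b)) a + ins D (fun w => ins E (K w) b) a + ins E (fun w => ins D (K w) b) a).

Lemma tid_comult K N :
  tid (fun w => cut w K) N = cut N (fun a b => tid (K a) b) + tid_X K N.
Proof. by rewrite addr0. Qed.

Lemma ins_comult D K N : op_add D ->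
  ins D (fun w => cut w K) N = cut N (fun a b => ins D (K a) b) + ins_X D K N.
Proof. by move=> aD; rewrite ins_cut // cutD addrC. Qed.

Lemma ins_swap D E K a b : op_add D -> op_add E -> exch D E ->
  ins E (fun w' => ins D (fun w => K w w') a) b = ins D (fun w => ins E (K w) b) a.
Proof.
move=> aD aE xDE; rewrite tr_ins //; first exact: ins_add.
by apply: ins_exch => //; exact: exch_sym.
Qed.

Lemma comp_comult D E K N : op_add D -> op_add E -> exch D E ->
  tcomp (ins E) (ins D) (fun w => cut w K) N =
  cut N (fun a b => tcomp (ins E) (ins D) (K a) b) + comp_X D E K N.
Proof.
move=> aD aE xDE; rewrite /tcomp /comp_X -cutD.
under tr_ext => w do rewrite ins_cut //.
rewrite ins_cut //; apply: eq_cut => a b; rewrite !ins_add // (@ins_swap D E K a b) //; zmod.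
Qed.

Lemma mid_ss P Phi1 Phi2 u F x0 xs : op_add P -> tr_add Phi1 -> tr_exch Phi2 P ->
  rot (fun R x0 N => cut R (fun R1 R2 => cut N (fun a b =>
    Phi1 (fun w1 => Phi2 (fun w2 => P (R2 ++ x0 :: w1) (fun a => F u (R1 ++ a :: w2))) b) a))) x0 xs
  = io P Phi1 (ss u Phi2 F) x0 xs.
Proof.
move=> aP a1 x2; rewrite /ss io_rot //; apply: eq_rot => R N; apply: eq_cut => R1 R2.
by apply: eq_cut => a b; apply: tr_ext => w; apply: x2.
Qed.

Lemma mid_io P Q Phi1 Phi2 F x0 xs : op_add P -> tr_add Phi1 -> tr_exch Phi2 P ->
  rot (fun R x0 N => cut R (fun R1 R2 => cut N (fun N1 N2 => cut N1 (fun a b =>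
    Phi1 (fun w1 => Phi2 (fun w2 => P (R2 ++ x0 :: w1) (fun a =>
       Q (R1 ++ a :: w2) (fun b => F b N2))) b) a)))) x0 xs
  = io P Phi1 (io Q Phi2 F) x0 xs.
Proof.
move=> aP a1 x2; rewrite {2}/io io_rot //; apply: eq_rot => R N; apply: eq_cut => R1 R2.
rewrite cutA; apply: eq_cut => a b; rewrite -tr_cut //; apply: tr_ext => w.
by rewrite op_cut //; apply: eq_cut => N1 N2; apply: x2.
Qed.

Variables (good : (L -> V) -> Prop) (u : L).

(** The value on a word with the letter [u] is zero, except for words of length two;
    there it is the other letter, with opposite signs on the two sides. The map
    [nu] absorbs the marks of the operation and of [u]. *)
Definition unital (P : op) (nu : V -> V) := forall s1 s2 k, good k ->
  P (s1 ++ u :: s2) k = match s1, s2 with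
    | [::], [:: z] => nu (k z) | [:: z], [::] => - nu (k z) | _, _ => 0 end.

Definition noempty Phi := forall (v : V) N, Phi (fun w => if w is [::] then v else 0) N = 0.

Definition hd_of F W := if W is z :: W' then F z W' else 0.
Definition last_of F W := if rev W is z :: W' then F z (rev W') else 0.

(** If the first letter is the unit, only the words of length two contribute: the
    rotated word starts with the unit and loses it from the left or from the
    right. *)
Lemma io_tid_unit P nu F W : op_add P -> unital P nu -> (forall N, good (F^~ N)) ->
  {morph nu : v w / v + w} ->
  io P tid F u W = nu (hd_of F W) - nu (last_of F W).
Proof.
move=> aP uP gF nuD.
have nu0 : nu 0 = 0 by apply: (addrI (nu 0)); rewrite -nuD !addr0.
transitivity (cut W (fun N R => if R is [::] then
    cut N (fun N1 N2 => if N1 is [:: z] then nu (F z N2) else 0) else 0)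
  - cut W (fun N R => if R is [:: z] then
    cut N (fun N1 N2 => if N1 is [::] then nu (F z N2) else 0) else 0)).
  rewrite -cutN -cutD; apply: eq_cut => N R; rewrite /ioG /tid.
  case: R => [|y [|y' R]].
  - rewrite subr0; apply: eq_cut => N1 N2; rewrite (uP [::]) //.
  - rewrite add0r -cutN; apply: eq_cut => N1 N2; rewrite (uP [:: y]) //.
    by case: N1 => //; rewrite oppr0.
  - rewrite subr0 -[RHS](cut0 _ N); apply: eq_cut => N1 N2.
    by rewrite (uP [:: y, y' & R]).
rewrite cut_nilr cut_onel /hd_of; congr (_ - _).
  by case: W => //=; rewrite nu0.
rewrite /last_of.
under eq_cut => N R.
  have -> : (match R with [:: z] => cut N (fun N1 N2 => match N1 with [::] => nu (F z N2) | _ :: _ => 0 end) | _ => 0 end) =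
    match R with [:: z] => nu (F z N) | _ => 0 end.
    by case: R => [|z [|z' R]] //; rewrite (cut_nill N (fun N2 => nu (F z N2))).
  over.
rewrite (cut_oner W (fun z N => nu (F z N))).
by case: (rev W) => [|z W'] //; rewrite nu0.
Qed.

Lemma io_unit P nu Phi (pD : op) F W :
  unital P nu -> (forall N, good (F^~ N)) -> tr_add Phi -> noempty Phi ->
  (forall h N, Phi (fun w => if w is [:: z] then h z else 0) N = pD N h) ->
  io P Phi F u W = cut W (fun N1 N2 => pD N1 (fun z => nu (F z N2))).
Proof.
move=> uP gF aPhi nPhi pPhi; rewrite /io /rot -[RHS](cut_nilr W (fun N => cut N _)).
apply: eq_cut => N R; rewrite /ioG.
case: R => [|y [|y' R]].
- apply: eq_cut => N1 N2; rewrite -pPhi; apply: tr_ext => w.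
  by rewrite (uP [::]).
- rewrite -[RHS](cut0 _ N); apply: eq_cut => N1 N2.
  rewrite -[RHS](nPhi (- nu (F y N2)) N1); apply: tr_ext => w.
  by rewrite (uP [:: y]).
- rewrite -[RHS](cut0 _ N); apply: eq_cut => N1 N2.
  rewrite -[RHS](tr_0 N1 aPhi); apply: tr_ext => w.
  by rewrite (uP [:: y, y' & R]).
Qed.

Lemma ins_noempty D : op_add D -> noempty (ins D).
Proof.
move=> aD v N; rewrite -[RHS](cut0 _ N); apply: eq_cut => s1 r.
rewrite -[RHS](cut0 _ r); apply: eq_cut => s2 s3; rewrite -[RHS](op_0 s2 aD).
by apply: op_ext => a; case: s1.
Qed.

Lemma ins_one D h N : op_add D ->
  ins D (fun w => if w is [:: z] then h z else 0) N = D N h.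
Proof.
move=> aD; rewrite -[RHS](cut_nill N (fun r => D r h)); apply: eq_cut => s1 r.
case: s1 => [|y s1].
  rewrite -[RHS](cut_nilr r (fun s => D s h)); apply: eq_cut => s2 s3.
  case: s3 => [|z s3] //=.
  by rewrite -[RHS](op_0 s2 aD).
rewrite -[RHS](cut0 _ r); apply: eq_cut => s2 s3; rewrite -[RHS](op_0 s2 aD).
by apply: op_ext => a; case: s1.
Qed.

Lemma comp_noempty D E : op_add D -> op_add E -> noempty (tcomp (ins E) (ins D)).
Proof.
move=> aD aE v N; rewrite /tcomp -[RHS](tr_0 N (ins_add aE)).
by apply: tr_ext => w; exact: ins_noempty.
Qed.

Lemma comp_one D E h N : op_add D -> op_add E ->
  tcomp (ins E) (ins D) (fun w => if w is [:: z] then h z else 0) N = dot D E N h.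
Proof.
by move=> aD aE; rewrite /tcomp /dot; apply: tr_ext => w; exact: ins_one.
Qed.

(** The sum over rotations of the difference between removing the unit in front of a
    word and removing it behind the word. *)
Definition tele Phi F x0 xs := rot (fun R x0 N =>
  Phi (fun w => hd_of F (R ++ x0 :: w) - last_of F (R ++ x0 :: w)) N) x0 xs.

(** Consecutive rotations share a term, except where the last letter has been changed
    by [Phi]; these exceptions form [res]. *)
Lemma teleE Phi F (res : seq L -> L -> seq L -> V) x0 xs : tr_add Phi ->
  (forall R N, Phi (fun w => last_of F (R ++ x0 :: w)) N = res R x0 N +
    if rev N is z :: N' then Phi (fun w => F z (R ++ x0 :: w)) (rev N') else 0) ->
  tele Phi F x0 xs = Phi (F x0) xs - rot res x0 xs.
Proof.
move=> aPhi lastE; rewrite /tele /rot.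
under eq_cut => N R do rewrite aPhi tr_N // lastE opprD addrA.
rewrite !cutD.
have -> : cut xs (fun N R => Phi (fun w => hd_of F (R ++ x0 :: w)) N) =
  cut xs (fun N R => if R is [::] then Phi (F x0) N else 0) +
  cut xs (fun N R => if R is z :: R' then Phi (fun w => F z (R' ++ x0 :: w)) N else 0).
  rewrite -cutD; apply: eq_cut => N [|z R] /=; first by rewrite addr0.
  by rewrite add0r.
rewrite cut_nilr (cut_shift _ (fun N z R => Phi (fun w => F z (R ++ x0 :: w)) N)) !cutN.
zmod.
Qed.

Lemma last_of_cat F R x0 w : last_of F (R ++ x0 :: w) =
  if rev w is z :: w' then F z (R ++ x0 :: rev w') else F x0 R.
Proof.
rewrite /last_of; case: (lastP w) => [|w' z].
  by rewrite cats1 rev_rcons revK.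
by rewrite -rcons_cons -rcons_cat !rev_rcons !revK.
Qed.

Definition ins_res D F R x0 N := cut N (fun s1 s2 => D s2 (fun a => F a (R ++ x0 :: s1))).

Lemma ins_last_of D F R x0 N : op_add D ->
  ins D (fun w => last_of F (R ++ x0 :: w)) N = ins_res D F R x0 N +
  if rev N is z :: N' then ins D (fun w => F z (R ++ x0 :: w)) (rev N') else 0.
Proof.
move=> aD; case: (lastP N) => [|N' z].
  by rewrite addr0 /ins /=; apply: op_ext => a; rewrite last_of_cat.
rewrite ins_last // rev_rcons /= revK; congr (_ + _).
  by apply: eq_cut => s1 s2; apply: op_ext => a; rewrite last_of_cat rev_rcons /= revK.
by apply: tr_ext => w; rewrite last_of_cat rev_rcons /= revK.
Qed.

Definition comp_res D E F R x0 N :=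
  cut N (fun s1 s2 => D s2 (fun a => ins E (fun w => F a (R ++ x0 :: w)) s1)
    + dot D E s2 (fun a => F a (R ++ x0 :: s1))
    + E s2 (fun b => ins D (fun w => F b (R ++ x0 :: w)) s1)).

Lemma comp_last_of D E F R x0 N : op_add D -> op_add E -> exch D E ->
  tcomp (ins E) (ins D) (fun w => last_of F (R ++ x0 :: w)) N = comp_res D E F R x0 N +
  if rev N is z :: N' then tcomp (ins E) (ins D) (fun w => F z (R ++ x0 :: w)) (rev N') else 0.
Proof.
move=> aD aE xDE; rewrite /tcomp.
under tr_ext => w do rewrite ins_last_of //.
rewrite ins_add // /comp_res cutD -addrA; congr (_ + _).
  rewrite /ins_res ins_cut //; apply: eq_cut => a b; congr (_ + _).
  by rewrite op_ins.
case: (lastP N) => [|N' z].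
  rewrite addr0 /ins /=; apply: op_ext => b.
  by [].
rewrite ins_last // rev_rcons /= revK; congr (_ + _).
  by apply: eq_cut => s1 s2; apply: op_ext => b; rewrite rev_rcons /= revK.
by apply: tr_ext => w; rewrite rev_rcons /= revK.
Qed.
End Instances.

(** * Homotopy identities for words *)

Section Main.
Variables (L : Type) (V : zmodType).
Implicit Types (s t xs N R w : seq L) (x : L) (H : seq L -> V) (k : L -> V).
Local Notation op := (op L V).
Local Notation trans := (trans L V).
Implicit Types (D E P Q : op) (F : L -> seq L -> V).
Variable good : (L -> V) -> Prop.
Hypothesis good_add : forall k k', good k -> good k' -> good (fun a => k a + k' a).

Lemma wgood_ins D H : in_good good D -> out_good good D ->
  wgood good H -> wgood good (ins D H).
Proof.
move=> iD oD gH; apply: wgood_cut => // [r|s1].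
  move=> p q; apply: good_cut => // s2 s3; apply: oD => a.
  have := gH p (q ++ a :: s3).
  by under [in X in X -> _]eq_fun => y do rewrite -cat_cons catA.
apply: wgood_cut => // [s3|s2] p q; first exact/iD/gH.
apply: oD => a; have := gH (s1 ++ a :: p) q.
by under [in X in X -> _]eq_fun => y do rewrite -catA.
Qed.

Variables (P : op) (lam nu : V -> V) (u : L).
Hypothesis lamD : {morph lam : v w / v + w}.
Hypothesis nuD : {morph nu : v w / v + w}.

(** [Dl] is the operation D with a bracket inserted among its closed inputs. *)
Definition deriv D (Dl : op) := forall s k,
  lam (D s k) = D s (fun a => lam (k a)) + Dl s k.
(** The equation [q, D] = 0 of a closed cochain, in the sign-free form. *)
Definition closed D (Dl : op) := forall s k, good k ->
  dot P D s k - dot D P s k + Dl s k = 0.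
Record lawful D : Prop := Lawful {
  law_add : op_add D;
  law_in : in_good good D;
  law_out : out_good good D;
  law_nu : forall s k, nu (D s k) = D s (fun a => nu (k a));
  law_exch : exch D P }.

Lemma nu_ins D H N : lawful D -> nu (ins D H N) = ins D (fun w => nu (H w)) N.
Proof.
move=> lD; rewrite /ins cut_morph //; apply: eq_cut => s1 r.
rewrite cut_morph //; apply: eq_cut => s2 s3; exact: law_nu.
Qed.

Lemma lam_ins D Dl H N : deriv D Dl ->
  lam (ins D H N) = ins D (fun w => lam (H w)) N + ins Dl H N.
Proof.
move=> dD; rewrite /ins cut_morph // -cutD; apply: eq_cut => s1 r.
rewrite cut_morph // -cutD; apply: eq_cut => s2 s3; exact: dD.
Qed.

Hypothesis lP : lawful P.
Let aP := law_add lP.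

(** A closed operation can be moved past P, up to the bracket term. *)
Lemma comm_ins D Dl H N : lawful D -> closed D Dl -> wgood good H ->
  ins D (ins P H) N = ins P (ins D H) N - ins Dl H N.
Proof.
move=> lD cD gH.
apply/eqP; rewrite addrC -subr_eq ins_comm //; [|exact: law_add lD|exact/exch_sym/(law_exch lD)].
rewrite -subr_eq0 opprK; apply/eqP.
rewrite /ins -cutN -!cutD -[RHS](cut0 _ N); apply: eq_cut => s1 r.
rewrite -cutN -!cutD -[RHS](cut0 _ r); apply: eq_cut => s2 s3; exact/cD/gH.
Qed.

Local Notation bt := (bdual P lam).

(** Specialization of [bt_io] to the wrap-around part of a Lie derivative. *)
Lemma bt_io_tid Q Ql QP F x0 xs : op_add Q -> exch Q P -> deriv Q Ql -> in_good good Q ->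
  (forall s k, good k -> dot Q P s k - Ql s k = QP s k) -> (forall N, good (F^~ N)) ->
  bt (io Q tid F) x0 xs = io Q tid (fun b N => L0 P F b N - lam (F b N)) x0 xs
  + io QP tid F x0 xs.
Proof.
move=> aQ xQ dQ iQ fQ gF.
rewrite (@bt_io _ _ good P lam aP lamD tid (fun _ _ => 0) (@tid_X _ _) tid_add (tid_exch P)
  (@tid_comult _ _) _ _ Q Ql QP) //.
- rewrite [X in _ - X](_ : _ = 0) ?subr0 //.
  rewrite -[RHS](cut0 _ xs); apply: eq_cut => N R; rewrite -[RHS](cut0 _ R).
  by apply: eq_cut => R1 R2; rewrite -[RHS](cut0 _ N); apply: eq_cut.
- by move=> H N; rewrite addr0.
- by move=> H N _; rewrite subr0.
Qed.

(** b commutes with iota_D up to the pair of terms with two copies of q whose sum is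
    killed by antisymmetry. *)
Lemma bt_io_ins Q Ql D Dl F x0 xs : lawful Q -> deriv Q Ql ->
  (forall s k, good k -> dot Q P s k = Ql s k) ->
  lawful D -> closed D Dl -> deriv D Dl -> (forall N, good (F^~ N)) ->
  bt (io Q (ins D) F) x0 xs = io Q (ins D) (fun b N => L0 P F b N - lam (F b N)) x0 xs
  - io P (ins D) (io Q tid F) x0 xs.
Proof.
move=> lQ dQ fQ lD cD dD gF; have aD := law_add lD.
have fQ0 s k : good k -> dot Q P s k - Ql s k = (fun _ _ => 0) s k.
  by move=> gk; rewrite fQ // subrr.
rewrite (@bt_io _ _ good P lam aP lamD (ins D) (ins Dl) (ins_X D) (ins_add aD)
  (ins_exch aP (law_exch lD)) _ _ _ Q Ql (fun _ _ => 0)) //.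
- congr (_ - _).
    rewrite [X in _ + X](_ : _ = 0) ?addr0 //.
    rewrite -[RHS](cut0 _ xs); apply: eq_cut => N R; rewrite -[RHS](cut0 _ N).
    apply: eq_cut => a b; exact/tr_0/ins_add.
  by rewrite -mid_io //; exact: ins_add.
- by move=> K N; rewrite ins_comult.
- by move=> H N; apply: lam_ins.
- by move=> H N gH; apply: comm_ins.
- exact: law_add lQ.
- exact: law_exch.
- exact: law_in.
Qed.

Lemma nu0 : nu 0 = 0.
Proof. by apply: (addrI (nu 0)); rewrite -nuD !addr0. Qed.
Lemma nuN v : nu (- v) = - nu v.
Proof. by apply: (addrI (nu v)); rewrite -nuD !subrr nu0. Qed.

Hypothesis uP : unital good u P nu.

(** b after the rotation operator sees the unit as first letter, and this gives the
    telescoping sum. *)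
Lemma ss_bt Phi F x0 xs : (forall N, good (F^~ N)) -> tr_add Phi ->
  (forall H N, nu (Phi H N) = Phi (fun w => nu (H w)) N) ->
  ss u Phi (bt F) x0 xs =
  rot (fun R x0 N => Phi (fun w => ins P (F u) (R ++ x0 :: w) - lam (F u (R ++ x0 :: w))) N) x0 xs
  + nu (tele Phi F x0 xs).
Proof.
move=> gF aPhi nPhi; rewrite /tele /ss /rot (@cut_morph _ _ _ nu) // -cutD.
apply: eq_cut => N R; rewrite nPhi -aPhi; apply: tr_ext => w.
rewrite /bdual /Lop /L0 (io_tid_unit _ aP uP) // nuD nuN; zmod.
Qed.

(** For the Connes operator the telescoping sum has no exceptional terms and vanishes,
    since the full cycle of rotations closes up. *)
Lemma bt_ss_tid F x0 xs : (forall N, good (F^~ N)) -> wgood good (F u) ->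
  bt (ss u tid F) x0 xs = ss u tid (bt F) x0 xs.
Proof.
move=> gF gFu; rewrite ss_bt //.
rewrite (@bt_ss _ _ good P lam aP lamD tid (fun _ _ => 0) (@tid_X _ _) tid_add (tid_exch P)
  (@tid_comult _ _)) //; first last.
- by move=> H N _; rewrite subr0.
- by move=> H N; rewrite addr0.
congr (_ + _).
rewrite (@teleE _ _ tid F (fun R x0 N => if N is [::] then F x0 R else 0)) //; last first.
  move=> R N; rewrite /tid last_of_cat; case: (lastP N) => [|N' z]; first by rewrite addr0.
  by rewrite rev_rcons; case: N' => [|? ?] /=; rewrite add0r.
have -> : rot (fun R x N => if N is [::] then F x R else 0) x0 xs = F x0 xs by exact: cut_nill.
rewrite /tid subrr nu0.
rewrite [X in - X](_ : _ = 0) ?oppr0 //.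
rewrite -[RHS](cut0 _ xs); apply: eq_cut => N R; rewrite -[RHS](cut0 _ R).
by apply: eq_cut => R1 R2.
Qed.

Lemma ins_resE D F x0 xs : cut xs (fun N R => cut R (fun R1 R2 =>
    D R1 (fun a => F a (R2 ++ x0 :: N)))) = rot (ins_res D F) x0 xs.
Proof. by rewrite -cutA. Qed.

(** The operation P has the unit among its inputs here, and can keep only one further
    input: the output of D. *)
Lemma ss_tid_io Phi D F x0 xs : op_add D ->
  (forall s k, nu (D s k) = D s (fun a => nu (k a))) -> (forall N, good (F^~ N)) ->
  tr_add Phi -> noempty Phi ->
  (forall h N, Phi (fun w => if w is [:: z] then h z else 0) N = D N h) ->
  ss u tid (io P Phi F) x0 xs = nu (rot (ins_res D F) x0 xs + io D tid F x0 xs).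
Proof.
move=> aD nD gF aPhi nPhi pPhi; rewrite -ins_resE [io D _ _ _ _]/io /ss /rot -cutD cut_morph //.
apply: eq_cut => N R; rewrite /ssG /tid (io_unit _ uP gF aPhi nPhi pPhi).
rewrite cut_cat /ioG nuD !(@cut_morph _ _ _ nu) //; congr (_ + _).
  by apply: eq_cut => a b; rewrite nD.
by apply: eq_cut => a b; rewrite nD.
Qed.

Lemma ss_ins_io D E F x0 xs : lawful D -> lawful E -> exch D E ->
  (forall N, good (F^~ N)) ->
  ss u (ins E) (io P (ins D) F) x0 xs =
  nu (rot (fun R x0 N => cut N (fun s1 s2 =>
        D s2 (fun a => ins E (fun w => F a (R ++ x0 :: w)) s1))) x0 xs
    + io D (ins E) F x0 xs + io D tid (L0 E F) x0 xs).
Proof.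
move=> lD lE xDE gF; have aD := law_add lD; have aE := law_add lE.
have -> : rot (fun R x0 N => cut N (fun s1 s2 =>
        D s2 (fun a => ins E (fun w => F a (R ++ x0 :: w)) s1))) x0 xs =
   cut xs (fun N R => cut R (fun R1 R2 => D R1 (fun a => ins E (fun w => F a (R2 ++ x0 :: w)) N))).
  by rewrite -cutA.
rewrite [io D (ins E) _ _ _]/io [io D tid _ _ _]/io /ss /rot -!cutD cut_morph //; apply: eq_cut => N R; rewrite /ssG.
transitivity (ins E (fun w => nu (cut (R ++ x0 :: w) (fun N1 N2 => D N1 (fun z => F z N2)))) N).
  apply: tr_ext => w.
  rewrite (io_unit _ uP gF (ins_add aD) (ins_noempty aD) (fun h N => ins_one h N aD)).
  by rewrite cut_morph //; apply: eq_cut => a b; rewrite (law_nu lD).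
rewrite -nu_ins //; congr nu.
under tr_ext => w do rewrite cut_cat.
rewrite ins_add // -addrA; congr (_ + _).
  rewrite tr_cut; last exact: ins_add.
  apply: eq_cut => R1 R2; apply: (ins_exch aD (exch_sym xDE)).
rewrite ins_cut // -cutD; apply: eq_cut => a b; congr (_ + _).
by rewrite /tid /L0 op_ins.
Qed.

Lemma Lop_io D E F x0 xs : op_add D -> op_add E -> exch D E -> in_good good D ->
  (forall N, good (F^~ N)) ->
  Lop E (io D tid F) x0 xs = io D tid (L0 E F) x0 xs + io (dot D E) tid F x0 xs.
Proof.
move=> aD aE xDE iD gF.
have := (@bt_io _ _ good E (fun _ => 0) aE (fun _ _ => esym (addr0 _)) tid (fun _ _ => 0) (@tid_X _ _) tid_add (tid_exch E)
  (@tid_comult _ _) (fun H N => esym (addr0 _)) (fun H N _ => esym (subr0 _)) D (fun _ _ => 0) (dot D E) aD xDE _ iD _ F x0 xs gF).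
rewrite /bdual subr0 => -> //; last 2 first.
- by move=> s k; rewrite op_0 // addr0.
- by move=> s k _; rewrite subr0.
rewrite [X in _ - X](_ : _ = 0) ?subr0; last first.
  rewrite -[RHS](cut0 _ xs); apply: eq_cut => N R; rewrite -[RHS](cut0 _ R).
  by apply: eq_cut => R1 R2; rewrite -[RHS](cut0 _ N); apply: eq_cut.
congr (_ + _); apply: eq_rot => R N; apply: eq_cut => N1 N2; rewrite /tid.
by apply: op_ext => a; rewrite subr0.
Qed.

Lemma tele_ins D F x0 xs : op_add D ->
  tele (ins D) F x0 xs = L0 D F x0 xs - rot (ins_res D F) x0 xs.
Proof.
by move=> aD; apply: teleE; [exact: ins_add | move=> R N; exact: ins_last_of].
Qed.

(** The Cartan homotopy formula for one insertion. The Lie derivative is the value of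
    the telescoping sum plus its exceptional terms, which [ss_tid_io] rewrites as the
    product of B and iota_D. *)
Lemma bt_ss_ins D Dl F x0 xs : lawful D -> closed D Dl -> deriv D Dl ->
  (forall N, good (F^~ N)) -> wgood good (F u) ->
  bt (ss u (ins D) F) x0 xs = ss u (ins D) (bt F) x0 xs
   - io P (ins D) (ss u tid F) x0 xs - nu (Lop D F x0 xs) + ss u tid (io P (ins D) F) x0 xs.
Proof.
move=> lD cD dD gF gFu; have aD := law_add lD.
rewrite ss_bt //; [|exact: ins_add|by move=> H N; exact: nu_ins].
rewrite (@bt_ss _ _ good P lam aP lamD (ins D) (ins Dl) (ins_X D) (ins_add aD)
  (ins_exch aP (law_exch lD))) //; first last.
- by move=> H N gH; apply: comm_ins.
- by move=> H N; apply: lam_ins.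
- by move=> K N; rewrite ins_comult.
rewrite (@ss_tid_io (ins D) D) //; [|exact: law_nu|exact: ins_add|exact: ins_noempty|by move=> h N; exact: ins_one].
rewrite -mid_ss //; [|exact: ins_add].
rewrite tele_ins // /Lop !nuD nuN.
zmod.
Qed.

Lemma bt_L0 E El F x0 xs : lawful E -> closed E El -> deriv E El -> wgood good (F x0) ->
  bt (L0 E F) x0 xs = L0 E (fun a w => L0 P F a w - lam (F a w)) x0 xs + io P tid (L0 E F) x0 xs.
Proof.
move=> lE cE dE gF; have aE := law_add lE.
have -> : L0 E (fun a w => L0 P F a w - lam (F a w)) x0 xs =
    ins E (ins P (F x0)) xs - ins E (fun w => lam (F x0 w)) xs.
  by rewrite /L0 ins_add // tr_N //; exact: ins_add.
rewrite (comm_ins _ lE cE gF) /bdual /Lop.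
have -> : lam (L0 E F x0 xs) = ins E (fun w => lam (F x0 w)) xs + ins El (F x0) xs.
  exact: lam_ins.
have -> : L0 P (L0 E F) x0 xs = ins P (ins E (F x0)) xs by [].
zmod.
Qed.

Lemma bt_Lop E El F x0 xs : lawful E -> closed E El -> deriv E El ->
  (forall x, wgood good (F x)) -> (forall N, good (F^~ N)) ->
  bt (Lop E F) x0 xs = Lop E (bt F) x0 xs.
Proof.
move=> lE cE dE gF gF'; have aE := law_add lE.
have LopD G G' : forall D, op_add D -> Lop D (fun a w => G a w + G' a w) x0 xs = Lop D G x0 xs + Lop D G' x0 xs.
  move=> D aD; rewrite /Lop addrACA; congr (_ + _); first exact: ins_add.
  rewrite /io /rot -cutD; apply: eq_cut => N R; rewrite /ioG -cutD; apply: eq_cut => a b.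
  by rewrite /tid aD.
have -> : bt (Lop E F) x0 xs = bt (L0 E F) x0 xs + bt (io E tid F) x0 xs.
  by rewrite /bdual LopD // lamD; zmod.
rewrite (bt_L0 _ lE cE dE) // (@bt_io_tid E El (dot P E)) //; [|exact: law_exch|exact: law_in|]; last first.
  move=> s k gk; apply/eqP; rewrite -subr_eq0 -oppr_eq0 -[X in _ == X](cE s k gk).
  by apply/eqP; zmod.
have -> : Lop E (bt F) x0 xs = Lop E (fun a w => L0 P F a w - lam (F a w)) x0 xs + Lop E (io P tid F) x0 xs.
  rewrite -LopD //; congr Lop; apply: funext => a; apply: funext => w.
  by rewrite /bdual /Lop; zmod.
rewrite (Lop_io _ _ aP aE (exch_sym (law_exch lE)) (law_in lP) gF') /Lop; zmod.
Qed.

Section Two.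
Variables (D Dl E El : op).
Hypothesis lD : lawful D.
Hypothesis cD : closed D Dl.
Hypothesis dD : deriv D Dl.
Hypothesis lE : lawful E.
Hypothesis cE : closed E El.
Hypothesis dE : deriv E El.
Hypothesis xDE : exch D E.
Let aD := law_add lD.
Let aE := law_add lE.
Let DE : trans := tcomp (ins E) (ins D).
Let DEl : trans := fun H N => ins E (ins Dl H) N + ins El (ins D H) N.

Lemma comp_add : tr_add DE.
Proof. by apply: tcomp_add; exact: ins_add. Qed.
Lemma comp_exch : tr_exch DE P.
Proof. by apply: tcomp_exch; apply: ins_exch => //; apply: law_exch. Qed.

Lemma lam_comp H N : lam (DE H N) = DE (fun w => lam (H w)) N + DEl H N.
Proof.
rewrite /DE /DEl /tcomp (lam_ins _ _ dE) addrA; congr (_ + _).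
by rewrite -ins_add //; apply: tr_ext => w; apply: lam_ins.
Qed.

Lemma comm_comp H N : wgood good H -> DE (ins P H) N = ins P (DE H) N - DEl H N.
Proof.
move=> gH; rewrite /DE /DEl /tcomp.
under tr_ext => w do rewrite (comm_ins w lD cD gH).
rewrite ins_add // tr_N; last exact: ins_add.
rewrite (comm_ins N lE cE); last by apply: wgood_ins => //; [exact: law_in|exact: law_out].
zmod.
Qed.

(** For two insertions the coproduct of [Phi] has four terms, so that b produces the
    products of the two contractions as well. *)
Lemma bt_io_comp Q Ql F x0 xs : lawful Q -> deriv Q Ql ->
  (forall s k, good k -> dot Q P s k = Ql s k) -> (forall N, good (F^~ N)) ->
  bt (io Q DE F) x0 xs = io Q DE (fun b N => L0 P F b N - lam (F b N)) x0 xs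
  - io P DE (io Q tid F) x0 xs - io P (ins D) (io Q (ins E) F) x0 xs
  - io P (ins E) (io Q (ins D) F) x0 xs.
Proof.
move=> lQ dQ fQ gF.
have fQ0 s k : good k -> dot Q P s k - Ql s k = (fun _ _ => 0) s k.
  by move=> gk; rewrite fQ // subrr.
rewrite (@bt_io _ _ good P lam aP lamD DE DEl (comp_X D E) comp_add
  comp_exch _ lam_comp comm_comp Q Ql (fun _ _ => 0)) //.
- have -> : io (fun _ _ => 0) DE F x0 xs = 0.
    rewrite -[RHS](cut0 _ xs); apply: eq_cut => N R; rewrite -[RHS](cut0 _ N).
    apply: eq_cut => a b; exact/tr_0/comp_add.
  have -> : rot (fun R x0 N => cut R (fun R1 R2 => cut N (fun N1 N2 => comp_X D E
      (fun w1 w2 => P (R2 ++ x0 :: w1) (fun a => Q (R1 ++ a :: w2) (F^~ N2))) N1))) x0 xs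
    = io P DE (io Q tid F) x0 xs + io P (ins D) (io Q (ins E) F) x0 xs
      + io P (ins E) (io Q (ins D) F) x0 xs.
    rewrite -!mid_io //; try exact: ins_add; try exact: comp_add;
      try by apply: ins_exch => //; apply: law_exch.
    rewrite /rot -!cutD; apply: eq_cut => N R; rewrite -!cutD; apply: eq_cut => R1 R2.
    rewrite -!cutD; apply: eq_cut => N1 N2; rewrite /comp_X -!cutD.
    by apply: eq_cut => a b.
  zmod.
- by move=> K N; rewrite /DE comp_comult.
- exact: law_add lQ.
- exact: law_exch.
- exact: law_in.
Qed.

Lemma tele_comp F x0 xs : tele DE F x0 xs = L0 E (L0 D F) x0 xs - rot (comp_res D E F) x0 xs.
Proof.
by apply: (teleE (Phi := DE)); [exact: comp_add | move=> R N; exact: comp_last_of].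
Qed.

(** The Cartan homotopy formula for two insertions. The telescoping sum now gives the
    product of the Lie derivatives, and D or E acts in the place of q when the unit is
    an input of q together with one output. *)
Lemma bt_ss_comp F x0 xs : (forall N, good (F^~ N)) -> wgood good (F u) ->
  bt (ss u DE F) x0 xs = ss u DE (bt F) x0 xs
  - io P DE (ss u tid F) x0 xs - io P (ins D) (ss u (ins E) F) x0 xs
  - io P (ins E) (ss u (ins D) F) x0 xs
  - nu (Lop E (Lop D F) x0 xs + io D (ins E) F x0 xs + io E (ins D) F x0 xs)
  + ss u (ins E) (io P (ins D) F) x0 xs + ss u (ins D) (io P (ins E) F) x0 xs
  + ss u tid (io P DE F) x0 xs.
Proof.
move=> gF gFu.
rewrite ss_bt //; [|exact: comp_add|by move=> H N; rewrite /DE /tcomp !nu_ins //; apply: tr_ext => w; exact: nu_ins].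
rewrite (@bt_ss _ _ good P lam aP lamD DE DEl (comp_X D E) comp_add comp_exch _ lam_comp comm_comp) //; last first.
  by move=> K N; rewrite /DE comp_comult.
have nudot s k : nu (dot D E s k) = dot D E s (fun a => nu (k a)).
  rewrite /dot nu_ins //; apply: tr_ext => w; exact: law_nu.
have adot : op_add (dot D E).
  by move=> s k k'; rewrite /dot -ins_add //; apply: tr_ext => w; exact: aD.
rewrite (ss_tid_io x0 xs adot nudot gF comp_add (comp_noempty aD aE) (fun h N => comp_one h N aD aE)).
rewrite (ss_ins_io x0 xs lD lE xDE gF) (ss_ins_io x0 xs lE lD (exch_sym xDE) gF).
have -> : rot (fun R x0 N => cut R (fun R1 R2 => comp_X D E
     (fun w1 w2 => P (R2 ++ x0 :: w1) (fun a => F u (R1 ++ a :: w2))) N)) x0 xs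
  = io P DE (ss u tid F) x0 xs + io P (ins D) (ss u (ins E) F) x0 xs
    + io P (ins E) (ss u (ins D) F) x0 xs.
  rewrite -!mid_ss //; try exact: ins_add; try exact: comp_add;
    try by apply: ins_exch => //; apply: law_exch.
  rewrite /rot -!cutD; apply: eq_cut => N R; rewrite -!cutD; apply: eq_cut => R1 R2.
  by rewrite /comp_X -!cutD; apply: eq_cut => a b.
have -> : Lop E (Lop D F) x0 xs = L0 E (L0 D F) x0 xs + io E tid (L0 D F) x0 xs
   + io D tid (L0 E F) x0 xs + io (dot D E) tid F x0 xs.
  rewrite -[RHS]addrA -Lop_io //; last exact: law_in.
  rewrite {1}/Lop [L0 E (Lop D F) x0 xs]/L0 /Lop ins_add //.
  have -> : io E tid (fun a w => L0 D F a w + io D tid F a w) x0 xs =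
    io E tid (L0 D F) x0 xs + io E tid (io D tid F) x0 xs.
    rewrite /io /rot -cutD; apply: eq_cut => N R; rewrite /ioG -cutD; apply: eq_cut => a b.
    by rewrite /tid aE.
  rewrite -/(L0 E (io D tid F) x0 xs) -/(L0 E (L0 D F) x0 xs); zmod.
rewrite tele_comp.
have -> : rot (comp_res D E F) x0 xs =
  rot (fun R x0 N => cut N (fun s1 s2 =>
        D s2 (fun a => ins E (fun w => F a (R ++ x0 :: w)) s1))) x0 xs
  + rot (ins_res (dot D E) F) x0 xs
  + rot (fun R x0 N => cut N (fun s1 s2 =>
        E s2 (fun a => ins D (fun w => F a (R ++ x0 :: w)) s1))) x0 xs.
  rewrite /rot -!cutD; apply: eq_cut => N R; rewrite /ins_res -!cutD.
  by apply: eq_cut.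
rewrite !nuD nuN !nuD; zmod.
Qed.
End Two.
End Main.

Section Normalized.
Variables (L : Type) (V : zmodType).
Implicit Types (s t xs N R w : seq L) (x : L) (H : seq L -> V) (k : L -> V).
Local Notation op := (op L V).
Local Notation trans := (trans L V).
Implicit Types (D E P Q : op) (F : L -> seq L -> V) (Phi : trans).
Variables (good : (L -> V) -> Prop) (u : L).
Hypothesis good_add : forall k k', good k -> good k' -> good (fun a => k a + k' a).

Definition normalized F := forall x s1 s2, F x (s1 ++ u :: s2) = 0.
Definition unitless D := unital good u D (fun _ => 0).

Lemma unitlessE D s1 s2 k : unitless D -> good k -> D (s1 ++ u :: s2) k = 0.
Proof.
by move=> uD gk; rewrite uD //; case: s1 => [|y [|? ?]]; case: s2 => [|z [|? ?]]; rewrite ?oppr0.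
Qed.

(** In a word with an inner unit, the operation either does not meet the unit, or has
    it as an input; then only the two neighbours of the unit matter, and their terms
    cancel. *)
Lemma Lop_normalized P nu F : op_add P -> unital good u P nu ->
  {morph nu : v w / v + w} -> (forall N, good (F^~ N)) -> (forall x, wgood good (F x)) ->
  normalized F -> normalized (Lop P F).
Proof.
move=> aP uP nuD gF gF' nF x0 s1 s2.
have nu0 : nu 0 = 0 by apply: (addrI (nu 0)); rewrite -nuD !addr0.
have E0 : L0 P F x0 (s1 ++ u :: s2) =
   (if s2 is [::] then 0 else nu (F x0 (s1 ++ s2))) - (if s1 is [::] then 0 else nu (F x0 (s1 ++ s2))).
  rewrite /L0 ins_cat_cons //.
  rewrite [X in X + _ + _](_ : _ = 0); last first.
    by rewrite -[RHS](tr_0 s1 (ins_add aP)); apply: tr_ext => w; exact: nF.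
  rewrite [X in _ + X + _](_ : _ = 0); last first.
    by rewrite -[RHS](tr_0 s2 (ins_add aP)); apply: tr_ext => w; exact: nF.
  rewrite !add0r.
  transitivity (cut s1 (fun R1 R2 => if R2 is [::] then
       cut s2 (fun w1 w2 => if w1 is [:: z] then nu (F x0 (R1 ++ z :: w2)) else 0) else 0)
    - cut s1 (fun R1 R2 => if R2 is [:: z] then
       cut s2 (fun w1 w2 => if w1 is [::] then nu (F x0 (R1 ++ z :: w2)) else 0) else 0)).
    rewrite -cutN -cutD; apply: eq_cut => R1 R2.
    case: R2 => [|y [|y' R2]].
    - by rewrite subr0; apply: eq_cut => w1 w2; rewrite (uP [::]) //; exact: (gF' x0 R1 w2).
    - rewrite add0r -cutN; apply: eq_cut => w1 w2; rewrite (uP [:: y]); last exact: (gF' x0 R1 w2).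
      by case: w1 => //; rewrite oppr0.
    - rewrite subr0 -[RHS](cut0 _ s2); apply: eq_cut => w1 w2.
      by rewrite (uP [:: y, y' & R2]) //; exact: (gF' x0 R1 w2).
  rewrite cut_nilr cut_onel; congr (_ - _); first by case: s2.
  transitivity (cut s1 (fun R1 R2 => if R2 is [:: z] then nu (F x0 (R1 ++ z :: s2)) else 0)).
    apply: eq_cut => R1 [|z [|? ?]] //.
    by rewrite (cut_nill s2 (fun w2 => nu (F x0 (R1 ++ z :: w2)))).
  rewrite (cut_oner s1 (fun z R1 => nu (F x0 (R1 ++ z :: s2)))).
  case: (lastP s1) => [|s z] //; rewrite rev_rcons revK cat_rcons.
  by case: s.
rewrite /Lop E0 /io /rot cut_cat.
have -> : cut s1 (fun a b => ioG P tid F (b ++ u :: s2) x0 a) =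
   if s2 is [::] then nu (F x0 (s1 ++ s2)) else 0.
  case: s2 {E0} => [|z s2]; last first.
    rewrite -[RHS](cut0 _ s1); apply: eq_cut => a b; rewrite -[RHS](cut0 _ a).
    apply: eq_cut => N1 N2; rewrite /tid -catA cat_cons uP //.
    by case: b => [|? [|? ?]] //; case: s2.
  rewrite cats0 -[RHS](cut_nilr s1 (fun a => nu (F x0 a))).
  apply: eq_cut => a b; case: b => [|y b].
    rewrite -[RHS](cut_nill a (fun c => nu (F x0 c))); apply: eq_cut => N1 N2.
    rewrite /tid (uP [::]) //; by case: N1.
  rewrite -[RHS](cut0 _ a); apply: eq_cut => N1 N2; rewrite /tid -catA (uP (y :: b)) //.
  by case: b.
have -> : cut s2 (fun a b => ioG P tid F b x0 (s1 ++ u :: a)) =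
   - (if s1 is [::] then nu (F x0 (s1 ++ s2)) else 0).
  case: s1 {E0} => [|z s1]; last first.
    rewrite oppr0 -[RHS](cut0 _ s2); apply: eq_cut => a b.
    rewrite /ioG cut_cat [X in X + _](_ : _ = 0) ?add0r; last first.
      rewrite -[RHS](cut0 _ (z :: s1)); apply: eq_cut => N1 N2.
      by rewrite /tid -[RHS](op_0 (b ++ x0 :: N1) aP); apply: op_ext => y; exact: nF.
    rewrite -[RHS](cut0 _ a); apply: eq_cut => N1 N2; rewrite /tid.
    have -> : b ++ x0 :: (z :: s1) ++ u :: N1 = (b ++ x0 :: z :: s1) ++ u :: N1 by rewrite -catA.
    by rewrite uP //; case: b => [|? [|? ?]].
  rewrite -[LHS]opprK -cutN; congr (- _).
  rewrite -[RHS](cut_nilr s2 (fun a => nu (F x0 a))); apply: eq_cut => a b.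
  rewrite /ioG /= /tid [X in - (X + _)](_ : _ = 0) ?add0r; last first.
    by rewrite -[RHS](op_0 (b ++ [:: x0]) aP); apply: op_ext => y; exact: (nF y [::]).
  case: b => [|y b].
    rewrite -cutN -[RHS](cut_nill a (fun c => nu (F x0 c))); apply: eq_cut => N1 N2.
    by rewrite (uP [:: x0]) //; case: N1; rewrite ?opprK ?oppr0.
  rewrite -cutN -[RHS](cut0 _ a); apply: eq_cut => N1 N2.
  have -> : (y :: b) ++ [:: x0, u & N1] = (y :: b ++ [:: x0]) ++ u :: N1 by rewrite /= -catA.
  by rewrite uP //; case: b => [|? ?]; rewrite oppr0.
case: s1 {E0} => [|y s1]; case: s2 => [|z s2]; rewrite ?cat0s ?cats0; zmod.
Qed.
End Normalized.

(** * Functionals that vanish on inner units *)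

Section Admissible.
Variables (L : Type) (V : zmodType).
Implicit Types (s t xs N R w : seq L) (x : L) (H : seq L -> V) (k : L -> V).
Local Notation op := (op L V).
Local Notation trans := (trans L V).
Implicit Types (D E P Q : op) (F : L -> seq L -> V) (Phi : trans).
Variables (good : (L -> V) -> Prop) (nice : V -> Prop) (u : L).
Hypothesis good_add : forall k k', good k -> good k' -> good (fun a => k a + k' a).
Hypothesis nice_add : forall v v', nice v -> nice v' -> nice (v + v').

(** The closure properties that let an operation act on functionals that factor through
    chains: [good] concerns one open letter, and [nice] the closed letters. *)
Record regular_op D : Prop := RegularOp {
  reg_add : op_add D;
  reg_in : in_good good D;
  reg_out : out_good good D;
  reg_nice : forall s k, good k -> (forall a, nice (k a)) -> nice (D s k) }.

Record regular Phi : Prop := Regular {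
  reg_tr_add : tr_add Phi;
  reg_tr_out : forall (K : L -> seq L -> V) N,
    (forall w, good (K^~ w)) -> good (fun a => Phi (K a) N);
  reg_tr_in : forall H, wgood good H -> wgood good (Phi H);
  reg_tr_nice : forall H N, wgood good H -> (forall w, nice (H w)) -> nice (Phi H N);
  reg_tr_unit : forall H N1 N2, wgood good H ->
    (forall w1 w2, H (w1 ++ u :: w2) = 0) -> Phi H (N1 ++ u :: N2) = 0 }.

(** A transformation whose output words are nonempty and do not consist of the unit
    alone. This is what makes contractions vanish on words with an inner unit, for which
    q could otherwise act as an identity. *)
Record expanding Phi : Prop := Expanding {
  exp_noempty : noempty Phi;
  exp_unit : forall H N1 N2, wgood good H ->
    (forall w1 w2, w1 ++ w2 <> [::] -> H (w1 ++ u :: w2) = 0) -> Phi H (N1 ++ u :: N2) = 0 }.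

Lemma nice_cut s (K : seq L -> seq L -> V) : (forall a b, nice (K a b)) -> nice (cut s K).
Proof.
elim: s K => [|x s IH] K nK /=; first exact: nK.
by apply: nice_add => //; apply: IH => a b; apply: nK.
Qed.

Lemma wgood_mid R t H : wgood good H -> wgood good (fun w => H (R ++ w ++ t)).
Proof. exact: wgood_cat. Qed.
Lemma wgood_left t H : wgood good H -> wgood good (fun w => H (w ++ t)).
Proof. exact: (@wgood_cat _ _ good H [::] t). Qed.
Lemma wgood_right R H : wgood good H -> wgood good (fun w => H (R ++ w)).
Proof.
by move=> gH; have := @wgood_mid R [::] H gH; under [in X in X -> _]eq_fun => w do rewrite cats0.
Qed.

Lemma tid_regular : regular tid.
Proof.
split.
- by [].
- by move=> K N gK; exact: gK.
- by [].
- by move=> H N _ nH; exact: nH.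
- by move=> H N1 N2 _ H0; exact: H0.
Qed.

Lemma ins_nice D H N : regular_op D -> wgood good H -> (forall w, nice (H w)) -> nice (ins D H N).
Proof.
move=> rD gH nH; apply: nice_cut => s1 r; apply: nice_cut => s2 s3.
by apply: reg_nice => // ; exact: gH.
Qed.

Lemma ins_out D (K : L -> seq L -> V) N : regular_op D ->
  (forall w, good (K^~ w)) -> good (fun a => ins D (K a) N).
Proof.
move=> rD gK; apply: good_cut => // s1 r; apply: good_cut => // s2 s3.
by apply: (reg_out rD) => b; exact: gK.
Qed.

Lemma ins_expanding D : regular_op D -> unitless good u D -> expanding (ins D).
Proof.
move=> rD uD; split=> [|H N1 N2 gH nH]; first exact/ins_noempty/reg_add.
rewrite ins_cat_cons; last exact: reg_add.
have E (T : seq L -> V) N : (forall s1 a s3, T (s1 ++ a :: s3) = 0) -> ins D T N = 0.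
  move=> T0; rewrite -[RHS](cut0 _ N); apply: eq_cut => s1 r; rewrite -[RHS](cut0 _ r).
  by apply: eq_cut => s2 s3; rewrite -[RHS](op_0 s2 (reg_add rD)); apply: op_ext => a; exact: T0.
rewrite !E ?add0r.
- rewrite -[RHS](cut0 _ N1); apply: eq_cut => R1 R2; rewrite -[RHS](cut0 _ N2).
  by apply: eq_cut => w1 w2; apply: (unitlessE (good := good)) => //; exact: gH.
- by move=> s1 a s3; apply: nH; case: N1 => //; case: s1.
- by move=> s1 a s3; apply: nH; case: s1.
Qed.

Lemma ins_regular D : regular_op D -> unitless good u D -> regular (ins D).
Proof.
move=> rD uD; split.
- exact/ins_add/reg_add.
- by move=> K N; apply: ins_out.
- by move=> H gH; apply: wgood_ins => //; case: rD.
- by move=> H N; apply: ins_nice.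
- by move=> H N1 N2 gH nH; apply: (exp_unit (ins_expanding rD uD)).
Qed.

Lemma ins2E D E H s : op_add D -> op_add E ->
  ins2 D E H s = cut s (fun s1 r => cut r (fun s2 s3 =>
    E s2 (fun b => ins D (fun R' => H (R' ++ b :: s3)) s1))).
Proof.
move=> aD aE; apply/esym.
transitivity (cut s (fun s1 r => cut s1 (fun t1 q => cut q (fun t2 t3 =>
  cut r (fun s2 s3 => E s2 (fun b => D t2 (fun a => H (t1 ++ a :: t3 ++ b :: s3)))))))).
  apply: eq_cut => s1 r; under [RHS]eq_cut => t1 q do rewrite cutC.
  rewrite cutC; apply: eq_cut => s2 s3; rewrite op_cut //; apply: eq_cut => t1 t2.
  rewrite op_cut //; apply: eq_cut => u1 u2.
  by apply: op_ext => b; apply: op_ext => a; rewrite -catA.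
by rewrite cutA /ins2; apply: eq_cut => t1 r1; rewrite cutA.
Qed.

Section Ins2.
Variables D E : op.
Hypothesis rD : regular_op D.
Hypothesis rE : regular_op E.
Hypothesis uD : unitless good u D.
Hypothesis uE : unitless good u E.
Let aD := reg_add rD.
Let aE := reg_add rE.

Lemma good_ins_letter H s1 s3 : wgood good H ->
  good (fun b => ins D (fun R' => H (R' ++ b :: s3)) s1).
Proof.
by move=> gH; apply: (ins_out (K := fun b R' => H (R' ++ b :: s3))) => // w; exact: gH.
Qed.

Lemma ins2_expanding : expanding (ins2 D E).
Proof.
split=> [v N|H N1 N2 gH nH].
  rewrite ins2E // -[RHS](cut0 _ N); apply: eq_cut => s1 r; rewrite -[RHS](cut0 _ r).
  apply: eq_cut => s2 s3; rewrite -[RHS](op_0 s2 aE); apply: op_ext => b.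
  by rewrite -[RHS](tr_0 s1 (ins_add aD)); apply: tr_ext => -[].
rewrite ins2E // cut_cat.
have E0 b s1 s3 : ins D (fun R' => H (R' ++ b :: s3)) s1 = 0 -> True by [].
have H0 w b s3 t : H (w ++ b :: s3 ++ u :: t) = 0.
  by rewrite -cat_cons catA; apply: nH; case: w.
rewrite [X in X + _](_ : _ = 0) ?add0r.
  rewrite -[RHS](cut0 _ N2); apply: eq_cut => s1 r; rewrite -[RHS](cut0 _ r).
  apply: eq_cut => s2 s3; rewrite -[RHS](op_0 s2 aE); apply: op_ext => b.
  apply: (reg_tr_unit (ins_regular rD uD)); first exact: wgood_left.
  by move=> w1 w2; rewrite -catA; apply: nH; case: w1 => //; case: w2.
rewrite -[RHS](cut0 _ N1); apply: eq_cut => s1 r; rewrite cut_cat.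
rewrite [X in X + _](_ : _ = 0) ?add0r.
  rewrite -[RHS](cut0 _ N2); apply: eq_cut => s2 s3.
  by apply: (unitlessE (good := good)) => //; exact: good_ins_letter.
rewrite -[RHS](cut0 _ r); apply: eq_cut => s2 s3; rewrite -[RHS](op_0 s2 aE); apply: op_ext => b.
by rewrite -[RHS](tr_0 s1 (ins_add aD)); apply: tr_ext => w; exact: H0.
Qed.

Lemma ins2_regular : regular (ins2 D E).
Proof.
split.
- move=> H H' N; rewrite !ins2E // -cutD; apply: eq_cut => s1 r; rewrite -cutD.
  by apply: eq_cut => s2 s3; rewrite -aE; apply: op_ext => b; exact: ins_add.
- move=> K N gK; under eq_fun => a do rewrite ins2E //.
  apply: good_cut => // s1 r; apply: good_cut => // s2 s3.
  apply: (reg_out rE) => b.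
  by apply: (ins_out (K := fun a R' => K a (R' ++ b :: s3))) => // w; exact: gK.
- move=> H gH; rewrite (_ : ins2 D E H = fun s => cut s (fun s1 r => cut r (fun s2 s3 =>
    E s2 (fun b => ins D (fun R' => H (R' ++ b :: s3)) s1)))); last by apply: funext => s; exact: ins2E.
  apply: wgood_cut => // [r|s1].
    move=> p q; apply: good_cut => // s2 s3.
    apply: (reg_out rE) => b.
    by apply: (reg_tr_in (ins_regular rD uD)); exact: wgood_left.
  apply: wgood_cut => // [s3|s2] p q; first by apply: (reg_in rE); exact: good_ins_letter.
  apply: (reg_out rE) => b.
  apply: (ins_out (K := fun a R' => H (R' ++ b :: p ++ a :: q))) => // w.
  have := gH (w ++ b :: p) q.
  by under [in X in X -> _]eq_fun => y do rewrite -catA.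
- move=> H N gH nH; rewrite ins2E //; apply: nice_cut => s1 r; apply: nice_cut => s2 s3.
  apply: (reg_nice rE); first exact: good_ins_letter.
  by move=> b; apply: ins_nice => //; exact: wgood_left.
- by move=> H N1 N2 gH nH; apply: (exp_unit ins2_expanding).
Qed.
End Ins2.

(** The functionals that factor through normalized chains. *)
Record admissible F : Prop := Admissible {
  adm_head : forall N, good (F^~ N);
  adm_tail : forall x, wgood good (F x);
  adm_nice : forall x w, nice (F x w);
  adm_unit : normalized u F }.

Section Preserved.
Variable F : L -> seq L -> V.
Hypothesis aF : admissible F.

Lemma good_op_letter Q k s1 s2 : regular_op Q -> good k -> good (fun a => Q (s1 ++ a :: s2) k).
Proof. by move=> rQ; exact: (reg_in rQ). Qed.

Lemma wgood_op Q k : regular_op Q -> good k -> wgood good (fun w => Q w k).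
Proof. by move=> rQ gk s1 s2; exact: (reg_in rQ). Qed.

Lemma io_good Q Phi : regular_op Q -> regular Phi ->
  [/\ forall N, good ((io Q Phi F)^~ N), forall x, wgood good (io Q Phi F x)
    & forall x w, nice (io Q Phi F x w)].
Proof.
move=> rQ rP.
have gk N2 := adm_head aF N2.
have gQ R x N2 : wgood good (fun w => Q (R ++ x :: w) (F^~ N2)).
  have := @wgood_right (R ++ [:: x]) _ (wgood_op rQ (gk N2)).
  by under [in X in X -> _]eq_fun => w do rewrite -catA.
split.
- move=> N; apply: good_cut => // a b; apply: good_cut => // N1 N2.
  apply: (reg_tr_out rP (K := fun x w => Q (b ++ x :: w) (F^~ N2))) => w.
  exact: good_op_letter.
- move=> x; apply: wgood_cut => // [R|N].
    apply: wgood_cut => // [N2|N1]; first by apply: (reg_tr_in rP); exact: gQ.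
    move=> p q; apply: (reg_tr_out rP (K := fun a w => Q (R ++ x :: w) (fun b => F b (p ++ a :: q)))) => w.
    by apply: (reg_out rQ) => b; exact: (adm_tail aF).
  move=> p q; apply: good_cut => // N1 N2.
  apply: (reg_tr_out rP (K := fun a w => Q ((p ++ a :: q) ++ x :: w) (F^~ N2))) => w.
  have := good_op_letter p (q ++ x :: w) rQ (gk N2).
  by under [in X in X -> _]eq_fun => y do rewrite -cat_cons catA.
- move=> x w; apply: nice_cut => a b; apply: nice_cut => N1 N2.
  apply: (reg_tr_nice rP); first exact: gQ.
  by move=> v; apply: (reg_nice rQ) => // y; exact: (adm_nice aF).
Qed.

(** If the inner unit is an input of Q, then Q has at least the first letter and an output
    of [Phi] as further inputs. *)
Lemma io_admissible Q nu Phi : regular_op Q -> unital good u Q nu -> regular Phi ->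
  expanding Phi -> admissible (io Q Phi F).
Proof.
move=> rQ uQ rP eP; have [g1 g2 g3] := io_good rQ rP; split=> // x s1 s2.
have gk N2 := adm_head aF N2.
have aP := reg_tr_add rP.
rewrite /io /rot cut_cat [X in X + _](_ : _ = 0) ?add0r.
  rewrite -[RHS](cut0 _ s2); apply: eq_cut => a R; rewrite /ioG cut_cat.
  rewrite [X in X + _](_ : _ = 0) ?add0r.
    rewrite -[RHS](cut0 _ a); apply: eq_cut => p N2; apply: (exp_unit eP).
      have := @wgood_right (R ++ [:: x]) _ (wgood_op rQ (gk N2)).
      by under [in X in X -> _]eq_fun => w do rewrite -catA.
    move=> w1 w2 w0; rewrite -cat_cons catA uQ //.
    by case: R => [|y [|? ?]] //; case: w1 w0 => [|? [|? ?]] //; case: w2.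
  rewrite -[RHS](cut0 _ s1); apply: eq_cut => N1 N2.
  rewrite -[RHS](tr_0 N1 aP); apply: tr_ext => w; rewrite -[RHS](op_0 (R ++ x :: w) (reg_add rQ)).
  by apply: op_ext => b; exact: (adm_unit aF).
rewrite -[RHS](cut0 _ s1); apply: eq_cut => N R; rewrite -[RHS](cut0 _ N).
apply: eq_cut => N1 N2.
transitivity (Phi (fun w => if w is [::] then Q ((R ++ u :: s2) ++ [:: x]) (F^~ N2) else 0) N1).
  apply: tr_ext => -[|y w] //; rewrite -catA uQ //.
  by case: R => [|? [|? ?]] //; case: s2 => //= ? [].
exact: (exp_noempty eP).
Qed.

Lemma ss_admissible u0 Phi : regular Phi -> admissible (ss u0 Phi F).
Proof.
move=> rP; have aP := reg_tr_add rP.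
have gR R x : wgood good (fun w => F u0 (R ++ x :: w)).
  have := @wgood_right (R ++ [:: x]) _ (adm_tail aF u0).
  by under [in X in X -> _]eq_fun => w do rewrite -catA.
split.
- move=> N; apply: good_cut => // a b.
  by apply: (reg_tr_out rP (K := fun x w => F u0 (b ++ x :: w))) => w; exact: (adm_tail aF).
- move=> x; apply: wgood_cut => // [R|N]; first by apply: (reg_tr_in rP).
  move=> p q; apply: (reg_tr_out rP (K := fun a w => F u0 ((p ++ a :: q) ++ x :: w))) => w.
  have := adm_tail aF u0 p (q ++ x :: w).
  by under [in X in X -> _]eq_fun => y do rewrite -cat_cons catA.
- move=> x w; apply: nice_cut => a b; apply: (reg_tr_nice rP) => // v; exact: (adm_nice aF).
- move=> x s1 s2; rewrite /ss /rot cut_cat [X in X + _](_ : _ = 0) ?add0r.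
    rewrite -[RHS](cut0 _ s2); apply: eq_cut => a b; apply: (reg_tr_unit rP) => // w1 w2.
    by rewrite -cat_cons catA; exact: (adm_unit aF).
  rewrite -[RHS](cut0 _ s1); apply: eq_cut => N R.
  rewrite -[RHS](tr_0 N aP); apply: tr_ext => w; rewrite -catA; exact: (adm_unit aF).
Qed.

Lemma Lop_admissible P nu : regular_op P -> unital good u P nu ->
  {morph nu : v w / v + w} -> admissible (Lop P F).
Proof.
move=> rP uP nuD; have [g1 g2 g3] := io_good rP tid_regular; split.
- move=> N; apply: good_add => //; apply: (ins_out (K := F)) => // w; exact: (adm_head aF).
- move=> x s1 s2; apply: good_add; last exact: g2.
  exact: (wgood_ins good_add (reg_in rP) (reg_out rP) (adm_tail aF x)).
- move=> x w; apply: nice_add => //; apply: ins_nice => //; first exact: (adm_tail aF).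
  exact: (adm_nice aF).
- apply: (Lop_normalized (reg_add rP) uP nuD); case: aF => //.
Qed.
End Preserved.
End Admissible.

(** * Koszul signs as signs of sequences of marks *)

Section Parity.
(** Signs depend only on the parity of a degree. *)
Definition oddz (z : int) : bool := odd `|z|%N.

Lemma oddzD a b : oddz (a + b) = oddz a (+) oddz b.
Proof. rewrite /oddz; lia. Qed.

Lemma oddzM a b : oddz (a * b) = oddz a && oddz b.
Proof. by rewrite /oddz abszM oddM. Qed.

Lemma exprz_odd (R : unitRingType) (z : int) : (-1 : R) ^ z = (-1) ^+ oddz z.
Proof.
rewrite /oddz; case: z => n; first by rewrite -exprnP signr_odd.
by rewrite NegzE abszN absz_nat -exprnN -exprVn invrN1 signr_odd.
Qed.
End Parity.

Section Alternating.
Variable K : fieldType.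

Definition cmp (i j : nat) : K := if (i < j)%N then 1 else if (j < i)%N then -1 else 0.

(** The sign of the permutation that sorts the list, and zero if an entry is repeated. *)
Fixpoint alt (w : seq nat) : K :=
  if w is i :: w' then (\prod_(j <- w') cmp i j) * alt w' else 1.

Lemma cmpC i j : cmp i j = - cmp j i.
Proof. by rewrite /cmp; case: ltngtP => //= _; rewrite ?opprK ?oppr0. Qed.

(** It suffices to exchange neighbours. *)
Definition alternating (U : zmodType) (f : seq nat -> U) :=
  forall u i j v, f (u ++ i :: j :: v) = - f (u ++ j :: i :: v).

Lemma alt_alternating : alternating alt.
Proof.
move=> u i j v; elim: u => [|k u IH] /=.
  rewrite !big_cons (cmpC i j); ring.
rewrite IH mulrN; congr (- (_ * _)); apply: perm_big.
by rewrite perm_cat2l (perm_catCA [:: i] [:: j] v).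
Qed.

Lemma alt_neq0 w : uniq w -> alt w != 0.
Proof.
elim: w => [|i w IH] /=; first by rewrite oner_eq0.
case/andP=> iw uw; rewrite mulf_neq0 ?IH //.
elim: w iw {IH uw} => [|j w IH]; first by rewrite big_nil oner_eq0.
rewrite inE negb_or big_cons => /andP[ij iw]; rewrite mulf_neq0 ?IH //.
by rewrite /cmp; case: ltngtP ij => //; rewrite ?oppr_eq0 ?oner_eq0.
Qed.

Variables (U : lmodType K) (f : seq nat -> U).
Hypothesis altf : alternating f.

Lemma alternating_move u i a v :
  f (u ++ i :: a ++ v) = (-1) ^+ size a *: f (u ++ a ++ i :: v).
Proof.
elim: a u => [|j a IH] u /=; first by rewrite scale1r.
by rewrite altf -cat_rcons IH cat_rcons exprS -scalerA scaleN1r.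
Qed.

(** Exchanging two blocks of marks costs the sign of the product of their lengths. This
    is the Koszul rule for the letters that carry the marks. *)
Lemma alternating_swap u a b v :
  f (u ++ a ++ b ++ v) = (-1) ^+ (size a * size b) *: f (u ++ b ++ a ++ v).
Proof.
elim: a u => [|i a IH] u /=; first by rewrite scale1r.
rewrite -cat_rcons IH cat_rcons alternating_move scalerA -exprD.
by rewrite mulSn addnC.
Qed.

Lemma alternating_pair u a i j v : f (u ++ a ++ i :: j :: v) = f (u ++ i :: j :: a ++ v).
Proof.
have := alternating_swap u a [:: i; j] v.
by rewrite /= => ->; rewrite muln2 -signr_odd odd_double scale1r.
Qed.
End Alternating.

Section KoszulMarks.
Variable K : fieldType.
(** A position, a degree and marks. *)
Definition item := ((nat * int) * seq nat)%type.
Implicit Types (W s : seq item) (p r : item).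

Definition imarks W : seq nat := flatten [seq p.2 | p <- W].
Definition iok p := odd (size p.2) == oddz p.1.2.
Definition ins_item p s : seq item :=
  [seq r <- s | (r.1.1 < p.1.1)%N] ++ p :: [seq r <- s | ~~ (r.1.1 < p.1.1)%N].
Fixpoint isort W : seq item := if W is p :: W' then ins_item p (isort W') else [::].

Definition ile (p r : item) := (p.1.1 <= r.1.1)%N.

Lemma sorted_split v s : sorted ile s ->
  s = [seq r <- s | (r.1.1 < v)%N] ++ [seq r <- s | ~~ (r.1.1 < v)%N].
Proof.
elim: s => //= p s IH ps; have {}IH := IH (path_sorted ps).
case: ifP => [_|/negbT]; first by rewrite /= -IH.
rewrite -leqNgt /= => vp.
have ge : all (fun r => ~~ (r.1.1 < v)%N) s.
  apply/allP => r rs; rewrite -leqNgt (leq_trans vp) //.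
  have tr : transitive ile by move=> a b c; exact: leq_trans.
  by move: (order_path_min tr ps) => /allP/(_ r rs).
have -> : [seq r <- s | (r.1.1 < v)%N] = [::].
  by apply/eqP; rewrite -(negbK (_ == _)) -has_filter; apply/hasPn => r /(allP ge).
by rewrite /= (all_filterP ge).
Qed.

Lemma perm_ins_item p s : perm_eq (ins_item p s) (p :: s).
Proof.
rewrite /ins_item (perm_catCA _ [:: p]) /= perm_cons.
by rewrite (perm_filterC (fun r => r.1.1 < p.1.1)%N).
Qed.

Lemma isort_perm W : perm_eq (isort W) W.
Proof.
elim: W => //= p W IH; apply: (perm_trans (perm_ins_item _ _)).
by rewrite perm_cons.
Qed.

Lemma isort_sorted W : sorted ile (isort W).
Proof.
elim: W => //= p W IH; rewrite /ins_item.
have tr : transitive ile by move=> a b c; exact: leq_trans.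
have st a := @sorted_filter _ _ tr a _ IH.
rewrite sorted_pairwise // pairwise_cat /= -!sorted_pairwise // !st !andbT /=.
apply/andP; split.
  rewrite /allrel; apply/allP => r; rewrite mem_filter => /andP[rp _].
  apply/allP => r'; rewrite inE => /orP[/eqP -> |]; first exact: ltnW.
  by rewrite mem_filter -leqNgt => /andP[pr' _]; apply: leq_trans pr'; exact: ltnW.
by apply/allP => r; rewrite mem_filter -leqNgt => /andP[].
Qed.

(** Operations share the position 0 and have to keep their order, hence the stability. *)
Lemma isort_stable v W : [seq r <- isort W | r.1.1 == v] = [seq r <- W | r.1.1 == v].
Proof.
elim: W => //= p W IH; rewrite /ins_item filter_cat /= -{}IH.
have sp := sorted_split p.1.1 (isort_sorted W).
rewrite [in RHS]sp filter_cat; case: eqP => [pv|//].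
suff -> : [seq r <- [seq r <- isort W | (r.1.1 < p.1.1)%N] | r.1.1 == v] = [::] by [].
apply/eqP; rewrite -(negbK (_ == _)) -has_filter; apply/hasPn => r.
by rewrite mem_filter -pv => /andP[rp _]; rewrite neq_ltn rp.
Qed.

Lemma sorted_stable_eq s1 s2 : sorted ile s1 -> sorted ile s2 ->
  (forall v, [seq r <- s1 | r.1.1 == v] = [seq r <- s2 | r.1.1 == v]) -> s1 = s2.
Proof.
have tr : transitive ile by move=> a b c; exact: leq_trans.
elim: s1 s2 => [|p s1 IH] [|r s2] //= S1 S2 e.
- by have := e r.1.1; rewrite /= eqxx.
- by have := e p.1.1; rewrite /= eqxx.
have pr : p.1.1 = r.1.1.
  apply/eqP; rewrite eqn_leq; apply/andP; split.
    have : r \in [seq q <- p :: s1 | q.1.1 == r.1.1].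
      by rewrite [X in _ \in X](e r.1.1) eqxx inE eqxx.
    rewrite mem_filter eqxx inE => /orP[/eqP -> //|] /=.
    by move/(allP (order_path_min tr S1)).
  have : p \in [seq q <- r :: s2 | q.1.1 == p.1.1].
    by rewrite -[X in _ \in X](e p.1.1) eqxx inE eqxx.
  rewrite mem_filter eqxx inE => /orP[/eqP -> //|] /=.
  by move/(allP (order_path_min tr S2)).
have := e p.1.1; rewrite /= eqxx pr eqxx => -[-> _].
congr (_ :: _); apply: IH; [exact: path_sorted S1|exact: path_sorted S2|move=> v].
by have := e v; rewrite /= -pr; case: eqP => // _ [].
Qed.

Variables (U : lmodType K) (f : seq nat -> U).
Hypothesis altf : alternating f.

(** Sorting the items of a word by position multiplies the value of an alternating
    function of the marks by the Koszul sign of the word, by the rule for the exchange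
    of blocks. *)
Lemma koszul_isort u W v : all iok W ->
  f (u ++ imarks W ++ v) = koszul K [seq p.1 | p <- W] *: f (u ++ imarks (isort W) ++ v).
Proof.
elim: W u => [|p W IH] u /=; first by rewrite scale1r.
case/andP=> okp okW.
have -> : u ++ imarks (p :: W) ++ v = (u ++ p.2) ++ imarks W ++ v by rewrite /imarks /= -!catA.
rewrite IH // -catA.
rewrite [in LHS](sorted_split p.1.1 (isort_sorted W)) /imarks /ins_item !map_cat !flatten_cat /= -!catA.
rewrite (alternating_swap altf u p.2) scalerA mulrC; congr (_ * _ *: _).
rewrite big_map -big_filter.
have pe : perm_eq [seq r <- W | (r.1.1 < p.1.1)%N] [seq r <- isort W | (r.1.1 < p.1.1)%N].
  by apply: perm_filter; rewrite perm_sym isort_perm.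
rewrite (perm_big _ pe) /=.
have : all iok [seq r <- isort W | (r.1.1 < p.1.1)%N].
  apply/allP => r; rewrite mem_filter => /andP[_]; rewrite (perm_mem (isort_perm W)).
  by move/(allP okW).
elim: [seq r <- isort W | _] => [|r s IHs] /=; first by rewrite big_nil muln0.
case/andP=> okr oks; rewrite big_cons -IHs // size_cat mulnDr exprD; congr (_ * _).
rewrite exprz_odd oddzM -(eqP okp) -(eqP okr) -signr_odd oddM.
by [].
Qed.
End KoszulMarks.

(** * Sums over shuffles and over splittings of an exponent *)

Section Shuffles.
Variables (T : Type) (U : zmodType).
Implicit Types (s : seq T) (G : seq T -> seq T -> U).

(** The unshuffle coproduct, summed. The closed letters form a symmetric word, and their
    signs are carried by the marks. *)
Fixpoint shuf s G : U :=
  if s is y :: s' then shuf s' (fun a b => G (y :: a) b) + shuf s' (fun a b => G a (y :: b))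
  else G [::] [::].

Lemma eq_shuf s G G' : (forall a b, G a b = G' a b) -> shuf s G = shuf s G'.
Proof. by move=> e; congr shuf; do 2!apply: funext => ?. Qed.

Lemma shufD s G G' : shuf s (fun a b => G a b + G' a b) = shuf s G + shuf s G'.
Proof. by elim: s G G' => //= y s IH G G'; rewrite !IH addrACA. Qed.

Lemma shuf0 s : shuf s (fun _ _ => 0) = 0.
Proof. by elim: s => //= y s ->; rewrite addr0. Qed.

Lemma shufN s G : shuf s (fun a b => - G a b) = - shuf s G.
Proof. by elim: s G => //= x s IH G; rewrite !IH opprD. Qed.

Lemma shufC s G : shuf s G = shuf s (fun a b => G b a).
Proof. by elim: s G => //= y s IH G; rewrite addrC (IH (fun a b => G a (y :: b))) (IH (fun a b => G (y :: a) b)). Qed.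

Lemma shufA s (G : seq T -> seq T -> seq T -> U) :
  shuf s (fun a b => shuf a (fun a1 a2 => G a1 a2 b)) =
  shuf s (fun a b => shuf b (fun b1 b2 => G a b1 b2)).
Proof. by elim: s G => //= y s IH G; rewrite !shufD !IH addrA. Qed.

Lemma shuf_swap s (G : seq T -> seq T -> seq T -> U) :
  shuf s (fun a b => shuf a (fun c d => G c d b)) =
  shuf s (fun a d => shuf a (fun c b => G c d b)).
Proof. by rewrite shufA [RHS]shufA; apply: eq_shuf => c r; rewrite shufC. Qed.

Lemma shuf_nilr s (g : seq T -> U) : shuf s (fun a b => if b is [::] then g a else 0) = g s.
Proof. by elim: s g => //= y s IH g; rewrite (IH (fun a => g (y :: a))) shuf0 addr0. Qed.

Lemma shuf_cat s1 s2 G : shuf (s1 ++ s2) G =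
  shuf s1 (fun a b => shuf s2 (fun c d => G (a ++ c) (b ++ d))).
Proof. by elim: s1 G => //= y s IH G; rewrite !IH. Qed.
End Shuffles.

Lemma shuf_morph (T : Type) (U U' : zmodType) (h : U -> U') (s : seq T) G :
  {morph h : u v / u + v} -> h (shuf s G) = shuf s (fun a b => h (G a b)).
Proof. by move=> hD; elim: s G => //= x s IH G; rewrite hD !IH. Qed.

Section Convolution.
Variables (n : nat) (U : zmodType).
Local Notation mon := 'X_{1..n}.
Implicit Types (m a b c d : mon) (G : mon -> mon -> U).

(** The sum over all [m = a + b], in the form that underlies the product of power
    series. *)
Definition conv m G : U :=
  \sum_(k : 'X_{1..n < (mdeg m).+1, (mdeg m).+1} | m == (k.1 + k.2)%MM) G k.1 k.2.

Lemma eq_conv m G G' : (forall a b, G a b = G' a b) -> conv m G = conv m G'.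
Proof. by move=> e; apply: eq_bigr => k _. Qed.

Lemma convD m G G' : conv m (fun a b => G a b + G' a b) = conv m G + conv m G'.
Proof. exact: big_split. Qed.

Lemma conv0 m : conv m (fun _ _ => 0) = 0.
Proof. exact: big1. Qed.

Lemma convN m G : conv m (fun a b => - G a b) = - conv m G.
Proof. exact: sumrN. Qed.

Lemma convC m G : conv m G = conv m (fun a b => G b a).
Proof.
rewrite /conv (reindex (fun k : 'X_{1..n < (mdeg m).+1, (mdeg m).+1} => (k.2, k.1))) /=.
  by apply: eq_bigl => k; rewrite addmC.
by exists (fun k => (k.2, k.1)) => -[].
Qed.

Lemma bmsum N N' (F : mon -> U) : (forall x, (N <= mdeg x)%N -> F x = 0) ->
  (forall x, (N' <= mdeg x)%N -> F x = 0) ->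
  \sum_(x : 'X_{1..n < N}) F x = \sum_(x : 'X_{1..n < N'}) F x.
Proof.
have aux M M' : (forall x, (M' <= mdeg x)%N -> F x = 0) ->
    \sum_(x : 'X_{1..n < M}) F x = \sum_(x <- [seq bmnm y | y : 'X_{1..n < M}] | (mdeg x < M')%N) F x.
  move=> F0; rewrite big_image_cond /= [RHS]big_mkcond /=; apply: eq_bigr => x _.
  by case: ltnP => // /F0.
move=> F1 F2; rewrite (aux _ N') // (aux N' N) // -[LHS]big_filter -[RHS]big_filter.
apply: perm_big; apply: uniq_perm.
- by apply: filter_uniq; rewrite map_inj_uniq ?enum_uniq //; exact: val_inj.
- by apply: filter_uniq; rewrite map_inj_uniq ?enum_uniq //; exact: val_inj.
move=> x; rewrite !mem_filter.
have im M : (x \in [seq bmnm y | y : 'X_{1..n < M}]) = (mdeg x < M)%N.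
  apply/imageP/idP => [[y _ ->]|lt]; first exact: bmdeg.
  by exists (BMultinom lt).
by rewrite !im andbC.
Qed.

(** A sum over pairs becomes a sum over one exponent, for which reindexing and exchange
    of sums are elementary. *)
Lemma conv_lem N m G : (mdeg m < N)%N ->
  conv m G = \sum_(x : 'X_{1..n < N}) (if (x <= m)%MM then G x (m - x)%MM else 0).
Proof.
move=> ltN.
have le_mdeg x y : (x <= y)%MM -> (mdeg x <= mdeg y)%N.
  by move=> le; rewrite -(submK le) mdegD leq_addl.
rewrite -(@bmsum (mdeg m).+1 N (fun x => if (x <= m)%MM then G x (m - x)%MM else 0)); first last.
- by move=> x; case: ifP => // /le_mdeg le /(leq_trans ltN); rewrite ltnNge le.
- by move=> x; case: ifP => // /le_mdeg le; rewrite ltnNge le.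
rewrite /conv -(pair_big_dep xpredT (fun (i j : 'X_{1..n < (mdeg m).+1}) => m == (i + j)%MM) (fun i j => G i j)) /=.
apply: eq_bigr => x _; case: ifP => [le|nle].
  have lt : (mdeg (m - x)%MM < (mdeg m).+1)%N.
    by rewrite -[X in (_ < (mdeg X).+1)%N](submK le) mdegD ltnS leq_addr.
  rewrite (big_pred1 (BMultinom lt)) // => y; rewrite /= bmeqP /=.
  apply/eqP/eqP => e; last by rewrite e addmC submK.
  by rewrite -(addmK x y) addmC -e.
rewrite big_pred0 // => y; apply/negP => /eqP e; case/negP: (negbT nle).
by apply/mnm_lepP => i; rewrite (congr1 (fun z : mon => z i) e) mnmDE leq_addr.
Qed.

Lemma conv_swap m (G : mon -> mon -> mon -> U) :
  conv m (fun a b => conv b (fun c d => G a c d)) =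
  conv m (fun c b => conv b (fun a d => G a c d)).
Proof.
set N := (mdeg m).+1.
have ltN : (mdeg m < N)%N by [].
have E (H : mon -> mon -> mon -> U) : conv m (fun a b => conv b (fun c d => H a c d)) =
  \sum_(a : 'X_{1..n < N}) \sum_(c : 'X_{1..n < N})
    (if ((a + c)%MM <= m)%MM then H a c (m - (a + c))%MM else 0).
  rewrite (conv_lem _ ltN); apply: eq_bigr => a _; case: ifP => [le|nle].
    have lt : (mdeg (m - a)%MM < N)%N.
      by rewrite /N -[X in (_ < (mdeg X).+1)%N](submK le) mdegD ltnS leq_addr.
    rewrite (conv_lem _ lt); apply: eq_bigr => c _.
    rewrite submDA; congr (if _ then _ else _).
    apply/mnm_lepP/mnm_lepP => H' i; have := H' i; have := mnm_lepP le i.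
      by rewrite mnmBE mnmDE; lia.
    by rewrite mnmBE mnmDE; lia.
  rewrite big1 // => c _; case: ifP => // le; case/negP: nle.
  by apply/mnm_lepP => i; have := mnm_lepP le i; rewrite mnmDE; lia.
rewrite E E exchange_big /=; apply: eq_bigr => c _; apply: eq_bigr => a _.
by rewrite addmC.
Qed.

Lemma convA m (G : mon -> mon -> mon -> U) :
  conv m (fun a b => conv a (fun c d => G c d b)) =
  conv m (fun c r => conv r (fun d b => G c d b)).
Proof.
rewrite convC conv_swap; apply: eq_conv => c r; exact: convC.
Qed.

Lemma conv_0l m (g : mon -> U) : conv m (fun a b => if a == 0%MM then g b else 0) = g m.
Proof.
have lt0 : (mdeg (0%MM : mon) < (mdeg m).+1)%N by rewrite mdeg0.
rewrite (conv_lem _ (leqnn _)) (bigD1 (BMultinom lt0)) //= eqxx.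
rewrite ifT; last by apply/mnm_lepP => i; rewrite mnm0E.
rewrite subm0 big1 ?addr0 // => x; rewrite bmeqP /= => /negbTE ->.
by case: ifP.
Qed.

Lemma conv_0r m (g : mon -> U) : conv m (fun b a => if a == 0%MM then g b else 0) = g m.
Proof. by rewrite convC conv_0l. Qed.
End Convolution.

Lemma conv_morph (n : nat) (U U' : zmodType) (h : U -> U') (m : 'X_{1..n}) G :
  h 0 = 0 -> {morph h : u v / u + v} -> h (conv m G) = conv m (fun a b => h (G a b)).
Proof. by move=> h0 hD; rewrite /conv (big_morph h hD h0). Qed.

Lemma shuf_sum (T : Type) (U : zmodType) (I : Type) (r : seq I) (P : pred I) (s : seq T)
    (G : I -> seq T -> seq T -> U) :
  shuf s (fun a b => \sum_(i <- r | P i) G i a b) = \sum_(i <- r | P i) shuf s (G i).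
Proof.
elim: s G => //= y s IH G.
by rewrite (IH (fun i a b => G i (y :: a) b)) (IH (fun i a b => G i a (y :: b))) -big_split.
Qed.

Lemma shuf_conv (T : Type) n (U : zmodType) (s : seq T) (m : 'X_{1..n})
    (G : seq T -> seq T -> 'X_{1..n} -> 'X_{1..n} -> U) :
  shuf s (fun a b => conv m (G a b)) = conv m (fun c d => shuf s (fun a b => G a b c d)).
Proof. exact: shuf_sum. Qed.

Lemma cut_sums (T : Type) (U : zmodType) (I : Type) (r : seq I) (P : pred I) (s : seq T)
    (G : I -> seq T -> seq T -> U) :
  cut s (fun a b => \sum_(i <- r | P i) G i a b) = \sum_(i <- r | P i) cut s (G i).
Proof.
elim: s G => //= y s IH G.
by rewrite (IH (fun i a b => G i (y :: a) b)) -big_split.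
Qed.

Lemma cut_conv (T : Type) n (U : zmodType) (s : seq T) (m : 'X_{1..n})
    (G : seq T -> seq T -> 'X_{1..n} -> 'X_{1..n} -> U) :
  cut s (fun a b => conv m (G a b)) = conv m (fun c d => cut s (fun a b => G a b c d)).
Proof. exact: cut_sums. Qed.

Lemma shuf_cut (S T : Type) (U : zmodType) (s : seq S) (t : seq T)
    (G : seq S -> seq S -> seq T -> seq T -> U) :
  shuf s (fun a b => cut t (G a b)) = cut t (fun c d => shuf s (fun a b => G a b c d)).
Proof. by elim: t G => //= y t IH G; rewrite shufD -IH. Qed.

(** * Colourings as iterated shuffles and cuts *)

Section Colourings.
Variables (T : Type) (U : zmodType).
Implicit Types (s r : seq T) (G : (nat -> seq T) -> U) (p q : nat -> seq T).

Lemma tuple_sum0 (I : finType) (P : pred (seq I)) (F : seq I -> U) :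
  \sum_(c : 0.-tuple I | P c) F c = if P [::] then F [::] else 0.
Proof.
rewrite big_mkcond (bigD1 [tuple]) //= big1 ?addr0 // => c /eqP[]; exact: tuple0.
Qed.

Lemma tuple_sumS (I : finType) k (P : pred (seq I)) (F : seq I -> U) :
  \sum_(c : k.+1.-tuple I | P c) F c =
  \sum_i \sum_(c : k.-tuple I | P (i :: c)) F (i :: c).
Proof.
rewrite pair_big_dep /= (reindex (fun x : I * k.-tuple I => cons_tuple x.1 x.2)) //=.
exists (fun c : k.+1.-tuple I => (thead c, behead_tuple c)) => [[i c] _|c _] /=.
  by congr pair; apply: val_inj.
by rewrite [RHS]tuple_eta; apply: val_inj.
Qed.

Definition addp (i : nat) (y : T) p : nat -> seq T := fun j => if i == j then y :: p j else p j.

Lemma part_cons i l y s : part (i :: l) (y :: s) = addp i y (part l s).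
Proof. by apply: funext => j; rewrite /part /addp /=; case: eqP. Qed.

Definition colour_sum m s G : U := \sum_(c : (size s).-tuple 'I_m) G (part (labels c) s).

Lemma colour_sum_cons m y s G :
  colour_sum m (y :: s) G = \sum_(i < m) colour_sum m s (fun p => G (addp i.+1 y p)).
Proof.
rewrite /colour_sum (tuple_sumS _ xpredT (fun c => G (part (labels c) (y :: s)))).
by apply: eq_bigr => i _; apply: eq_bigr => c _; rewrite part_cons.
Qed.

Lemma colour_sum_nil m G : colour_sum m [::] G = G (fun _ => [::]).
Proof.
rewrite /colour_sum (tuple_sum0 xpredT (fun c => G (part (labels c) [::]))) /=.
by congr G; apply: funext => j; rewrite /part mask0.
Qed.

Lemma colour_sumS m s G : colour_sum m.+2 s G =
  shuf s (fun s' z => colour_sum m.+1 s' (fun p => G (fun j => if j == m.+2 then z else p j))).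
Proof.
elim: s G => [|y s IH] G /=.
  by rewrite !colour_sum_nil; congr G; apply: funext => j; case: ifP.
rewrite colour_sum_cons big_ord_recr /= IH addrC [RHS]addrC; congr (_ + _).
  apply: eq_shuf => a b; apply: eq_bigr => c _; congr G; apply: funext => j.
  by rewrite /addp eq_sym; case: eqP.
under eq_bigr => i _ do rewrite IH.
rewrite -shuf_sum; apply: eq_shuf => a b; rewrite colour_sum_cons; apply: eq_bigr => i _.
apply: eq_bigr => c _; congr G; apply: funext => j.
rewrite /addp; case: (j =P m.+2) => // ->; rewrite ifF //.
by rewrite eqSS ltn_eqF.
Qed.

(** Decomposition into [m.+1] blocks numbered from 1, by splitting off the last block
    repeatedly. *)
Fixpoint shufp m s G : U :=
  if m is m'.+1 then
    shuf s (fun s' z => shufp m' s' (fun p => G (fun j => if j == m'.+2 then z else p j)))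
  else G (fun j => if j == 1%N then s else [::]).

Lemma colour_sumE m s G : colour_sum m.+1 s G = shufp m s G.
Proof.
elim: m s G => [|m IH] s G.
  rewrite /=; elim: s G => [|y s IH] G.
    by rewrite colour_sum_nil; congr G; apply: funext => j; case: ifP.
  rewrite colour_sum_cons big_ord1 IH; congr G; apply: funext => j.
  by rewrite /addp /= eq_sym; case: eqP.
by rewrite colour_sumS /=; apply: eq_shuf => a b; rewrite IH.
Qed.

(** Nondecreasing lists of labels are the colourings by consecutive intervals. *)
Fixpoint ssum (lo hi k : nat) (F : seq nat -> U) : U :=
  if k is k'.+1 then \sum_(lo <= i < hi.+1) ssum i hi k' (fun l => F (i :: l)) else F [::].

Lemma eq_ssum lo hi k F F' : (forall l, all (leq lo) l -> F l = F' l) ->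
  ssum lo hi k F = ssum lo hi k F'.
Proof.
elim: k lo F F' => [|k IH] lo F F' e /=; first exact: e.
apply: eq_big_nat => i /andP[li _]; apply: IH => l al; apply: e => /=.
by rewrite li; apply/allP => j /(allP al); apply: leq_trans.
Qed.

Lemma ssum_shift lo hi k F : ssum lo.+1 hi.+1 k F = ssum lo hi k (fun l => F (map S l)).
Proof.
elim: k lo F => [|k IH] lo F //=; rewrite big_add1 /=.
by apply: eq_bigr => i _; rewrite IH.
Qed.

Lemma path_ssum m k lo F : (0 < lo)%N ->
  \sum_(e : k.-tuple 'I_m | path leq lo (labels e)) F (labels e) = ssum lo m k F.
Proof.
elim: k lo F => [|k IH] lo F lo0.
  by rewrite (tuple_sum0 (fun e => path leq lo (labels e)) (fun e => F (labels e))).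
rewrite (tuple_sumS _ (fun e => path leq lo (labels e)) (fun e => F (labels e))) /=.
transitivity (\sum_(i < m | (lo <= i.+1)%N) ssum i.+1 m k (fun l => F (i.+1 :: l))).
  rewrite [RHS]big_mkcond /=; apply: eq_bigr => i _; case: ifP => le.
    rewrite -(IH i.+1 (fun l => F (i.+1 :: l))) //.
  by rewrite big_pred0.
case: lo lo0 => // lo _; rewrite big_add1 /=.
rewrite -(big_mkord (fun i => lo.+1 <= i.+1)%N (fun i => ssum i.+1 m k (fun l => F (i.+1 :: l)))).
have [le|lt] := leqP lo m; last first.
  rewrite (big_geq (ltnW lt)) big_nat_cond big_pred0 // => i.
  by rewrite ltnS; lia.
rewrite (big_cat_nat (n := lo)) //= big_nat_cond big_pred0 ?add0r; last by move=> i; lia.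
by rewrite big_nat_cond [RHS]big_nat_cond; apply: eq_bigl => i; lia.
Qed.

Lemma sorted_ssum m k F :
  \sum_(e : k.-tuple 'I_m | sorted leq (labels e)) F (labels e) = ssum 1 m k F.
Proof.
rewrite -path_ssum //; apply: eq_bigl => e.
by rewrite /labels; case: (tval e).
Qed.

Lemma nonempty_ssum m k F :
  \sum_(e : k.+1.-tuple 'I_m.+1 | sorted leq (labels e) && (1%N \in labels e)) F (labels e) =
  ssum 1 m.+1 k (fun l => F (1%N :: l)).
Proof.
rewrite (tuple_sumS _ (fun e => sorted leq (labels e) && (1%N \in labels e)) (fun e => F (labels e))).
rewrite big_ord_recl /= [X in _ + X]big1 ?addr0.
  rewrite -path_ssum //; apply: eq_bigl => e.
  by rewrite inE eqxx andbT.
move=> i _; rewrite big_pred0 // => e; rewrite inE /=.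
apply/negP => /andP[pe].
have tr : transitive leq by move=> a b c; exact: leq_trans.
by move/(allP (order_path_min tr pe)).
Qed.

Lemma part_shift l s j : part (map S l) s j.+1 = part l s j.
Proof. by rewrite /part -map_comp; congr mask; apply: eq_map => i /=. Qed.

Lemma part_small lo l s j : all (leq lo) l -> (j < lo)%N -> part l s j = [::].
Proof.
move=> al lt; rewrite /part (_ : [seq i == j | i <- l] = nseq (size l) false).
  by rewrite mask_false.
elim: l al => //= i l IH /andP[li al]; rewrite IH //; congr (_ :: _).
by apply/negbTE; rewrite neq_ltn (leq_trans lt li) orbT.
Qed.

(** Decomposition into [m.+1] consecutive intervals numbered from 1, by splitting off the
    first interval repeatedly. *)
Fixpoint cutp m s G : U :=
  if m is m'.+1 then
    cut s (fun s1 r => cutp m' r (fun p => G (fun j => if j == 1%N then s1 else p j.-1)))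
  else G (fun j => if j == 1%N then s else [::]).

Lemma ssum_cut m s G : ssum 1 m.+2 (size s) (fun l => G (part l s)) =
  cut s (fun s1 r => ssum 1 m.+1 (size r) (fun l =>
     G (fun j => if j == 1%N then s1 else part l r j.-1))).
Proof.
elim: s G => [|y s IH] G.
  rewrite /=; congr G; apply: funext => j; rewrite /part !mask0; by case: eqP.
rewrite [LHS]/= big_ltn // [RHS]/= addrC; congr (_ + _).
  rewrite big_add1 /=; apply: eq_big_nat => i /andP[i1 _]; rewrite ssum_shift.
  apply: eq_ssum => l al; congr G; apply: funext => -[|[|j]].
  - rewrite -map_cons /=; rewrite (part_small (lo := 1)) //=; last first.
      by apply/allP => k /mapP[k' _ ->].
    by rewrite (part_small (lo := 1)) //= i1 /=; apply/allP => k /(allP al); apply: leq_trans.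
  - rewrite -map_cons (part_small (lo := 2)) //=.
    by rewrite ltnS i1; apply/allP => k /mapP[k' /(allP al) k'i ->]; rewrite ltnS (leq_trans i1 k'i).
  - by rewrite -map_cons part_shift.
transitivity (ssum 1 m.+2 (size s) (fun l => G (addp 1 y (part l s)))).
  by apply: eq_ssum => l _; rewrite part_cons.
rewrite (IH (fun p => G (addp 1 y p))); apply: eq_cut => a b; apply: eq_ssum => l _.
by congr G; apply: funext => -[|[|j]].
Qed.

Lemma ssum_cutp m s G : ssum 1 m.+1 (size s) (fun l => G (part l s)) = cutp m s G.
Proof.
elim: m s G => [|m IH] s G.
  elim: s G => [|y s IH] G.
    by rewrite /=; congr G; apply: funext => j; rewrite /part mask0; case: ifP.
  rewrite /= big_nat1.
  transitivity (ssum 1 1 (size s) (fun l => G (addp 1 y (part l s)))).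
    by apply: eq_ssum => l _; rewrite part_cons.
  rewrite (IH (fun p => G (addp 1 y p))) /=; congr G; apply: funext => -[|[|j]] //.
by rewrite ssum_cut /=; apply: eq_cut => a b; rewrite -IH.
Qed.

Lemma sorted_cutp m s G :
  \sum_(e : (size s).-tuple 'I_m.+1 | sorted leq (labels e)) G (part (labels e) s) = cutp m s G.
Proof. by rewrite (sorted_ssum _ _ (fun l => G (part l s))) ssum_cutp. Qed.

(** If the first interval is nonempty, it contains the first letter, which can thus be
    taken out of the sum. *)
Lemma nonempty_cutp m x s G :
  \sum_(e : (size (x :: s)).-tuple 'I_m.+1 | sorted leq (labels e) && (1%N \in labels e))
     G (part (labels e) (x :: s))
  = cutp m s (fun p => G (addp 1 x p)).
Proof.
rewrite (nonempty_ssum _ _ (fun l => G (part l (x :: s)))) -ssum_cutp.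
by apply: eq_ssum => l _; rewrite part_cons.
Qed.
End Colourings.

(** * Marked letters and the Koszul sign of a word *)

Section Parts.
Variable T : eqType.
Implicit Types (s : seq T) (l js : seq nat) (a : pred T).

Lemma count_parts_cons a i l y s js :
  count a (flatten [seq part (i :: l) (y :: s) j | j <- js]) =
  (a y * count_mem i js + count a (flatten [seq part l s j | j <- js]))%N.
Proof.
elim: js => [|j js IH] /=; first by rewrite muln0.
rewrite !count_cat IH /= /part /= eq_sym; case: eqP => /= _; lia.
Qed.

Lemma count_parts n a (c : seq 'I_n) s js : size c = size s -> perm_eq js (iota 1 n) ->
  count a (flatten [seq part (labels c) s j | j <- js]) = count a s.
Proof.
move=> sc pj; elim: s c sc => [|y s IH] [|i c] //=.
  by elim: js {pj} => //= j js IHj; rewrite count_cat IHj /part.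
move=> [sc]; rewrite count_parts_cons IH //; congr (_ + _)%N.
rewrite (permP pj) count_uniq_mem ?iota_uniq // mem_iota.
by rewrite ltnS leq0n add1n ltnS ltn_ord muln1.
Qed.
End Parts.

Section Marked.
Variables (K : fieldType) (V : int -> lmodType K).

(** The marks of a letter record its parity in the form of formal odd symbols. *)
Record marked := Marked {
  mlet : letter V; mmk : seq nat; mpar : odd (size mmk) == oddz (sdeg mlet) }.

Definition er (s : seq marked) : seq (letter V) := [seq mlet y | y <- s].
Definition mks (s : seq marked) : seq nat := flatten [seq mmk y | y <- s].

Lemma marked_eq (a b : marked) : mlet a = mlet b -> mmk a = mmk b -> a = b.
Proof.
case: a b => [x m h] [x' m' h'] /= ex em; subst x' m'.
by rewrite (eq_irrelevance h h').
Qed.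

Lemma mks_cat s t : mks (s ++ t) = mks s ++ mks t.
Proof. by rewrite /mks map_cat flatten_cat. Qed.
Lemma er_cat s t : er (s ++ t) = er s ++ er t.
Proof. exact: map_cat. Qed.

Lemma sdegs_cat (s t : seq (letter V)) : sdegs (s ++ t) = sdegs s + sdegs t.
Proof. exact: big_cat. Qed.
Lemma sdegs_cons x (s : seq (letter V)) : sdegs (x :: s) = sdeg x + sdegs s.
Proof. exact: big_cons. Qed.
Lemma sdegs_nil : sdegs ([::] : seq (letter V)) = 0.
Proof. exact: big_nil. Qed.

Lemma mks_parity s : odd (size (mks s)) = oddz (sdegs (er s)).
Proof.
elim: s => [|y s IH]; first by rewrite sdegs_nil.
by rewrite /= sdegs_cons oddzD -IH /mks /= size_cat oddD (eqP (mpar y)).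
Qed.

Definition letter_items (k : nat) (s : seq marked) : seq item :=
  zip (zip (iota k (size (er s))) [seq sdeg y | y <- er s]) [seq mmk y | y <- s].

Lemma size_letter_items k s : size (letter_items k s) = size s.
Proof. by rewrite /letter_items !size_zip size_iota !size_map !minnn. Qed.

Lemma letter_items_fst k s :
  [seq p.1 | p <- letter_items k s] = zip (iota k (size (er s))) [seq sdeg y | y <- er s].
Proof. by rewrite [LHS]unzip1_zip // size_zip size_iota !size_map minnn. Qed.

Lemma letter_items_pos k s : [seq p.1.1 | p <- letter_items k s] = iota k (size s).
Proof.
have := congr1 (map fst) (letter_items_fst k s); rewrite -map_comp => ->.
by rewrite [LHS]unzip1_zip ?size_iota ?size_map.
Qed.

Lemma letter_items_marks k s : [seq p.2 | p <- letter_items k s] = [seq mmk y | y <- s].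
Proof. by rewrite [LHS]unzip2_zip // size_zip size_iota !size_map minnn. Qed.

Lemma letter_items_ok k s : all iok (letter_items k s).
Proof.
rewrite /letter_items; elim: s k => //= y s IH k; rewrite IH andbT.
exact: mpar.
Qed.
End Marked.

Lemma map_part (S T : Type) (f : S -> T) l (s : seq S) j : map f (part l s j) = part l (map f s) j.
Proof. by rewrite /part map_mask. Qed.

Section Words.
Variables (K : fieldType) (g A : int -> lmodType K).
Implicit Types (Ys : seq (marked g)) (Xs : seq (marked A)).
(** A block of a word, with the marks of the operation if the block is one. *)
Definition wblock := (block * seq nat)%type.
Implicit Types (wb : seq wblock) (y : nat -> seq (marked g)) (x : nat -> seq (marked A)).

Definition wmarks wb y x : seq nat :=
  flatten [seq match b.1 with Op _ => b.2 | Y j => mks (y j) | X j => mks (x j) end | b <- wb].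
Definition opmarks wb : seq nat := flatten [seq if b.1 is Op _ then b.2 else [::] | b <- wb].
Definition wok wb := all (fun b => if b.1 is Op d then odd (size b.2) == oddz d else true) wb.
Definition ylab wb := flatten [seq if b.1 is Y j then [:: j] else [::] | b <- wb].
Definition xlab wb := flatten [seq if b.1 is X j then [:: j] else [::] | b <- wb].

Section OneWord.
Variables (n m : nat) (wb : seq wblock) (Ys : seq (marked g)) (Xs : seq (marked A)).
Variables (c : seq 'I_n) (e : seq 'I_m).
Hypothesis sc : size c = size Ys.
Hypothesis se : size e = size Xs.
Hypothesis okw : wok wb.
Hypothesis yw : perm_eq (ylab wb) (iota 1 n).
Hypothesis xw : perm_eq (xlab wb) (iota 1 m).

Let iy := letter_items 1 Ys.
Let ix := letter_items (size Ys).+1 Xs.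
Let itemw (b : wblock) : seq item := match b.1 with
  | Op d => [:: ((0%N, d), b.2)] | Y j => part (labels c) iy j | X j => part (labels e) ix j end.
Let W := flatten [seq itemw b | b <- wb].
Let ops : seq item := flatten [seq if b.1 is Op d then [:: ((0%N, d), b.2)] else [::] | b <- wb].

Lemma part_ok l s j : all iok s -> all iok (part l s j).
Proof. by move/allP => os; apply/allP => r /mem_mask /os. Qed.

Lemma W_ok : all iok W.
Proof.
rewrite /W; move: okw; elim: wb => //= b w IH /andP[ob ow].
rewrite all_cat {}IH // andbT /itemw; case: b.1 ob => [d|j|j] //=; rewrite ?andbT //.
  by move=> _; apply: part_ok; exact: letter_items_ok.
by move=> _; apply: part_ok; exact: letter_items_ok.
Qed.

Lemma W_fst : [seq p.1 | p <- W] = word_of (labels c) (labels e) [seq sdeg a | a <- er Ys]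
  [seq sdeg a | a <- er Xs] [seq b.1 | b <- wb].
Proof.
rewrite /W /word_of; elim: wb => //= b w IH; rewrite map_cat IH; congr (_ ++ _).
by rewrite /itemw; case: b.1 => [d|j|j] //=; rewrite map_part letter_items_fst !size_map.
Qed.

Lemma W_marks : imarks W = wmarks wb (part (labels c) Ys) (part (labels e) Xs).
Proof.
rewrite /imarks /W /wmarks; elim: wb => //= b w IH.
rewrite map_cat flatten_cat IH; congr (_ ++ _); rewrite /itemw.
by case: b.1 => [d|j|j] /=; rewrite ?cats0 // /mks map_part letter_items_marks map_part.
Qed.

Lemma W_perm : perm_eq W (ops ++ iy ++ ix).
Proof.
apply/permP => a.
have -> : count a W = (count a ops + count a (flatten [seq part (labels c) iy j | j <- ylab wb])
   + count a (flatten [seq part (labels e) ix j | j <- xlab wb]))%N.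
  rewrite /W /ops /ylab /xlab; elim: wb => //= b w IH.
  rewrite !map_cat !flatten_cat !count_cat IH /itemw; case: b.1 => [d|j|j] /=;
    rewrite ?count_cat /=; lia.
rewrite (count_parts _ _ yw) ?size_letter_items // (count_parts _ _ xw) ?size_letter_items //.
by rewrite !count_cat addnA.
Qed.

Lemma W_ops : [seq r <- W | r.1.1 == 0%N] = [seq r <- ops ++ iy ++ ix | r.1.1 == 0%N].
Proof.
have pos k (V : int -> lmodType K) (s : seq (marked V)) r : r \in letter_items k.+1 s -> (r.1.1 == 0%N) = false.
  move=> /(map_f (fun p : item => p.1.1)); rewrite letter_items_pos mem_iota => /andP[h _].
  by case: (r.1.1) h.
have f0 (s : seq item) : {in s, forall r, (r.1.1 == 0%N) = false} -> [seq r <- s | r.1.1 == 0%N] = [::].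
  by move=> h; rewrite -(@eq_in_filter _ pred0) ?filter_pred0 // => r /h.
rewrite !filter_cat (f0 iy) ?(f0 ix) ?cats0; try by move=> r; apply: pos.
rewrite /W /ops; elim: wb => //= b w IH; rewrite !filter_cat IH; congr (_ ++ _).
rewrite /itemw; case: b.1 => [d|j|j] //=; apply: f0 => r /mem_mask; exact: pos.
Qed.

Lemma isort_W : isort W = ops ++ iy ++ ix.
Proof.
have ops0 : all (fun r : item => r.1.1 == 0%N) ops.
  by rewrite /ops; elim: wb => //= b w IH; rewrite all_cat IH andbT; case: b.1.
have opsE : [seq p.1.1 | p <- ops] = nseq (size ops) 0%N.
  by elim: ops ops0 => //= r s IH /andP[/eqP -> /IH ->].
have posE : [seq p.1.1 | p <- ops ++ iy ++ ix] = nseq (size ops) 0%N ++ iota 1 (size Ys + size Xs).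
  by rewrite !map_cat opsE /iy /ix !letter_items_pos iotaD.
apply: sorted_stable_eq; first exact: isort_sorted.
  have -> : sorted ile (ops ++ iy ++ ix) = sorted leq [seq p.1.1 | p <- ops ++ iy ++ ix].
    by rewrite sorted_map.
  rewrite posE; elim: (size ops) => [|k IH] /=; first exact: iota_sorted.
  rewrite path_min_sorted //; apply/allP => r _; exact: leq0n.
move=> v; rewrite isort_stable; have [->|v0] := eqVneq v 0%N; first exact: W_ops.
apply: perm_small_eq; last by apply: perm_filter; exact: W_perm.
rewrite size_filter -(count_map (fun p : item => p.1.1) (pred1 v)) posE count_cat.
rewrite (_ : count _ (nseq _ _) = 0)%N ?add0n.
  by rewrite count_uniq_mem ?iota_uniq //; case: (_ \in _).
by rewrite count_nseq /= eq_sym (negbTE v0).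
Qed.

(** The Koszul sign is the ratio of the weights of the two orders in which the marks can
    be read: as in the word of the term, and with the operations first. *)
Lemma kappa_marks (U : lmodType K) (f : seq nat -> U) u : alternating f ->
  f (u ++ wmarks wb (part (labels c) Ys) (part (labels e) Xs)) =
  kappa (labels c) (labels e) (er Ys) (er Xs) [seq b.1 | b <- wb]
    *: f (u ++ opmarks wb ++ mks Ys ++ mks Xs).
Proof.
move=> af; have := koszul_isort af u [::] W_ok; rewrite W_fst W_marks isort_W !cats0 => ->.
congr (_ *: f (_ ++ _)); rewrite /imarks !map_cat !flatten_cat /iy /ix !letter_items_marks.
congr (_ ++ _); rewrite /opmarks /ops; elim: wb => //= b w IH.
by rewrite map_cat flatten_cat IH; case: b.1 => //= d; rewrite cats0.
Qed.
End OneWord.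

Lemma tuple_cast (I : finType) (U : nmodType) k k' (P : pred (seq I)) (F : seq I -> U) : k = k' ->
  \sum_(c : k.-tuple I | P c) F c = \sum_(c : k'.-tuple I | P c) F c.
Proof. by move->. Qed.

Section KoszulSum.
Variables (U : lmodType K) (u : seq nat) (wb : seq wblock).
Variable t : (nat -> seq (letter g)) -> (nat -> seq (letter A)) -> seq nat -> U.
Hypothesis altt : forall (p : nat -> seq (letter g)) (r : nat -> seq (letter A)), alternating (t p r).
Hypothesis okw : wok wb.

Let tm y x := t (fun j => er (y j)) (fun j => er (x j)) (u ++ wmarks wb y x).

Lemma koszul_term n m Ys Xs (c : seq 'I_n) (e : seq 'I_m) :
  size c = size Ys -> size e = size Xs ->
  perm_eq (ylab wb) (iota 1 n) -> perm_eq (xlab wb) (iota 1 m) ->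
  kappa (labels c) (labels e) (er Ys) (er Xs) [seq b.1 | b <- wb] *:
    t (part (labels c) (er Ys)) (part (labels e) (er Xs)) (u ++ opmarks wb ++ mks Ys ++ mks Xs) =
  tm (part (labels c) Ys) (part (labels e) Xs).
Proof.
move=> sc se yw xw; rewrite /tm.
have -> : (fun j => er (part (labels c) Ys j)) = part (labels c) (er Ys).
  by apply: funext => j; rewrite /er map_part.
have -> : (fun j => er (part (labels e) Xs j)) = part (labels e) (er Xs).
  by apply: funext => j; rewrite /er map_part.
by rewrite (kappa_marks sc se okw yw xw).
Qed.

Lemma koszul_sum_cut n m Ys Xs :
  perm_eq (ylab wb) (iota 1 n.+1) -> perm_eq (xlab wb) (iota 1 m.+1) ->
  koszul_sum n.+1 m.+1 false (er Ys) (er Xs) [seq b.1 | b <- wb]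
    (fun p r => t p r (u ++ opmarks wb ++ mks Ys ++ mks Xs)) =
  shufp n Ys (fun y => cutp m Xs (fun x => tm y x)).
Proof.
move=> yw xw; rewrite /koszul_sum -colour_sumE /colour_sum.
pose P (e : seq 'I_m.+1) := sorted leq (labels e) && (false ==> (1%N \in labels e)).
pose T (c : seq 'I_n.+1) (e : seq 'I_m.+1) := kappa (labels c) (labels e) (er Ys) (er Xs) [seq b.1 | b <- wb] *:
  t (part (labels c) (er Ys)) (part (labels e) (er Xs)) (u ++ opmarks wb ++ mks Ys ++ mks Xs).
apply: (etrans (tuple_cast xpredT (fun c : seq 'I_n.+1 =>
  \sum_(e : (size (er Xs)).-tuple 'I_m.+1 | P e) T c e) (size_map _ Ys))).
apply: eq_bigr => c _; rewrite -sorted_cutp.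
apply: (etrans (tuple_cast P (T c) (size_map _ Xs))).
apply: eq_big => [e|e _]; first by rewrite /P andbT.
by apply: koszul_term => //; rewrite size_tuple.
Qed.

Lemma koszul_sum_cut1 n m Ys X0 Xs :
  perm_eq (ylab wb) (iota 1 n.+1) -> perm_eq (xlab wb) (iota 1 m.+1) ->
  koszul_sum n.+1 m.+1 true (er Ys) (er (X0 :: Xs)) [seq b.1 | b <- wb]
    (fun p r => t p r (u ++ opmarks wb ++ mks Ys ++ mks (X0 :: Xs))) =
  shufp n Ys (fun y => cutp m Xs (fun x => tm y (addp 1 X0 x))).
Proof.
move=> yw xw; rewrite /koszul_sum -colour_sumE /colour_sum.
pose P (e : seq 'I_m.+1) := sorted leq (labels e) && (true ==> (1%N \in labels e)).
pose T (c : seq 'I_n.+1) (e : seq 'I_m.+1) := kappa (labels c) (labels e) (er Ys) (er (X0 :: Xs)) [seq b.1 | b <- wb] *: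
  t (part (labels c) (er Ys)) (part (labels e) (er (X0 :: Xs))) (u ++ opmarks wb ++ mks Ys ++ mks (X0 :: Xs)).
apply: (etrans (tuple_cast xpredT (fun c : seq 'I_n.+1 =>
  \sum_(e : (size (er (X0 :: Xs))).-tuple 'I_m.+1 | P e) T c e) (size_map _ Ys))).
apply: eq_bigr => c _; rewrite -nonempty_cutp.
apply: (etrans (tuple_cast P (T c) (size_map _ (X0 :: Xs)))).
by apply: eq_bigr => e _; apply: koszul_term => //; rewrite size_tuple.
Qed.

End KoszulSum.
End Words.

(** * Cochains as sign-free operations *)

Section LinearSums.
Variables (K : fieldType) (U U' : lmodType K).

(** Linearity as a property, because the maps in question are built from letters of
    varying degree and from quotients. *)
Definition lin_map (h : U -> U') := forall c v w, h (c *: v + w) = c *: h v + h w.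

Variable h : U -> U'.
Hypothesis hl : lin_map h.
Lemma lin_mapD v w : h (v + w) = h v + h w.
Proof. by rewrite -[v in LHS]scale1r hl scale1r. Qed.
Lemma lin_map0 : h 0 = 0.
Proof. by apply: (addrI (h 0)); rewrite -lin_mapD !addr0. Qed.
Lemma lin_mapZ c v : h (c *: v) = c *: h v.
Proof. by rewrite -[c *: v]addr0 hl lin_map0 addr0. Qed.
Lemma lin_mapN v : h (- v) = - h v.
Proof. by rewrite -scaleN1r lin_mapZ scaleN1r. Qed.
Lemma lin_map_sum (I : Type) (r : seq I) (P : pred I) F :
  h (\sum_(i <- r | P i) F i) = \sum_(i <- r | P i) h (F i).
Proof. exact: (big_morph h lin_mapD lin_map0). Qed.

Variables (g A : int -> lmodType K).
Lemma lin_koszul_sum n m J (ys : seq (letter g)) (xs : seq (letter A)) w t :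
  h (koszul_sum n m J ys xs w t) = koszul_sum n m J ys xs w (fun p r => h (t p r)).
Proof.
rewrite lin_map_sum; apply: eq_bigr => c _; rewrite lin_map_sum.
by apply: eq_bigr => e _; rewrite lin_mapZ.
Qed.
Lemma lin_shuffle_sum (ys : seq (letter g)) t :
  h (shuffle_sum ys t) = shuffle_sum ys (fun a b => h (t a b)).
Proof. by rewrite lin_map_sum; apply: eq_bigr => c _; rewrite lin_mapZ. Qed.
End LinearSums.

Lemma eq_koszul_sum (K : fieldType) (g A : int -> lmodType K) (U : lmodType K) n m J
  (ys : seq (letter g)) (xs : seq (letter A)) w (t t' : _ -> _ -> U) :
  (forall p r, t p r = t' p r) ->
  koszul_sum n m J ys xs w t = koszul_sum n m J ys xs w t'.
Proof. by move=> e; apply: eq_bigr => c _; apply: eq_bigr => d _; rewrite e. Qed.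

Section ScaleSums.
Variables (K : fieldType) (U : lmodType K).
Lemma shufZ (T : Type) (s : seq T) c (G : seq T -> seq T -> U) :
  shuf s (fun a b => c *: G a b) = c *: shuf s G.
Proof. by elim: s G => //= y s IH G; rewrite !IH scalerDr. Qed.
Lemma convZ n (m : 'X_{1..n}) c (G : 'X_{1..n} -> 'X_{1..n} -> U) :
  conv m (fun a b => c *: G a b) = c *: conv m G.
Proof. by rewrite /conv scaler_sumr. Qed.
End ScaleSums.

Section Evaluate.
Variables (K : fieldType) (V : int -> lmodType K) (U : zmodType).

(** A functional of marked letters as a total function of the letter and its marks, with
    value zero if the parities disagree. In this form linearity in the letter can be
    stated for fixed marks. *)
Definition pk (k : marked V -> U) (x : letter V) (mk : seq nat) : U :=
  if insub mk is Some m then k (Marked (valP (m : {m | odd (size m) == oddz (sdeg x)})))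
  else 0.

Lemma pkE k x mk (h : odd (size mk) == oddz (sdeg x)) : pk k x mk = k (Marked h).
Proof.
by rewrite /pk insubT /=; congr k; apply: marked_eq.
Qed.

Lemma pk_bad k x mk : odd (size mk) != oddz (sdeg x) -> pk k x mk = 0.
Proof. by move=> nh; rewrite /pk insubN. Qed.

Lemma pk_val k (x : marked V) : k x = pk k (mlet x) (mmk x).
Proof. by case: x => x mk h /=; rewrite pkE. Qed.
End Evaluate.

Section Model.
Variables (K : fieldType) (g A : int -> lmodType K) (n : nat) (one : A 0).
Local Notation YL := (marked g).
Local Notation XL := (marked A).
Local Notation mon := 'X_{1..n}.
Local Notation chain := (chain g one).
(** The values of functionals: they depend on the closed letters, on the exponent of [t]
    and on the marks already collected from outer operations. *)
Definition state : zmodType := (seq YL -> mon -> seq nat -> chain) : zmodType.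
Implicit Types (Ys : seq YL) (s t : seq XL) (m a b : mon) (mu mk : seq nat).
Implicit Types (v : state) (k : XL -> state).

Lemma state_addE v v' Ys m mu : (v + v') Ys m mu = v Ys m mu + v' Ys m mu.
Proof. by []. Qed.
Lemma state_cut (T : Type) (r : seq T) (G : seq T -> seq T -> state) Ys m mu :
  cut r G Ys m mu = cut r (fun p q => G p q Ys m mu).
Proof. exact: (cut_morph (h := fun v : state => v Ys m mu)). Qed.

(** Functionals of one open letter that are linear in the letter and alternating in its
    marks. By [good_pair] an even number of marks of a letter may be moved to the
    collected marks; this is used when a unit is removed together with q. *)
Record good k : Prop := Good {
  good_lin : forall d mk Ys m mu,
    lin_map (fun v : A d => pk k (Tagged A v) mk Ys m mu);
  good_anti : forall x Ys m mu, alternating (fun mk => pk k x mk Ys m mu);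
  good_pair : forall x i j mk Ys m mu,
    pk k x [:: i, j & mk] Ys m mu = pk k x mk Ys m (mu ++ [:: i; j]) }.

(** The corresponding properties in the closed letters, with graded symmetry turned into
    plain symmetry by the marks. *)
Record nice v : Prop := Nice {
  nice_lin : forall Y1 Y2 d mk m mu,
    lin_map (fun w : g d => pk (fun y => v (Y1 ++ y :: Y2) m mu) (Tagged g w) mk);
  nice_anti : forall Y1 Y2 y m mu, alternating (pk (fun y => v (Y1 ++ y :: Y2) m mu) y);
  nice_sym : forall Y1 y z Y2 m mu, v (Y1 ++ y :: z :: Y2) m mu = v (Y1 ++ z :: y :: Y2) m mu }.

Lemma good_intro k :
  (forall d mk Ys m mu c (v w : A d) h1 h2 h3,
     k (@Marked _ _ (Tagged A (c *: v + w)) mk h1) Ys m mu =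
     c *: k (@Marked _ _ (Tagged A v) mk h2) Ys m mu + k (@Marked _ _ (Tagged A w) mk h3) Ys m mu) ->
  (forall x l1 i j l2 h1 h2 Ys m mu, k (@Marked _ _ x (l1 ++ i :: j :: l2) h1) Ys m mu
     = - k (@Marked _ _ x (l1 ++ j :: i :: l2) h2) Ys m mu) ->
  (forall x i j mk h1 h2 Ys m mu, k (@Marked _ _ x [:: i, j & mk] h1) Ys m mu
     = k (@Marked _ _ x mk h2) Ys m (mu ++ [:: i; j])) ->
  good k.
Proof.
move=> H1 H2 H3; split.
- move=> d mk Ys m mu c v w.
  have [h|nh] := boolP (odd (size mk) == oddz (d - 1)).
    by rewrite !pkE; exact: H1.
  by rewrite !pk_bad // scaler0 addr0.
- move=> x Ys m mu l1 i j l2.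
  have sz : size (l1 ++ i :: j :: l2) = size (l1 ++ j :: i :: l2) by rewrite !size_cat.
  have [h|nh] := boolP (odd (size (l1 ++ i :: j :: l2)) == oddz (sdeg x)).
    have h' := h; rewrite sz in h'; rewrite !pkE; exact: H2.
  have nh' := nh; rewrite sz in nh'; by rewrite !pk_bad // oppr0.
- move=> x i j mk Ys m mu.
  have [h|nh] := boolP (odd (size mk) == oddz (sdeg x)).
    have h' : odd (size [:: i, j & mk]) == oddz (sdeg x) by rewrite /= negbK.
    rewrite !pkE; exact: H3.
  by rewrite !pk_bad //= negbK.
Qed.

Lemma nice_intro v :
  (forall Y1 Y2 d mk m mu c (p q : g d) h1 h2 h3,
     v (Y1 ++ @Marked _ _ (Tagged g (c *: p + q)) mk h1 :: Y2) m mu =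
     c *: v (Y1 ++ @Marked _ _ (Tagged g p) mk h2 :: Y2) m mu
     + v (Y1 ++ @Marked _ _ (Tagged g q) mk h3 :: Y2) m mu) ->
  (forall Y1 Y2 y l1 i j l2 h1 h2 m mu, v (Y1 ++ @Marked _ _ y (l1 ++ i :: j :: l2) h1 :: Y2) m mu
     = - v (Y1 ++ @Marked _ _ y (l1 ++ j :: i :: l2) h2 :: Y2) m mu) ->
  (forall Y1 y z Y2 m mu, v (Y1 ++ y :: z :: Y2) m mu = v (Y1 ++ z :: y :: Y2) m mu) ->
  nice v.
Proof.
move=> H1 H2 H3; split=> //.
- move=> Y1 Y2 d mk m mu c p q.
  have [h|nh] := boolP (odd (size mk) == oddz (d - 1)).
    by rewrite !pkE; exact: H1.
  by rewrite !pk_bad // scaler0 addr0.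
- move=> Y1 Y2 y m mu l1 i j l2.
  have sz : size (l1 ++ i :: j :: l2) = size (l1 ++ j :: i :: l2) by rewrite !size_cat.
  have [h|nh] := boolP (odd (size (l1 ++ i :: j :: l2)) == oddz (sdeg y)).
    have h' := h; rewrite sz in h'; rewrite !pkE; exact: H2.
  have nh' := nh; rewrite sz in nh'; by rewrite !pk_bad // oppr0.
Qed.

Lemma pkD (V : int -> lmodType K) (U : zmodType) (k k' : marked V -> U) x mk :
  pk (fun y => k y + k' y) x mk = pk k x mk + pk k' x mk.
Proof. by rewrite /pk; case: insub => [m|] //; rewrite addr0. Qed.

Lemma good_add k k' : good k -> good k' -> good (fun x => k x + k' x).
Proof.
move=> [n1 a1 p1] [n2 a2 p2]; split.
- move=> d mk Ys m mu c v w; rewrite !pkD !state_addE n1 n2 scalerDr; exact: addrACA.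
- by move=> x Ys m mu l1 i j l2; rewrite !pkD !state_addE a1 a2 opprD.
- by move=> x i j mk Ys m mu; rewrite !pkD !state_addE p1 p2.
Qed.

Lemma nice_add v v' : nice v -> nice v' -> nice (v + v').
Proof.
move=> [n1 a1 s1] [n2 a2 s2]; split.
- move=> Y1 Y2 d mk m mu c p q.
  rewrite !(pkD (fun y => v _ m mu) (fun y => v' _ m mu)) n1 n2 scalerDr; exact: addrACA.
- move=> Y1 Y2 y m mu l1 i j l2.
  by rewrite !(pkD (fun y => v _ m mu) (fun y => v' _ m mu)) a1 a2 opprD.
- by move=> Y1 y z Y2 m mu; rewrite !state_addE s1 s2.
Qed.

(** A power series of cochains of a fixed degree, with marks of the same parity. *)
Record mop := Mop {
  odeg : int; omk : seq nat; opar : odd (size omk) == oddz odeg;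
  ofun : tseries n (cochain g A) }.
Implicit Types (O : mop).

Lemma app_par O a Ys s :
  odd (size (omk O ++ mks Ys ++ mks s)) == oddz (sdeg (cval (odeg O) (ofun O a) (er Ys) (er s))).
Proof.
rewrite /cval /sdeg /= addrK !size_cat !oddD !oddzD -!mks_parity (eqP (opar O)).
by rewrite addbA.
Qed.

(** The output of an operation carries the marks of the operation and of all its inputs, in
    the order of the bracketed expression. *)
Definition app O a Ys s : XL := Marked (app_par O a Ys s).

(** The operation of a cochain: it takes some of the closed letters and part of the
    exponent of [t]. *)
Definition opc O : op XL state := fun s k Ys m mu =>
  shuf Ys (fun Y1 Y2 => conv m (fun a b => k (app O a Y2 s) Y1 b mu)).

Lemma opc_add O : op_add (opc O).
Proof.
move=> s k k'; apply: funext => Ys; apply: funext => m; apply: funext => mu.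
rewrite state_addE /opc -shufD; apply: eq_shuf => Y1 Y2; rewrite -convD.
by apply: eq_conv => a b.
Qed.

(** Two operations on different inputs share closed letters and exponents symmetrically,
    and their outputs carry their own marks; so no sign appears. *)
Lemma opc_exch O O' : exch (opc O) (opc O').
Proof.
move=> s t F; apply: funext => Ys; apply: funext => m; apply: funext => mu.
rewrite /opc.
transitivity (shuf Ys (fun Y1 Y2 => shuf Y1 (fun Y3 Y4 =>
   conv m (fun a b => conv b (fun c d => F (app O a Y2 s) (app O' c Y4 t) Y3 d mu))))).
  by apply: eq_shuf => Y1 Y2; rewrite shuf_conv.
rewrite shuf_swap; apply: eq_shuf => Y1 Y2; rewrite -shuf_conv; apply: eq_shuf => Y3 Y4.
exact: conv_swap.
Qed.

Lemma opc_out O : out_good good (opc O).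
Proof.
move=> s F gF; apply: good_intro.
- move=> d mk Ys m mu c v w h1 h2 h3; rewrite /opc -shufZ -shufD; apply: eq_shuf => Y1 Y2.
  rewrite -convZ -convD; apply: eq_conv => a b.
  by have := good_lin (gF (app O a Y2 s)) mk Y1 b mu c v w; rewrite !pkE.
- move=> x l1 i j l2 h1 h2 Ys m mu; rewrite /opc -shufN; apply: eq_shuf => Y1 Y2.
  rewrite -convN; apply: eq_conv => a b.
  by have := good_anti (gF (app O a Y2 s)) x Y1 b mu l1 i j l2; rewrite !pkE.
- move=> x i j mk h1 h2 Ys m mu; rewrite /opc; apply: eq_shuf => Y1 Y2; apply: eq_conv => a b.
  by have := good_pair (gF (app O a Y2 s)) x i j mk Y1 b mu; rewrite !pkE.
Qed.

Definition op_cochain O := forall a, is_cochain (odeg O) (ofun O a).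

Lemma cval_at p (D : cochain g A) ys xs d : d = p + sdegs ys + sdegs xs + 1 ->
  cval p D ys xs = Tagged A (D ys xs d).
Proof. by move->. Qed.

Lemma opc_in O : op_cochain O -> in_good good (opc O).
Proof.
move=> cO s1 s2 k gk; apply: good_intro.
- move=> d mk Ys m mu c v w h1 h2 h3; rewrite /opc -shufZ -shufD; apply: eq_shuf => Y1 Y2.
  rewrite -convZ -convD; apply: eq_conv => a b.
  rewrite !(pk_val k) /= !mks_cat /= !er_cat /=.
  set e := odeg O + sdegs (er Y2) + sdegs (er s1 ++ Tagged A v :: er s2) + 1.
  rewrite !(@cval_at _ _ _ _ e); try by rewrite /e !sdegs_cat !sdegs_cons.
  by rewrite (cochain_multilinear_open (cO a)) (good_lin gk).
- move=> x l1 i j l2 h1 h2 Ys m mu; rewrite /opc -shufN; apply: eq_shuf => Y1 Y2.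
  rewrite -convN; apply: eq_conv => a b; rewrite !(pk_val k) /= !er_cat /=.
  have E q : omk O ++ mks Y2 ++ mks (s1 ++ q :: s2) = (omk O ++ mks Y2 ++ mks s1) ++ mmk q ++ mks s2.
    by rewrite mks_cat -!catA.
  by rewrite !E /= -!catA !(catA (mks s1)) !(catA (mks Y2)) !(catA (omk O)) (good_anti gk).
- move=> x i j mk h1 h2 Ys m mu; rewrite /opc; apply: eq_shuf => Y1 Y2; apply: eq_conv => a b.
  rewrite !(pk_val k) /= !er_cat /=.
  have E q : omk O ++ mks Y2 ++ mks (s1 ++ q :: s2) = (omk O ++ mks Y2 ++ mks s1) ++ mmk q ++ mks s2.
    by rewrite mks_cat -!catA.
  rewrite !E /= -(good_pair gk).
  exact: (alternating_pair (good_anti gk _ _ _ _) [::]).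
Qed.

(** For the symmetry in the closed letters, the degree sign of the cochain is cancelled by
    the sign of exchanging the marks. *)
Lemma opc_nice O : op_cochain O -> forall s k, good k -> (forall x, nice (k x)) -> nice (opc O s k).
Proof.
move=> cO s k gk nk; apply: nice_intro.
- move=> Y1 Y2 d mk m mu c p q h1 h2 h3; rewrite /opc !shuf_cat /= -shufZ -shufD.
  apply: eq_shuf => P1 Z1; rewrite scalerDr addrACA; congr (_ + _).
    rewrite -shufZ -shufD; apply: eq_shuf => P2 Z2; rewrite -convZ -convD; apply: eq_conv => a b.
    by have := nice_lin (nk (app O a (Z1 ++ Z2) s)) P1 P2 mk b mu c p q; rewrite !pkE.
  rewrite -shufZ -shufD; apply: eq_shuf => P2 Z2; rewrite -convZ -convD; apply: eq_conv => a b.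
  rewrite !(pk_val k) /= !mks_cat /= !er_cat /=.
  set e := odeg O + sdegs (er Z1 ++ Tagged g p :: er Z2) + sdegs (er s) + 1.
  rewrite !(@cval_at _ _ _ _ e); try by rewrite /e !sdegs_cat !sdegs_cons.
  by rewrite (cochain_multilinear_closed (cO a)) (good_lin gk).
- move=> Y1 Y2 y l1 i j l2 h1 h2 m mu; rewrite /opc !shuf_cat /= -shufN.
  apply: eq_shuf => P1 Z1; rewrite opprD; congr (_ + _).
    rewrite -shufN; apply: eq_shuf => P2 Z2; rewrite -convN; apply: eq_conv => a b.
    by have := nice_anti (nk (app O a (Z1 ++ Z2) s)) P1 P2 y b mu l1 i j l2; rewrite !pkE.
  rewrite -shufN; apply: eq_shuf => P2 Z2; rewrite -convN; apply: eq_conv => a b.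
  rewrite !(pk_val k) /= !er_cat /=.
  have E q : omk O ++ mks (Z1 ++ q :: Z2) ++ mks s = (omk O ++ mks Z1) ++ mmk q ++ mks Z2 ++ mks s.
    by rewrite mks_cat -!catA.
  by rewrite !E /= -!catA !(catA (mks Z1)) !(catA (omk O)) (good_anti gk).
- move=> Y1 y z Y2 m mu; rewrite /opc !shuf_cat; apply: eq_shuf => P1 Z1 /=.
  have S1 : shuf Y2 (fun P2 Z2 => conv m (fun a b => k (app O a (Z1 ++ Z2) s) (P1 ++ y :: z :: P2) b mu))
    = shuf Y2 (fun P2 Z2 => conv m (fun a b => k (app O a (Z1 ++ Z2) s) (P1 ++ z :: y :: P2) b mu)).
    by apply: eq_shuf => P2 Z2; apply: eq_conv => a b; exact: (nice_sym (nk _)).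
  have S2 : shuf Y2 (fun P2 Z2 => conv m (fun a b => k (app O a (Z1 ++ y :: z :: Z2) s) (P1 ++ P2) b mu))
    = shuf Y2 (fun P2 Z2 => conv m (fun a b => k (app O a (Z1 ++ z :: y :: Z2) s) (P1 ++ P2) b mu)).
    apply: eq_shuf => P2 Z2; apply: eq_conv => a b; rewrite !(pk_val k) /= !er_cat /=.
    have E q q' : omk O ++ mks (Z1 ++ q :: q' :: Z2) ++ mks s
      = (omk O ++ mks Z1) ++ mmk q ++ mmk q' ++ mks Z2 ++ mks s.
      by rewrite mks_cat /= -!catA.
    rewrite !E (alternating_swap (good_anti gk _ _ _ _)).
    set e := odeg O + sdegs (er Z1 ++ mlet y :: mlet z :: er Z2) + sdegs (er s) + 1.
    rewrite !(@cval_at _ _ _ _ e); try by rewrite /e !sdegs_cat !sdegs_cons; ring.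
    rewrite (cochain_symmetric (cO a)) (lin_mapZ (good_lin gk _ _ _ _)) scalerA exprz_odd oddzM.
    rewrite -(eqP (mpar y)) -(eqP (mpar z)) -oddM signr_odd -expr2 sqrr_sign scale1r //.
  rewrite S1 S2; zmod.
Qed.

Lemma opc_regular O : op_cochain O -> regular_op good nice (opc O).
Proof.
move=> cO; split; [exact: opc_add|exact: opc_in|exact: opc_out|exact: opc_nice].
Qed.
End Model.

(** * Units and composition of cochains *)

Section Folding.
Variables (K : fieldType) (g A : int -> lmodType K) (n : nat) (one : A 0).
Local Notation YL := (marked g).
Local Notation XL := (marked A).
Local Notation mon := 'X_{1..n}.
Local Notation chain := (chain g one).
Local Notation state := (state g n one).
Local Notation mop := (mop g A n).
Implicit Types (Ys : seq YL) (s t : seq XL) (m a b : mon) (mu mk : seq nat).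
Implicit Types (v : state) (k : XL -> state) (O : mop).
Local Notation good := (@good K g A n one).
Local Notation nice := (@nice K g n one).
Local Notation opc := (@opc K g A n one).

Lemma alternating_pad (U : zmodType) (f : seq nat -> U) u w :
  alternating f -> alternating (fun mk => f (u ++ mk ++ w)).
Proof. by move=> af p i j r; rewrite -!catA !cat_cons !(catA u) af. Qed.

Lemma uletter_par (c : nat) : odd (size [:: c]) == oddz (sdeg (Tagged A one)).
Proof. by []. Qed.
Definition uletter (c : nat) : XL := Marked (uletter_par c).

(** The unit relations of a power series of cochains; [kap] is the power series by which
    the two-fold products with the unit act. It is 1 for a family of structures, but
    series with other [kap] occur when single coefficients are studied. *)
Record unit_family (kap : tseries n K) (f : tseries n (cochain g A)) : Prop := UnitFamily {
  uf_left : forall m i (x : A i), f m [::] [:: Tagged A one; Tagged A x] i = kap m *: x;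
  uf_right : forall m i (x : A i),
    (-1) ^ (sdeg (Tagged A x) + 1) *: f m [::] [:: Tagged A x; Tagged A one] i = kap m *: x;
  uf_other : forall m ys xs1 xs2 d, ~ (ys = [::] /\ size (xs1 ++ Tagged A one :: xs2) = 2) ->
    f m ys (xs1 ++ Tagged A one :: xs2) d = 0 }.

(** The normalization condition for cochains. *)
Definition vanishing (f : tseries n (cochain g A)) := forall m ys xs1 xs2 d,
  f m ys (xs1 ++ Tagged A one :: xs2) d = 0.

(** Removal of a unit: multiplication by [kap] and the marks of the operation and of the
    unit, which form an even pair. *)
Definition nu (kap : tseries n K) (i j : nat) (v : state) : state := fun Ys m mu =>
  conv m (fun a b => kap a *: v Ys b (mu ++ [:: i; j])).

Lemma nuD kap i j : {morph nu kap i j : v w / v + w}.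
Proof.
move=> v w; apply: funext => Ys; apply: funext => m; apply: funext => mu.
by rewrite state_addE /nu -convD; apply: eq_conv => a b; rewrite state_addE scalerDr.
Qed.

Lemma good0 k d mk Ys m mu : good k -> pk k (Tagged A (0 : A d)) mk Ys m mu = 0.
Proof. by move=> gk; rewrite (lin_map0 (good_lin gk mk Ys m mu)). Qed.

Lemma opc_unitless O c : vanishing (ofun O) -> unitless good (uletter c) (opc O).
Proof.
move=> vO s1 s2 k gk.
have -> : opc O (s1 ++ uletter c :: s2) k = 0.
  apply: funext => Ys; apply: funext => m; apply: funext => mu.
  rewrite /opc -[RHS](shuf0 _ Ys); apply: eq_shuf => Y1 Y2; rewrite -[RHS](conv0 _ m).
  apply: eq_conv => a b; rewrite pk_val /= er_cat /= /cval vO; exact: good0.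
by case: s1 => [|? [|? ?]]; case: s2 => [|? [|? ?]]; rewrite ?oppr0.
Qed.

(** The sign in the right unit relation is cancelled by moving the mark of the unit past
    the marks of the other letter. *)
Lemma opc_unital O kap th c : odeg O = 1 -> omk O = [:: th] -> unit_family kap (ofun O) ->
  unital good (uletter c) (opc O) (nu kap th c).
Proof.
move=> dO mO uO s1 s2 k gk.
apply: funext => Ys; apply: funext => m; apply: funext => mu.
have zero a Y1 Y2 b : ~ (Y2 = [::] /\ size (s1 ++ uletter c :: s2) = 2) ->
    k (app O a Y2 (s1 ++ uletter c :: s2)) Y1 b mu = 0.
  move=> h; rewrite pk_val /= er_cat /= /cval (uf_other uO); first exact: good0.
  case=> Y20; rewrite size_cat /= !size_map -(size_cat s1 (uletter c :: s2)) => sz.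
  by apply: h; split=> //; case: Y2 Y20.
have zz : size (s1 ++ uletter c :: s2) <> 2 -> opc O (s1 ++ uletter c :: s2) k Ys m mu = 0.
  move=> h; rewrite /opc -[RHS](shuf0 _ Ys); apply: eq_shuf => Y1 Y2; rewrite -[RHS](conv0 _ m).
  by apply: eq_conv => a b; apply: zero => -[].
move: zero zz; case: s1 => [|x [|x' s1]]; case: s2 => [|z [|z' s2]] zero zz; try by apply: zz; rewrite ?size_cat /=; lia.
- rewrite /opc /nu.
  transitivity (shuf Ys (fun Y1 Y2 => if Y2 is [::] then
     conv m (fun a b => kap a *: k z Y1 b (mu ++ [:: th; c])) else 0)); last exact: shuf_nilr.
  apply: eq_shuf => Y1 [|y Y2]; last first.
    by rewrite -[RHS](conv0 _ m); apply: eq_conv => a b; apply: zero => -[].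
  apply: eq_conv => a b; rewrite !(pk_val k) /= mO /=.
  have -> : mks [:: uletter c; z] = c :: mmk z by rewrite /mks /= cats0.
  case: (mlet z) => i x; rewrite (@cval_at _ _ _ _ _ _ _ i); last first.
    by rewrite dO !sdegs_cons !sdegs_nil /sdeg /=; ring.
  by rewrite (uf_left uO) (lin_mapZ (good_lin gk _ _ _ _)) (good_pair gk).
- rewrite /opc /nu.
  transitivity (shuf Ys (fun Y1 Y2 => if Y2 is [::] then
     conv m (fun a b => - (kap a *: k x Y1 b (mu ++ [:: th; c]))) else 0)); last first.
    by rewrite (shuf_nilr Ys (fun Y1 => conv m _)) convN.
  apply: eq_shuf => Y1 [|y Y2]; last first.
    by rewrite -[RHS](conv0 _ m); apply: eq_conv => a b; apply: zero => -[].
  apply: eq_conv => a b; rewrite !(pk_val k) /= mO /=.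
  have -> : mks [:: x; uletter c] = mmk x ++ [:: c] by rewrite /mks /= ?cats0.
  rewrite (alternating_swap (good_anti gk _ _ _ _) [:: th] (mmk x) [:: c] [::]) /= ?cats0 muln1.
  have := mpar x; case: (mlet x) => i w h; rewrite (@cval_at _ _ _ _ _ _ _ i); last first.
    by rewrite dO !sdegs_cons !sdegs_nil /sdeg /=; ring.
  have -> : ofun O a [::] [:: Tagged A w; Tagged A one] i = (-1) ^ (sdeg (Tagged A w) + 1) *: (kap a *: w).
    rewrite -(uf_right uO) scalerA !exprz_odd -expr2 sqrr_sign scale1r //.
  rewrite !(lin_mapZ (good_lin gk _ _ _ _)) (good_pair gk) scalerA exprz_odd oddzD -(eqP h).
  rewrite -[oddz 1]/true addbT signrN mulNr scaleNr scalerN -signr_odd -scalerA.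
  by rewrite (scalerA _ _ (_ *: _)) -expr2 sqrr_sign scale1r.
Qed.

Lemma cauchyE (S T : Type) (U : lmodType K) (f : S -> T -> U) (x : tseries n S) (y : tseries n T) m :
  cauchy f x y m = conv m (fun a b => f (x a) (y b)).
Proof. by []. Qed.

Lemma eq_cut_in (T : Type) (U : zmodType) (r : seq T) (G G' : seq T -> seq T -> U) :
  (forall p q, r = p ++ q -> G p q = G' p q) -> cut r G = cut r G'.
Proof.
elim: r G G' => [|x r IH] G G' e /=; first exact: e.
by rewrite e //; congr (_ + _); apply: IH => p q pq; apply: e; rewrite pq.
Qed.

Lemma eq_shuf_deg (V : int -> lmodType K) (U : zmodType) (r : seq (marked V))
    (G G' : seq (marked V) -> seq (marked V) -> U) :
  (forall p q, sdegs (er r) = sdegs (er p) + sdegs (er q) -> G p q = G' p q) ->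
  shuf r G = shuf r G'.
Proof.
elim: r G G' => [|x r IH] G G' e /=; first by apply: e; rewrite sdegs_nil addr0.
congr (_ + _); apply: IH => p q pq; apply: e; rewrite /= !sdegs_cons pq; ring.
Qed.

Lemma bullet_par O O' : odd (size (omk O ++ omk O')) == oddz (odeg O + odeg O').
Proof. by rewrite size_cat oddD oddzD (eqP (opar O)) (eqP (opar O')). Qed.
Definition bulletm O O' : mop :=
  Mop (bullet_par O O') (family_bullet (odeg O) (odeg O') (ofun O) (ofun O')).

(** The composition of operations is the operation of the composite cochain, since the
    Koszul signs in its definition are those of the marks. *)
Lemma dot_bullet O O' s k : good k -> dot (opc O) (opc O') s k = opc (bulletm O O') s k.
Proof.
move=> gk; apply: funext => Ys; apply: funext => m; apply: funext => mu.
pose T Y1 Z1 Z2 a1 a2 b s1 s2 s3 := k (app O a1 Z1 (s1 ++ app O' a2 Z2 s2 :: s3)) Y1 b mu.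
transitivity (cut s (fun s1 r => cut r (fun s2 s3 => shuf Ys (fun Y' Z2 => shuf Y' (fun Y1 Z1 =>
  conv m (fun a2 c => conv c (fun a1 b => T Y1 Z1 Z2 a1 a2 b s1 s2 s3))))))).
  rewrite /dot /ins state_cut; apply: eq_cut => s1 r; rewrite state_cut; apply: eq_cut => s2 s3.
  by apply: eq_shuf => Y' Z2; rewrite shuf_conv.
have foldE Y1 Z a b : k (app (bulletm O O') a Z s) Y1 b mu =
  conv a (fun a1 a2 => shuf Z (fun Z1 Z2 => cut s (fun s1 r => cut r (fun s2 s3 =>
     T Y1 Z1 Z2 a1 a2 b s1 s2 s3)))).
  rewrite pk_val /= /cval.
  set d := odeg O + odeg O' + _ + _ + 1.
  have hl := good_lin gk (d := d) ((omk O ++ omk O') ++ mks Z ++ mks s) Y1 b mu.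
  rewrite /family_bullet cauchyE.
  rewrite (conv_morph (h := fun v : A d => pk k (Tagged A v) _ Y1 b mu)); first last.
  - exact: (lin_mapD hl).
  - exact: (lin_map0 hl).
  apply: eq_conv => a1 a2; rewrite /bullet (lin_koszul_sum hl).
  pose wb : seq wblock := [:: (Op (odeg O), omk O); (Y 1, [::]); (X 1, [::]);
     (Op (odeg O'), omk O'); (Y 2, [::]); (X 2, [::]); (X 3, [::])].
  have := @koszul_sum_cut K g A _ [::] wb (fun p r mk =>
    pk k (Tagged A (ofun O a1 (p 1%N) (r 1%N ++ cval (odeg O') (ofun O' a2) (p 2) (r 2) :: r 3) d)) mk Y1 b mu)
    (fun p r => good_anti gk _ _ _ _) _ 1 2 Z s.
  rewrite /wok /= (opar O) (opar O') => /(_ isT isT isT) E.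
  rewrite (_ : (omk O ++ omk O') ++ mks Z ++ mks s = [::] ++ opmarks wb ++ mks Z ++ mks s); last first.
    by rewrite /opmarks /= cats0 -?catA.
  rewrite E; apply: eq_shuf_deg => Z1 Z2 dZ; apply: eq_cut_in => s1 r sr.
  apply: eq_cut_in => s2 s3 rs; rewrite /T (pk_val k) /= er_cat /=.
  rewrite -(@cval_at _ _ _ (odeg O)); last first.
    rewrite sdegs_cat sdegs_cons /d dZ sr rs !er_cat !sdegs_cat /cval /sdeg /=; ring.
  by congr (pk k _ _ Y1 b mu); rewrite /wmarks /= mks_cat /mks /= !cats0 -?catA.
transitivity (shuf Ys (fun Y1 Z => conv m (fun a b => conv a (fun a1 a2 =>
  shuf Z (fun Z1 Z2 => cut s (fun s1 r => cut r (fun s2 s3 => T Y1 Z1 Z2 a1 a2 b s1 s2 s3))))))); last first.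
  by apply: eq_shuf => Y1 Z; apply: eq_conv => a b; rewrite foldE.
transitivity (shuf Ys (fun Y' Z2 => shuf Y' (fun Y1 Z1 => cut s (fun s1 r => cut r (fun s2 s3 =>
  conv m (fun a2 c => conv c (fun a1 b => T Y1 Z1 Z2 a1 a2 b s1 s2 s3))))))).
  under eq_cut => s1 r.
    rewrite -shuf_cut; under eq_shuf => Y' Z2 do rewrite -shuf_cut.
    over.
  rewrite -shuf_cut; apply: eq_shuf => Y' Z2; exact: esym (shuf_cut _ _ _).
rewrite shufA; apply: eq_shuf => Y1 Z.
under [RHS]eq_conv => a b do rewrite -shuf_conv.
rewrite -shuf_conv; apply: eq_shuf => Z1 Z2.
transitivity (conv m (fun a2 c => conv c (fun a1 b => cut s (fun s1 r => cut r (fun s2 s3 =>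
   T Y1 Z1 Z2 a1 a2 b s1 s2 s3))))).
  under eq_cut => s1 r do rewrite cut_conv.
  rewrite cut_conv; apply: eq_conv => a2 c.
  under eq_cut => s1 r do rewrite cut_conv.
  by rewrite cut_conv.
by rewrite conv_swap -convA.
Qed.
End Folding.

(** * The brackets on closed inputs *)

Section Bracket.
Variables (K : fieldType) (g A : int -> lmodType K) (n : nat) (one : A 0).
Local Notation YL := (marked g).
Local Notation XL := (marked A).
Local Notation mon := 'X_{1..n}.
Local Notation chain := (chain g one).
Local Notation state := (state g n one).
Local Notation mop := (mop g A n).
Implicit Types (Ys Z : seq YL) (s t : seq XL) (m a b : mon) (mu mk : seq nat).
Implicit Types (v : state) (k : XL -> state) (O : mop).
Local Notation good := (@good K g A n one).
Local Notation nice := (@nice K g A n one).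
Local Notation opc := (@opc K g A n one).

Lemma shuffle_sum_shuf (U : lmodType K) (t : seq (letter g) -> seq (letter g) -> seq nat -> U) u r Ys :
  (forall p q, alternating (t p q)) ->
  shuffle_sum (er Ys) (fun p q => t p q (u ++ mks Ys ++ r)) =
  shuf Ys (fun Z1 Z2 => t (er Z1) (er Z2) (u ++ mks Z1 ++ mks Z2 ++ r)).
Proof.
move=> at_; pose wb : seq wblock := [:: (Y 1, [::]); (Y 2, [::])].
rewrite -[RHS](colour_sumE 1 Ys (fun p => t (er (p 1%N)) (er (p 2)) (u ++ mks (p 1%N) ++ mks (p 2) ++ r))).
rewrite /shuffle_sum /colour_sum.
apply: (etrans (tuple_cast xpredT (fun c : seq 'I_2 =>
   koszul K (word_of (labels c) [::] [seq sdeg y | y <- er Ys] [::] [:: Y 1; Y 2])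
      *: t (part (labels c) (er Ys) 1) (part (labels c) (er Ys) 2) (u ++ mks Ys ++ r)) (size_map _ Ys))).
apply: eq_bigr => c _; rewrite -!map_part.
have al := alternating_pad [::] r (at_ (er (part (labels c) Ys 1)) (er (part (labels c) Ys 2))).
have := @kappa_marks K g A 2 0 wb Ys [::] c [::] (size_tuple c) erefl isT isT isT U _ u al.
rewrite /wmarks /opmarks /kappa /= !cats0 -!catA => -> //.
Qed.

Variables (l : brackets g) (hl : L_infinity l) (th : nat).

Lemma bl_par Z : odd (size (th :: mks Z)) == oddz (sdeg (bval l (er Z))).
Proof. by rewrite /= mks_parity /bval /sdeg /= addrK oddzD. Qed.
(** The bracket of closed letters as a marked letter; [th] is the mark of the bracket. *)
Definition bl Z : YL := Marked (bl_par Z).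

(** The bracket is applied to some closed letters and its output is put in front, as in
    the differential. *)
Definition lamc (v : state) : state := fun Ys m mu =>
  shuf Ys (fun Y2 Z => v (bl Z :: Y2) m mu).

Lemma lamcD : {morph lamc : v w / v + w}.
Proof.
move=> v w; apply: funext => Ys; apply: funext => m; apply: funext => mu.
by rewrite state_addE /lamc -shufD; apply: eq_shuf.
Qed.

(** The operation with a bracket among its closed inputs. *)
Definition opl O : op XL state := fun s k Ys m mu =>
  shuf Ys (fun Y1 Z => conv m (fun a b => shuf Z (fun Z2 Z1 =>
    k (app O a (bl Z1 :: Z2) s) Y1 b mu))).

(** The output of a bracket applied to all closed letters is afterwards either an input of
    the operation or not. *)
Lemma deriv_opl O : deriv lamc (opc O) (opl O).
Proof.
move=> s k; apply: funext => Ys; apply: funext => m; apply: funext => mu.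
rewrite state_addE /lamc /opl /opc /= -/(opc O).
under eq_shuf => Y2 Z do rewrite /=.
rewrite shufD; congr (_ + _).
  transitivity (shuf Ys (fun Y' Z => shuf Y' (fun P Q => conv m (fun a b => k (app O a Q s) (bl Z :: P) b mu)))).
    by [].
  rewrite shuf_swap; apply: eq_shuf => Y1 Y2; rewrite shuf_conv; by apply: eq_conv.
transitivity (shuf Ys (fun Y' Z => shuf Y' (fun P Q => conv m (fun a b => k (app O a (bl Z :: Q) s) P b mu)))).
  by [].
by rewrite shufA; apply: eq_shuf => Y1 Z; rewrite shuf_conv.
Qed.

Lemma opl_par O : odd (size (omk O ++ [:: th])) == oddz (odeg O + 1).
Proof. by rewrite size_cat oddD oddzD (eqP (opar O)). Qed.
Definition bracketm O : mop := Mop (opl_par O)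
  (fun m ys xs d => shuffle_sum ys (fun p q => ofun O m (bval l p :: q) xs d)).

Lemma opl_bracket O s k : good k -> opl O s k = opc (bracketm O) s k.
Proof.
move=> gk; apply: funext => Ys; apply: funext => m; apply: funext => mu.
apply: eq_shuf => Y1 Z; apply: eq_conv => a b.
rewrite [in RHS]pk_val /= /cval.
set d := odeg O + 1 + _ + _ + 1.
have lk := good_lin gk (d := d) ((omk O ++ [:: th]) ++ mks Z ++ mks s) Y1 b mu.
rewrite (lin_shuffle_sum lk).
have E := @shuffle_sum_shuf _ (fun p q mk => pk k (Tagged A (ofun O a (bval l p :: q) (er s) d)) mk Y1 b mu)
  (omk O ++ [:: th]) (mks s) Z (fun p q => good_anti gk _ _ _ _).
rewrite E shufC; apply: eq_shuf_deg => Z2 Z1 dZ; rewrite (pk_val k) /=.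
rewrite -(@cval_at _ _ _ (odeg O)).
  by rewrite /mks /= -!catA.
rewrite /d dZ sdegs_cons /bval /sdeg /=; ring.
Qed.

Lemma lamc_nice v : nice v -> nice (lamc v).
Proof.
move=> nv; apply: nice_intro.
- move=> Y1 Y2 d mk m mu c p q h1 h2 h3; rewrite /lamc !shuf_cat /= -shufZ -shufD.
  apply: eq_shuf => P1 Z1; rewrite scalerDr addrACA; congr (_ + _).
    rewrite -shufZ -shufD; apply: eq_shuf => P2 Z2.
    by have := nice_lin nv (bl (Z1 ++ Z2) :: P1) P2 mk m mu c p q; rewrite !pkE.
  rewrite -shufZ -shufD; apply: eq_shuf => P2 Z2.
  set e := 1 + sdegs (er Z1 ++ Tagged g p :: er Z2) + 1.
  have E (w : g d) h (M := (@Marked _ g (Tagged g w) mk h)) :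
      v (bl (Z1 ++ M :: Z2) :: P1 ++ P2) m mu =
      pk (fun y => v ([::] ++ y :: P1 ++ P2) m mu)
       (Tagged g (l (er Z1 ++ Tagged g w :: er Z2) e)) (th :: mks Z1 ++ mk ++ mks Z2).
    rewrite -[LHS](pkE (fun y => v ([::] ++ y :: P1 ++ P2) m mu) (bl_par _)).
    rewrite /mks map_cat flatten_cat /=; congr (pk _ _ _).
    rewrite /bval er_cat /=; have -> // : 1 + sdegs (er Z1 ++ Tagged g w :: er Z2) + 1 = e.
    by rewrite /e !sdegs_cat !sdegs_cons.
  rewrite !E (Linf_multilinear hl); exact: (nice_lin nv [::] (P1 ++ P2)).
- move=> Y1 Y2 y l1 i j l2 h1 h2 m mu; rewrite /lamc !shuf_cat /= -shufN.
  apply: eq_shuf => P1 Z1; rewrite opprD; congr (_ + _).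
    rewrite -shufN; apply: eq_shuf => P2 Z2.
    by have := nice_anti nv (bl (Z1 ++ Z2) :: P1) P2 y m mu l1 i j l2; rewrite !pkE.
  rewrite -shufN; apply: eq_shuf => P2 Z2.
  have E mk h (M := (@Marked _ g y mk h)) :
      v (bl (Z1 ++ M :: Z2) :: P1 ++ P2) m mu =
      pk (fun y => v ([::] ++ y :: P1 ++ P2) m mu)
       (bval l (er Z1 ++ y :: er Z2)) (th :: mks Z1 ++ mk ++ mks Z2).
    rewrite -[LHS](pkE (fun y => v ([::] ++ y :: P1 ++ P2) m mu) (bl_par _)).
    by rewrite /mks map_cat flatten_cat /= er_cat.
  by rewrite !E -!catA !(catA (mks Z1)) -!cat_cons (nice_anti nv).
- move=> Y1 y z Y2 m mu; rewrite /lamc !shuf_cat; apply: eq_shuf => P1 Z1 /=.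
  have S1 : shuf Y2 (fun P2 Z2 => v (bl (Z1 ++ Z2) :: P1 ++ y :: z :: P2) m mu)
    = shuf Y2 (fun P2 Z2 => v (bl (Z1 ++ Z2) :: P1 ++ z :: y :: P2) m mu).
    by apply: eq_shuf => P2 Z2; exact: (nice_sym nv (bl (Z1 ++ Z2) :: P1)).
  have S2 : shuf Y2 (fun P2 Z2 => v (bl (Z1 ++ y :: z :: Z2) :: P1 ++ P2) m mu)
    = shuf Y2 (fun P2 Z2 => v (bl (Z1 ++ z :: y :: Z2) :: P1 ++ P2) m mu).
    apply: eq_shuf => P2 Z2.
    have E p q : v (bl (Z1 ++ p :: q :: Z2) :: P1 ++ P2) m mu =
      pk (fun y => v ([::] ++ y :: P1 ++ P2) m mu)
       (bval l (er Z1 ++ mlet p :: mlet q :: er Z2)) ((th :: mks Z1) ++ mmk p ++ mmk q ++ mks Z2).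
      rewrite -[LHS](pkE (fun y => v ([::] ++ y :: P1 ++ P2) m mu) (bl_par _)).
      by rewrite /mks map_cat flatten_cat /= er_cat.
    rewrite !E (alternating_swap (nice_anti nv [::] _ _ _ _)).
    set e := 1 + sdegs (er Z1 ++ mlet y :: mlet z :: er Z2) + 1.
    have -> : bval l (er Z1 ++ mlet z :: mlet y :: er Z2) =
       Tagged g (l (er Z1 ++ mlet z :: mlet y :: er Z2) e).
      rewrite /bval; have -> // : 1 + sdegs (er Z1 ++ mlet z :: mlet y :: er Z2) + 1 = e.
      by rewrite /e !sdegs_cat !sdegs_cons; ring.
    rewrite /bval -/e (Linf_symmetric hl) (lin_mapZ (nice_lin nv [::] _ _ _ _)) scalerA exprz_odd oddzM.
    by rewrite -(eqP (mpar y)) -(eqP (mpar z)) -oddM signr_odd -expr2 sqrr_sign scale1r.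
  rewrite S1 S2; zmod.
Qed.

Lemma opc_add_fun O O1 O2 s k : good k -> odeg O1 = odeg O -> odeg O2 = odeg O ->
  omk O1 = omk O -> omk O2 = omk O ->
  (forall m ys xs d, ofun O m ys xs d = ofun O1 m ys xs d + ofun O2 m ys xs d) ->
  opc O s k = opc O1 s k + opc O2 s k.
Proof.
move=> gk d1 d2 m1 m2 eO; apply: funext => Ys; apply: funext => m; apply: funext => mu.
rewrite state_addE /opc -shufD; apply: eq_shuf => Y1 Y2; rewrite -convD; apply: eq_conv => a b.
rewrite !(pk_val k) /= m1 m2 d1 d2 /cval eO.
exact: (lin_mapD (good_lin gk _ _ _ _)).
Qed.

Lemma opc_ext O O' s k : good k -> odeg O = odeg O' -> omk O = omk O' ->
  (forall m ys xs d, ofun O m ys xs d = ofun O' m ys xs d) -> opc O s k = opc O' s k.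
Proof.
move=> gk d1 m1 eO; apply: funext => Ys; apply: funext => m; apply: funext => mu.
apply: eq_shuf => Y1 Y2; apply: eq_conv => a b.
by rewrite !(pk_val k) /= m1 d1 /cval eO.
Qed.

Lemma opc_swap O O' i j s k : good k -> odeg O = odeg O' -> omk O = [:: i; j] -> omk O' = [:: j; i] ->
  (forall m ys xs d, ofun O m ys xs d = ofun O' m ys xs d) -> opc O s k = - opc O' s k.
Proof.
move=> gk d1 m1 m2 eO; apply: funext => Ys; apply: funext => m; apply: funext => mu.
rewrite -[RHS]/(- (opc O' s k Ys m mu)) /opc -shufN; apply: eq_shuf => Y1 Y2.
rewrite -convN; apply: eq_conv => a b.
rewrite !(pk_val k) /= m1 m2 d1 /cval eO; exact: (good_anti gk _ _ _ _ [::]).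
Qed.

Definition op1 (f : tseries n (cochain g A)) (i : nat) : mop :=
  @Mop K g A n 1 [:: i] isT f.

Section Families.
Variable q : tseries n (cochain g A).
Hypothesis relq : forall m ys xs d,
  shuffle_sum ys (fun y1 y2 => q m (bval l y1 :: y2) xs d) = family_bullet 1 1 q q m ys xs d.

(** The structure relation in the form that has no sign. *)
Lemma flat_q i s k : good k -> dot (opc (op1 q i)) (opc (op1 q th)) s k = opl (op1 q i) s k.
Proof.
move=> gk; rewrite dot_bullet // opl_bracket //; apply: opc_ext => // m ys xs d.
by rewrite /= relq.
Qed.

Variable D : tseries n (cochain g A).
Hypothesis relD : forall m ys xs d,
  shuffle_sum ys (fun y1 y2 => D m (bval l y1 :: y2) xs d) =
  family_bullet 1 1 D q m ys xs d + family_bullet 1 1 q D m ys xs d.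

(** The derivative of the structure relation. One of its two compositions has the marks in
    the opposite order, which yields the sign of the commutator. *)
Lemma closed_D j : closed good (opc (op1 q th)) (opc (op1 D j)) (opl (op1 D j)).
Proof.
move=> s k gk; rewrite !dot_bullet // opl_bracket //.
pose O' := @Mop K g A n 2 [:: j; th] isT (family_bullet 1 1 q D).
rewrite (@opc_swap _ O' th j) //.
rewrite (@opc_add_fun (bracketm (op1 D j)) (bulletm (op1 D j) (op1 q th)) O') //.
by rewrite -opprD [X in - X]addrC addNr.
Qed.
End Families.
End Bracket.

(** * Chains modulo their relations *)

Section Quotient.
Variables (K : fieldType) (g A : int -> lmodType K) (n : nat) (one : A 0).
Local Notation YL := (marked g).
Local Notation XL := (marked A).
Local Notation mon := 'X_{1..n}.
Local Notation chain := (chain g one).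
Local Notation state := (state g n one).
Implicit Types (Ys Z : seq YL) (s t W : seq XL) (m a b : mon) (mu mk : seq nat).
Local Notation good := (@good K g A n one).
Local Notation nice := (@nice K g A n one).
Local Notation free := (free_chain g A).

Definition pic (w : free) : chain := (\pi_(quot_module (@chain_relb K g A one)) w)%qT.

Lemma pic_lin : lin_map pic.
Proof.
move=> c v w; rewrite /pic raddfD; congr (_ + _); exact: esym (quot_scale_pi _ _ _).
Qed.

Lemma pic_rel w : chain_rel one w -> pic w = 0.
Proof.
move=> rw; rewrite -[RHS](lin_map0 pic_lin); apply/eqP.
rewrite -Quotient.idealrBE subr0; exact/asboolP.
Qed.

Lemma pic_eq v w : chain_rel one (v - w) -> pic v = pic w.
Proof.
move=> /pic_rel e; apply/eqP; rewrite -subr_eq0 -(lin_mapN pic_lin) -(lin_mapD pic_lin).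
exact/eqP.
Qed.

Lemma pic_repr (v : chain) : pic (repr v) = v.
Proof. exact: reprK. Qed.

Lemma pic_rel_inv w : pic w = 0 -> chain_rel one w.
Proof.
rewrite -(lin_map0 pic_lin) => /eqP; rewrite -Quotient.idealrBE subr0.
by move/asboolP.
Qed.

Lemma linear_ext_lin (f : seq (letter g) -> seq (letter A) -> free) : lin_map (linear_ext f).
Proof.
rewrite /linear_ext; set h := fglift _.
have hB v w : h (v - w) = h v - h w by exact: lift_is_additive.
have h0 : h 0 = 0 by have := hB 0 0; rewrite !subrr.
have hN v : h (- v) = - h v by rewrite -sub0r hB h0 sub0r.
have hD v w : h (v + w) = h v + h w by rewrite -{1}[w]opprK hB hN opprK.
have hZ c w : h (c *: w) = c *: h w.
  rewrite -[in RHS](freeg_sumE w) [c *: w]/(fgscale c w) /fgscale.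
  rewrite !(big_morph h hD h0) scaler_sumr; apply: eq_bigr => x _.
  by rewrite /h !liftU scalerA.
by move=> c v w; rewrite hD hZ.
Qed.

Lemma linear_ext_pure (f : seq (letter g) -> seq (letter A) -> free) ys x xs :
  linear_ext f (pure ys (x :: xs)) = f ys (x :: xs).
Proof. by rewrite /linear_ext /= liftU scale1r. Qed.

Definition compatible (f : seq (letter g) -> seq (letter A) -> free) :=
  forall w, chain_rel one w -> pic (linear_ext f w) = 0.

Lemma chain_op_pic f w : compatible f -> chain_op (one := one) f (pic w) = pic (linear_ext f w).
Proof.
move=> cf; apply/eqP; rewrite -subr_eq0 -[chain_op _ _]/(pic (linear_ext f (repr (pic w)))).
rewrite -(lin_mapN pic_lin) -(lin_mapD pic_lin) -(lin_mapN (linear_ext_lin f)) -(lin_mapD (linear_ext_lin f)).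
apply/eqP/cf/pic_rel_inv; rewrite (lin_mapD pic_lin) (lin_mapN pic_lin) pic_repr subrr //.
Qed.

Lemma chain_op_lin f : compatible f -> lin_map (chain_op (one := one) f).
Proof.
move=> cf c v w; rewrite -(pic_repr v) -(pic_repr w) -pic_lin !chain_op_pic //.
by rewrite (linear_ext_lin f) pic_lin.
Qed.

(** A linear operator on chains is determined by its values on words. *)
Lemma chain_ind (S S' : chain -> chain) : lin_map S -> lin_map S' ->
  (forall ys x xs, S (pic (pure ys (x :: xs))) = S' (pic (pure ys (x :: xs)))) -> S =1 S'.
Proof.
move=> lS lS' e v; rewrite -(pic_repr v); move: (repr v) => w.
elim/freeg_ind_dom0: w => [|c x w _ _ IH].
  by rewrite (lin_map0 pic_lin) (lin_map0 lS) (lin_map0 lS').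
have -> : << c *g x >> + w = c *: pure x.1 (x.2.1 :: x.2.2) + w.
  congr (_ + _); case: x => ys [x xs] /=; apply/eqP/freeg_eqP => z.
  by rewrite coeffZ !coeffU mul1r.
by rewrite pic_lin lS lS' e IH.
Qed.

Section Marking.
Variable V : int -> lmodType K.

Definition mark_at (i : nat) (x : letter V) : seq nat := if oddz (sdeg x) then [:: i] else [::].
Lemma mark_at_par i x : odd (size (mark_at i x)) == oddz (sdeg x).
Proof. by rewrite /mark_at; case: oddz. Qed.
(** Different marks for different letters, starting with a given number. *)
Fixpoint marking (i : nat) (s : seq (letter V)) : seq (marked V) :=
  if s is x :: s' then Marked (mark_at_par i x) :: marking i.+1 s' else [::].

Lemma er_marking i (s : seq (letter V)) : er (marking i s) = s.
Proof. by elim: s i => //= x s IH i; rewrite IH. Qed.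

Lemma marking_cat i (s t : seq (letter V)) : marking i (s ++ t) = marking i s ++ marking (i + size s)%N t.
Proof. by elim: s i => [|x s IH] i /=; rewrite ?addn0 // IH addSnnS. Qed.

Lemma mks_marking i (s : seq (letter V)) : {subset mks (marking i s) <= iota i (size s)}.
Proof.
elim: s i => //= x s IH i j; rewrite /mks /= mem_cat inE => /orP[|/IH ->]; last by rewrite orbT.
by rewrite /mark_at; case: oddz; rewrite // inE => ->.
Qed.

Lemma uniq_marking i (s : seq (letter V)) : uniq (mks (marking i s)).
Proof.
elim: s i => //= x s IH i; rewrite /mks /= cat_uniq IH andbT /mark_at.
case: oddz => //=; apply/hasPn => j; first by move/mks_marking; rewrite mem_iota inE; lia.
by [].
Qed.
End Marking.

(** The evaluation of a chain operator on a word, weighted by the sign of its marks. All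
    functionals of interest arise from it by operations. *)
Definition final (T : tseries n (chain -> chain)) (W : seq XL) : state := fun Ys m mu =>
  alt K (mu ++ mks Ys ++ mks W) *: T m (pic (pure (er Ys) (er W))).
Definition Fin T : XL -> seq XL -> state := fun x w => final T (x :: w).

Section Final.
Variable T : tseries n (chain -> chain).
Hypothesis lT : forall m, lin_map (T m).

Lemma final_good s1 s2 : good (fun x => final T (s1 ++ x :: s2)).
Proof.
apply: good_intro.
- move=> d mk Ys m mu c v w h1 h2 h3; rewrite /final !mks_cat !er_cat /=.
  rewrite scalerA mulrC -scalerA -scalerDr -lT -pic_lin; congr (_ *: T m _).
  by apply: pic_eq; exact: chain_rel_open.
- move=> x l1 i j l2 h1 h2 Ys m mu; rewrite /final !er_cat /= -scaleNr; congr (_ *: _).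
  have E q : mu ++ mks Ys ++ mks (s1 ++ q :: s2) = (mu ++ mks Ys ++ mks s1) ++ mmk q ++ mks s2.
    by rewrite mks_cat /mks /= -!catA.
  rewrite !E /=; exact: (alternating_pad _ _ (@alt_alternating K)).
- move=> x i j mk h1 h2 Ys m mu; rewrite /final !er_cat /=; congr (_ *: _).
  have E u q : u ++ mks Ys ++ mks (s1 ++ q :: s2) = u ++ (mks Ys ++ mks s1) ++ mmk q ++ mks s2.
    by rewrite mks_cat /mks /= -!catA.
  rewrite !E /= -[in RHS]catA /=.
  exact: (alternating_pair (U := K^o) (@alt_alternating K)).
Qed.

Lemma final_nice W : nice (final T W).
Proof.
case: W => [|x W].
  have z Ys m mu : final T [::] Ys m mu = 0.
    by rewrite /final /= (lin_map0 (@pic_lin)) (lin_map0 (lT m)) scaler0.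
  apply: nice_intro => *; rewrite !z ?scaler0 ?addr0 ?oppr0 //.
apply: nice_intro.
- move=> Y1 Y2 d mk m mu c v w h1 h2 h3; rewrite /final !mks_cat !er_cat /=.
  rewrite scalerA mulrC -scalerA -scalerDr -lT -pic_lin; congr (_ *: T m _).
  by apply: pic_eq; exact: (chain_rel_closed one (er Y1) c v w (er Y2) (mlet x :: er W)).
- move=> Y1 Y2 y l1 i j l2 h1 h2 m mu; rewrite /final !er_cat /= -scaleNr; congr (_ *: _).
  have E q : mu ++ mks (Y1 ++ q :: Y2) ++ mks (x :: W) = (mu ++ mks Y1) ++ mmk q ++ mks Y2 ++ mks (x :: W).
    by rewrite mks_cat /mks /= -!catA.
  rewrite !E /=; exact: (alternating_pad _ _ (@alt_alternating K)).
- move=> Y1 y z Y2 m mu; rewrite /final !er_cat /=.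
  have E q q' : mu ++ mks (Y1 ++ q :: q' :: Y2) ++ mks (x :: W) =
     (mu ++ mks Y1) ++ mmk q ++ mmk q' ++ mks Y2 ++ mks (x :: W).
    by rewrite mks_cat /mks /= -!catA.
  rewrite !E (alternating_swap (U := K^o) (@alt_alternating K)).
  have -> : pic (pure (er Y1 ++ mlet y :: mlet z :: er Y2) (mlet x :: er W)) =
    (-1) ^ (sdeg (mlet y) * sdeg (mlet z)) *: pic (pure (er Y1 ++ mlet z :: mlet y :: er Y2) (mlet x :: er W)).
    rewrite -(lin_mapZ pic_lin); apply: pic_eq; exact: (chain_rel_symmetric one (er Y1) (mlet y) (mlet z) (er Y2) (mlet x :: er W)).
  rewrite (lin_mapZ (lT m)) scalerA exprz_odd oddzM -(eqP (mpar y)) -(eqP (mpar z)) -oddM signr_odd.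
  by rewrite mulrAC -expr2 sqrr_sign mul1r.
Qed.

Lemma Fin_admissible c : admissible good nice (uletter one c) (Fin T).
Proof.
split.
- by move=> N; exact: (final_good [::]).
- by move=> x s1 s2; exact: (final_good (x :: s1)).
- by move=> x w; exact: final_nice.
- move=> x s1 s2; apply: funext => Ys; apply: funext => m; apply: funext => mu.
  rewrite /Fin /final /= er_cat /= pic_rel ?(lin_map0 (lT m)) ?scaler0 //.
  exact: chain_rel_normalized.
Qed.
End Final.
End Quotient.

(** * Operators that descend to normalized chains *)

Section WellDefined.
Variables (K : fieldType) (g A : int -> lmodType K) (n : nat) (one : A 0).
Local Notation YL := (marked g).
Local Notation XL := (marked A).
Local Notation mon := 'X_{1..n}.
Local Notation chain := (chain g one).
Local Notation state := (state g n one).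
Implicit Types (Ys Z : seq YL) (m a b : mon) (mu mk : seq nat).
Local Notation good := (@good K g A n one).
Local Notation nice := (@nice K g A n one).
Local Notation free := (free_chain g A).
Local Notation pic := (@pic K g A one).

Lemma scale_cancel (U : lmodType K) (c : K) (v w : U) : c != 0 -> c *: v = c *: w -> v = w.
Proof. by move=> c0 e; rewrite -[v]scale1r -[w]scale1r -(mulVf c0) -!scalerA e. Qed.

Variables (f : seq (letter g) -> seq (letter A) -> free) (F : XL -> seq XL -> state).
Variables (c0 : nat) (ops : seq nat).
Hypothesis aF : admissible good nice (uletter one c0) F.
Hypothesis uops : uniq (c0 :: ops).
Hypothesis FE : forall x xs Ys, F x xs Ys 0%MM [::] =
  alt K (ops ++ mks Ys ++ mks (x :: xs)) *: pic (f (er Ys) (er (x :: xs))).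

Let N := (\max_(i <- c0 :: ops) i).+1.
Let ltN i : i \in c0 :: ops -> (i < N)%N.
Proof. by move=> h; rewrite ltnS; exact: leq_bigmax_seq. Qed.

Lemma alt_fresh (ys : seq (letter g)) (Xs : seq XL) :
  uniq (mks Xs) -> (forall i, i \in mks Xs -> i \notin ops /\ i \notin iota N (size ys)) ->
  alt K (ops ++ mks (marking N ys) ++ mks Xs) != 0.
Proof.
move=> uX dX; apply: alt_neq0; move: uops => /= /andP[_ uo].
rewrite cat_uniq uo cat_uniq uniq_marking uX andbT /=; apply/andP; split.
  apply/hasPn => i; rewrite mem_cat => /orP[/mks_marking|/dX[]//].
  rewrite mem_iota => /andP[Ni _]; apply/negP => io.
  by have := @ltN i; rewrite inE io orbT => /(_ isT); rewrite ltnNge Ni.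
apply/hasPn => i /dX[_]; apply: contra => /mks_marking //.
Qed.

Lemma alt_marking (ys : seq (letter g)) (xs : seq (letter A)) :
  alt K (ops ++ mks (marking N ys) ++ mks (marking (N + size ys) xs)) != 0.
Proof.
apply: alt_fresh; first exact: uniq_marking.
move=> i /mks_marking; rewrite !mem_iota => /andP[le lt]; split.
  apply/negP => io; have := @ltN i; rewrite inE io orbT => /(_ isT).
  by rewrite ltnNge (leq_trans (leq_addr _ _) le).
by rewrite negb_and -leqNgt le orbT.
Qed.

(** For each defining relation of chains, mark all letters differently, so that the weight
    is a nonzero sign; then the corresponding property of an admissible functional is the
    relation for the images. *)
Lemma compatible_intro : compatible one f.
Proof.
have lL := linear_ext_lin f.
move=> w; elim=> [|c v w' _ IHv _ IHw|ys1 i c u v ys2 xs|ys xs1 i c u v xs2|ys1 a b ys2 xs|ys x xs1 xs2].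
- by rewrite (lin_map0 lL) (lin_map0 (@pic_lin K g A one)).
- by rewrite lL pic_lin IHv IHw scaler0 addr0.
- case: xs => [|x xs].
    by rewrite /= scaler0 addr0 subr0 (lin_map0 lL) (lin_map0 (@pic_lin K g A one)).
  rewrite (lin_mapD lL) (lin_mapN lL) lL !linear_ext_pure.
  rewrite (lin_mapD (@pic_lin K g A one)) (lin_mapN (@pic_lin K g A one)) pic_lin; apply/eqP; rewrite subr_eq0; apply/eqP.
  set Xs := marking (N + size (ys1 ++ Tagged g u :: ys2)) (x :: xs).
  pose j := (N + size ys1)%N; pose mk := mark_at j (Tagged g u).
  have nX := adm_nice aF (head (uletter one 0) Xs) (behead Xs).
  pose Y1 := marking N ys1; pose Y2 := marking j.+1 ys2.
  pose al := alt K (ops ++ mks (marking N (ys1 ++ Tagged g u :: ys2)) ++ mks Xs).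
  have al0 : al != 0 by exact: alt_marking.
  have E w1 (h : odd (size mk) == oddz (sdeg (Tagged g w1))) :
      pk (fun y => F (head (uletter one 0) Xs) (behead Xs) (Y1 ++ y :: Y2) 0%MM [::]) (Tagged g w1) mk
      = al *: pic (f (ys1 ++ Tagged g w1 :: ys2) (x :: xs)).
    rewrite pkE FE /= er_cat /= !er_marking; congr (alt K _ *: _).
    by rewrite marking_cat !mks_cat /mks /= -?catA.
  have h := mark_at_par j (Tagged g u).
  have := nice_lin nX Y1 Y2 mk 0%MM [::] c u v; rewrite !E // => e.
  by apply: (scale_cancel al0); rewrite e scalerDr !scalerA mulrC.
- have [x [xs Exs]] : exists x xs, xs1 ++ Tagged A (c *: u + v) :: xs2 = x :: xs.
    by case: xs1 => [|x xs1]; [exists (Tagged A (c *: u + v)), xs2 | exists x, (xs1 ++ Tagged A (c *: u + v) :: xs2)].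
  have LE w1 : linear_ext f (pure ys (xs1 ++ Tagged A w1 :: xs2)) = f ys (xs1 ++ Tagged A w1 :: xs2).
    by case: xs1 {Exs} => [|y xs1]; rewrite linear_ext_pure.
  rewrite (lin_mapD lL) (lin_mapN lL) lL !LE.
  rewrite (lin_mapD (@pic_lin K g A one)) (lin_mapN (@pic_lin K g A one)) pic_lin; apply/eqP; rewrite subr_eq0; apply/eqP.
  pose i0 := (N + size ys)%N; pose j := (i0 + size xs1)%N; pose mk := mark_at j (Tagged A u).
  pose X1 := marking i0 xs1; pose X2 := marking j.+1 xs2; pose Ys := marking N ys.
  pose al := alt K (ops ++ mks Ys ++ mks (marking i0 (xs1 ++ Tagged A u :: xs2))).
  have al0 : al != 0 by exact: alt_marking.
  pose k (y : XL) : state := if X1 ++ y :: X2 is y0 :: r then F y0 r else 0.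
  have gk : good k.
    suff gX (X : seq XL) : good (fun y => if X ++ y :: X2 is y0 :: r then F y0 r else 0) by exact: gX.
    by case: X => [|y0 r] /=; [exact: (adm_head aF) | exact: (adm_tail aF)].
  have E w1 (h : odd (size mk) == oddz (sdeg (Tagged A w1))) :
      pk k (Tagged A w1) mk Ys 0%MM [::] = al *: pic (f ys (xs1 ++ Tagged A w1 :: xs2)).
    rewrite pkE /k.
    have -> : forall s : seq XL, (0 < size s)%N -> (if s is y0 :: r then F y0 r else 0) Ys 0%MM [::] =
        alt K (ops ++ mks Ys ++ mks s) *: pic (f (er Ys) (er s)).
      by case=> // y0 r _; rewrite FE.
      rewrite er_cat /= !er_marking; congr (alt K _ *: _).
      by rewrite marking_cat !mks_cat /mks /= -?catA.
    by rewrite size_cat addnS.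
  have h := mark_at_par j (Tagged A u).
  have := good_lin gk mk Ys 0%MM [::] c u v; rewrite !E // => e.
  by apply: (scale_cancel al0); rewrite e scalerDr !scalerA mulrC.
- case: xs => [|x xs].
    by rewrite /= scaler0 subr0 (lin_map0 lL) (lin_map0 (@pic_lin K g A one)).
  rewrite (lin_mapD lL) (lin_mapN lL) (lin_mapZ lL) !linear_ext_pure.
  rewrite (lin_mapD (@pic_lin K g A one)) (lin_mapN (@pic_lin K g A one)) (lin_mapZ (@pic_lin K g A one)).
  apply/eqP; rewrite subr_eq0; apply/eqP.
  set Xs := marking (N + size (ys1 ++ a :: b :: ys2)) (x :: xs).
  pose j := (N + size ys1)%N.
  pose ma := Marked (mark_at_par j a); pose mb := Marked (mark_at_par j.+1 b).
  have nX := adm_nice aF (head (uletter one 0) Xs) (behead Xs).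
  pose Y1 := marking N ys1; pose Y2 := marking j.+2 ys2.
  pose al := alt K (ops ++ mks (marking N (ys1 ++ a :: b :: ys2)) ++ mks Xs).
  have al0 : al != 0 by exact: alt_marking.
  have := nice_sym nX Y1 ma mb Y2 0%MM [::].
  rewrite !FE /= !er_cat /= !er_marking.
  have -> : alt K (ops ++ mks (Y1 ++ ma :: mb :: Y2) ++ mks Xs) = al.
    by congr (alt K _); rewrite /al marking_cat !mks_cat /mks /= -?catA.
  have -> : alt K (ops ++ mks (Y1 ++ mb :: ma :: Y2) ++ mks Xs) =
     (-1) ^+ (size (mmk mb) * size (mmk ma)) *: (al : K^o).
    have mksE q (W : seq YL) : mks (q :: W) = mmk q ++ mks W by [].
    have -> : ops ++ mks (Y1 ++ mb :: ma :: Y2) ++ mks Xs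
       = (ops ++ mks Y1) ++ mmk mb ++ mmk ma ++ mks Y2 ++ mks Xs.
      by rewrite mks_cat !mksE -!catA.
    have E : (ops ++ mks Y1) ++ mmk ma ++ mmk mb ++ mks Y2 ++ mks Xs
       = ops ++ mks (marking N (ys1 ++ a :: b :: ys2)) ++ mks Xs.
      by rewrite marking_cat mks_cat /mks /= -!catA.
    by rewrite (alternating_swap (U := K^o) (@alt_alternating K)) E.
  move=> e; apply: (scale_cancel al0); rewrite e exprz_odd oddzM -(eqP (mark_at_par j a)) -(eqP (mark_at_par j.+1 b)).
  rewrite scalerA; congr (_ *: _).
  rewrite -[LHS]/((-1) ^+ (size (mark_at j.+1 b) * size (mark_at j a)) * al) mulrC.
  by congr (_ * _); rewrite -oddM signr_odd mulnC.
- rewrite linear_ext_pure.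
  pose i0 := (N + size ys)%N; pose X1 := marking i0 (x :: xs1); pose X2 := marking (i0 + (size xs1).+1)%N xs2.
  pose Ys := marking N ys.
  have := adm_unit aF (head (uletter one 0) X1) (behead X1) X2.
  move/(congr1 (fun v : state => v Ys 0%MM [::])); rewrite FE /= er_cat /= !er_marking => e.
  have EX : perm_eq (mks (X1 ++ uletter one c0 :: X2)) (c0 :: mks (marking i0 ((x :: xs1) ++ xs2))).
    by rewrite marking_cat !mks_cat -[mks (_ :: _)]/([:: c0] ++ mks X2) perm_catCA.
  have hi i : i \in mks (marking i0 ((x :: xs1) ++ xs2)) -> (i0 <= i)%N.
    by move/mks_marking; rewrite mem_iota => /andP[].
  have hc : (c0 < N)%N by apply: ltN; rewrite inE eqxx.
  apply: (scale_cancel _ (etrans e (esym (scaler0 _ _)))); apply: alt_fresh.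
    rewrite (perm_uniq EX) cons_uniq uniq_marking andbT; apply/negP => /hi.
    by rewrite /i0; lia.
  move=> i; rewrite (perm_mem EX) inE => /orP[/eqP ->|/hi le]; split.
  - by move: uops => /= /andP[].
  - by rewrite mem_iota negb_and -ltnNge hc.
  - apply/negP => io; have := @ltN i; rewrite inE io orbT => /(_ isT).
    by rewrite /i0 in le; lia.
  - by rewrite mem_iota negb_and -leqNgt le orbT.
Qed.
End WellDefined.

(** * Functionals represented by the formulas of the operators *)

Lemma cutp_shuf (S T : Type) (U : zmodType) k (xs : seq T) (ys : seq S)
  (H : (nat -> seq T) -> seq S -> seq S -> U) :
  cutp k xs (fun x => shuf ys (H x)) = shuf ys (fun a b => cutp k xs (fun x => H x a b)).
Proof.
elim: k xs H => [|k IH] xs H //=.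
by rewrite shuf_cut; apply: eq_cut => s r; rewrite -IH.
Qed.

Lemma cutp_conv (T : Type) n (U : zmodType) k (xs : seq T) (m : 'X_{1..n})
  (H : (nat -> seq T) -> _ -> _ -> U) :
  cutp k xs (fun x => conv m (H x)) = conv m (fun a b => cutp k xs (fun x => H x a b)).
Proof.
elim: k xs H => [|k IH] xs H //=.
by rewrite -cut_conv; apply: eq_cut => s r; rewrite -IH.
Qed.

Section Reassociation.
Variables (L : Type) (V : zmodType).
Implicit Types (xs : seq L).

Lemma cut_reassoc3 xs (G : seq L -> seq L -> seq L -> seq L -> seq L -> V) :
  cut xs (fun N R => cut N (fun M P => cut M (fun s1 p => cut p (fun s2 s3 => G s1 s2 s3 P R)))) =
  cut xs (fun s1 r => cut r (fun s2 r => cut r (fun s3 r => cut r (fun P R => G s1 s2 s3 P R)))).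
Proof.
rewrite cutA; transitivity (cut xs (fun M r => cut M (fun s1 p => cut p (fun s2 s3 =>
    cut r (fun P R => G s1 s2 s3 P R))))).
  by apply: eq_cut => M r; rewrite cutC; apply: eq_cut => s1 p; rewrite cutC.
by rewrite cutA; apply: eq_cut => s1 r; rewrite cutA.
Qed.

Lemma cut_reassoc5 xs (G : seq L -> seq L -> seq L -> seq L -> seq L -> seq L -> seq L -> V) :
  cut xs (fun N R => cut N (fun M P => cut M (fun s1 p => cut p (fun s2 p => cut p (fun s3 p =>
    cut p (fun s4 s5 => G s1 s2 s3 s4 s5 P R)))))) =
  cut xs (fun s1 r => cut r (fun s2 r => cut r (fun s3 r => cut r (fun s4 r => cut r (fun s5 r =>
    cut r (fun P R => G s1 s2 s3 s4 s5 P R)))))).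
Proof.
rewrite cutA; transitivity (cut xs (fun M r => cut M (fun s1 p => cut p (fun s2 p => cut p (fun s3 p =>
    cut p (fun s4 s5 => cut r (fun P R => G s1 s2 s3 s4 s5 P R))))))).
  apply: eq_cut => M r; rewrite cutC; apply: eq_cut => s1 p; rewrite cutC; apply: eq_cut => s2 p2.
  by rewrite cutC; apply: eq_cut => s3 p3; rewrite cutC.
rewrite cutA; apply: eq_cut => s1 r; rewrite cutA; apply: eq_cut => s2 r2.
by rewrite cutA; apply: eq_cut => s3 r3; rewrite cutA.
Qed.
End Reassociation.

Section SeveralOps.
Variables (S T : Type) (U : zmodType) (n : nat).
Implicit Types (xs : seq T) (ys p : seq S).
Local Notation mon := 'X_{1..n}.

(** Sums over closed letters, exponents and intervals are interchanged; the outer operation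
    comes first in the functional and last in the formula. *)
Lemma two_ops k xs ys (m : mon) (C : (nat -> seq T) -> seq S -> seq S -> seq S -> mon -> mon -> mon -> U) :
  cutp k xs (fun x => shuf ys (fun p z => conv m (fun e s =>
    shuf p (fun y w => conv s (fun d b => C x y w z d e b))))) =
  conv m (fun r b => conv r (fun d e => shuf ys (fun p z => shuf p (fun y w =>
    cutp k xs (fun x => C x y w z d e b))))).
Proof.
rewrite cutp_shuf; transitivity (shuf ys (fun p z => conv m (fun e s => conv s (fun d b =>
   shuf p (fun y w => cutp k xs (fun x => C x y w z d e b)))))).
  apply: eq_shuf => p z; rewrite cutp_conv; apply: eq_conv => e s; rewrite cutp_shuf -shuf_conv.
  by apply: eq_shuf => y w; rewrite cutp_conv.
rewrite shuf_conv convA conv_swap; apply: eq_conv => e s.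
rewrite shuf_conv; exact: eq_conv.
Qed.

Lemma three_ops k xs ys (m : mon)
    (C : (nat -> seq T) -> seq S -> seq S -> seq S -> seq S -> mon -> mon -> mon -> mon -> U) :
  cutp k xs (fun x => shuf ys (fun p z => conv m (fun e s => shuf p (fun p' w => conv s (fun d s' =>
    shuf p' (fun y v => conv s' (fun q b => C x y v w z q d e b))))))) =
  conv m (fun r b => conv r (fun r' e => conv r' (fun q d => shuf ys (fun p z => shuf p (fun p' w =>
    shuf p' (fun y v => cutp k xs (fun x => C x y v w z q d e b))))))).
Proof.
rewrite cutp_shuf; transitivity (shuf ys (fun p z => conv m (fun e s => conv s (fun r b => conv r (fun q d =>
   shuf p (fun p' w => shuf p' (fun y v => cutp k xs (fun x => C x y v w z q d e b)))))))).
  apply: eq_shuf => p z; rewrite cutp_conv; apply: eq_conv => e s; exact: two_ops.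
rewrite shuf_conv convA conv_swap; apply: eq_conv => e s.
rewrite shuf_conv; apply: eq_conv => r b; rewrite shuf_conv; exact: eq_conv.
Qed.
End SeveralOps.

Lemma mks_cons (K : fieldType) (V : int -> lmodType K) (y : marked V) s : mks (y :: s) = mmk y ++ mks s.
Proof. by []. Qed.
Lemma er_cons (K : fieldType) (V : int -> lmodType K) (y : marked V) s : er (y :: s) = mlet y :: er s.
Proof. by []. Qed.

Section Connections.
Variables (K : fieldType) (g A : int -> lmodType K) (n : nat) (one : A 0).
Local Notation YL := (marked g).
Local Notation XL := (marked A).
Local Notation mon := 'X_{1..n}.
Local Notation chain := (chain g one).
Local Notation state := (state g n one).
Local Notation mop := (mop g A n).
Implicit Types (Ys Z : seq YL) (m a b : mon) (mu o ops : seq nat).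
Implicit Types (Q D E : mop).
Local Notation good := (@good K g A n one).
Local Notation nice := (@nice K g A n one).
Local Notation free := (free_chain g A).
Local Notation pic := (@pic K g A one).
Local Notation opc := (@opc K g A n one).
Implicit Types (T : tseries n (chain -> chain)).
Local Notation formula := (seq (letter g) -> seq (letter A) -> free).

(** The functional of a power series of operators, with further marks [o] of operations that
    have been applied before. *)
Definition FinS o T : XL -> seq XL -> state := fun x w Ys m mu => Fin T x w Ys m (mu ++ o).

Ltac finish_marks :=
  rewrite /FinS /Fin /final /wmarks /addp /=;
  repeat (rewrite ?mks_cons ?mks_cat ?er_cons ?er_cat /=); rewrite ?cats0; repeat rewrite -?catA /=.

(** The functional [Phi] evaluates the chain-level formula [phi], with the marks [ops] of
    its operations in the order in which they occur in the word of the formula. *)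
Definition represents (Phi : (XL -> seq XL -> state) -> XL -> seq XL -> state) ops
    (phi : mon -> formula) :=
  forall T o (x0 : XL) xs Ys m mu, (forall m, lin_map (T m)) ->
    Phi (FinS o T) x0 xs Ys m mu =
    alt K ((mu ++ o) ++ ops ++ mks Ys ++ mks (x0 :: xs)) *:
      conv m (fun r b => T b (pic (phi r (er Ys) (er (x0 :: xs))))).

(** The weight absorbs the Koszul signs of a formula. *)
Lemma alt_koszul_sum (U : lmodType K) (h : free -> U) u wb t k l (x0 : XL) (xs : seq XL) Ys : lin_map h -> wok wb ->
  perm_eq (ylab wb) (iota 1 k.+1) -> perm_eq (xlab wb) (iota 1 l.+1) ->
  alt K (u ++ opmarks wb ++ mks Ys ++ mks (x0 :: xs)) *:
    h (koszul_sum k.+1 l.+1 true (er Ys) (er (x0 :: xs)) [seq bl.1 | bl <- wb] t) =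
  shufp k Ys (fun y => cutp l xs (fun x => alt K (u ++ wmarks wb y (addp 1 x0 x)) *:
    h (t (fun j => er (y j)) (fun j => er (addp 1 x0 x j))))).
Proof.
move=> lh ow yw xw; rewrite (lin_koszul_sum lh).
rewrite -(@koszul_sum_cut1 K g A U u wb (fun p x mk => alt K mk *: h (t p x))) //; last first.
  by move=> p x s i j s'; rewrite (@alt_alternating K) scaleNr.
rewrite /koszul_sum scaler_sumr; apply: eq_bigr => c _; rewrite scaler_sumr.
by apply: eq_bigr => e _; rewrite !scalerA mulrC.
Qed.

Definition L0_formula D : mon -> formula := fun r ys xs =>
  koszul_sum 2 3 true ys xs [:: Y 1; X 1; Op (odeg D); Y 2; X 2; X 3]
    (fun y x => pure (y 1%N) (x 1%N ++ cval (odeg D) (ofun D r) (y 2) (x 2) :: x 3)).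

Lemma L0_represents D : represents (L0 (opc D)) (omk D) (L0_formula D).
Proof.
move=> T o x0 xs Ys m mu lT.
have -> : L0 (opc D) (FinS o T) x0 xs Ys m mu = cutp 2 xs (fun x => shuf Ys (fun Y1 Z => conv m (fun a b =>
   FinS o T x0 (x 1%N ++ app D a Z (x 2) :: x 3) Y1 b mu))).
  rewrite /L0 /ins state_cut; apply: eq_cut => s1 r; rewrite state_cut; by apply: eq_cut => s2 s3.
rewrite cutp_shuf.
under eq_shuf => Y1 Z do rewrite cutp_conv.
rewrite shuf_conv -convZ; apply: eq_conv => a b.
pose wb : seq wblock := [:: (Y 1, [::]); (X 1, [::]); (Op (odeg D), omk D); (Y 2, [::]); (X 2, [::]); (X 3, [::])].
have := @alt_koszul_sum _ (fun v => T b (pic v)) (mu ++ o) wb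
  (fun y x => pure (y 1%N) (x 1%N ++ cval (odeg D) (ofun D a) (y 2) (x 2) :: x 3)) 1 2 x0 xs Ys.
rewrite /opmarks /= cats0 => -> //; first 1 last.
- by move=> c v w; rewrite pic_lin lT.
- by rewrite /wok /= (opar D).
apply: eq_shuf => Y1 Z; apply: eq_cut => s1 r; apply: eq_cut => s2 s3.
by finish_marks.
Qed.

Definition io_tid_formula D : mon -> formula := fun r ys xs =>
  koszul_sum 2 3 true ys xs [:: Y 1; Op (odeg D); Y 2; X 3; X 1; X 2]
    (fun y x => pure (y 1%N) (cval (odeg D) (ofun D r) (y 2) (x 3 ++ x 1%N) :: x 2)).

Lemma io_tid_represents D : represents (io (opc D) tid) (omk D) (io_tid_formula D).
Proof.
move=> T o x0 xs Ys m mu lT.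
have -> : io (opc D) tid (FinS o T) x0 xs Ys m mu = cutp 2 xs (fun x => shuf Ys (fun Y1 Z => conv m (fun a b =>
   FinS o T (app D a Z (x 3 ++ x0 :: x 1%N)) (x 2) Y1 b mu))).
  rewrite /io /rot /ioG cutA state_cut; apply: eq_cut => s1 r; rewrite state_cut; by apply: eq_cut => s2 s3.
rewrite cutp_shuf.
under eq_shuf => Y1 Z do rewrite cutp_conv.
rewrite shuf_conv -convZ; apply: eq_conv => a b.
pose wb : seq wblock := [:: (Y 1, [::]); (Op (odeg D), omk D); (Y 2, [::]); (X 3, [::]); (X 1, [::]); (X 2, [::])].
have := @alt_koszul_sum _ (fun v => T b (pic v)) (mu ++ o) wb
  (fun y x => pure (y 1%N) (cval (odeg D) (ofun D a) (y 2) (x 3 ++ x 1%N) :: x 2)) 1 2 x0 xs Ys.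
rewrite /opmarks /= cats0 => -> //; first 1 last.
- by move=> c v w; rewrite pic_lin lT.
- by rewrite /wok /= (opar D).
apply: eq_shuf => Y1 Z; apply: eq_cut => s1 r; apply: eq_cut => s2 s3.
by finish_marks.
Qed.

(** The formula of the Connes operator, whose sign is explicit instead of a Koszul sign. *)
Definition connes_formula : formula := fun ys xs =>
  \sum_(e : (size xs).-tuple 'I_2 |
        sorted leq (labels e) && (1%N \in labels e))
    let x := part (labels e) xs in
    (-1) ^ (sdegs ys + sdegs (x 1%N) * sdegs (x 2))
      *: pure ys (Tagged A one :: x 2 ++ x 1%N).

Definition ss_tid_formula : mon -> formula := fun r ys xs =>
  if r == 0%MM then connes_formula ys xs else 0.

(** The explicit sign is that of moving the mark of the unit past the closed letters and of
    exchanging the two parts of the rotated word. *)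
Lemma alt_connes (U : lmodType K) (h : free -> U) v c (x0 : XL) (xs : seq XL) Ys : lin_map h ->
  alt K (v ++ [:: c] ++ mks Ys ++ mks (x0 :: xs)) *: h (connes_formula (er Ys) (er (x0 :: xs))) =
  cut xs (fun s1 s2 => alt K (v ++ mks Ys ++ c :: mks s2 ++ mks (x0 :: s1)) *:
    h (pure (er Ys) (Tagged A one :: er s2 ++ er (x0 :: s1)))).
Proof.
move=> lh; rewrite /connes_formula (lin_map_sum lh) scaler_sumr.
pose G (p : nat -> seq XL) : U := alt K (v ++ [:: c] ++ mks Ys ++ mks (x0 :: xs)) *:
   ((-1) ^ (sdegs (er Ys) + sdegs (er (p 1%N)) * sdegs (er (p 2))) *:
     h (pure (er Ys) (Tagged A one :: er (p 2) ++ er (p 1%N)))).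
transitivity (cutp 1 xs (fun p => G (addp 1 x0 p))).
  rewrite -nonempty_cutp.
  apply: (etrans (tuple_cast (fun e : seq 'I_2 => sorted leq (labels e) && (1%N \in labels e))
    (fun e : seq 'I_2 => alt K (v ++ [:: c] ++ mks Ys ++ mks (x0 :: xs)) *:
      h ((-1) ^ (sdegs (er Ys) + sdegs (part (labels e) (er (x0 :: xs)) 1) * sdegs (part (labels e) (er (x0 :: xs)) 2)) *:
       pure (er Ys) (Tagged A one :: part (labels e) (er (x0 :: xs)) 2 ++ part (labels e) (er (x0 :: xs)) 1)))
    (size_map _ (x0 :: xs)))).
  by apply: eq_bigr => e _; rewrite (lin_mapZ lh) /G -!map_part.
apply: eq_cut_in => s1 s2 e; rewrite /G /addp /= e scalerA; congr (_ *: _).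
have -> : mks (x0 :: s1 ++ s2) = mks (x0 :: s1) ++ mks s2 by rewrite -cat_cons mks_cat.
rewrite exprz_odd oddzD oddzM -!mks_parity -[_ :: er s1]/(er (x0 :: s1)) -?mks_parity.
move: (mks Ys) (mks (x0 :: s1)) (mks s2) => y p r.
have at_ := @alt_alternating K.
have E := alternating_swap (U := K^o) at_ v [:: c] y (p ++ r).
have E' := alternating_swap (U := K^o) at_ (v ++ y ++ [:: c]) r p [::].
rewrite !cats0 -!catA /= in E E'; rewrite E E' mul1n.
set w := alt K _; rewrite -![_ *: (w : K^o)]/(_ * w) mulrAC; congr (_ * _).
by rewrite -[(-1) ^+ size y]signr_odd -signr_addb -[RHS]signr_odd oddM addbA addbb andbC.
Qed.

Lemma ss_tid_represents c : represents (ss (uletter one c) tid) [:: c] ss_tid_formula.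
Proof.
move=> T o x0 xs Ys m mu lT.
rewrite (@eq_conv n _ m _ (fun r b => if r == 0%MM then T b (pic (
   connes_formula (er Ys) (er (x0 :: xs)))) else 0)); last first.
  move=> a b; rewrite /ss_tid_formula; case: eqP => // _.
  by rewrite (lin_map0 (@pic_lin K g A one)) (lin_map0 (lT b)).
rewrite conv_0l (@alt_connes _ (fun v => T m (pic v))); last by move=> d v w; rewrite pic_lin lT.
rewrite /ss /rot state_cut; apply: eq_cut => s1 s2.
by rewrite /ssG /tid; finish_marks.
Qed.

Definition ss_ins_formula D : mon -> formula := fun r ys xs =>
  koszul_sum 2 4 true ys xs
    [:: Y 1; Op (-1); X 4; X 1; Op (odeg D); Y 2; X 2; X 3]
    (fun y x => pure (y 1%N)
      (Tagged A one :: x 4 ++ x 1%N ++ cval (odeg D) (ofun D r) (y 2) (x 2) :: x 3)).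

Lemma ss_ins_represents c D :
  represents (ss (uletter one c) (ins (opc D))) (c :: omk D) (ss_ins_formula D).
Proof.
move=> T o x0 xs Ys m mu lT.
have -> : ss (uletter one c) (ins (opc D)) (FinS o T) x0 xs Ys m mu =
   cutp 3 xs (fun x => shuf Ys (fun Y1 Z => conv m (fun a b =>
   FinS o T (uletter one c) (x 4 ++ x0 :: x 1%N ++ app D a Z (x 2) :: x 3) Y1 b mu))).
  rewrite /ss /rot /ssG /ins cutA state_cut; apply: eq_cut => s1 r'.
  by rewrite cutA state_cut; apply: eq_cut => s2 r2; rewrite state_cut; apply: eq_cut.
rewrite cutp_shuf.
under eq_shuf => Y1 Z do rewrite cutp_conv.
rewrite shuf_conv -convZ; apply: eq_conv => a b.
pose wb : seq wblock := [:: (Y 1, [::]); (Op (-1), [:: c]); (X 4, [::]); (X 1, [::]);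
   (Op (odeg D), omk D); (Y 2, [::]); (X 2, [::]); (X 3, [::])].
have := @alt_koszul_sum _ (fun v => T b (pic v)) (mu ++ o) wb
  (fun y x => pure (y 1%N) (Tagged A one :: x 4 ++ x 1%N ++ cval (odeg D) (ofun D a) (y 2) (x 2) :: x 3)) 1 3 x0 xs Ys.
rewrite /opmarks /= cats0 => -> //; first 1 last.
- by move=> d v w; rewrite pic_lin lT.
- by rewrite /wok /= (opar D).
apply: eq_shuf => Y1 Z; apply: eq_cut => s1 r; apply: eq_cut => s2 r2; apply: eq_cut => s3 s4.
by finish_marks.
Qed.

Lemma pic_conv T b r (G : mon -> mon -> free) : lin_map (T b) ->
  T b (pic (conv r G)) = conv r (fun c d => T b (pic (G c d))).
Proof.
move=> lT; have lp := @pic_lin K g A one; rewrite (@conv_morph _ _ _ pic) //; first last.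
- exact: lin_mapD.
- exact: lin_map0.
rewrite (@conv_morph _ _ _ (T b)) //; [exact: lin_map0 lT|exact: lin_mapD lT].
Qed.

Definition io_ins_term Q D c d : formula := fun ys xs =>
  koszul_sum 3 5 true ys xs
    [:: Y 1; Op (odeg Q); Y 2; X 5; X 1; Op (odeg D); Y 3; X 2; X 3; X 4]
    (fun y x => pure (y 1%N)
        (cval (odeg Q) (ofun Q c) (y 2) (x 5 ++ x 1%N ++ cval (odeg D) (ofun D d) (y 3) (x 2) :: x 3) :: x 4)).
Definition io_ins_formula Q D : mon -> formula := fun r ys xs => conv r (fun c d =>
  io_ins_term Q D c d ys xs).

Lemma io_ins_represents Q D :
  represents (io (opc Q) (ins (opc D))) (omk Q ++ omk D) (io_ins_formula Q D).
Proof.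
move=> T o x0 xs Ys m mu lT.
have -> : io (opc Q) (ins (opc D)) (FinS o T) x0 xs Ys m mu =
   cutp 4 xs (fun x => shuf Ys (fun Y' Z => conv m (fun d s => shuf Y' (fun Y1 W => conv s (fun c b =>
   FinS o T (app Q c W (x 5 ++ x0 :: x 1%N ++ app D d Z (x 2) :: x 3)) (x 4) Y1 b mu))))).
  rewrite /io /rot /ioG /ins cut_reassoc3 state_cut; apply: eq_cut => s1 r1.
  rewrite state_cut; apply: eq_cut => s2 r2; rewrite state_cut; apply: eq_cut => s3 r3.
  by rewrite state_cut; apply: eq_cut.
rewrite two_ops -convZ; apply: eq_conv => r b.
rewrite pic_conv // -convZ; apply: eq_conv => c d.
pose wb : seq wblock := [:: (Y 1, [::]); (Op (odeg Q), omk Q); (Y 2, [::]); (X 5, [::]); (X 1, [::]);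
   (Op (odeg D), omk D); (Y 3, [::]); (X 2, [::]); (X 3, [::]); (X 4, [::])].
have := @alt_koszul_sum _ (fun v => T b (pic v)) (mu ++ o) wb
  (fun y x => pure (y 1%N)
        (cval (odeg Q) (ofun Q c) (y 2) (x 5 ++ x 1%N ++ cval (odeg D) (ofun D d) (y 3) (x 2) :: x 3) :: x 4)) 2 4 x0 xs Ys.
rewrite /opmarks /= cats0 => -> //; first 1 last.
- by move=> f v w; rewrite pic_lin lT.
- by rewrite /wok /= (opar D) (opar Q).
apply: eq_shuf => Y' Z; apply: eq_shuf => Y1 W.
apply: eq_cut => s1 r1; apply: eq_cut => s2 r2; apply: eq_cut => s3 s4; apply: eq_cut => s5 s6.
by finish_marks.
Qed.

Definition ss_ins2_term D E d e : formula := fun ys xs =>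
  koszul_sum 3 6 true ys xs
    [:: Y 1; Op (-1); X 6; X 1; Op (odeg D); Y 2; X 2; X 3; Op (odeg E); Y 3; X 4; X 5]
    (fun y x => pure (y 1%N)
        (Tagged A one :: x 6 ++ x 1%N ++ cval (odeg D) (ofun D d) (y 2) (x 2) :: x 3
                            ++ cval (odeg E) (ofun E e) (y 3) (x 4) :: x 5)).
Definition ss_ins2_formula D E : mon -> formula := fun r ys xs => conv r (fun d e =>
  ss_ins2_term D E d e ys xs).

Lemma ss_ins2_represents c D E :
  represents (ss (uletter one c) (ins2 (opc D) (opc E))) (c :: omk D ++ omk E) (ss_ins2_formula D E).
Proof.
move=> T o x0 xs Ys m mu lT.
have -> : ss (uletter one c) (ins2 (opc D) (opc E)) (FinS o T) x0 xs Ys m mu =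
   cutp 5 xs (fun x => shuf Ys (fun Y' Z => conv m (fun e s => shuf Y' (fun Y1 W => conv s (fun d b =>
   FinS o T (uletter one c) (x 6 ++ x0 :: x 1%N ++ app D d W (x 2) :: x 3 ++ app E e Z (x 4) :: x 5) Y1 b mu))))).
  rewrite /ss /rot /ssG /ins2 cutA state_cut; apply: eq_cut => s1 r1.
  rewrite cutA state_cut; apply: eq_cut => s2 r2; rewrite cutA state_cut; apply: eq_cut => s3 r3.
  rewrite cutA state_cut; apply: eq_cut => s4 r4.
  by rewrite state_cut; apply: eq_cut.
rewrite two_ops -convZ; apply: eq_conv => r b.
rewrite pic_conv // -convZ; apply: eq_conv => d e.
pose wb : seq wblock := [:: (Y 1, [::]); (Op (-1), [:: c]); (X 6, [::]); (X 1, [::]);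
   (Op (odeg D), omk D); (Y 2, [::]); (X 2, [::]); (X 3, [::]); (Op (odeg E), omk E); (Y 3, [::]); (X 4, [::]); (X 5, [::])].
have := @alt_koszul_sum _ (fun v => T b (pic v)) (mu ++ o) wb
  (fun y x => pure (y 1%N)
        (Tagged A one :: x 6 ++ x 1%N ++ cval (odeg D) (ofun D d) (y 2) (x 2) :: x 3
                            ++ cval (odeg E) (ofun E e) (y 3) (x 4) :: x 5)) 2 5 x0 xs Ys.
rewrite /opmarks /= cats0 => -> //; first 1 last.
- by move=> f v w; rewrite pic_lin lT.
- by rewrite /wok /= (opar D) (opar E).
apply: eq_shuf => Y' Z; apply: eq_shuf => Y1 W.
apply: eq_cut => s1 r1; apply: eq_cut => s2 r2; apply: eq_cut => s3 r3; apply: eq_cut => s4 r4; apply: eq_cut => s5 s6.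
by finish_marks.
Qed.

Definition io_ins2_term Q D E c d e : formula := fun ys xs =>
  koszul_sum 4 7 true ys xs
      [:: Y 1; Op (odeg Q); Y 2; X 7; X 1; Op (odeg D); Y 3; X 2; X 3; Op (odeg E); Y 4; X 4; X 5; X 6]
      (fun y x => pure (y 1%N)
        (cval (odeg Q) (ofun Q c) (y 2) (x 7 ++ x 1%N ++ cval (odeg D) (ofun D d) (y 3) (x 2) :: x 3
                             ++ cval (odeg E) (ofun E e) (y 4) (x 4) :: x 5) :: x 6)).
Definition io_ins2_formula Q D E : mon -> formula := fun r ys xs => conv r (fun s e => conv s (fun c d =>
  io_ins2_term Q D E c d e ys xs)).

Lemma io_ins2_represents Q D E :
  represents (io (opc Q) (ins2 (opc D) (opc E))) (omk Q ++ omk D ++ omk E) (io_ins2_formula Q D E).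
Proof.
move=> T o x0 xs Ys m mu lT.
have -> : io (opc Q) (ins2 (opc D) (opc E)) (FinS o T) x0 xs Ys m mu =
   cutp 6 xs (fun x => shuf Ys (fun Y'' Z => conv m (fun e s => shuf Y'' (fun Y' W => conv s (fun d s' =>
   shuf Y' (fun Y1 W' => conv s' (fun c b =>
   FinS o T (app Q c W' (x 7 ++ x0 :: x 1%N ++ app D d W (x 2) :: x 3 ++ app E e Z (x 4) :: x 5)) (x 6) Y1 b mu))))))).
  rewrite /io /rot /ioG /ins2 cut_reassoc5 state_cut; apply: eq_cut => s1 r1.
  rewrite state_cut; apply: eq_cut => s2 r2; rewrite state_cut; apply: eq_cut => s3 r3.
  rewrite state_cut; apply: eq_cut => s4 r4; rewrite state_cut; apply: eq_cut => s5 r5.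
  by rewrite state_cut; apply: eq_cut.
rewrite three_ops -convZ; apply: eq_conv => r b.
rewrite pic_conv // -convZ; apply: eq_conv => s e.
rewrite pic_conv // -convZ; apply: eq_conv => c d.
pose wb : seq wblock := [:: (Y 1, [::]); (Op (odeg Q), omk Q); (Y 2, [::]); (X 7, [::]); (X 1, [::]);
   (Op (odeg D), omk D); (Y 3, [::]); (X 2, [::]); (X 3, [::]); (Op (odeg E), omk E); (Y 4, [::]); (X 4, [::]); (X 5, [::]); (X 6, [::])].
have := @alt_koszul_sum _ (fun v => T b (pic v)) (mu ++ o) wb
  (fun y x => pure (y 1%N)
        (cval (odeg Q) (ofun Q c) (y 2) (x 7 ++ x 1%N ++ cval (odeg D) (ofun D d) (y 3) (x 2) :: x 3
                             ++ cval (odeg E) (ofun E e) (y 4) (x 4) :: x 5) :: x 6)) 3 6 x0 xs Ys.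
rewrite /opmarks /= cats0 => -> //; first 1 last.
- by move=> f v w; rewrite pic_lin lT.
- by rewrite /wok /= (opar D) (opar Q) (opar E).
apply: eq_shuf => Y'' Z; apply: eq_shuf => Y' W; apply: eq_shuf => Y1 W'.
apply: eq_cut => s1 r1; apply: eq_cut => s2 r2; apply: eq_cut => s3 r3; apply: eq_cut => s4 r4; apply: eq_cut => s5 r5; apply: eq_cut => s6 s7.
by finish_marks.
Qed.
End Connections.

(** * Power series of operators *)

Fixpoint insert_mark (i : nat) (o : seq nat) : bool * seq nat :=
  if o is j :: o' then
    if (j < i)%N then let: (b, r) := insert_mark i o' in (~~ b, j :: r) else (false, i :: o)
  else (false, [:: i]).
(** Signs between concrete lists of marks are computed by sorting. *)
Fixpoint sort_marks (o : seq nat) : bool * seq nat :=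
  if o is i :: o' then let: (b, r) := sort_marks o' in
    let: (b', r') := insert_mark i r in (b (+) b', r') else (false, [::]).

Lemma alternating_insert (U : zmodType) (f : seq nat -> U) i o u w : alternating f ->
  f (u ++ (i :: o) ++ w) =
  let: (b, r) := insert_mark i o in if b then - f (u ++ r ++ w) else f (u ++ r ++ w).
Proof.
move=> af; elim: o u => [|j o IH] u //=.
case: ifP => // ji; rewrite af.
have := IH (u ++ [:: j]); rewrite -!catA /= => ->.
case: insert_mark => b r; case: b; rewrite -?catA /= ?opprK //.
Qed.

Lemma alternating_sort (U : zmodType) (f : seq nat -> U) o u w : alternating f ->
  f (u ++ o ++ w) =
  if (sort_marks o).1 then - f (u ++ (sort_marks o).2 ++ w) else f (u ++ (sort_marks o).2 ++ w).
Proof.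
move=> af; elim: o u => [|i o IH] u //=.
have := IH (u ++ [:: i]); rewrite -!catA /=; case: sort_marks => b r /= ->.
have := alternating_insert i r u w af; rewrite /=; case: insert_mark => b' r' -> /=.
by case: b; case: b'; rewrite ?opprK.
Qed.

Lemma conv_0 n (U : zmodType) (G : 'X_{1..n} -> 'X_{1..n} -> U) : conv 0%MM G = G 0%MM 0%MM.
Proof.
rewrite -(conv_0l 0%MM (fun b => G 0%MM b)); apply: eq_bigr => -[a b] /= /eqP e.
case: eqP => [-> //|[]]; apply/mnmP => i.
by have := congr1 (fun z : 'X_{1..n} => z i) e; rewrite mnmDE mnm0E; lia.
Qed.

Section Families.
Variables (K : fieldType) (g A : int -> lmodType K) (n : nat) (one : A 0).
Local Notation YL := (marked g).
Local Notation XL := (marked A).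
Local Notation mon := 'X_{1..n}.
Local Notation chain := (chain g one).
Local Notation state := (state g n one).
Local Notation mop := (mop g A n).
Local Notation good := (@good K g A n one).
Local Notation nice := (@nice K g A n one).
Local Notation free := (free_chain g A).
Local Notation pic := (@pic K g A one).
Local Notation opc := (@opc K g A n one).
Local Notation family := (tseries n (chain -> chain)).
Local Notation formula := (seq (letter g) -> seq (letter A) -> free).
Implicit Types (T S : family) (o ops : seq nat) (m : mon).
Local Notation FinS := (@FinS K g A n one).

Definition linear_family T := forall m, lin_map (T m).
(** The product of power series of operators, with [S] applied first. *)
Definition star T S : family := fun m v => conv m (fun a b => T b (S a v)).
Definition idf : family := Defs.constant id.

Lemma star_linear T S : linear_family T -> linear_family S -> linear_family (star T S).
Proof.
move=> lT lS m c v w; rewrite /star -convZ -convD; apply: eq_conv => a b.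
by rewrite lS lT.
Qed.
Lemma idf_linear : linear_family idf.
Proof.
move=> m c v w; rewrite /idf /Defs.constant; case: eqP => //= _.
by rewrite scaler0 addr0.
Qed.
Lemma star_idl S m v : star idf S m v = S m v.
Proof.
rewrite /star -[RHS](conv_0r m (fun a => S a v)).
by apply: eq_conv => a b; rewrite /idf /Defs.constant; case: eqP.
Qed.

(** The functional [Phi] is the transpose of [S]: composing functionals corresponds to
    composing operators in the opposite order. *)
Definition acts (Phi : (XL -> seq XL -> state) -> XL -> seq XL -> state) ops S :=
  forall T o, linear_family T -> Phi (FinS o T) = FinS (o ++ ops) (star T S).

Lemma acts_intro Phi ops phi S : represents Phi ops phi ->
  (forall m ys x xs, S m (pic (pure ys (x :: xs))) = pic (phi m ys (x :: xs))) ->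
  acts Phi ops S.
Proof.
move=> rP eS T o lT; apply: funext => x0; apply: funext => xs.
apply: funext => Ys; apply: funext => m; apply: funext => mu.
rewrite rP // /FinS /Fin /final -!catA; congr (_ *: _).
by rewrite /star; apply: eq_conv => a b; rewrite -eS.
Qed.

(** Admissibility of the functional is what the defining relations of chains require of
    the formula. *)
Lemma compatible_represents Phi ops phi c : represents Phi ops phi ->
  (forall F, admissible good nice (uletter one c) F -> admissible good nice (uletter one c) (Phi F)) ->
  uniq (c :: ops) -> compatible one (phi 0%MM).
Proof.
move=> rP aP u.
have l1 (m : mon) : lin_map (id : chain -> chain) by [].
apply: (@compatible_intro K g A n one _ (Phi (FinS [::] (fun=> id))) c ops).
- apply: aP; have := Fin_admissible l1 c.
  congr (admissible _ _ _ _); apply: funext => x; apply: funext => xs.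
  by apply: funext => Ys; apply: funext => m; apply: funext => mu; rewrite /FinS cats0.
- by [].
by move=> x xs Ys; rewrite rP // conv_0.
Qed.

Lemma FinS_sort o T x xs : FinS o T x xs =
  if (sort_marks o).1 then - FinS (sort_marks o).2 T x xs else FinS (sort_marks o).2 T x xs.
Proof.
have E o' Ys m mu : FinS o' T x xs Ys m mu =
   alt K (mu ++ o' ++ mks Ys ++ mks (x :: xs)) *: T m (pic (pure (er Ys) (er (x :: xs)))).
  by rewrite /FinS /Fin /final -catA.
apply: funext => Ys; apply: funext => m; apply: funext => mu; rewrite E.
rewrite (alternating_sort o mu _ (@alt_alternating K)).
case: (sort_marks o).1; rewrite -?E // scaleNr -E //.
Qed.

Lemma FinSD o T T' x xs : FinS o (fun m v => T m v + T' m v) x xs = FinS o T x xs + FinS o T' x xs.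
Proof.
apply: funext => Ys; apply: funext => m; apply: funext => mu.
by rewrite state_addE /FinS /Fin /final scalerDr.
Qed.
Lemma FinSN o T x xs : FinS o (fun m v => - T m v) x xs = - FinS o T x xs.
Proof.
apply: funext => Ys; apply: funext => m; apply: funext => mu.
by rewrite -[RHS]/(- (FinS o T x xs Ys m mu)) /FinS /Fin /final scalerN.
Qed.

(** With pairwise different marks the weight can be chosen nonzero, so the functional
    determines the operators. *)
Lemma FinS_inj o T T' : uniq o -> linear_family T -> linear_family T' ->
  (forall x xs, FinS o T x xs = FinS o T' x xs) -> forall m v, T m v = T' m v.
Proof.
move=> uo lT lT' e m; apply: chain_ind => // ys x xs.
(* marks that are fresh for [o] *)
set N := (\max_(i <- o) i).+1.
have := e (head (uletter one 0) (marking (N + size ys) (x :: xs))) (marking (N + size ys).+1 xs).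
move/(congr1 (fun f : state => f (marking N ys) m [::])).
rewrite /FinS /Fin /final /= !er_marking; apply: scale_cancel.
apply: alt_neq0.
rewrite -[Marked _ :: _]/(marking (N + size ys) (x :: xs)); set MX := marking _ (x :: xs).
have hX i : i \in mks MX -> (N + size ys <= i)%N.
  by move/mks_marking; rewrite mem_iota => /andP[].
have hY i : i \in mks (marking N ys) -> (N <= i < N + size ys)%N.
  by move/mks_marking; rewrite mem_iota.
have hN i : i \in o -> (i < N)%N by move=> io; rewrite ltnS; exact: leq_bigmax_seq.
rewrite cat_uniq uo cat_uniq !uniq_marking andbT /=; apply/andP; split.
  by apply/hasPn => i; rewrite mem_cat => /orP[/hY|/hX] h; apply/negP => /hN; lia.
by apply/hasPn => i /hX h; apply/negP => /hY; lia.
Qed.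

Lemma linear_extZ c (f : formula) w : linear_ext (fun ys xs => c *: f ys xs) w = c *: linear_ext f w.
Proof.
elim/freeg_ind_dom0: w => [|a x w _ _ IH].
  by rewrite !(lin_map0 (linear_ext_lin _)) scaler0.
rewrite !(lin_mapD (linear_ext_lin _)) IH scalerDr; congr (_ + _).
by rewrite /linear_ext !liftU !scalerA mulrC.
Qed.
Lemma linear_extD (f f' : formula) w :
  linear_ext (fun ys xs => f ys xs + f' ys xs) w = linear_ext f w + linear_ext f' w.
Proof.
elim/freeg_ind_dom0: w => [|a x w _ _ IH].
  by rewrite !(lin_map0 (linear_ext_lin _)) addr0.
rewrite !(lin_mapD (linear_ext_lin _)) IH addrACA; congr (_ + _).
by rewrite /linear_ext !liftU scalerDr.
Qed.
Lemma chain_opZ c (f : formula) v : chain_op (one := one) (fun ys xs => c *: f ys xs) v = c *: chain_op f v.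
Proof. by rewrite /chain_op linear_extZ; exact: (lin_mapZ (@pic_lin K g A one)). Qed.
Lemma chain_opD (f f' : formula) v :
  chain_op (one := one) (fun ys xs => f ys xs + f' ys xs) v = chain_op f v + chain_op f' v.
Proof. by rewrite /chain_op linear_extD; exact: (lin_mapD (@pic_lin K g A one)). Qed.
End Families.

(** * The operators of the calculus and their functionals *)

Section Actions.
Variables (K : fieldType) (g A : int -> lmodType K) (n : nat) (one : A 0).
Local Notation YL := (marked g).
Local Notation XL := (marked A).
Local Notation mon := 'X_{1..n}.
Local Notation chain := (chain g one).
Local Notation state := (state g n one).
Local Notation mop := (mop g A n).
Local Notation good := (@good K g A n one).
Local Notation nice := (@nice K g A n one).
Local Notation free := (free_chain g A).
Local Notation pic := (@pic K g A one).
Local Notation opc := (@opc K g A n one).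
Local Notation family := (tseries n (chain -> chain)).
Local Notation formula := (seq (letter g) -> seq (letter A) -> free).
Local Notation acts := (@acts K g A n one).
Local Notation chain_op := (@chain_op K g A one).
Implicit Types (T S : family) (o ops : seq nat) (m c d e : mon) (O Q D E : mop).

(** Either the unit relations of a structure up to a factor, or normalization. The second
    case covers an infinitesimal deformation in the place of q. *)
Definition unit_rule O := (exists2 kap, unit_family one kap (ofun O) & odeg O = 1 /\ size (omk O) = 1)
  \/ vanishing one (ofun O).

(** The series with all coefficients equal to the coefficient of [c]. Its constant term is
    the term of interest, and the unit relations persist with constant [kap]. *)
Definition repeated O c : mop := Mop (opar O) (fun=> ofun O c).

Lemma repeated_cochain O c : op_cochain O -> op_cochain (repeated O c).
Proof. by move=> cO m; exact: cO. Qed.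

Lemma repeated_vanishing O c : vanishing one (ofun O) -> vanishing one (ofun (repeated O c)).
Proof. by move=> vO m; exact: vO. Qed.

Lemma repeated_unit_rule O c : unit_rule O -> unit_rule (repeated O c).
Proof.
move=> [[kap [u1 u2 u3] [dO mO]]|vO]; last by right; exact: repeated_vanishing.
left; exists (fun=> kap c) => //; split=> m.
- by move=> i x; exact: u1.
- by move=> i x; exact: u2.
- by move=> ys xs1 xs2 d; exact: u3.
Qed.

Lemma unit_rule_unital O i : unit_rule O ->
  exists2 nu : state -> state, {morph nu : v w / v + w} & unital good (uletter one i) (opc O) nu.
Proof.
move=> [[kap uO [dO mO]]|vO].
  case E: (omk O) mO => [|th [|]] // _; exists (@nu K g A n one kap th i); first exact: nuD.
  exact: opc_unital.
exists (fun=> 0); [by move=> v w; rewrite addr0|exact: opc_unitless].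
Qed.

(** The series concentrated in exponent 0. In contrast with [repeated], composites of such
    series are again of this form. *)
Definition atzero O c : mop := Mop (opar O) (fun m => if m == 0%MM then ofun O c else fun _ _ _ => 0).

Lemma zero_cochain p : @is_cochain K g A p (fun _ _ _ => 0).
Proof. by split=> // *; move=> *; rewrite scaler0 ?addr0. Qed.

Lemma atzero_cochain O c : op_cochain O -> op_cochain (atzero O c).
Proof. by move=> cO m /=; case: ifP => _; [exact: cO|exact: zero_cochain]. Qed.

Lemma atzero_vanishing O c : vanishing one (ofun O) -> vanishing one (ofun (atzero O c)).
Proof. by move=> vO m /= *; case: ifP => // _; exact: vO. Qed.

(** The property of a cochain that is needed to insert it. It is stated for operations and
    not for cochains, so that it can be shown for a composite of cochains from its
    factors. *)
Definition insertable O := forall c i,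
  regular_op good nice (opc (atzero O c)) /\ unitless good (uletter one i) (opc (atzero O c)).

Lemma insertable_cochain O : op_cochain O -> vanishing one (ofun O) -> insertable O.
Proof.
move=> cO vO c i; split; first exact/opc_regular/atzero_cochain.
exact/opc_unitless/atzero_vanishing.
Qed.

Lemma fresh_mark (o : seq nat) : uniq o -> exists i, uniq (i :: o).
Proof.
move=> u; exists (\max_(i <- o) i).+1; rewrite /= u andbT; apply/negP => io.
have : ((\max_(i <- o) i).+1 <= \max_(i <- o) i)%N by exact: leq_bigmax_seq.
by rewrite ltnn.
Qed.

Lemma conv_chain_op c (f : mon -> mon -> formula) ys xs :
  (forall a b, compatible one (f a b)) ->
  conv c (fun a b => chain_op (f a b) (pic (pure ys xs))) =
  pic (conv c (fun a b => linear_ext (f a b) (pure ys xs))).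
Proof.
move=> cf; rewrite (@conv_morph _ _ _ pic); first last.
- exact: lin_mapD (@pic_lin K g A one).
- exact: lin_map0 (@pic_lin K g A one).
by apply: eq_conv => a b; rewrite chain_op_pic.
Qed.

Lemma conv_lin_family c (f : mon -> mon -> chain -> chain) :
  (forall a b, lin_map (f a b)) -> lin_map (fun v => conv c (fun a b => f a b v)).
Proof.
move=> lf s v w; rewrite -convZ -convD; apply: eq_conv => a b; exact: lf.
Qed.

Section Single.
Variable O : mop.
Hypothesis cO : op_cochain O.
Hypothesis uo : uniq (omk O).

Definition Lie_formula c : formula := fun ys xs => L0_formula O c ys xs + io_tid_formula O c ys xs.
(** Up to the sign of the definition, the operators L_D, and for q the open part of b. *)
Definition Lie : family := fun c => chain_op (Lie_formula c).

Lemma Lie_represents O' : represents (Lop (opc O')) (omk O')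
  (fun c ys xs => L0_formula O' c ys xs + io_tid_formula O' c ys xs : free) (one := one).
Proof.
move=> T o x0 xs Ys m mu lT; rewrite /Lop state_addE L0_represents // io_tid_represents //.
rewrite -scalerDr -convD; congr (_ *: _); apply: eq_conv => a b.
by rewrite (lin_mapD (@pic_lin K g A one)) (lin_mapD (lT b)).
Qed.

Hypothesis vO : unit_rule O.
Lemma Lie_compatible c : compatible one (Lie_formula c).
Proof.
have [i ui] := fresh_mark uo.
apply: (@compatible_represents K g A n one _ _ _ i (Lie_represents (repeated O c))) => // F aF.
have [nu nD uO] := unit_rule_unital i (repeated_unit_rule c vO).
apply: (Lop_admissible (@good_add _ _ _ _ _) (@nice_add _ _ _ _ _) aF _ uO nD).
exact/opc_regular/repeated_cochain.
Qed.
Lemma Lie_linear : linear_family Lie.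
Proof. by move=> c; exact/chain_op_lin/Lie_compatible. Qed.
Lemma Lie_acts : acts (Lop (opc O)) (omk O) Lie.
Proof.
apply: (acts_intro (Lie_represents O)) => c ys x xs.
by rewrite /Lie chain_op_pic ?linear_ext_pure //; exact: Lie_compatible.
Qed.
End Single.

Lemma conv_linear_ext c (f : mon -> mon -> formula) ys x xs :
  conv c (fun a b => linear_ext (f a b) (pure ys (x :: xs))) = conv c (fun a b => f a b ys (x :: xs)).
Proof. by apply: eq_conv => a b; rewrite linear_ext_pure. Qed.

Lemma zero_lin : lin_map (0 : chain -> chain).
Proof. by move=> x v w; rewrite -[LHS]/0 -[in RHS]/(x *: (0 : chain) + 0) scaler0 addr0. Qed.

Local Notation adm i := (admissible good nice (uletter one i)).
Let gA := @good_add K g A n one.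
Let nA := @nice_add K g A n one.

Section Rotation.
Definition rotation_formula : formula := connes_formula one.
Definition rotation : family := Defs.constant (chain_op rotation_formula).

Lemma rotation_compatible : compatible one rotation_formula.
Proof.
have := @compatible_represents K g A n one _ _ _ 0%N (@ss_tid_represents K g A n one 1%N).
rewrite /ss_tid_formula eqxx; apply=> // F aF.
apply: (ss_admissible gA nA aF); exact: tid_regular.
Qed.
Lemma rotation_linear : linear_family rotation.
Proof.
move=> c v w; rewrite /rotation /Defs.constant; case: ifP => _; last exact: zero_lin.
exact: (chain_op_lin rotation_compatible).
Qed.
Lemma rotation_acts i : acts (ss (uletter one i) tid) [:: i] rotation.
Proof.
apply: (acts_intro (@ss_tid_represents K g A n one i)) => c ys x xs.
rewrite /rotation /Defs.constant /ss_tid_formula; case: eqP => _.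
  by rewrite chain_op_pic ?linear_ext_pure //; exact: rotation_compatible.
exact/esym/(lin_map0 (@pic_lin K g A one)).
Qed.
End Rotation.

Section RotationInsertion.
Variable D : mop.
Hypothesis iD : insertable D.
Hypothesis uD : uniq (omk D).
(** The operators S_D up to sign. *)
Definition rotins : family := fun c => chain_op (ss_ins_formula one D c).

Lemma rotins_compatible c : compatible one (ss_ins_formula one D c).
Proof.
have [i ui] := fresh_mark uD; have [j uj] := fresh_mark ui.
have [rD vD] := iD c j.
have := @compatible_represents K g A n one _ _ _ j (@ss_ins_represents K g A n one i (atzero D c)).
rewrite /ss_ins_formula /= eqxx; apply=> // F aF.
by apply: (ss_admissible gA nA aF); apply: (ins_regular gA nA).
Qed.
Lemma rotins_linear : linear_family rotins.
Proof. by move=> c; exact/chain_op_lin/rotins_compatible. Qed.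
Lemma rotins_acts i : acts (ss (uletter one i) (ins (opc D))) (i :: omk D) rotins.
Proof.
apply: (acts_intro (@ss_ins_represents K g A n one i D)) => c ys x xs.
by rewrite /rotins chain_op_pic ?linear_ext_pure //; exact: rotins_compatible.
Qed.
End RotationInsertion.

Section Contraction.
Variables Q D : mop.
Hypothesis cQ : op_cochain Q.
Hypothesis vQ : unit_rule Q.
Hypothesis iD : insertable D.
Hypothesis uQD : uniq (omk Q ++ omk D).
(** The operators iota_D up to sign, with any cochain in the place of q. *)
Definition contraction : family := fun r v => conv r (fun c d => chain_op (io_ins_term Q D c d) v).

Lemma contraction_compatible c d : compatible one (io_ins_term Q D c d).
Proof.
have [i ui] := fresh_mark uQD.
have := @compatible_represents K g A n one _ _ _ i (@io_ins_represents K g A n one (repeated Q c) (atzero D d)).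
rewrite (_ : io_ins_formula _ _ 0 = io_ins_term Q D c d); last first.
  by apply: funext => ys; apply: funext => xs; rewrite /io_ins_formula conv_0 /io_ins_term /= eqxx.
apply=> // F aF.
have [nu nD uO] := unit_rule_unital i (repeated_unit_rule c vQ).
have [rD lD] := iD d i.
apply: (io_admissible gA nA aF _ uO).
- exact/opc_regular/repeated_cochain.
- exact: (ins_regular gA nA).
- exact: (ins_expanding rD lD).
Qed.
Lemma contraction_linear : linear_family contraction.
Proof. by move=> c; apply: conv_lin_family => a b; exact/chain_op_lin/contraction_compatible. Qed.
Lemma contraction_acts : acts (io (opc Q) (ins (opc D))) (omk Q ++ omk D) contraction.
Proof.
apply: (acts_intro (@io_ins_represents K g A n one Q D)) => c ys x xs.
rewrite /contraction conv_chain_op; last exact: contraction_compatible.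
by rewrite conv_linear_ext.
Qed.
End Contraction.

Section RotationInsertion2.
Variables D E : mop.
Hypothesis cD : op_cochain D.
Hypothesis vD : vanishing one (ofun D).
Hypothesis cE : op_cochain E.
Hypothesis vE : vanishing one (ofun E).
Hypothesis uDE : uniq (omk D ++ omk E).
(** The operators S_{D,E}. *)
Definition rotins2 : family := fun r v => conv r (fun d e => chain_op (ss_ins2_term one D E d e) v).

Lemma rotins2_compatible d e : compatible one (ss_ins2_term one D E d e).
Proof.
have [i ui] := fresh_mark uDE; have [j uj] := fresh_mark ui.
have := @compatible_represents K g A n one _ _ _ j (@ss_ins2_represents K g A n one i (repeated D d) (repeated E e)).
rewrite (_ : ss_ins2_formula _ _ _ 0 = ss_ins2_term one D E d e); last first.
  by apply: funext => ys; apply: funext => xs; rewrite /ss_ins2_formula conv_0.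
apply=> // F aF; apply: (ss_admissible gA nA aF).
apply: (ins2_regular gA nA).
- exact/opc_regular/repeated_cochain.
- exact/opc_regular/repeated_cochain.
- exact/opc_unitless/repeated_vanishing.
- exact/opc_unitless/repeated_vanishing.
Qed.
Lemma rotins2_linear : linear_family rotins2.
Proof. by move=> c; apply: conv_lin_family => a b; exact/chain_op_lin/rotins2_compatible. Qed.
Lemma rotins2_acts i : acts (ss (uletter one i) (ins2 (opc D) (opc E))) (i :: omk D ++ omk E) rotins2.
Proof.
apply: (acts_intro (@ss_ins2_represents K g A n one i D E)) => c ys x xs.
rewrite /rotins2 conv_chain_op; last exact: rotins2_compatible.
by rewrite conv_linear_ext.
Qed.
End RotationInsertion2.

Section Contraction2.
Variables Q D E : mop.
Hypothesis cQ : op_cochain Q.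
Hypothesis vQ : unit_rule Q.
Hypothesis cD : op_cochain D.
Hypothesis vD : vanishing one (ofun D).
Hypothesis cE : op_cochain E.
Hypothesis vE : vanishing one (ofun E).
Hypothesis uQDE : uniq (omk Q ++ omk D ++ omk E).
(** The operators iota_{D,E}. *)
Definition contraction2 : family := fun r v => conv r (fun s e => conv s (fun c d =>
  chain_op (io_ins2_term Q D E c d e) v)).

Lemma contraction2_compatible c d e : compatible one (io_ins2_term Q D E c d e).
Proof.
have [i ui] := fresh_mark uQDE.
have := @compatible_represents K g A n one _ _ _ i (@io_ins2_represents K g A n one (repeated Q c) (repeated D d) (repeated E e)).
rewrite (_ : io_ins2_formula _ _ _ 0 = io_ins2_term Q D E c d e); last first.
  by apply: funext => ys; apply: funext => xs; rewrite /io_ins2_formula !conv_0.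
apply=> // F aF.
have [nu nD uO] := unit_rule_unital i (repeated_unit_rule c vQ).
have rD : regular_op good nice (opc (repeated D d)) by exact/opc_regular/repeated_cochain.
have lD : unitless good (uletter one i) (opc (repeated D d)) by exact/opc_unitless/repeated_vanishing.
have rE : regular_op good nice (opc (repeated E e)) by exact/opc_regular/repeated_cochain.
have lE : unitless good (uletter one i) (opc (repeated E e)) by exact/opc_unitless/repeated_vanishing.
apply: (io_admissible gA nA aF _ uO).
- exact/opc_regular/repeated_cochain.
- exact: (ins2_regular gA nA).
- exact: (ins2_expanding gA nA rD rE lD lE).
Qed.
Lemma contraction2_linear : linear_family contraction2.
Proof.
move=> c; apply: conv_lin_family => s e; apply: conv_lin_family => a b.
exact/chain_op_lin/contraction2_compatible.
Qed.
Lemma contraction2_acts : acts (io (opc Q) (ins2 (opc D) (opc E))) (omk Q ++ omk D ++ omk E) contraction2.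
Proof.
apply: (acts_intro (@io_ins2_represents K g A n one Q D E)) => c ys x xs.
transitivity (conv c (fun s e => pic (conv s (fun a b => io_ins2_term Q D E a b e ys (x :: xs))))).
  apply: eq_conv => s e.
  rewrite conv_chain_op; last by move=> a b; exact: contraction2_compatible.
  by rewrite conv_linear_ext.
rewrite /io_ins2_formula (@conv_morph _ _ _ pic) //.
- exact: lin_map0 (@pic_lin K g A one).
- exact: lin_mapD (@pic_lin K g A one).
Qed.
End Contraction2.

Section ClosedPart.
Variables (l : brackets g) (hl : L_infinity l).
Definition bracket_formula : formula := fun ys xs => shuffle_sum ys (fun y1 y2 => pure (bval l y1 :: y2) xs).
Definition bracketing : family := Defs.constant (chain_op bracket_formula).

Lemma bracket_represents i : represents (fun F x xs => lamc (one := one) l i (F x xs)) [:: i]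
  (fun c ys xs => if c == 0%MM then bracket_formula ys xs else 0) (n := n).
Proof.
move=> T o x0 xs Ys m mu lT.
rewrite (@eq_conv n _ m _ (fun r b => if r == 0%MM then T b (pic (bracket_formula (er Ys) (er (x0 :: xs)))) else 0)); last first.
  move=> a b; case: eqP => // _.
  by rewrite (lin_map0 (@pic_lin K g A one)) (lin_map0 (lT b)).
rewrite conv_0l.
have lh : lin_map (fun v => T m (pic v)) by move=> d v w; rewrite pic_lin lT.
have E := @shuffle_sum_shuf K g A chain (fun p q mk => alt K mk *: T m (pic (pure (bval l p :: q) (er (x0 :: xs)))))
  ((mu ++ o) ++ [:: i]) (mks (x0 :: xs)) Ys.
rewrite /bracket_formula (lin_shuffle_sum lh).
transitivity (shuffle_sum (er Ys) (fun p q => alt K (((mu ++ o) ++ [:: i]) ++ mks Ys ++ mks (x0 :: xs)) *: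
    T m (pic (pure (bval l p :: q) (er (x0 :: xs)))))).
  rewrite E; last by move=> p q s a b s'; rewrite (@alt_alternating K) scaleNr.
  rewrite /lamc shufC; apply: eq_shuf => Z1 Z2.
  by rewrite /FinS /Fin /final mks_cons -!catA.
rewrite [LHS]/shuffle_sum [in RHS]/shuffle_sum scaler_sumr; apply: eq_bigr => c _.
by rewrite !scalerA mulrC -!catA.
Qed.

Lemma lamc_good i (k : XL -> state) : good k -> good (fun x => lamc (one := one) l i (k x)).
Proof.
move=> gk; apply: good_intro.
- move=> d mk Ys m mu c v w h1 h2 h3; rewrite /lamc -shufZ -shufD; apply: eq_shuf => Y1 Y2.
  by have := good_lin gk mk (bl l i Y2 :: Y1) m mu c v w; rewrite !pkE.
- move=> x l1 i' j l2 h1 h2 Ys m mu; rewrite /lamc -shufN; apply: eq_shuf => Y1 Y2.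
  by have := good_anti gk x (bl l i Y2 :: Y1) m mu l1 i' j l2; rewrite !pkE.
- move=> x i' j mk h1 h2 Ys m mu; rewrite /lamc; apply: eq_shuf => Y1 Y2.
  by have := good_pair gk x i' j mk (bl l i Y2 :: Y1) m mu; rewrite !pkE.
Qed.

Lemma bracket_compatible : compatible one bracket_formula.
Proof.
have := @compatible_represents K g A n one _ _ _ 0%N (bracket_represents 1).
rewrite eqxx; apply=> // F [a1 a2 a3 a4]; split.
- by move=> N; apply: (@lamc_good _ (F^~ N)).
- by move=> x s1 s2; exact: (@lamc_good 1%N (fun a => F x (s1 ++ a :: s2)) (a2 x s1 s2)).
- move=> x w; exact/lamc_nice.
- move=> x s1 s2; rewrite a4; exact: lam0 (lamcD _ _).
Qed.
Lemma bracketing_linear : linear_family bracketing.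
Proof.
move=> c v w; rewrite /bracketing /Defs.constant; case: ifP => _; last exact: zero_lin.
exact: (chain_op_lin bracket_compatible).
Qed.
Lemma bracketing_acts i : acts (fun F x xs => lamc (one := one) l i (F x xs)) [:: i] bracketing.
Proof.
apply: (acts_intro (bracket_represents i)) => c ys x xs.
rewrite /bracketing /Defs.constant; case: eqP => _.
  by rewrite chain_op_pic ?linear_ext_pure //; exact: bracket_compatible.
exact/esym/(lin_map0 (@pic_lin K g A one)).
Qed.
End ClosedPart.
End Actions.

(** * Insertion of a composite cochain *)

Section Dot.
Variables (L : Type) (V : zmodType).
Variables (good : (L -> V) -> Prop) (nice : V -> Prop) (u : L).
Hypothesis good_add : forall k k', good k -> good k' -> good (fun a => k a + k' a).
Hypothesis nice_add : forall v v', nice v -> nice v' -> nice (v + v').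
Variables D E : op L V.
Hypothesis rD : regular_op good nice D.
Hypothesis rE : regular_op good nice E.
Hypothesis uD : unitless good u D.
Hypothesis uE : unitless good u E.

(** Composition of operations is insertion of one into the functional of the other. *)
Lemma dot_regular : regular_op good nice (dot D E).
Proof.
split.
- by move=> s k k'; rewrite /dot -(ins_add (reg_add rE)); apply: tr_ext => t; exact: (reg_add rD).
- move=> s1 s2 k gk; apply: (reg_tr_in (ins_regular good_add nice_add rE uE)).
  by move=> t1 t2; exact: (reg_in rD).
- move=> s k gk; apply: (ins_out good_add (K := fun a t => D t (k a)) _ rE) => t.
  by apply: (reg_out rD).
- move=> s k gk nk; apply: (ins_nice nice_add _ rE); last by move=> t; exact: (reg_nice rD).
  by move=> t1 t2; exact: (reg_in rD).
Qed.

Lemma dot_unitless : unitless good u (dot D E).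
Proof.
move=> s1 s2 k gk; have -> : dot D E (s1 ++ u :: s2) k = 0.
  apply: (reg_tr_unit (ins_regular good_add nice_add rE uE)).
    by move=> t1 t2; exact: (reg_in rD).
  by move=> w1 w2; apply: unitlessE gk.
by case: s1 => [|? [|? ?]]; case: s2 => [|? [|? ?]]; rewrite ?oppr0.
Qed.

End Dot.

Section Bullet.
Variables (K : fieldType) (g A : int -> lmodType K) (n : nat) (one : A 0).
Local Notation YL := (marked g).
Local Notation XL := (marked A).
Local Notation mon := 'X_{1..n}.
Local Notation chain := (chain g one).
Local Notation state := (state g n one).
Local Notation mop := (mop g A n).
Local Notation good := (@good K g A n one).
Local Notation nice := (@nice K g A n one).
Local Notation opc := (@opc K g A n one).
Implicit Types (m c d e : mon) (O : mop).
Let gA := @good_add K g A n one.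
Let nA := @nice_add K g A n one.

Lemma good_zero : good (fun _ => 0).
Proof.
have z Ys m mu : (0 : state) Ys m mu = 0 by [].
by apply: good_intro => *; rewrite !z ?scaler0 ?addr0 ?oppr0.
Qed.
Lemma nice_zero : nice 0.
Proof.
have z Ys m mu : (0 : state) Ys m mu = 0 by [].
by apply: nice_intro => *; rewrite !z ?scaler0 ?addr0 ?oppr0.
Qed.

Lemma good_conv c (k : mon -> mon -> XL -> state) : (forall a b, good (k a b)) ->
  good (fun x => conv c (fun a b => k a b x)).
Proof.
move=> gk; rewrite /conv; elim: index_enum => [|i r IH].
  by rewrite (_ : (fun _ => _) = fun _ => 0); [exact: good_zero|apply: funext => x; rewrite big_nil].
case: (boolP (c == (i.1 + i.2)%MM)) => [e|/negPf e].
  rewrite (_ : (fun _ => _) = fun x => k i.1 i.2 x + \sum_(i <- r | c == (i.1 + i.2)%MM) k i.1 i.2 x); first exact: gA.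
  by apply: funext => x; rewrite big_cons e.
by rewrite (_ : (fun _ => _) = fun x => \sum_(i <- r | c == (i.1 + i.2)%MM) k i.1 i.2 x) //;
  apply: funext => x; rewrite big_cons e.
Qed.
Lemma nice_conv c (k : mon -> mon -> state) : (forall a b, nice (k a b)) -> nice (conv c k).
Proof.
move=> gk; rewrite /conv; elim: index_enum => [|i r IH]; first by rewrite big_nil; exact: nice_zero.
by rewrite big_cons; case: ifP => // _; exact: nA.
Qed.

Lemma state_conv c (k : mon -> mon -> state) Ys m mu :
  conv c k Ys m mu = conv c (fun a b => k a b Ys m mu).
Proof. by rewrite (@conv_morph n state chain (fun v : state => v Ys m mu)). Qed.

Lemma opc_atzero_bullet O O' c s (k : XL -> state) : op_cochain O -> good k ->
  opc (atzero (bulletm O O') c) s k = conv c (fun a b => dot (opc (atzero O a)) (opc (atzero O' b)) s k).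
Proof.
move=> cO gk; apply: funext => Ys; apply: funext => m; apply: funext => mu.
rewrite state_conv; under [RHS]eq_conv => a b do rewrite dot_bullet // /opc.
rewrite -shuf_conv; apply: eq_shuf => Y1 Z.
transitivity (conv m (fun x y => conv c (fun a b => k (app (bulletm (atzero O a) (atzero O' b)) x Z s) Y1 y mu))); last first.
  by rewrite /conv exchange_big.
apply: eq_conv => x y; rewrite pk_val /=.
under [RHS]eq_conv => a b do rewrite pk_val /=.
rewrite /cval; set d := odeg O + odeg O' + _ + _ + 1.
have lk := good_lin gk (d := d) ((omk O ++ omk O') ++ mks Z ++ mks s) Y1 y mu.
rewrite -(conv_morph (h := fun v : A d => pk k (Tagged A v) _ Y1 y mu)); first last.
- exact: (lin_mapD lk).
- exact: (lin_map0 lk).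
congr (pk k (Tagged A _) _ _ _ _).
rewrite /family_bullet.
under [RHS]eq_conv => a b.
  rewrite cauchyE; have -> : conv x (fun y z => bullet (odeg O) (odeg O') (ofun (atzero O a) y) (ofun (atzero O' b) z) (er Z) (er s) d)
    = if x == 0%MM then bullet (odeg O) (odeg O') (ofun O a) (ofun O' b) (er Z) (er s) d else 0.
    have [->|x0] := eqVneq x 0%MM; first by rewrite conv_0 /= eqxx.
    rewrite -[RHS](conv0 _ x); rewrite /conv; apply: eq_bigr => -[v w] /= /eqP e.
    rewrite /bullet; transitivity (koszul_sum 2 3 false (er Z) (er s)
      [:: Op (odeg O); Y 1; X 1; Op (odeg O'); Y 2; X 2; X 3] (fun _ _ => 0 : A d)).
      apply: eq_koszul_sum => p r; have [v0|//] := eqVneq (v : mon) 0%MM.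
      have [w0|_] := eqVneq (w : mon) 0%MM; first by move: x0; rewrite e v0 w0 addm0 eqxx.
      rewrite /cval; set i := _ + 1.
      have lm : lin_map (fun x : A i => ofun O a (p 1%N) (r 1%N ++ Tagged A x :: r 3) d).
        by move=> ? ? ?; exact: (cochain_multilinear_open (cO a)).
      exact: (lin_map0 lm).
    by rewrite /koszul_sum big1 // => ? _; rewrite big1 // => ? _; rewrite scaler0.
  over.
by case: eqP => // _; rewrite conv0.
Qed.

(** Coefficientwise, a composite is a finite sum of compositions of operations. *)
Lemma insertable_bullet O O' : op_cochain O -> vanishing one (ofun O) ->
  op_cochain O' -> vanishing one (ofun O') -> insertable one (bulletm O O').
Proof.
move=> cO vO cO' vO' c i.
have rO a : regular_op good nice (opc (atzero O a)) by exact/opc_regular/atzero_cochain.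
have rO' a : regular_op good nice (opc (atzero O' a)) by exact/opc_regular/atzero_cochain.
have uO a : unitless good (uletter one i) (opc (atzero O a)) by exact/opc_unitless/atzero_vanishing.
have uO' a : unitless good (uletter one i) (opc (atzero O' a)) by exact/opc_unitless/atzero_vanishing.
have rd a b := dot_regular gA nA (rO a) (rO' b) (uO' b).
split.
  split; [exact: opc_add| |exact: opc_out|].
  - move=> s1 s2 k gk; under eq_fun => x do rewrite opc_atzero_bullet //.
    by apply: good_conv => a b; exact: (reg_in (rd a b)).
  - move=> s k gk nk; rewrite opc_atzero_bullet //; apply: nice_conv => a b.
    exact: (reg_nice (rd a b)).
move=> s1 s2 k gk; have -> : opc (atzero (bulletm O O') c) (s1 ++ uletter one i :: s2) k = 0.
  rewrite opc_atzero_bullet // -[RHS](conv0 _ c); apply: eq_conv => a b.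
  exact: (unitlessE _ _ (dot_unitless gA nA (rO a) (rO' b) (uO a) (uO' b)) gk).
by case: s1 => [|? [|? ?]]; case: s2 => [|? [|? ?]]; rewrite ?oppr0.
Qed.
End Bullet.

(** * Homotopy identities for cochains *)

Lemma split_sub (V : zmodType) (x y z : V) : x - z = x + y - z - y.
Proof. zmod. Qed.

Section Identities.
Variables (K : fieldType) (g A : int -> lmodType K) (n : nat) (one : A 0).
Local Notation YL := (marked g).
Local Notation XL := (marked A).
Local Notation mon := 'X_{1..n}.
Local Notation chain := (chain g one).
Local Notation state := (state g n one).
Local Notation mop := (mop g A n).
Local Notation good := (@good K g A n one).
Local Notation nice := (@nice K g A n one).
Local Notation opc := (@opc K g A n one).
Local Notation family := (tseries n (chain -> chain)).
Local Notation acts := (@acts K g A n one).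
Local Notation op1 := (@op1 K g A n).
Local Notation FinS := (@FinS K g A n one).
Local Notation trans := (trans XL state).
Local Notation unit_letter := (uletter one).
Local Notation Lie := (@Lie K g A n one).
Local Notation bracketing := (@bracketing K g A n one).
Implicit Types (T S : family) (o ops : seq nat) (m : mon) (O : mop) (F : XL -> seq XL -> state) (Phi : trans).
Let gA := @good_add K g A n one.

(** Exchanging two marks reverses the sign, whatever is between them. *)
Lemma swap_far (U : zmodType) (f : seq nat -> U) u i v j w : alternating f ->
  f (u ++ i :: v ++ j :: w) = - f (u ++ j :: v ++ i :: w).
Proof.
move=> af; elim: v u => [|k v IH] u /=; first exact: af.
have := IH (rcons u k); rewrite !cat_rcons => e.
by rewrite [LHS]af e opprK [in RHS]af opprK.
Qed.

Lemma opc_opc_swap q i j s t1 t2 (k : XL -> state) : good k ->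
  opc (op1 q j) s (fun b => opc (op1 q i) (t1 ++ b :: t2) k) =
  - opc (op1 q i) s (fun b => opc (op1 q j) (t1 ++ b :: t2) k).
Proof.
move=> gk; apply: funext => Ys; apply: funext => m; apply: funext => mu.
rewrite -[RHS]/(- (opc (op1 q i) s (fun b => opc (op1 q j) (t1 ++ b :: t2) k) Ys m mu)) /opc.
rewrite -shufN; apply: eq_shuf => Y1 Y2; rewrite -convN; apply: eq_conv => a b.
rewrite -shufN; apply: eq_shuf => Y3 Y4; rewrite -convN; apply: eq_conv => c d.
rewrite !(pk_val k) /= !er_cat /= !mks_cat !mks_cons /=.
have E (x y : nat) : x :: mks Y4 ++ mks t1 ++ (y :: mks Y2 ++ mks s) ++ mks t2 =
  [::] ++ x :: (mks Y4 ++ mks t1) ++ y :: (mks Y2 ++ mks s ++ mks t2) by rewrite /= -!catA.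
rewrite !E; exact: (swap_far (f := fun mk => pk k _ mk Y3 d mu) [::] i _ j _ (good_anti gk _ _ _ _)).
Qed.

(** In a composition of two copies of q the two marks enter the list of marks of one letter,
    and exchanging the copies exchanges the marks. *)
Lemma io_swap q i j Phi F x0 xs : tr_add Phi -> (forall N, good (F^~ N)) ->
  io (opc (op1 q j)) Phi (io (opc (op1 q i)) tid F) x0 xs =
  - io (opc (op1 q i)) Phi (io (opc (op1 q j)) tid F) x0 xs.
Proof.
move=> aPhi gF; rewrite /io /rot /ioG -cutN; apply: eq_cut => N R.
rewrite -cutN; apply: eq_cut => N1 N2; rewrite -tr_N //; apply: tr_ext => w.
rewrite !op_cut; try exact: opc_add.
rewrite -cutN; apply: eq_cut => N' R'; rewrite !op_cut; try exact: opc_add.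
rewrite -cutN; apply: eq_cut => M1 M2; exact/opc_opc_swap.
Qed.

Lemma io_fadd Q Phi F F' x0 xs : op_add Q -> tr_add Phi ->
  io Q Phi (fun b N => F b N - F' b N) x0 xs = io Q Phi F x0 xs - io Q Phi F' x0 xs.
Proof.
move=> aQ aPhi; rewrite /io /rot /ioG -cutN -cutD; apply: eq_cut => N R.
rewrite -cutN -cutD; apply: eq_cut => N1 N2; rewrite -tr_N // -aPhi; apply: tr_ext => w.
apply: (addIr (Q (R ++ x0 :: w) (fun b => F' b N2))); rewrite subrK -aQ.
by apply: op_ext => b; rewrite subrK.
Qed.

(** The unit of a family of structures is constant, so the factor is the constant 1. *)
Definition kap0 : tseries n K := fun m => (m == 0%MM)%:R.
Lemma nu_FinS i j o T x xs : nu kap0 i j (FinS o T x xs) = FinS ([:: i; j] ++ o) T x xs.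
Proof.
apply: funext => Ys; apply: funext => m; apply: funext => mu.
rewrite /nu /kap0; transitivity (conv m (fun a b => if a == 0%MM then FinS o T x xs Ys b (mu ++ [:: i; j]) else 0)).
  by apply: eq_conv => a b; case: eqP; rewrite ?scale1r ?scale0r.
by rewrite conv_0l /FinS -catA.
Qed.

Lemma nu_opc kap i j O s (k : XL -> state) : nu kap i j (opc O s k) = opc O s (fun a => nu kap i j (k a)).
Proof.
apply: funext => Ys; apply: funext => m; apply: funext => mu.
rewrite /nu /opc; under eq_conv => a b do rewrite -shufZ.
rewrite -shuf_conv; apply: eq_shuf => Y1 Y2.
under eq_conv => a b do rewrite -convZ.
by rewrite conv_swap.
Qed.

(** The second operator sees the unit inserted by the first one inside the word, where
    normalized functionals vanish. *)
Lemma ss_ss_0 c c' Phi Phi' F x0 xs : tr_add Phi -> tr_add Phi' -> normalized (unit_letter c) F ->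
  ss (unit_letter c) Phi (ss (unit_letter c') Phi' F) x0 xs = 0.
Proof.
move=> aP aP' nF; rewrite /ss /rot -[RHS](cut0 _ xs); apply: eq_cut => N R.
rewrite /ssG -[RHS](tr_0 N aP); apply: tr_ext => w.
rewrite -[RHS](cut0 _ (R ++ x0 :: w)); apply: eq_cut => M M'.
rewrite -[RHS](tr_0 M aP'); apply: tr_ext => v; exact: nF.
Qed.

Variables (l : brackets g) (hl : L_infinity l).
Variable q : tseries n (cochain g A).
Hypothesis cq : forall m, is_cochain 1 (q m).
Hypothesis uq : unit_family one kap0 q.
Hypothesis relq : forall m ys xs d,
  shuffle_sum ys (fun y1 y2 => q m (bval l y1 :: y2) xs d) = family_bullet 1 1 q q m ys xs d.
Local Notation P := (opc (op1 q 0)).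
Local Notation Q := (opc (op1 q 1)).
Local Notation lam := (@lamc K g A n one l 0).
Local Notation nu0 := (@nu K g A n one kap0 0 2).
Local Notation u := (unit_letter 2).
Local Notation bt := (bdual P lam).

Lemma lawful_opc O k i j kap : op_cochain O -> lawful good (opc (op1 q k)) (nu kap i j) (opc O).
Proof.
move=> cO; split.
- exact: opc_add.
- exact: opc_in.
- exact: opc_out.
- by move=> s f; exact: nu_opc.
- exact: opc_exch.
Qed.

Lemma uP : unital good u P nu0.
Proof. exact: opc_unital. Qed.

Lemma q_unit_rule i : unit_rule one (op1 q i).
Proof. by left; exists kap0. Qed.

Lemma cq1 i : op_cochain (op1 q i).
Proof. exact: cq. Qed.

(** The operators b. *)
Definition hoch : family := fun m v => Lie (op1 q 0) m v - bracketing l m v.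
Lemma hoch_linear : linear_family hoch.
Proof.
move=> m c v w; rewrite /hoch (Lie_linear (cq1 0) isT (q_unit_rule 0)).
rewrite (bracketing_linear hl) scalerBr opprD; exact: addrACA.
Qed.
Lemma bt_acts : acts bt [:: 0%N] hoch.
Proof.
move=> T o lT; apply: funext => x; apply: funext => xs; rewrite /bdual.
have -> : Lop P (FinS o T) = FinS (o ++ [:: 0%N]) (star T (Lie (op1 q 0))).
  exact: (Lie_acts (cq1 0) isT (q_unit_rule 0) o lT).
have -> : lam (FinS o T x xs) = FinS (o ++ [:: 0%N]) (star T (bracketing l)) x xs.
  exact: (congr1 (fun F => F x xs) (bracketing_acts hl 0 o lT)).
rewrite -FinSN -FinSD; congr (FinS _ _ _ _); apply: funext => m; apply: funext => v.
rewrite /star -convN -convD; apply: eq_conv => a b.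
by rewrite -(lin_mapN (lT b)) -(lin_mapD (lT b)).
Qed.

Lemma bt_split F b N : L0 P F b N - lam (F b N) = bt F b N - io P tid F b N.
Proof. exact: split_sub. Qed.

Lemma bt_splitE F : (fun b N => L0 P F b N - lam (F b N)) = (fun b N => bt F b N - io P tid F b N).
Proof. by apply: funext => b; apply: funext => N; exact: bt_split. Qed.

Let lamD : {morph lam : v w / v + w}.
Proof. exact: lamcD. Qed.
Let nuD0 : {morph nu0 : v w / v + w}.
Proof. exact: nuD. Qed.
Let lP : lawful good P nu0 P.
Proof. exact: lawful_opc. Qed.
Let lQ : lawful good P nu0 Q.
Proof. exact: lawful_opc. Qed.
Let dQ : deriv lam Q (opl l 0 (op1 q 1)).
Proof. exact: deriv_opl. Qed.
Let fQ s k : good k -> dot Q P s k = opl l 0 (op1 q 1) s k.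
Proof. by move=> gk; exact: flat_q. Qed.

(** The two terms with two copies of q cancel: [io_swap]. *)
Lemma bt_io_exchange Phi F x xs : tr_add Phi -> (forall N, good (F^~ N)) ->
  io Q Phi (fun b N => L0 P F b N - lam (F b N)) x xs - io P Phi (io Q tid F) x xs = io Q Phi (bt F) x xs.
Proof.
move=> aPhi gF; rewrite bt_splitE io_fadd //; last exact: opc_add.
by rewrite io_swap // opprK addrK.
Qed.

(** Normalized cochains that satisfy the first derivative of the structure relation. *)
Definition infinitesimal (D : tseries n (cochain g A)) := [/\ forall m, is_cochain 1 (D m), vanishing one D &
  forall m ys xs d, shuffle_sum ys (fun y1 y2 => D m (bval l y1 :: y2) xs d) =
  family_bullet 1 1 D q m ys xs d + family_bullet 1 1 q D m ys xs d].

Section OneCochain.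
Variables (D : tseries n (cochain g A)) (i : nat).
Hypothesis hD : infinitesimal D.
Local Notation oD := (op1 D i).
Local Notation Dop := (opc oD).

Lemma infinitesimal_cochain : op_cochain oD. Proof. by case: hD. Qed.
Let cD := infinitesimal_cochain.
Lemma infinitesimal_vanishing : vanishing one (ofun oD). Proof. by case: hD. Qed.
Let vD := infinitesimal_vanishing.
Lemma infinitesimal_lawful : lawful good P nu0 Dop. Proof. exact: lawful_opc. Qed.
Let lD := infinitesimal_lawful.
Lemma infinitesimal_deriv : deriv lam Dop (opl l 0 oD). Proof. exact: deriv_opl. Qed.
Let dD := infinitesimal_deriv.
Lemma infinitesimal_closed : closed good P Dop (opl l 0 oD).
Proof. by apply: closed_D; case: hD. Qed.
Let cdD := infinitesimal_closed.
Lemma infinitesimal_unit_rule : unit_rule one oD. Proof. by right. Qed.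
Lemma infinitesimal_insertable : insertable one oD. Proof. exact: insertable_cochain. Qed.

Lemma hoch_contraction F x xs : (forall N, good (F^~ N)) ->
  bt (io Q (ins Dop) F) x xs = io Q (ins Dop) (bt F) x xs.
Proof.
move=> gF; rewrite (bt_io_ins lamD lP x xs lQ dQ fQ lD cdD dD gF).
exact/bt_io_exchange/gF/ins_add/opc_add.
Qed.

Lemma hoch_rotins F x xs : (forall N, good (F^~ N)) -> wgood good (F u) ->
  bt (ss u (ins Dop) F) x xs = ss u (ins Dop) (bt F) x xs
   - io P (ins Dop) (ss u tid F) x xs - nu0 (Lop Dop F x xs) + ss u tid (io P (ins Dop) F) x xs.
Proof. by move=> gF gu; exact: (bt_ss_ins lamD nuD0 lP uP x xs lD cdD dD gF gu). Qed.

Lemma hoch_Lie F x xs : (forall y, wgood good (F y)) -> (forall N, good (F^~ N)) ->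
  bt (Lop Dop F) x xs = Lop Dop (bt F) x xs.
Proof. by move=> gx gF; exact: (bt_Lop lamD lP x xs lD cdD dD gx gF). Qed.

(** This is the telescoping argument for the Connes operator, with D in the place of q and
    without unit relation. *)
Lemma rotation_Lie F x xs : (forall N, good (F^~ N)) -> wgood good (F u) ->
  Lop Dop (ss u tid F) x xs = ss u tid (Lop Dop F) x xs.
Proof.
(* D satisfies the unit relations with factor 0 *)
pose z (v : state) : state := 0; move=> gF gu.
have zD : {morph z : v w / v + w} by move=> v w; rewrite /z addr0.
have lz : lawful good Dop z Dop.
  case: lD => a1 a2 a3 _ _; split=> //; last exact: opc_exch.
  by move=> s k; rewrite op_0 //; exact: opc_add.
have := bt_ss_tid zD zD lz (opc_unitless 2 vD) x xs gF gu.
have btE H y ys : bdual Dop z H y ys = Lop Dop H y ys by rewrite /bdual /z subr0.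
by rewrite btE => ->; congr (ss u tid _ x xs); apply: funext => y; apply: funext => ys; exact: btE.
Qed.
End OneCochain.

Section TwoCochains.
Variables (D E : tseries n (cochain g A)) (i j : nat).
Hypothesis hD : infinitesimal D.
Hypothesis hE : infinitesimal E.
Local Notation Dop := (opc (op1 D i)).
Local Notation Eop := (opc (op1 E j)).
Local Notation DE := (tcomp (ins Eop) (ins Dop)).
Let xDE : exch Dop Eop := @opc_exch K g A n one (op1 D i) (op1 E j).
Let lD := infinitesimal_lawful i hD.
Let lE := infinitesimal_lawful j hE.
Let cD := infinitesimal_closed i hD.
Let cE := infinitesimal_closed j hE.
Let dD := infinitesimal_deriv D i.
Let dE := infinitesimal_deriv E j.

Lemma DE_add : tr_add DE.
Proof. exact: (comp_add lD lE). Qed.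

Lemma hoch_iota2 F x xs : (forall N, good (F^~ N)) ->
  bt (io Q DE F) x xs = io Q DE (bt F) x xs
  - io P (ins Dop) (io Q (ins Eop) F) x xs - io P (ins Eop) (io Q (ins Dop) F) x xs.
Proof.
move=> gF; rewrite (bt_io_comp gA lamD lP lD cD dD lE cE dE xDE x xs lQ dQ fQ gF).
by congr (_ - _ - _); exact: (bt_io_exchange x xs DE_add gF).
Qed.

Lemma hoch_rotins2 F x xs : (forall N, good (F^~ N)) -> wgood good (F u) ->
  bt (ss u DE F) x xs = ss u DE (bt F) x xs
  - io P DE (ss u tid F) x xs - io P (ins Dop) (ss u (ins Eop) F) x xs
  - io P (ins Eop) (ss u (ins Dop) F) x xs
  - nu0 (Lop Eop (Lop Dop F) x xs + io Dop (ins Eop) F x xs + io Eop (ins Dop) F x xs)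
  + ss u (ins Eop) (io P (ins Dop) F) x xs + ss u (ins Dop) (io P (ins Eop) F) x xs
  + ss u tid (io P DE F) x xs.
Proof. by move=> gF gu; exact: (bt_ss_comp gA lamD nuD0 lP uP lD cD dD lE cE dE xDE x xs gF gu). Qed.
End TwoCochains.
End Identities.

(** * Homotopy identities for power series of operators *)

Lemma arrange_rotins (V : zmodType) (sb bs Bi iB L : V) :
  sb = bs - - Bi - L + - iB -> bs - sb + (Bi - iB) = L.
Proof. by move=> ->; zmod. Qed.

Lemma arrange_iota2 (V : zmodType) (a b c d : V) :
  - a = b - - c - d -> b + a = d + - c.
Proof. by move=> e; rewrite -[a]opprK e; zmod. Qed.

Lemma arrange_rotins2 (V : zmodType) (sb bs Bi iB sEiD sDiE LL DE ED iDsE iEsD : V) :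
  - sb = bs - - Bi - - sEiD - sDiE - (LL + DE + - ED) + - iDsE + iEsD + iB ->
  bs + sb + (Bi + iB) = sDiE + - sEiD + (iDsE + - iEsD) + LL + (DE + - ED).
Proof. by move=> e; rewrite -[sb]opprK e; zmod. Qed.

Section Theorems.
Variables (K : fieldType) (g A : int -> lmodType K) (n : nat) (one : A 0).
Local Notation YL := (marked g).
Local Notation XL := (marked A).
Local Notation mon := 'X_{1..n}.
Local Notation chain := (chain g one).
Local Notation state := (state g n one).
Local Notation mop := (mop g A n).
Local Notation good := (@good K g A n one).
Local Notation nice := (@nice K g A n one).
Local Notation opc := (@opc K g A n one).
Local Notation family := (tseries n (chain -> chain)).
Local Notation acts := (@acts K g A n one).
Local Notation op1 := (@op1 K g A n).
Local Notation FinS := (@FinS K g A n one).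
Local Notation trans := (trans XL state).
Local Notation unit_letter := (uletter one).
Local Notation Lie := (@Lie K g A n one).
Local Notation idf := (@idf K g A n one).
Local Notation pic := (@pic K g A one).
Implicit Types (T S : family) (o ops : seq nat) (m : mon) (O : mop) (F : XL -> seq XL -> state).
Let gA := @good_add K g A n one.
Local Notation cfam := (tseries n (cochain g A)).

(** Evaluation on a word is linear in each letter by the relations of chains. *)
Lemma FinS_good o T N : linear_family T -> good (fun x => FinS o T x N).
Proof.
move=> lT; apply: good_intro.
- move=> d mk Ys m mu c v w h1 h2 h3; rewrite /FinS /Fin /final !mks_cons !er_cons /=.
  rewrite scalerA mulrC -scalerA -scalerDr -lT -pic_lin; congr (_ *: T m _).
  by apply: pic_eq; exact: (chain_rel_open one (er Ys) [::]).
- move=> x l1 i j l2 h1 h2 Ys m mu; rewrite /FinS /Fin /final !er_cons /= -scaleNr; congr (_ *: _).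
  have E q : (mu ++ o) ++ mks Ys ++ mks (q :: N) = ((mu ++ o) ++ mks Ys) ++ mmk q ++ mks N.
    by rewrite mks_cons -!catA.
  rewrite !E /=; exact: (alternating_pad _ _ (@alt_alternating K)).
- move=> x i j mk h1 h2 Ys m mu; rewrite /FinS /Fin /final !er_cons /=; congr (_ *: _).
  have E v q : (v ++ o) ++ mks Ys ++ mks (q :: N) = v ++ (o ++ mks Ys) ++ mmk q ++ mks N.
    by rewrite mks_cons -!catA.
  rewrite !E /= -[in RHS]catA /=.
  exact: (alternating_pair (U := K^o) (@alt_alternating K)).
Qed.

Lemma FinS_wgood o x T : linear_family T -> wgood good (FinS o T x).
Proof.
move=> lT s1 s2; apply: good_intro.
- move=> d mk Ys m mu c v w h1 h2 h3; rewrite /FinS /Fin /final !mks_cons !mks_cat !mks_cons !er_cons !er_cat !er_cons /=.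
  rewrite scalerA mulrC -scalerA -scalerDr -lT -pic_lin; congr (_ *: T m _).
  by apply: pic_eq; exact: (chain_rel_open one (er Ys) (mlet x :: er s1)).
- move=> y l1 i j l2 h1 h2 Ys m mu; rewrite /FinS /Fin /final !er_cons !er_cat !er_cons /= -scaleNr; congr (_ *: _).
  have E q : (mu ++ o) ++ mks Ys ++ mks (x :: s1 ++ q :: s2) = ((mu ++ o) ++ mks Ys ++ mks (x :: s1)) ++ mmk q ++ mks s2.
    by rewrite !mks_cons mks_cat mks_cons -!catA.
  rewrite !E /=; exact: (alternating_pad _ _ (@alt_alternating K)).
- move=> y i j mk h1 h2 Ys m mu; rewrite /FinS /Fin /final !er_cons !er_cat !er_cons /=; congr (_ *: _).
  have E v q : (v ++ o) ++ mks Ys ++ mks (x :: s1 ++ q :: s2) = v ++ (o ++ mks Ys ++ mks (x :: s1)) ++ mmk q ++ mks s2.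
    by rewrite !mks_cons mks_cat mks_cons -!catA.
  rewrite !E /= -[in RHS]catA /=.
  exact: (alternating_pair (U := K^o) (@alt_alternating K)).
Qed.

Lemma FinS_swap o i j k T x xs : FinS (o ++ [:: i; j; k]) T x xs = - FinS (o ++ [:: i; k; j]) T x xs.
Proof.
apply: funext => Ys; apply: funext => m; apply: funext => mu.
rewrite -[RHS]/(- (FinS (o ++ [:: i; k; j]) T x xs Ys m mu)) /FinS /Fin /final.
rewrite -scaleNr; congr (_ *: _).
have E1 p r w : (mu ++ (o ++ [:: i; p; r])) ++ w = (mu ++ o ++ [:: i]) ++ p :: r :: w by rewrite -!catA.
rewrite !E1; exact: (@alt_alternating K).
Qed.

Lemma star_idE S : star idf S = S.
Proof. by apply: funext => m; apply: funext => v; exact: star_idl. Qed.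

Lemma linear_add T S : linear_family T -> linear_family S -> linear_family (fun m v => T m v + S m v).
Proof. by move=> lT lS m c v w; rewrite lT lS scalerDr; exact: addrACA. Qed.
Lemma linear_opp T : linear_family T -> linear_family (fun m v => - T m v).
Proof. by move=> lT m c v w; rewrite lT scalerN opprD. Qed.

Lemma starDr T S S' m v : linear_family T ->
  star T (fun m v => S m v + S' m v) m v = star T S m v + star T S' m v.
Proof. by move=> lT; rewrite /star -convD; apply: eq_conv => a b; rewrite (lin_mapD (lT b)). Qed.
Lemma starNr T S m v : linear_family T -> star T (fun m v => - S m v) m v = - star T S m v.
Proof. by move=> lT; rewrite /star -convN; apply: eq_conv => a b; rewrite (lin_mapN (lT b)). Qed.

Variables (l : brackets g) (hl : L_infinity l).
Variable q : cfam.
Hypothesis cq : forall m, is_cochain 1 (q m).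
Hypothesis uq : unit_family one (@kap0 K n) q.
Hypothesis relq : forall m ys xs d,
  shuffle_sum ys (fun y1 y2 => q m (bval l y1 :: y2) xs d) = family_bullet 1 1 q q m ys xs d.
Local Notation P := (opc (op1 q 0)).
Local Notation Q := (opc (op1 q 1)).
Local Notation lam := (@lamc K g A n one l 0).
Local Notation nu0 := (@nu K g A n one (@kap0 K n) 0 2).
Local Notation u := (unit_letter 2).
Local Notation bt := (bdual P lam).
Local Notation F0 := (FinS [::] idf).
Local Notation infinitesimal := (@infinitesimal K g A n one l q).

Lemma F0E : F0 = Fin idf.
Proof.
apply: funext => x; apply: funext => xs; apply: funext => Ys; apply: funext => m; apply: funext => mu.
by rewrite /FinS cats0.
Qed.
Lemma F0_admissible c : admissible good nice (unit_letter c) F0.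
Proof. by rewrite F0E; apply: Fin_admissible; exact: idf_linear. Qed.

Definition hochF : family := @hoch K g A n one l q.
Definition rotF : family := @rotation K g A n one.
Definition iotaF (p : cfam) (D : cfam) : family := @contraction K g A n one (op1 p 0) (op1 D 0).
Definition rotinsF (D : cfam) : family := @rotins K g A n one (op1 D 0).
Definition LieF (D : cfam) : family := Lie (op1 D 0).
Definition iota2F (D E : cfam) : family := @contraction2 K g A n one (op1 q 0) (op1 D 0) (op1 E 0).
Definition rotins2F (D E : cfam) : family := @rotins2 K g A n one (op1 D 0) (op1 E 0).
Definition iota_bulletF (D E : cfam) : family :=
  @contraction K g A n one (op1 q 0) (bulletm (op1 D 0) (op1 E 0)).
Definition rotins_bulletF (D E : cfam) : family := @rotins K g A n one (bulletm (op1 D 0) (op1 E 0)).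
(** The contraction part of sigma. The sign of the second summand comes from the order of
    the marks of D and E. *)
Definition iota_compF (D E : cfam) : family := fun m v =>
  iota2F D E m v - iota2F E D m v + iota_bulletF D E m v.
Definition rotins_compF (D E : cfam) : family := fun m v =>
  rotins2F D E m v - rotins2F E D m v + rotins_bulletF D E m v.

Lemma hochF_acts : acts bt [:: 0%N] hochF.
Proof. exact: bt_acts. Qed.
Lemma hochF_linear : linear_family hochF.
Proof. exact: hoch_linear. Qed.
Lemma rotF_acts i : acts (ss (unit_letter i) tid) [:: i] rotF.
Proof. exact: rotation_acts. Qed.
Lemma rotF_linear : linear_family rotF.
Proof. exact: rotation_linear. Qed.

Section Acts1.
Variables (D : cfam) (hD : infinitesimal D).
Lemma iotaF_acts i j : i != j -> acts (io (opc (op1 q i)) (ins (opc (op1 D j)))) [:: i; j] (iotaF q D).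
Proof.
move=> ij; apply: contraction_acts => //.
- exact: q_unit_rule.
- exact: infinitesimal_insertable hD.
- by rewrite /= inE ij.
Qed.
Lemma iotaF_linear : linear_family (iotaF q D).
Proof.
apply: (@contraction_linear K g A n one (op1 q 0) (op1 D 1)) => //; first exact: q_unit_rule.
exact: infinitesimal_insertable hD.
Qed.
Lemma rotinsF_acts i j : acts (ss (unit_letter i) (ins (opc (op1 D j)))) [:: i; j] (rotinsF D).
Proof. by apply: rotins_acts => //; exact: infinitesimal_insertable hD. Qed.
Lemma rotinsF_linear : linear_family (rotinsF D).
Proof. by apply: rotins_linear => //; exact: infinitesimal_insertable hD. Qed.
Lemma LieF_acts i : acts (Lop (opc (op1 D i))) [:: i] (LieF D).
Proof. by apply: Lie_acts => //; [exact: infinitesimal_cochain hD|exact: infinitesimal_unit_rule hD]. Qed.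
Lemma LieF_linear : linear_family (LieF D).
Proof. by apply: Lie_linear => //; [exact: infinitesimal_cochain hD|exact: infinitesimal_unit_rule hD]. Qed.
End Acts1.

Lemma FinS_eq o T T' : linear_family T -> linear_family T' -> uniq o ->
  (forall x xs, FinS o T x xs = FinS o T' x xs) -> forall m v, T m v = T' m v.
Proof. by move=> lT lT' uo; exact: FinS_inj. Qed.

Ltac linfam := repeat first [assumption | apply: star_linear | apply: linear_opp | apply: linear_add].

Section One.
Variables (D : cfam) (hD : infinitesimal D).
Let gF0 N : good (F0^~ N).
Proof. exact: (adm_head (F0_admissible 0)). Qed.
Let gF0' x : wgood good (F0 x).
Proof. exact: (adm_tail (F0_admissible 0)). Qed.
Let l0 := @idf_linear K g A n one.

Lemma iota_hoch m v : star hochF (iotaF q D) m v = star (iotaF q D) hochF m v.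
Proof.
have aI : acts (io Q (ins (opc (op1 D 3)))) [:: 1; 3]%N (iotaF q D) by exact: iotaF_acts.
have lI := iotaF_linear hD; have lb := hochF_linear.
apply: (@FinS_eq [:: 0; 1; 3]%N) => [|||x xs] //; [linfam|linfam|].
have := hoch_contraction cq relq 3 hD x xs gF0.
rewrite aI // hochF_acts ?hochF_acts ?star_idE // aI //.
by rewrite FinS_sort /= => ->.
Qed.

(** The sign is the one for exchanging the marks of q and D. *)
Lemma Lie_hoch m v : star hochF (LieF D) m v = - star (LieF D) hochF m v.
Proof.
have aL : acts (Lop (opc (op1 D 3))) [:: 3]%N (LieF D) by exact: LieF_acts.
have lL := LieF_linear hD; have lb := hochF_linear.
apply: (@FinS_eq [:: 0; 3]%N (star _ _) (fun m v => - star _ _ m v)) => [|||x xs] //; [linfam|linfam|].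
have := hoch_Lie cq 3 hD x xs gF0' gF0.
rewrite aL // hochF_acts ?hochF_acts ?star_idE // aL // FinSN.
by rewrite FinS_sort /= => <-.
Qed.

Lemma Lie_rot m v : star rotF (LieF D) m v = - star (LieF D) rotF m v.
Proof.
have aL : acts (Lop (opc (op1 D 3))) [:: 3]%N (LieF D) by exact: LieF_acts.
have lL := LieF_linear hD; have lb := rotF_linear.
apply: (@FinS_eq [:: 2; 3]%N (star _ _) (fun m v => - star _ _ m v)) => [|||x xs] //; [linfam|linfam|].
have := rotation_Lie 3 hD x xs gF0 (gF0' _).
rewrite aL // rotF_acts ?rotF_acts ?star_idE // aL // FinSN => ->.
by rewrite FinS_sort.
Qed.

(** The Cartan homotopy formula. *)
Lemma hoch_rotinsF m v : star hochF (rotinsF D) m v - star (rotinsF D) hochF m v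
  + (star rotF (iotaF q D) m v - star (iotaF q D) rotF m v) = LieF D m v.
Proof.
have aI : acts (io P (ins (opc (op1 D 3)))) [:: 0; 3]%N (iotaF q D) by exact: iotaF_acts.
have aS : acts (ss u (ins (opc (op1 D 3)))) [:: 2; 3]%N (rotinsF D) by exact: rotinsF_acts.
have aL : acts (Lop (opc (op1 D 3))) [:: 3]%N (LieF D) by exact: LieF_acts.
have lI := iotaF_linear hD; have lb := hochF_linear; have lS := rotinsF_linear hD.
have lL := LieF_linear hD; have lB := rotF_linear.
apply: (@FinS_eq [:: 0; 2; 3]%N (fun m v => star hochF (rotinsF D) m v + - star (rotinsF D) hochF m v
  + (star rotF (iotaF q D) m v + - star (iotaF q D) rotF m v)) (LieF D)) => [|||x xs] //; first by linfam.
have := hoch_rotins cq uq 3 hD x xs gF0 (gF0' _).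
rewrite aS // hochF_acts ?hochF_acts ?star_idE // aS // rotF_acts // aI ?star_idE // aI ?star_idE // rotF_acts ?star_idE // aL //.
rewrite nu_FinS star_idE.
rewrite FinS_sort /= (FinS_sort [:: 2; 0; 3]%N) /= (FinS_sort [:: 0; 3; 2]%N) /=.
rewrite !FinSD !FinSN.
exact: arrange_rotins.
Qed.
End One.

Lemma acts_zero Phi Phi' o1 o2 S S' : acts Phi o1 S -> acts Phi' o2 S' ->
  linear_family S -> linear_family S' -> uniq (o1 ++ o2) ->
  (forall x xs, Phi' (Phi F0) x xs = 0) -> forall m v, star S S' m v = 0.
Proof.
move=> aS aS' lS lS' uo z m v.
have l0 := @idf_linear K g A n one.
have lz : linear_family ((fun _ _ => 0) : family) by move=> ? c w w'; rewrite scaler0 addr0.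
have E := @FinS_eq (o1 ++ o2) (star S S') (fun _ _ => 0) (star_linear lS lS') lz uo.
apply: E => x xs.
have := z x xs; rewrite aS // aS' ?star_idE // => ->.
apply: funext => Ys; apply: funext => m'; apply: funext => mu.
by rewrite /FinS /Fin /final scaler0.
Qed.

Lemma F0_normalized : normalized u F0.
Proof. exact: (adm_unit (F0_admissible 2)). Qed.

Section Two.
Variables (D E : cfam) (hD : infinitesimal D) (hE : infinitesimal E).
Local Notation Dop := (opc (op1 D 3)).
Local Notation Eop := (opc (op1 E 4)).
Local Notation DE := (tcomp (ins Eop) (ins Dop)).
Let gF0 N : good (F0^~ N).
Proof. exact: (adm_head (F0_admissible 0)). Qed.
Let gF0' x : wgood good (F0 x).
Proof. exact: (adm_tail (F0_admissible 0)). Qed.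
Let l0 := @idf_linear K g A n one.

Lemma bullet_insertable i j : insertable one (bulletm (op1 D i) (op1 E j)).
Proof.
apply: insertable_bullet.
- exact: infinitesimal_cochain hD.
- exact: infinitesimal_vanishing hD.
- exact: infinitesimal_cochain hE.
- exact: infinitesimal_vanishing hE.
Qed.

Lemma rot_rotins m v : star rotF (rotinsF D) m v = 0.
Proof.
have aS : acts (ss u (ins Dop)) [:: 2; 3]%N (rotinsF D) by exact: rotinsF_acts.
apply: (acts_zero (rotF_acts 5) aS rotF_linear (rotinsF_linear hD)) => // x xs.
by apply: ss_ss_0 F0_normalized => //; exact/ins_add/opc_add.
Qed.
Lemma rotins_rot m v : star (rotinsF D) rotF m v = 0.
Proof.
have aS : acts (ss (unit_letter 5) (ins Dop)) [:: 5; 3]%N (rotinsF D) by exact: rotinsF_acts.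
apply: (acts_zero aS (rotF_acts 2) (rotinsF_linear hD) rotF_linear) => // x xs.
by apply: ss_ss_0 F0_normalized => //; exact/ins_add/opc_add.
Qed.
Lemma rotins_rotins m v : star (rotinsF D) (rotinsF E) m v = 0.
Proof.
have aS : acts (ss (unit_letter 5) (ins Dop)) [:: 5; 3]%N (rotinsF D) by exact: rotinsF_acts.
have aS' : acts (ss u (ins Eop)) [:: 2; 4]%N (rotinsF E) by exact: rotinsF_acts.
apply: (acts_zero aS aS' (rotinsF_linear hD) (rotinsF_linear hE)) => // x xs.
by apply: ss_ss_0 F0_normalized => //; exact/ins_add/opc_add.
Qed.

Let aD : op_add Dop := @opc_add K g A n one (op1 D 3).
Let aE : op_add Eop := @opc_add K g A n one (op1 E 4).
Let xDE : exch Dop Eop := @opc_exch K g A n one (op1 D 3) (op1 E 4).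

(** The composite of two insertions consists of the two orders side by side and of the
    insertion of the composite cochain; these are the three parts of sigma. *)
Lemma comp_ins H s : wgood good H ->
  DE H s = ins2 Dop Eop H s + ins2 Eop Dop H s + ins (opc (bulletm (op1 D 3) (op1 E 4))) H s.
Proof.
move=> gH; rewrite /tcomp (ins_ins _ _ aD aE xDE); congr (_ + _).
apply: eq_cut => s1 r; apply: eq_cut => s2 s3; exact/dot_bullet/gH.
Qed.

Lemma io_comp_acts i : i \notin [:: 3; 4]%N ->
  acts (io (opc (op1 q i)) DE) [:: i; 3; 4]%N (iota_compF D E).
Proof.
move=> i34.
have a1 : acts (io (opc (op1 q i)) (ins2 Dop Eop)) [:: i; 3; 4]%N (iota2F D E).
  apply: contraction2_acts => //; first exact: q_unit_rule.
  - exact: infinitesimal_cochain hD.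
  - exact: infinitesimal_vanishing hD.
  - exact: infinitesimal_cochain hE.
  - exact: infinitesimal_vanishing hE.
  - by rewrite /= i34.
have a2 : acts (io (opc (op1 q i)) (ins2 Eop Dop)) [:: i; 4; 3]%N (iota2F E D).
  apply: contraction2_acts => //; first exact: q_unit_rule.
  - exact: infinitesimal_cochain hE.
  - exact: infinitesimal_vanishing hE.
  - exact: infinitesimal_cochain hD.
  - exact: infinitesimal_vanishing hD.
  - by move: i34; rewrite /= !inE orbC => ->.
have a3 : acts (io (opc (op1 q i)) (ins (opc (bulletm (op1 D 3) (op1 E 4))))) [:: i; 3; 4]%N (iota_bulletF D E).
  apply: contraction_acts => //; first exact: q_unit_rule.
  - exact: bullet_insertable.
  - by rewrite /= i34.
have a12 T o x xs : linear_family T -> io (opc (op1 q i)) DE (FinS o T) x xs =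
   FinS (o ++ [:: i; 3; 4]%N) (star T (iota2F D E)) x xs + FinS (o ++ [:: i; 4; 3]%N) (star T (iota2F E D)) x xs
   + FinS (o ++ [:: i; 3; 4]%N) (star T (iota_bulletF D E)) x xs.
  move=> lT; rewrite -a1 // -a2 // -a3 // /io /rot /ioG -!cutD; apply: eq_cut => N R.
  rewrite -!cutD; apply: eq_cut => N1 N2; apply: comp_ins => s1 s2.
  have := opc_in (cq1 cq i) (R ++ x :: s1) s2 (FinS_good o N2 lT).
  by under eq_fun => y do rewrite -catA.
move=> T o lT; apply: funext => x; apply: funext => xs; rewrite a12 //.
have -> : FinS (o ++ [:: i; 4; 3]%N) (star T (iota2F E D)) x xs =
  FinS (o ++ [:: i; 3; 4]%N) (fun m v => - star T (iota2F E D) m v) x xs.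
  rewrite FinSN; exact: FinS_swap.
rewrite -!FinSD; congr (FinS _ _ x xs); apply: funext => m; apply: funext => v.
by rewrite /iota_compF !starDr // starNr.
Qed.

Lemma ss_comp_acts : acts (ss u DE) [:: 2; 3; 4]%N (rotins_compF D E).
Proof.
have a1 : acts (ss u (ins2 Dop Eop)) [:: 2; 3; 4]%N (rotins2F D E).
  apply: rotins2_acts => //.
  - exact: infinitesimal_cochain hD.
  - exact: infinitesimal_vanishing hD.
  - exact: infinitesimal_cochain hE.
  - exact: infinitesimal_vanishing hE.
have a2 : acts (ss u (ins2 Eop Dop)) [:: 2; 4; 3]%N (rotins2F E D).
  apply: rotins2_acts => //.
  - exact: infinitesimal_cochain hE.
  - exact: infinitesimal_vanishing hE.
  - exact: infinitesimal_cochain hD.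
  - exact: infinitesimal_vanishing hD.
have a3 : acts (ss u (ins (opc (bulletm (op1 D 3) (op1 E 4))))) [:: 2; 3; 4]%N (rotins_bulletF D E).
  by apply: rotins_acts => //; exact: bullet_insertable.
have a12 T o x xs : linear_family T -> ss u DE (FinS o T) x xs =
   FinS (o ++ [:: 2; 3; 4]%N) (star T (rotins2F D E)) x xs + FinS (o ++ [:: 2; 4; 3]%N) (star T (rotins2F E D)) x xs
   + FinS (o ++ [:: 2; 3; 4]%N) (star T (rotins_bulletF D E)) x xs.
  move=> lT; rewrite -a1 // -a2 // -a3 // /ss /rot /ssG -!cutD; apply: eq_cut => N R.
  apply: comp_ins => s1 s2.
  have := FinS_wgood o u lT (R ++ x :: s1) s2.
  by under eq_fun => y do rewrite -catA.
move=> T o lT; apply: funext => x; apply: funext => xs; rewrite a12 //.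
have -> : FinS (o ++ [:: 2; 4; 3]%N) (star T (rotins2F E D)) x xs =
  FinS (o ++ [:: 2; 3; 4]%N) (fun m v => - star T (rotins2F E D) m v) x xs.
  rewrite FinSN; exact: FinS_swap.
rewrite -!FinSD; congr (FinS _ _ x xs); apply: funext => m; apply: funext => v.
by rewrite /rotins_compF !starDr // starNr.
Qed.

Let DE_tr_add : tr_add DE.
Proof. exact: (DE_add 3 4 hD hE). Qed.

Lemma iota_comp_linear : linear_family (iota_compF D E).
Proof.
apply: linear_add; [apply: linear_add; [|apply: linear_opp]|].
- apply: (@contraction2_linear K g A n one (op1 q 0) (op1 D 1) (op1 E 2)) => //; first exact: q_unit_rule.
  + exact: infinitesimal_cochain hD.
  + exact: infinitesimal_vanishing hD.
  + exact: infinitesimal_cochain hE.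
  + exact: infinitesimal_vanishing hE.
- apply: (@contraction2_linear K g A n one (op1 q 0) (op1 E 1) (op1 D 2)) => //; first exact: q_unit_rule.
  + exact: infinitesimal_cochain hE.
  + exact: infinitesimal_vanishing hE.
  + exact: infinitesimal_cochain hD.
  + exact: infinitesimal_vanishing hD.
- apply: (@contraction_linear K g A n one (op1 q 0) (bulletm (op1 D 1) (op1 E 2))) => //; first exact: q_unit_rule.
  exact: bullet_insertable.
Qed.

Lemma rotins_comp_linear : linear_family (rotins_compF D E).
Proof.
apply: linear_add; [apply: linear_add; [|apply: linear_opp]|].
- apply: (@rotins2_linear K g A n one (op1 D 1) (op1 E 2)) => //.
  + exact: infinitesimal_cochain hD.
  + exact: infinitesimal_vanishing hD.
  + exact: infinitesimal_cochain hE.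
  + exact: infinitesimal_vanishing hE.
- apply: (@rotins2_linear K g A n one (op1 E 1) (op1 D 2)) => //.
  + exact: infinitesimal_cochain hE.
  + exact: infinitesimal_vanishing hE.
  + exact: infinitesimal_cochain hD.
  + exact: infinitesimal_vanishing hD.
- apply: (@rotins_linear K g A n one (bulletm (op1 D 1) (op1 E 2))) => //.
  exact: bullet_insertable.
Qed.

Lemma rot_rotins_comp m v : star rotF (rotins_compF D E) m v = 0.
Proof.
apply: (acts_zero (rotF_acts 5) ss_comp_acts rotF_linear rotins_comp_linear) => // x xs.
exact: ss_ss_0 F0_normalized.
Qed.

Lemma rotins_comp_rot m v : star (rotins_compF D E) rotF m v = 0.
Proof.
apply: (acts_zero ss_comp_acts (rotF_acts 5) rotins_comp_linear rotF_linear) => // x xs.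
by apply: ss_ss_0 (adm_unit (F0_admissible 5)).
Qed.

(** Only the terms in which each of D and E is inserted in an input of its own copy of q
    survive, and these are the products of the two contractions. *)
Lemma hoch_iota_comp m v : star hochF (iota_compF D E) m v + star (iota_compF D E) hochF m v =
  star (iotaF q D) (iotaF q E) m v - star (iotaF q E) (iotaF q D) m v.
Proof.
have aC : acts (io Q DE) [:: 1; 3; 4]%N (iota_compF D E) by exact: io_comp_acts.
have aI : acts (io P (ins Dop)) [:: 0; 3]%N (iotaF q D) by exact: iotaF_acts.
have aI' : acts (io P (ins Eop)) [:: 0; 4]%N (iotaF q E) by exact: iotaF_acts.
have aJ : acts (io Q (ins Dop)) [:: 1; 3]%N (iotaF q D) by exact: iotaF_acts.
have aJ' : acts (io Q (ins Eop)) [:: 1; 4]%N (iotaF q E) by exact: iotaF_acts.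
have lb := hochF_linear; have li := iotaF_linear hD; have li' := iotaF_linear hE.
have lI := iota_comp_linear; have lS := rotins_comp_linear.
apply: (@FinS_eq [:: 0; 1; 3; 4]%N (fun m v => star hochF (iota_compF D E) m v + star (iota_compF D E) hochF m v)
  (fun m v => star (iotaF q D) (iotaF q E) m v + - star (iotaF q E) (iotaF q D) m v)) => [|||x xs] //; [linfam|linfam|].
have := hoch_iota2 cq relq 3 4 hD hE x xs gF0.
rewrite aC // hochF_acts ?hochF_acts ?star_idE // aC // aJ' ?star_idE // aJ ?star_idE // aI // aI' //.
rewrite FinS_sort /= (FinS_sort [:: 1; 4; 0; 3]%N) /= (FinS_sort [:: 1; 3; 0; 4]%N) /=.
rewrite !FinSD !FinSN; exact: arrange_iota2.
Qed.

(** The Cartan homotopy formula for sigma. The last two terms have D or E in the place of q,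
    and will be matched by the derivatives of the contractions. *)
Lemma hoch_rotins_comp m v : star hochF (rotins_compF D E) m v + star (rotins_compF D E) hochF m v
  + (star rotF (iota_compF D E) m v + star (iota_compF D E) rotF m v) =
  star (rotinsF D) (iotaF q E) m v - star (rotinsF E) (iotaF q D) m v
  + (star (iotaF q D) (rotinsF E) m v - star (iotaF q E) (rotinsF D) m v)
  + star (LieF D) (LieF E) m v + (iotaF D E m v - iotaF E D m v).
Proof.
have aC : acts (io P DE) [:: 0; 3; 4]%N (iota_compF D E) by exact: io_comp_acts.
have aI : acts (io P (ins Dop)) [:: 0; 3]%N (iotaF q D) by exact: iotaF_acts.
have aI' : acts (io P (ins Eop)) [:: 0; 4]%N (iotaF q E) by exact: iotaF_acts.
have aS : acts (ss u (ins Dop)) [:: 2; 3]%N (rotinsF D) by exact: rotinsF_acts.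
have aS' : acts (ss u (ins Eop)) [:: 2; 4]%N (rotinsF E) by exact: rotinsF_acts.
have aL : acts (Lop Dop) [:: 3]%N (LieF D) by exact: LieF_acts.
have aL' : acts (Lop Eop) [:: 4]%N (LieF E) by exact: LieF_acts.
have aX : acts (io Dop (ins Eop)) [:: 3; 4]%N (iotaF D E).
  apply: contraction_acts => //; first exact: infinitesimal_cochain hD.
    exact: infinitesimal_unit_rule hD.
  exact: infinitesimal_insertable hE.
have aX' : acts (io Eop (ins Dop)) [:: 4; 3]%N (iotaF E D).
  apply: contraction_acts => //; first exact: infinitesimal_cochain hE.
    exact: infinitesimal_unit_rule hE.
  exact: infinitesimal_insertable hD.
have lX : linear_family (iotaF D E).
  apply: (@contraction_linear K g A n one (op1 D 1) (op1 E 2)) => //; first exact: infinitesimal_cochain hD.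
    exact: infinitesimal_unit_rule hD.
  exact: infinitesimal_insertable hE.
have lX' : linear_family (iotaF E D).
  apply: (@contraction_linear K g A n one (op1 E 1) (op1 D 2)) => //; first exact: infinitesimal_cochain hE.
    exact: infinitesimal_unit_rule hE.
  exact: infinitesimal_insertable hD.
have lb := hochF_linear; have li := iotaF_linear hD; have li' := iotaF_linear hE.
have lI := iota_comp_linear; have lS := rotins_comp_linear.
have ls := rotinsF_linear hD; have ls' := rotinsF_linear hE; have lr := rotF_linear.
have ll := LieF_linear hD; have ll' := LieF_linear hE; have aSC := ss_comp_acts.
apply: (@FinS_eq [:: 0; 2; 3; 4]%N (fun m v => star hochF (rotins_compF D E) m v + star (rotins_compF D E) hochF m v
  + (star rotF (iota_compF D E) m v + star (iota_compF D E) rotF m v))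
  (fun m v => star (rotinsF D) (iotaF q E) m v + - star (rotinsF E) (iotaF q D) m v
  + (star (iotaF q D) (rotinsF E) m v + - star (iotaF q E) (rotinsF D) m v)
  + star (LieF D) (LieF E) m v + (iotaF D E m v + - iotaF E D m v))) => [|||x xs] //; [linfam|linfam|].
have := hoch_rotins2 cq uq 3 4 hD hE x xs gF0 (gF0' _).
rewrite aSC // hochF_acts ?hochF_acts ?star_idE // aSC // rotF_acts // aC ?star_idE // aS' ?star_idE // aI ?star_idE //.
rewrite ?aS ?star_idE // ?aI' ?star_idE // ?aL ?star_idE // ?aL' // ?aX // ?aX' // ?aS' ?star_idE // ?aS // ?aC ?star_idE // ?rotF_acts ?star_idE // ?aS ?aS' ?star_idE // (aI idf) ?star_idE // aS' //.
rewrite !nuD !nu_FinS ?star_idE.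
rewrite FinS_sort /= (FinS_sort [:: 2; 0; 3; 4]%N) /= (FinS_sort [:: 2; 4; 0; 3]%N) /= (FinS_sort [:: 2; 3; 0; 4]%N) /=.
rewrite (FinS_sort [:: 0; 2; 4; 3]%N) /= (FinS_sort [:: 0; 3; 2; 4]%N) /= (FinS_sort [:: 0; 4; 2; 3]%N) /= (FinS_sort [:: 0; 3; 4; 2]%N) /=.
rewrite !FinSD !FinSN; exact: arrange_rotins2.
Qed.
End Two.
End Theorems.

(** * The Leibniz rule *)

Section Leibniz.
Variables (n : nat) (U : zmodType) (i : 'I_n).
Local Notation mon := 'X_{1..n}.
Local Notation e := (U_(i))%MM.
Implicit Types (m a b : mon) (G : mon -> mon -> U).

Lemma mnm_pos a : (0 < a i)%N -> (a - e + e)%MM = a.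
Proof.
move=> a0; apply: submK; apply/mnm_lepP => j; rewrite mnm1E.
by case: eqP => // <-.
Qed.

Lemma bm_shift N (F : mon -> U) : (forall a, a i = 0%N -> F a = 0) ->
  \sum_(a : 'X_{1..n < N.+1}) F a = \sum_(a : 'X_{1..n < N}) F (a + e)%MM.
Proof.
move=> F0.
have im M : forall x, (x \in [seq bmnm y | y : 'X_{1..n < M}]) = (mdeg x < M)%N.
  move=> x; apply/imageP/idP => [[y _ ->]|lt]; first exact: bmdeg.
  by exists (BMultinom lt).
have um M : uniq [seq bmnm y | y : 'X_{1..n < M}].
  by rewrite map_inj_uniq ?enum_uniq //; exact: val_inj.
transitivity (\sum_(a <- [seq bmnm y | y : 'X_{1..n < N.+1}] | (0 < a i)%N) F a).
  rewrite big_image_cond /= [RHS]big_mkcond; apply: eq_bigr => a _.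
  by case: (posnP (a i)) => // /F0.
have -> : \sum_(a : 'X_{1..n < N}) F (a + e)%MM = \sum_(a <- [seq bmnm y | y : 'X_{1..n < N}]) F (a + e)%MM.
  by rewrite big_image.
rewrite -(big_map (fun a : mon => (a + e)%MM) xpredT F).
rewrite -[LHS]big_filter; apply: perm_big; apply: uniq_perm.
- exact/filter_uniq/um.
- rewrite map_inj_uniq ?um // => a b; exact: addIm.
move=> x; rewrite mem_filter im; apply/andP/mapP => [[x0 lt]|[a]].
  exists (x - e)%MM; last by rewrite mnm_pos.
  by rewrite im; move: lt; rewrite -{1}(mnm_pos x0) mdegD mdeg1 addn1 ltnS.
by rewrite im => lt ->; rewrite mnmDE mnm1E eqxx addn1 mdegD mdeg1 addn1 ltnS.
Qed.

(** The exponents without [t_i] do not contribute on the left, and the others are shifted. *)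
Lemma conv_shiftl m G :
  conv (m + e)%MM (fun a b => G a b *+ a i) = conv m (fun a b => G (a + e)%MM b *+ (a i).+1).
Proof.
have d : mdeg (m + e)%MM = (mdeg m).+1 by rewrite mdegD mdeg1 addn1.
rewrite (@conv_lem _ _ (mdeg m).+2) ?d // (@conv_lem _ _ (mdeg m).+1) //.
rewrite (@bm_shift _ (fun x => if (x <= m + e)%MM then G x (m + e - x)%MM *+ x i else 0)); last first.
  by move=> a ->; case: ifP.
apply: eq_bigr => a _; rewrite !mnmDE mnm1E eqxx addn1.
have -> : (m + e - (a + e))%MM = (m - a)%MM.
  by apply/mnmP => j; rewrite !(mnmDE, mnmBE) subnDr.
congr (if _ then _ else _); apply/mnm_lepP/mnm_lepP => le j; have := le j;
  by rewrite !mnmDE leq_add2r.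
Qed.

(** The Leibniz rule: an exponent of [t_i] in a product is the sum of those in the factors. *)
Lemma conv_leibniz m G : conv (m + e)%MM G *+ (m i).+1 =
  conv m (fun a b => G (a + e)%MM b *+ (a i).+1) + conv m (fun a b => G a (b + e)%MM *+ (b i).+1).
Proof.
rewrite -conv_shiftl [X in _ + X]convC -(conv_shiftl m (fun b a => G a b)) [X in _ + X]convC -convD.
rewrite /conv -sumrMnl; apply: eq_bigr => -[a b] /= /eqP ab.
by rewrite -mulrnDr -mnmDE -ab mnmDE mnm1E eqxx addn1.
Qed.
End Leibniz.

Section Derivative.
Variables (K : fieldType) (g A : int -> lmodType K) (n : nat) (one : A 0) (i : 'I_n).
Local Notation YL := (marked g).
Local Notation XL := (marked A).
Local Notation mon := 'X_{1..n}.
Local Notation chain := (chain g one).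
Local Notation state := (state g n one).
Local Notation mop := (mop g A n).
Local Notation good := (@good K g A n one).
Local Notation opc := (@opc K g A n one).
Local Notation family := (tseries n (chain -> chain)).
Local Notation op1 := (@op1 K g A n).
Local Notation FinS := (@FinS K g A n one).
Local Notation idf := (@idf K g A n one).
Local Notation cfam := (tseries n (cochain g A)).
Implicit Types (T S : family) (m : mon) (O : mop) (F : XL -> seq XL -> state).

(** The partial derivative on states. *)
Definition dst (v : state) : state := fun Ys m mu => v Ys (m + U_(i))%MM mu *+ (m i).+1.
Definition dfam T : family := fun m v => T (m + U_(i))%MM v *+ (m i).+1.

Lemma dstD : {morph dst : v w / v + w}.
Proof.
move=> v w; apply: funext => Ys; apply: funext => m; apply: funext => mu.
by rewrite state_addE /dst state_addE mulrnDl.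
Qed.

Lemma dst_FinS o T x xs : dst (FinS o T x xs) = FinS o (dfam T) x xs.
Proof.
apply: funext => Ys; apply: funext => m; apply: funext => mu.
by rewrite /dst /FinS /Fin /final scalerMnr.
Qed.

Lemma mnm_neq0 m : (m + U_(i))%MM != 0%MM.
Proof. by apply/eqP => /(congr1 (fun z : mon => z i)); rewrite mnmDE mnm1E eqxx mnm0E addn1. Qed.

Lemma dst_F0 x xs : dst (FinS [::] idf x xs) = 0.
Proof.
rewrite dst_FinS; apply: funext => Ys; apply: funext => m; apply: funext => mu.
rewrite /FinS /Fin /final /dfam /idf /Defs.constant (negbTE (mnm_neq0 m)).
by rewrite -[RHS]/(0 : chain) mul0rn scaler0.
Qed.

Definition dmop O : mop := Mop (opar O) (family_partial i (ofun O)).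

(** The derivative of an operation, by the Leibniz rule and linearity in the output. *)
Lemma dst_opc O s k : good k -> dst (opc O s k) = opc (dmop O) s k + opc O s (fun a => dst (k a)).
Proof.
move=> gk; apply: funext => Ys; apply: funext => m; apply: funext => mu.
rewrite state_addE /dst /opc -shufD.
have hM : {morph (fun v : chain => v *+ (m i).+1) : v w / v + w} by move=> v w; rewrite mulrnDl.
apply: (etrans (shuf_morph _ _ hM)).
apply: eq_shuf => Y1 Y2; rewrite conv_leibniz; congr (_ + _).
apply: eq_conv => a b; rewrite !(pk_val k) /= /cval.
set d := odeg O + _ + _ + 1.
have lk := good_lin gk (d := d) (omk O ++ mks Y2 ++ mks s) Y1 b mu.
by rewrite /family_partial /partial -!scaler_nat (lin_mapZ lk).
Qed.

Lemma dst_cut s (G : seq XL -> seq XL -> state) : dst (cut s G) = cut s (fun a b => dst (G a b)).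
Proof. exact: (cut_morph (h := dst) _ _ dstD). Qed.

Section Operators.
Variable F : XL -> seq XL -> state.
Hypothesis gF : forall N, good (F^~ N).
Hypothesis gF' : forall x, wgood good (F x).
Hypothesis dF : forall x xs, dst (F x xs) = 0.

Lemma dst_ins O H N : wgood good H -> dst (ins (opc O) H N) =
  ins (opc (dmop O)) H N + ins (opc O) (fun w => dst (H w)) N.
Proof.
move=> gH; rewrite /ins dst_cut -cutD; apply: eq_cut => s1 r; rewrite dst_cut -cutD.
by apply: eq_cut => s2 s3; rewrite dst_opc.
Qed.

Lemma dst_ss_ins O c x xs :
  dst (ss (uletter one c) (ins (opc O)) F x xs) = ss (uletter one c) (ins (opc (dmop O))) F x xs.
Proof.
rewrite /ss /rot dst_cut; apply: eq_cut => N R; rewrite /ssG dst_ins; last first.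
  by move=> s1 s2; have := gF' (uletter one c) (R ++ x :: s1) s2; under eq_fun => y do rewrite -catA.
rewrite [X in _ + X](_ : _ = 0) ?addr0 // -[RHS](tr_0 N (ins_add (@opc_add K g A n one O))).
by apply: tr_ext => w; rewrite dF.
Qed.

Lemma dst_io_ins O O' x xs : op_cochain O ->
  dst (io (opc O) (ins (opc O')) F x xs) =
  io (opc (dmop O)) (ins (opc O')) F x xs + io (opc O) (ins (opc (dmop O'))) F x xs.
Proof.
move=> cO; rewrite /io /rot dst_cut -cutD; apply: eq_cut => N R; rewrite /ioG dst_cut -cutD.
apply: eq_cut => N1 N2; rewrite dst_ins; last first.
  move=> s1 s2; have := opc_in cO (R ++ x :: s1) s2 (gF N2).
  by under eq_fun => y do rewrite -catA.
rewrite addrC; congr (_ + _); apply: tr_ext => w; rewrite dst_opc //.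
rewrite [X in _ + X](_ : _ = 0) ?addr0 // -[RHS](op_0 (R ++ x :: w) (@opc_add K g A n one O)).
by apply: op_ext => y; rewrite dF.
Qed.
End Operators.
End Derivative.

(** * Derivatives of a family of structures *)

Section FamilyDerivatives.
Variables (K : fieldType) (g A : int -> lmodType K) (n : nat) (one : A 0).
Local Notation YL := (marked g).
Local Notation XL := (marked A).
Local Notation mon := 'X_{1..n}.
Local Notation chain := (chain g one).
Local Notation state := (state g n one).
Local Notation good := (@good K g A n one).
Local Notation opc := (@opc K g A n one).
Local Notation family := (tseries n (chain -> chain)).
Local Notation acts := (@acts K g A n one).
Local Notation op1 := (@op1 K g A n).
Local Notation FinS := (@FinS K g A n one).
Local Notation idf := (@idf K g A n one).
Local Notation cfam := (tseries n (cochain g A)).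
Local Notation iotaF := (@iotaF K g A n one).
Local Notation rotinsF := (@rotinsF K g A n one).
Implicit Types (T S : family) (m : mon) (p D : cfam).

Definition cochain_family p := forall m, is_cochain 1 (p m).

Lemma partial_cochain (i : 'I_n) p : cochain_family p -> cochain_family (family_partial i p).
Proof.
move=> cp m; have cm := cp (m + U_(i))%MM; rewrite /family_partial /partial; split.
- move=> xs k s1 d c u v s2; rewrite (cochain_multilinear_closed cm) mulrnDl.
  by rewrite -!scaler_nat !scalerA mulrC.
- move=> ys k s1 d c u v s2; rewrite (cochain_multilinear_open cm) mulrnDl.
  by rewrite -!scaler_nat !scalerA mulrC.
- move=> xs k s1 a b s2; rewrite (cochain_symmetric cm).
  by rewrite -!scaler_nat !scalerA mulrC.
- by move=> ys xs k h; rewrite (cochain_degree cm) // mul0rn.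
- by move=> k; rewrite (cochain_nullary cm) mul0rn.
Qed.

Lemma partial_vanishing (i : 'I_n) p : vanishing one p -> vanishing one (family_partial i p).
Proof. by move=> vp m ys xs1 xs2 d; rewrite /family_partial /partial vp mul0rn. Qed.

Lemma dfam_linear (i : 'I_n) T : linear_family T -> linear_family (dfam i T).
Proof. by move=> lT m c v w; rewrite /dfam lT mulrnDl scalerMnr. Qed.

Lemma contraction_acts1 p D i j : cochain_family p -> unit_rule one (op1 p i) ->
  cochain_family D -> vanishing one D -> i != j ->
  acts (io (opc (op1 p i)) (ins (opc (op1 D j)))) [:: i; j] (iotaF p D).
Proof.
move=> cp vp cD vD ij; apply: contraction_acts => //.
- exact: insertable_cochain.
- by rewrite /= inE ij.
Qed.

Lemma contraction_linear1 p D : cochain_family p -> unit_rule one (op1 p 0) ->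
  cochain_family D -> vanishing one D -> linear_family (iotaF p D).
Proof.
move=> cp vp cD vD; apply: (@contraction_linear K g A n one (op1 p 0) (op1 D 1)) => //.
exact: insertable_cochain.
Qed.

Lemma rotins_acts1 D i j : cochain_family D -> vanishing one D ->
  acts (ss (uletter one i) (ins (opc (op1 D j)))) [:: i; j] (rotinsF D).
Proof. by move=> cD vD; apply: rotins_acts => //; exact: insertable_cochain. Qed.

Lemma rotins_linear1 D : cochain_family D -> vanishing one D -> linear_family (rotinsF D).
Proof. by move=> cD vD; apply: rotins_linear => //; exact: insertable_cochain. Qed.

Let gF0 N : good ((FinS [::] idf)^~ N).
Proof. exact/FinS_good/idf_linear. Qed.
Let gF0' x : wgood good (FinS [::] idf x).
Proof. exact/FinS_wgood/idf_linear. Qed.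

(** Both q and D depend on [t]; the first term has the derivative of q in the place of q. *)
Lemma partial_iotaF (i : 'I_n) p D m v : cochain_family p ->
  (forall j, unit_rule one (op1 p j)) -> vanishing one (family_partial i p) ->
  cochain_family D -> vanishing one D ->
  iotaF p D (m + U_(i))%MM v *+ (m i).+1
  = iotaF (family_partial i p) D m v + iotaF p (family_partial i D) m v.
Proof.
move=> cp up vp cD vD.
have cp' := partial_cochain i cp; have cD' := partial_cochain i cD; have vD' := partial_vanishing i vD.
have up' j : unit_rule one (op1 (family_partial i p) j) by right.
have l0 := @idf_linear K g A n one.
apply: (@FinS_eq K g A n one [:: 0; 1]%N (dfam i (iotaF p D))
  (fun m v => iotaF (family_partial i p) D m v + iotaF p (family_partial i D) m v)) => [|||x xs] //.
- exact/dfam_linear/contraction_linear1.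
- apply: linear_add; exact: contraction_linear1.
have a1 := @contraction_acts1 p D 0 1 cp (up _) cD vD isT.
have a2 := @contraction_acts1 _ D 0 1 cp' (up' _) cD vD isT.
have a3 := @contraction_acts1 p _ 0 1 cp (up _) cD' vD' isT.
have := @dst_io_ins K g A n one i _ gF0 (@dst_F0 K g A n one i) (op1 p 0) (op1 D 1) x xs cp.
rewrite a1 // (a2 idf) // (a3 idf) // dst_FinS ?star_idE FinSD.
by move=> ->.
Qed.

Lemma partial_rotinsF (i : 'I_n) D m v : cochain_family D -> vanishing one D ->
  rotinsF D (m + U_(i))%MM v *+ (m i).+1 = rotinsF (family_partial i D) m v.
Proof.
move=> cD vD; have cD' := partial_cochain i cD; have vD' := partial_vanishing i vD.
have l0 := @idf_linear K g A n one.
apply: (@FinS_eq K g A n one [:: 0; 1]%N (dfam i (rotinsF D)) (rotinsF (family_partial i D))) => [|||x xs] //.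
- exact/dfam_linear/rotins_linear1.
- exact: rotins_linear1.
have := @dst_ss_ins K g A n one i _ gF0' (@dst_F0 K g A n one i) (op1 D 1) 0 x xs.
rewrite (@rotins_acts1 D 0 1) // dst_FinS star_idE => ->.
by have -> := @rotins_acts1 _ 0 1 cD' vD' idf [::] l0; rewrite star_idE.
Qed.

Lemma family_partialC (i j : 'I_n) p : family_partial i (family_partial j p) = family_partial j (family_partial i p).
Proof.
apply: funext => m; apply: funext => ys; apply: funext => xs; apply: functional_extensionality_dep => k.
rewrite /family_partial /partial -!mulrnA -!addmA [(U_(i) + _)%MM]addmC.
have [->//|ij] := eqVneq i j.
by rewrite !mnmDE !mnm1E [j == i]eq_sym (negbTE ij) !addn0 mulnC.
Qed.

Variables (l : brackets g) (q : cfam).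
Hypothesis hq : unital_ocha_family l one q.

Lemma family_unit_family : unit_family one (@kap0 K n) q.
Proof.
split.
- move=> m d x; rewrite /kap0; have [->|m0] := eqVneq m 0%MM.
    by rewrite (family_unit_left hq) scale1r.
  rewrite scale0r; apply: (@family_unit_other _ _ _ _ _ _ _ hq m [::] [::] [:: Tagged A x]) => -[e].
  by rewrite e eqxx in m0.
- move=> m d x; rewrite /kap0; have [->|m0] := eqVneq m 0%MM.
    by rewrite (family_unit_right hq) scale1r.
  rewrite scale0r (@family_unit_other _ _ _ _ _ _ _ hq m [::] [:: Tagged A x] [::]) ?scaler0 // => -[e].
  by rewrite e eqxx in m0.
- move=> m ys xs1 xs2 d h; apply: (family_unit_other hq) => -[_ [e1 e2]]; exact: h.
Qed.

(** The structure relation is quadratic in q, with constant brackets; its derivative is the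
    equation of a closed cochain. The unit relations are constant, hence their derivative
    is normalization. *)
Lemma family_partial_infinitesimal (i : 'I_n) : infinitesimal one l q (family_partial i q).
Proof.
split.
- exact/partial_cochain/(family_cochain hq).
- move=> m ys xs1 xs2 d; rewrite /family_partial /partial (family_unit_other hq) ?mul0rn // => -[e].
  by move: (mnm_neq0 i m); rewrite e eqxx.
move=> m ys xs d; rewrite /family_partial /partial.
have lM k (V : lmodType K) : lin_map (fun v : V => v *+ k).
  by move=> c v w; rewrite mulrnDl scalerMnr.
transitivity (family_bullet 1 1 q q (m + U_(i))%MM ys xs d *+ (m i).+1).
  rewrite -(family_relation hq); exact: esym (lin_shuffle_sum (lM (m i).+1 (A d)) _ _).
apply: (etrans (conv_leibniz i m (fun a b => bullet 1 1 (q a) (q b) ys xs d))).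
congr (_ + _).
  rewrite /family_bullet cauchyE; apply: eq_conv => a b; rewrite /bullet (lin_koszul_sum (lM (a i).+1 (A d))).
  exact: eq_koszul_sum.
rewrite /family_bullet cauchyE; apply: eq_conv => a b; rewrite /bullet (lin_koszul_sum (lM (b i).+1 (A d))).
apply: eq_koszul_sum => p r; rewrite /cval; set e := 1 + _ + _ + 1.
have lm : lin_map (fun x : A e => q a (p 1%N) (r 1%N ++ Tagged A x :: r 3) d).
  by move=> ? ? ?; exact: (cochain_multilinear_open (family_cochain hq a)).
by rewrite -scaler_nat -(lin_mapZ lm) scaler_nat.
Qed.
End FamilyDerivatives.

(** * The curvature *)

Section Assembly.
Variables (K : fieldType) (g A : int -> lmodType K) (n : nat) (one : A 0).
Local Notation mon := 'X_{1..n}.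
Local Notation chain := (chain g one).
Local Notation family := (tseries n (chain -> chain)).
Local Notation cfam := (tseries n (cochain g A)).
Local Notation useries := (useries g n one).
Local Notation iotaF := (@iotaF K g A n one).
Local Notation rotinsF := (@rotinsF K g A n one).
Local Notation LieF := (@LieF K g A n one).
Local Notation rotF := (@rotF K g A n one).
Implicit Types (T S : family) (m : mon) (p D E : cfam) (e : useries) (k : int).

Lemma extendE T e m k : extend T e m k = conv m (fun a b => T a (e b k)).
Proof. by rewrite /extend /cauchy fct_sumE. Qed.

Lemma eq_extend T S e : (forall m v, T m v = S m v) -> extend T e = extend S e.
Proof. by move=> eTS; congr extend; do 2 apply: funext => ?. Qed.

Lemma extend_comp T S e : linear_family T -> extend T (extend S e) = extend (star T S) e.
Proof.
move=> lT; apply: funext => m; apply: funext => k; rewrite !extendE.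
transitivity (conv m (fun a r => conv r (fun c d => T a (S c (e d k))))).
  apply: eq_conv => a r; rewrite extendE (@conv_morph _ _ _ (T a)) //.
    exact: lin_map0 (lT a).
  exact: lin_mapD (lT a).
rewrite conv_swap -convA; apply: eq_conv => r d.
by rewrite /star convC.
Qed.

Lemma extend_linear T : linear_family T -> {morph extend T : e e' / e + e'}.
Proof.
move=> lT e e'; apply: funext => m; apply: funext => k.
rewrite -[RHS]/(extend T e m k + extend T e' m k) !extendE -convD.
by apply: eq_conv => a b; rewrite -(lin_mapD (lT a)).
Qed.

Lemma extendDl T S e : extend (fun m v => T m v + S m v) e = extend T e + extend S e.
Proof.
apply: funext => m; apply: funext => k.
by rewrite -[RHS]/(extend T e m k + extend S e m k) !extendE -convD.
Qed.
Lemma extendNl T e : extend (fun m v => - T m v) e = - extend T e.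
Proof.
apply: funext => m; apply: funext => k.
by rewrite -[RHS]/(- (extend T e m k)) !extendE -convN.
Qed.
Lemma extend0l e : extend (fun _ _ => 0) e = 0.
Proof. by apply: funext => m; apply: funext => k; rewrite extendE conv0. Qed.

Lemma extend_shift T j e : extend T (u_power j e) = u_power j (extend T e).
Proof. by apply: funext => m; apply: funext => k; rewrite /u_power !extendE. Qed.

Lemma u_powerD j e e' : u_power j (e + e') = u_power j e + u_power j e'.
Proof. by []. Qed.
Lemma u_powerN j e : u_power j (- e) = - u_power j e.
Proof. by []. Qed.
Lemma u_power_comp j j' e : u_power j (u_power j' e) = u_power (j + j') e.
Proof. by apply: funext => m; apply: funext => k; rewrite /u_power -addrA -opprD. Qed.
Lemma u_power0 e : u_power 0 e = e.
Proof. by apply: funext => m; apply: funext => k; rewrite /u_power subr0. Qed.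

Definition upartial (i : 'I_n) e : useries := Defs.partial i e.

Lemma upartialE i e m k : upartial i e m k = e (m + U_(i))%MM k *+ (m i).+1.
Proof. by rewrite /upartial /Defs.partial; elim: (m i).+1 => // r IH; rewrite !mulrS -IH. Qed.

Lemma upartialD i e e' : upartial i (e + e') = upartial i e + upartial i e'.
Proof.
apply: funext => m; apply: funext => k.
by rewrite -[RHS]/(upartial i e m k + upartial i e' m k) !upartialE -mulrnDl.
Qed.
Lemma upartial_shift i j e : upartial i (u_power j e) = u_power j (upartial i e).
Proof. by apply: funext => m; apply: funext => k; rewrite /u_power !upartialE. Qed.

Lemma upartialC i j e : upartial i (upartial j e) = upartial j (upartial i e).
Proof.
apply: funext => m; apply: funext => k; rewrite !upartialE -!mulrnA -!addmA [(U_(i) + _)%MM]addmC.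
have [->//|ij] := eqVneq i j.
by rewrite !mnmDE !mnm1E [j == i]eq_sym (negbTE ij) !addn0 mulnC.
Qed.

Lemma upartial_extend i T e : linear_family T ->
  upartial i (extend T e) = extend (dfam i T) e + extend T (upartial i e).
Proof.
move=> lT; apply: funext => m; apply: funext => k.
rewrite -[RHS]/(extend (dfam i T) e m k + extend T (upartial i e) m k) upartialE !extendE conv_leibniz.
congr (_ + _); apply: eq_conv => a b; rewrite upartialE.
by rewrite -!scaler_nat (lin_mapZ (lT a)).
Qed.

Lemma cauchy_apply (S1 S2 : Type) (f : S1 -> S2 -> chain -> chain) (x : tseries n S1) (y : tseries n S2) m v :
  cauchy f x y m v = conv m (fun a b => f (x a) (y b) v).
Proof. by rewrite /cauchy fct_sumE. Qed.

Lemma iota_opE D p m v : cauchy (@iota_op K g A one 1) p D m v = - iotaF p D m v.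
Proof.
rewrite cauchy_apply -convN; apply: eq_conv => a b.
by rewrite [LHS]chain_opZ scaleN1r.
Qed.
Lemma S_opE D m v : S_op (one := one) 1 (D m) v = - rotinsF D m v.
Proof. by rewrite [LHS]chain_opZ scaleN1r. Qed.
Lemma L_opE D m v : L_op (one := one) 1 (D m) v = - LieF D m v.
Proof. by rewrite [LHS]chain_opD !chain_opZ !scaleN1r -opprD [in RHS]/LieF /Lie chain_opD. Qed.

Lemma sign11 : (-1 : K) ^ (1 + 1 : int) = 1.
Proof. by rewrite exprz_odd. Qed.

Variables (q : cfam).
(** The sign of the definition is -1 for a cochain of degree 1. *)
Lemma R_familyE D e : @R_family K g A n one 1 q D e = - (extend (iotaF q D) e + u_power 1 (extend (rotinsF D) e)).
Proof.
rewrite opprD -extendNl -u_powerN -extendNl.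
by congr (_ + u_power 1 _); apply: eq_extend => m v; [exact: iota_opE|exact: S_opE].
Qed.
Lemma L_familyE D e : @L_family K g A n one 1 D e = - extend (LieF D) e.
Proof. by rewrite -extendNl; apply: eq_extend => m v; exact: L_opE. Qed.
Lemma R2_familyE D E e : @R2_family K g A n one 1 1 q D E e =
  extend (@iota2F K g A n one q D E) e + u_power 1 (extend (@rotins2F K g A n one D E) e).
Proof.
congr (_ + u_power 1 _); apply: eq_extend => m v.
  rewrite cauchy_apply /iota2F /contraction2; apply: eq_conv => s c.
  rewrite /cauchy !fct_sumE; apply: eq_bigr => -[a b] /= _.
  by rewrite [LHS]chain_opZ sign11 scale1r.
rewrite cauchy_apply; apply: eq_conv => a b.
by rewrite [LHS]chain_opZ sign11 scale1r.
Qed.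
Lemma R_bulletE D E e : @R_family K g A n one (1 + 1) q (family_bullet 1 1 D E) e =
  extend (@iota_bulletF K g A n one q D E) e + u_power 1 (extend (@rotins_bulletF K g A n one D E) e).
Proof.
congr (_ + u_power 1 _); apply: eq_extend => m v.
  rewrite cauchy_apply; apply: eq_conv => a b.
  by rewrite [LHS]chain_opZ sign11 scale1r.
by rewrite [LHS]chain_opZ sign11 scale1r.
Qed.

Lemma sigmaE D E e : @sigma_family K g A n one 1 1 q D E e =
  extend (@iota_compF K g A n one q D E) e + u_power 1 (extend (@rotins_compF K g A n one D E) e).
Proof.
rewrite /sigma_family; have -> : forall f h k : useries -> useries, (f + (-1 : K) ^ (1 * 1 : int) *: h + k) e = f e - h e + k e.
  by move=> f h k; rewrite mulr1 expr1z scaleN1r.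
rewrite !R2_familyE R_bulletE /iota_compF /rotins_compF !extendDl !extendNl !u_powerD !u_powerN.
by rewrite opprD [X in X + _]addrACA [LHS]addrACA.
Qed.
End Assembly.

Section AbstractCurvature.
Variables (V : zmodType).
Variables (w U : V -> V) (b B di dj iD iE sD sE lD lE I S XD XE Y Z : V -> V).
Notation additive f := {morph f : x y / x + y}.
Hypotheses (aw : additive w) (aU : additive U) (ab : additive b) (aB : additive B).
Hypotheses (ai : additive di) (aj : additive dj).
Hypotheses (aiD : additive iD) (aiE : additive iE) (asD : additive sD) (asE : additive sE).
Hypotheses (alE : additive lE) (aI : additive I) (aS : additive S).
Hypotheses (wU : forall v, w (U v) = v) (Uw : forall v, U (w v) = v).
Notation commutes f := (forall v, f (w v) = w (f v)).
Notation commutesU f := (forall v, f (U v) = U (f v)).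
Hypotheses (wb : commutes b) (wB : commutes B) (wi : commutes di) (wj : commutes dj).
Hypotheses (wiD : commutes iD) (wiE : commutes iE) (wsD : commutes sD) (wsE : commutes sE).
Hypotheses (wlE : commutes lE) (wI : commutes I) (wS : commutes S).
Hypotheses (ub : commutesU b) (uB : commutesU B).
Hypotheses (uiD : commutesU iD) (usD : commutesU sD) (ulE : commutesU lE) (uI : commutesU I) (uS : commutesU S).
Hypothesis h1 : forall v, b (iD v) = iD (b v).
Hypothesis h2 : forall v, b (sD v) - sD (b v) + (B (iD v) - iD (B v)) = lD v.
Hypothesis h3 : forall v, B (sD v) = 0.
Hypothesis h3' : forall v, sD (B v) = 0.
Hypothesis h4 : forall v, b (lE v) = - lE (b v).
Hypothesis h5 : forall v, B (lE v) = - lE (B v).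
Hypothesis h6 : forall v, b (I v) + I (b v) = iD (iE v) - iE (iD v).
Hypothesis h7 : forall v, b (S v) + S (b v) + (B (I v) + I (B v)) =
  sD (iE v) - sE (iD v) + (iD (sE v) - iE (sD v)) + lD (lE v) + (XD v - XE v).
Hypothesis h8 : forall v, B (S v) = 0.
Hypothesis h8' : forall v, S (B v) = 0.
Hypothesis h9 : forall v, sD (sE v) = 0.
Hypothesis h9' : forall v, sE (sD v) = 0.
Hypothesis d1 : forall v, di (iE v) = XD v + Y v + iE (di v).
Hypothesis d2 : forall v, dj (iD v) = XE v + Y v + iD (dj v).
Hypothesis d3 : forall v, di (sE v) = Z v + sE (di v).
Hypothesis d4 : forall v, dj (sD v) = Z v + sD (dj v).
Hypothesis d5 : forall v, di (dj v) = dj (di v).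

Let a0 (f : V -> V) : additive f -> f 0 = 0.
Proof. by move=> af; apply: (addrI (f 0)); rewrite -af !addr0. Qed.
Let aN (f : V -> V) : additive f -> forall v, f (- v) = - f v.
Proof. by move=> af v; apply/eqP; rewrite -addr_eq0 -af addNr a0. Qed.

Variables (N1 N2 d h : V -> V).
Hypothesis N1E : forall v, N1 v = di v + (w (iD v) + sD v).
Hypothesis N2E : forall v, N2 v = dj v + (w (iE v) + sE v).
Hypothesis dE : forall v, d v = b v + U (B v).
Hypothesis hE : forall v, h v = w (w (I v + U (S v))) - w (w (iD (lE v) + U (sD (lE v)))).

(** The computation of the curvature from the identities. Here [w] and [U] are the
    multiplications by u^-1 and u, [XD] and [XE] are the contractions with D or E in the
    place of q, and [Y], [Z] are those of the second derivative of q, which cancel. The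
    coefficients of u^-2, u^-1 and 1 are the three groups of identities. *)
Lemma abstract_curvature v : N1 (N2 v) - N2 (N1 v) = d (h v) + h (d v).
Proof.
have bI x : b (I x) = iD (iE x) - iE (iD x) - I (b x) by rewrite -h6 addrK.
have bS x : b (S x) = sD (iE x) - sE (iD x) + (iD (sE x) - iE (sD x)) + lD (lE x) + (XD x - XE x)
   - (B (I x) + I (B x)) - S (b x) by rewrite -h7 !addrK.
(* moving B to the left through L_E lets it meet the unit inserted by S_D *)
have sLB x : sD (lE (B x)) = 0.
  by rewrite -[lE _]opprK -h5 (aN asD) h3' oppr0.
have bs x : b (sD x) = lD x + sD (b x) - (B (iD x) - iD (B x)) by rewrite -h2; zmod.
transitivity (w (w (iD (iE v))) - w (w (iE (iD v))) +
  (w (XD v) - w (XE v) + w (iD (sE v)) + w (sD (iE v)) - w (iE (sD v)) - w (sE (iD v)))).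
  rewrite !(N1E, N2E) !(ai, aj, aiD, aiE, asD, asE, aw) !(wi, wj, wiD, wiE, wsD, wsE).
  rewrite !(d1, d2, d3, d4) d5 !aw h9 h9'; zmod.
rewrite !(dE, hE) !aw !wU !(ab, aB, aI, aS, aiD, asD, alE, aN ab, aN aB, aw).
rewrite !(wb, wB, wI, wS, wiD, wsD, wlE) !(ub, uB, uI, uS, uiD, usD, ulE).
do 2! rewrite ?(h1, h4, h5, h8, h8', bI, bS, bs, h3, h3', aiD, asD, aN aiD, aN asD, a0 aiD, a0 asD).
rewrite ?(aw, aU, aN aw, aN aU, a0 aw, a0 aU, wU, Uw, sLB).
zmod.
Qed.
End AbstractCurvature.

Section Curvature.
Variables (K : fieldType) (g A : int -> lmodType K) (n : nat) (one : A 0).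
Local Notation chain := (chain g one).
Local Notation family := (tseries n (chain -> chain)).
Local Notation iotaF := (@iotaF K g A n one).
Local Notation rotinsF := (@rotinsF K g A n one).
Local Notation LieF := (@LieF K g A n one).
Local Notation rotF := (@rotF K g A n one).
Local Notation hochF := (@hochF K g A n one).
Local Notation iota_compF := (@iota_compF K g A n one).
Local Notation rotins_compF := (@rotins_compF K g A n one).
Variables (l : brackets g) (q : tseries n (cochain g A)).
Hypothesis hq : unital_ocha_family l one q.

Lemma curvature (i j : 'I_n) (e : useries g n one) :
  graded_commutator 0 0 (nabla q i) (nabla q j) e
  = graded_commutator 1 (-1) (differential l q) (homotopy q i j) e.
Proof.
set D := family_partial i q; set E := family_partial j q; set F := family_partial i E.
have hl := family_closed hq; have cq := family_cochain hq; have uq := family_unit_family hq.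
have relq := family_relation hq.
have hD : infinitesimal one l q D := family_partial_infinitesimal hq i.
have hE : infinitesimal one l q E := family_partial_infinitesimal hq j.
have [cD vD _] := hD; have [cE vE _] := hE.
have FE : family_partial j D = F by exact: family_partialC.
have uqr k : unit_rule one (@op1 K g A n q k) by left; exists (@kap0 K n).
have lb : linear_family (hochF l q) by exact: hochF_linear.
have lr : linear_family rotF by exact: rotF_linear.
have li : linear_family (iotaF q D) by exact: iotaF_linear hD.
have li' : linear_family (iotaF q E) by exact: iotaF_linear hE.
have ls : linear_family (rotinsF D) by exact: rotinsF_linear hD.
have ls' : linear_family (rotinsF E) by exact: rotinsF_linear hE.
have lL : linear_family (LieF D) by exact: LieF_linear hD.
have lL' : linear_family (LieF E) by exact: LieF_linear hE.
have lI : linear_family (iota_compF q D E) by exact: iota_comp_linear hD hE.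
have lS : linear_family (rotins_compF D E) by exact: rotins_comp_linear hD hE.
pose X (T : family) := @extend K g A n one T.
have xx (T S : family) v : linear_family T -> X T (X S v) = X (star T S) v by exact: extend_comp.
have xs (T S S' : family) v : linear_family T -> (forall m w, star T S m w = S' m w) -> X T (X S v) = X S' v.
  by move=> lT eS; rewrite xx //; exact: eq_extend.
have NE k (G := family_partial k q) v : nabla q k v =
    upartial k v + (u_power (-1) (X (iotaF q G) v) + X (rotinsF G) v).
  rewrite [LHS]/(upartial k v - u_power (-1) (R_family 1 q G v)) R_familyE u_powerN opprK.
  by rewrite u_powerD u_power_comp u_power0.
have dE v : differential l q v = X (hochF l q) v + u_power 1 (X rotF v).
  by congr (_ + _); apply: eq_extend.
have hE' v : homotopy q i j v =
   u_power (-1) (u_power (-1) (X (iota_compF q D E) v + u_power 1 (X (rotins_compF D E) v)))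
   - u_power (-1) (u_power (-1) (X (iotaF q D) (X (LieF E) v) + u_power 1 (X (rotinsF D) (X (LieF E) v)))).
  rewrite [LHS]/(u_power (-2) (sigma_family 1 1 q D E v) - u_power (-2) (R_family 1 q D (L_family 1 E v))).
  rewrite sigmaE R_familyE L_familyE !u_power_comp.
  congr (_ - _); congr (u_power _ _).
  have xN (T : family) v' : linear_family T -> extend T (- v') = - extend T v'.
    move=> lT; apply/eqP; rewrite -addr_eq0 -(extend_linear lT) addNr; apply/eqP.
    by apply: (addrI (extend T 0)); rewrite -(extend_linear lT) !addr0.
  by rewrite !xN // u_powerN -opprD opprK.
transitivity (nabla q i (nabla q j e) - nabla q j (nabla q i e)).
  by rewrite /graded_commutator mulr0 expr0z scale1r.
transitivity (differential l q (homotopy q i j e) + homotopy q i j (differential l q e)); last first.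
  by rewrite /graded_commutator (_ : (-1 : K) ^ (1 * -1 : int) = -1) ?exprz_odd // scaleN1r opprK.
apply: (@abstract_curvature _ (u_power (-1)) (u_power 1) (X (hochF l q)) (X rotF) (upartial i) (upartial j)
  (X (iotaF q D)) (X (iotaF q E)) (X (rotinsF D)) (X (rotinsF E)) (X (LieF D)) (X (LieF E))
  (X (iota_compF q D E)) (X (rotins_compF D E)) (X (iotaF D E)) (X (iotaF E D)) (X (iotaF q F)) (X (rotinsF F))).
all: try exact: extend_linear.
all: try by move=> v; exact: extend_shift.
all: try by move=> v; exact: upartial_shift.
all: try by move=> v w; exact: upartialD.
all: try by [].
- by move=> v; rewrite u_power_comp u_power0.
- by move=> v; rewrite u_power_comp u_power0.
- by move=> v; rewrite !xx //; apply: eq_extend => m w; exact: (iota_hoch hl cq uq relq hD).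
- move=> v; rewrite !xx // /X -!extendNl -!extendDl; apply: eq_extend => m w.
  exact: (hoch_rotinsF hl cq uq hD).
- move=> v; rewrite xx // -(extend0l v); apply: eq_extend => m w; exact: (rot_rotins hD).
- move=> v; rewrite xx // -(extend0l v); apply: eq_extend => m w; exact: (rotins_rot hD).
- move=> v; rewrite !xx // /X -extendNl; apply: eq_extend => m w; exact: (Lie_hoch hl cq uq hE).
- move=> v; rewrite !xx // /X -extendNl; apply: eq_extend => m w; exact: (Lie_rot hE).
- move=> v; rewrite !xx // /X -extendNl -!extendDl; apply: eq_extend => m w.
  exact: (hoch_iota_comp hl cq uq relq hD hE).
- move=> v; rewrite !xx // /X -!extendNl -!extendDl; apply: eq_extend => m w.
  exact: (hoch_rotins_comp hl cq uq hD hE).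
- move=> v; rewrite xx // -(extend0l v); apply: eq_extend => m w; exact: (rot_rotins_comp hD hE).
- move=> v; rewrite xx // -(extend0l v); apply: eq_extend => m w; exact: (rotins_comp_rot hD hE).
- move=> v; rewrite xx // -(extend0l v); apply: eq_extend => m w; exact: (rotins_rotins hD hE).
- move=> v; rewrite xx // -(extend0l v); apply: eq_extend => m w; exact: (rotins_rotins hE hD).
- move=> v; rewrite upartial_extend // -extendDl; congr (_ + _); apply: eq_extend => m w.
  exact: partial_iotaF.
- move=> v; rewrite upartial_extend // -extendDl; congr (_ + _); apply: eq_extend => m w.
  by rewrite -FE; exact: partial_iotaF.
- move=> v; rewrite upartial_extend //; congr (_ + _); apply: eq_extend => m w.
  exact: partial_rotinsF.
- move=> v; rewrite upartial_extend //; congr (_ + _); apply: eq_extend => m w.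
  by rewrite -FE; exact: partial_rotinsF.
- by move=> v; rewrite upartialC.
all: first [exact: NE | exact: dE | exact: hE'].
Qed.
End Curvature.

Theorem theorem1p4 (R : realType) (g A : int -> lmodType R[i])
    (l : brackets g) (one : A 0) (n : nat) (q : tseries n (cochain g A))
    (hq : unital_ocha_family l one q) (i j : 'I_n)
    (e : useries g n one) (he : periodic e) :
  graded_commutator 0 0 (nabla q i) (nabla q j) e
  = graded_commutator 1 (-1) (differential l q) (homotopy q i j) e.
Proof. exact: curvature. Qed.
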